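(* Let $\bar u\in\mathcal{U}_{ad}$ be an $L^2$-local solution of the optimal control problem $\inf_{u\in\mathcal{U}_{ad}}J(G(u),u)$. Then $$\mathcal{J}'(\bar u)(v-\bar u)\ge 0\quad\text{for every }v\in\mathcal{U}_{ad},$$ equivalently $$\sum_{i=1}^N\int_{Q_i}\left(\alpha_i\bar u_i-\rho_i\frac{\partial q_i}{\partial x}\right)(v_i-\bar u_i)\,dx\,dt\ge 0\quad\text{for every }v\in\mathcal{U}_{ad},$$ where $\rho=G(\bar u)$ is the unique weak solution of the state equation with control $\bar u$ and $q$ is the unique weak solution of the adjoint equation associated with $\bar u$ and $\rho$.
   Context: Fix $N\ge 1$, $T>0$, lengths $l_i>0$ and constants $D_i>0$, $\alpha_i>0$, $i=1,\dots,N$; set $Q_i=(0,l_i)\times(0,T)$. The star graph has $N$ edges $(0,l_i)$ joined at the common vertex $x=0$. Spaces: $\mathbb{L}^2=\prod_{i=1}^N L^2(0,l_i)$; $\mathbb{L}^\infty=\prod_{i=1}^N L^\infty(Q_i)$ with $\|u\|_{\mathbb{L}^\infty}=\sum_i\|u_i\|_{L^\infty(Q_i)}$; $\mathbb{H}^1=\prod_{i=1}^N H^1(0,l_i)$ with $\|v\|_{\mathbb{H}^1}^2=\sum_i\|v_i\|_{H^1(0,l_i)}^2$; $$\mathbb{V}=\{\varphi\in\mathbb{H}^1:\ \varphi_i(0)=\varphi_j(0)\ (i\ne j),\ \varphi_i(l_i)=0,\ i,j=1,\dots,N\}$$ with the $\mathbb{H}^1$ norm. $\mathbb{V}^\star$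 is its dual, and $\mathbb{L}^2$ is identified with its dual so that $\mathbb{V}\hookrightarrow\mathbb{L}^2\hookrightarrow\mathbb{V}^\star$. $\mathbb{W}(0,T)=\{\rho\in L^2(0,T;\mathbb{V}):\rho_t\in L^2(0,T;\mathbb{V}^\star)\}$, which embeds continuously in $\mathcal{C}([0,T];\mathbb{L}^2)$. For $u\in\mathbb{L}^\infty$ and a.e. time $t$, $\mathcal{F}[u](\rho,\varphi)=\sum_{i=1}^N\int_0^{l_i}(D_i\partial_x\rho_i+u_i\rho_i)\,\partial_x\varphi_i\,dx$ for $\rho,\varphi\in\mathbb{V}$. Fix $\rho^0\in\mathbb{L}^2$, $\rho^d\in L^2(0,T;\mathbb{L}^2)$, $\rho^T\in\mathbb{L}^2$. State equation: for $u\in\mathbb{L}^\infty$, the weak solution of the Fokker--Planck state equation ($\partial_t\rho_i-D_i\partial_x^2\rho_i-\partial_x(u_i\rho_i)=0$ in $Q_i$, $\rho_i(x,0)=\rho_i^0(x)$, $\sum_i[D_i\partial_x\rho_i(0,t)+u_i(0,t)\rho_i(0,t)]=0$, $\rho_i(0,t)=\rho_j(0,t)$, $\rho_i(l_i,t)=0$) is the unique $\rho\in\mathbb{W}(0,T)$ with $\rho_t+\mathcal{F}[u](\rho,\cdot)=0$ in $L^2(0,T;\mathbb{V}^\star)$ and $\rho(\cdot,0)=\rho^0$ in $\mathbb{L}^2$. The control-to-state operator $G:\mathbb{L}^\infty\to\mathbb{W}(0,T)$ maps $u$ to this $\rho$. Adjoint equation: for $u\in\mathbb{L}^\infty$ and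 $\rho=G(u)$, the weak solution of the adjoint equation ($-\partial_tq_i-D_i\partial_x^2q_i+u_i\partial_xq_i=\rho_i-\rho_i^d$ in $Q_i$, $q_i(x,T)=\rho_i(x,T)-\rho_i^T(x)$, $\sum_iD_i\partial_xq_i(0,t)=0$, $q_i(0,t)=q_j(0,t)$, $q_i(l_i,t)=0$) is the unique $q\in\mathbb{W}(0,T)$ with $-q_t+\mathcal{F}[u](\cdot,q)=\rho-\rho^d$ in $L^2(0,T;\mathbb{V}^\star)$ and $q(\cdot,T)=\rho(\cdot,T)-\rho^T$ in $\mathbb{L}^2$. Cost: $$J(\rho,u)=\frac12\sum_{i=1}^N\int_{Q_i}|\rho_i-\rho_i^d|^2\,dx\,dt+\frac12\sum_{i=1}^N\int_0^{l_i}|\rho_i(T)-\rho_i^T|^2\,dx+\frac12\sum_{i=1}^N\alpha_i\int_{Q_i}|u_i|^2\,dx\,dt,$$ and the reduced cost is $\mathcal{J}:\mathbb{L}^\infty\to\mathbb{R}$, $\mathcal{J}(u)=J(G(u),u)$; $\mathcal{J}'(u)$ denotes its Fréchet derivative. Given fixed $u^{\min},u^{\max}\in\mathbb{L}^\infty$, $\mathcal{U}_{ad}=\{u\in\mathbb{L}^\infty:\ u_i^{\min}\le u_i\le u_i^{\max}\ \text{a.e. in }Q_i,\ i=1,\dots,N\}$. A control $\bar u\in\mathcal{U}_{ad}$ is an $L^2$-local solution if there exists $\varepsilon>0$ such that $J(G(\bar u),\bar u)\le J(G(u),u)$ for every $u\in\mathcal{U}_{ad}$ with $\|u-\bar u\|_{L^2(0,T;\mathbb{L}^2)}\le\varepsilon$.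 *)

(* Defs.v *)
From mathcomp Require Import all_boot all_order all_algebra.
From mathcomp Require Import all_classical all_reals all_analysis.
Set Implicit Arguments.
Unset Strict Implicit.
Unset Printing Implicit Defensive.
Import Order.TTheory GRing.Theory Num.Theory.
Import numFieldNormedType.Exports.
Local Open Scope classical_set_scope.
Local Open Scope ring_scope.

(* Conventions.  Elements of L^2, L^oo, H^1, V, ... are represented by functions
   and every notion below is invariant under a.e. modification; equality in such
   a space is equality a.e. (equivalently, vanishing of the norm of the
   difference).  A space is given by a set of representatives together with a
   norm, which is a seminorm on representatives. *)

Section normed_spaces.
Context {R : realType}.

Definition linear_on {X : lmodType R} (E : set X) (f : X -> R) :=
  forall (a : R) (x y : X), E x -> E y -> f (a *: x + y) = a * f x + f y.

(* Elements of the topological dual of E; values outside E are irrelevant. *)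
Definition dual {X : lmodType R} (E : set X) (nrm : X -> R) : set (X -> R) :=
  [set f | linear_on E f /\ exists C : R, forall x, E x -> `|f x| <= C * nrm x].

Definition dual_norm {X : lmodType R} (E : set X) (nrm : X -> R)
    (f : X -> R) : R :=
  sup [set `|f x| | x in [set x | E x /\ nrm x <= 1]].

Definition is_frechet_derivative {X : lmodType R} (E : set X) (nrm : X -> R)
    (F : X -> R) (x : X) (dF : X -> R) :=
  dual E nrm dF /\
  forall eps : R, 0 < eps -> exists2 delta : R, 0 < delta &
    forall h, E h -> nrm h <= delta ->
      `|F (x + h) - F x - dF h| <= eps * nrm h.

(* Bochner spaces. *)
Definition simple_function {X : zmodType} (E : set X) (s : R -> X) :=
  [/\ finite_set (range s), forall t, E (s t) &
      forall x, measurable (s @^-1` [set x])].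

Definition strongly_measurable {X : zmodType} (E : set X) (nrm : X -> R)
    (T : R) (f : R -> X) :=
  exists s : nat -> R -> X, (forall n, simple_function E (s n)) /\
    {ae (@lebesgue_measure R), forall t, t \in `]0, T[ ->
       E (f t) /\ nrm (s n t - f t) @[n --> \oo] --> (0 : R)}.

Definition bochner_L2 {X : zmodType} (E : set X) (nrm : X -> R) (T : R) :
    set (R -> X) :=
  [set f | strongly_measurable E nrm T f /\
    (\int[@lebesgue_measure R]_(t in `]0%R, T[) ((nrm (f t)) ^+ 2)%:E < +oo)%E].

End normed_spaces.

Section one_edge.
Context {R : realType}.
Local Notation mu := (@lebesgue_measure R).

Definition L2_edge (a : R) : set (R -> R) :=
  [set v | (v \_ `]0, a[) \in Lfun mu 2%:E].

(* C_c^oo(0, a), extended by zero to the whole line. *)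
Definition test_function (a : R) : set (R -> R) :=
  [set psi | (forall n x, derivable (derive1n n psi) x 1) /\
    exists b c : R, [/\ 0 < b, c < a &
      forall x, x \notin `[b, c] -> psi x = 0]].

Definition is_weak_derivative (a : R) (v w : R -> R) :=
  L2_edge a w /\ forall psi, test_function a psi ->
    \int[mu]_(x in `]0, a[) (v x * derive1 psi x) =
    - \int[mu]_(x in `]0, a[) (w x * psi x).

Definition H1_edge (a : R) : set (R -> R) :=
  [set v | L2_edge a v /\ exists w, is_weak_derivative a v w].

Definition weak_derivative (a : R) (v : R -> R) : R -> R :=
  xget (fun=> 0) [set w | is_weak_derivative a v w].

(* The representative of an H^1(0, a) function that is continuous on [0, a],
   used to give a meaning to the values at the end points. *)
Definition is_continuous_rep (a : R) (v vc : R -> R) :=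
  {within `[0, a], continuous vc} /\
  {ae mu, forall x, x \in `]0, a[ -> vc x = v x}.

(* The integral over Q = (0, a) x (0, T) with respect to dx dt.  It is written
   as an iterated integral because an element of L^2(0, T; X), with X a space of
   functions of x, need not be represented by a jointly measurable function. *)
Definition int_Q (a T : R) (f : R -> R -> R) : R :=
  \int[mu]_(t in `]0, T[) \int[mu]_(x in `]0, a[) f x t.

End one_edge.

Section star_graph.
Context {R : realType} {N : nat}.
Local Notation mu := (@lebesgue_measure R).
Local Notation mu2 := (mu \x mu)%E.

(* Functions on the star graph: edge index, then position x. *)
Definition graph_fun := 'I_N -> R -> R^o.
(* Controls: edge index, then (x, t). *)
Definition control := 'I_N -> R * R -> R^o.
(* Functions of time with values in functions on the graph. *)
Definition evolution := R -> graph_fun.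

Implicit Types (l D alpha : 'I_N -> R) (T : R).

Definition L2 l : set graph_fun := [set v | forall i, L2_edge (l i) (v i)].

Definition inner_L2 l (v w : graph_fun) : R :=
  \sum_i \int[mu]_(x in `]0, l i[) (v i x * w i x).

Definition norm_L2 l (v : graph_fun) : R := Num.sqrt (inner_L2 l v v).

Definition Dx l (v : graph_fun) : graph_fun :=
  fun i => weak_derivative (l i) (v i).

Definition V l : set graph_fun :=
  [set v | (forall i, H1_edge (l i) (v i)) /\
    exists vc : graph_fun,
      [/\ forall i, is_continuous_rep (l i) (v i) (vc i),
          forall i j, i != j -> vc i 0 = vc j 0 &
          forall i, vc i (l i) = 0]].

Definition norm_V l (v : graph_fun) : R :=
  Num.sqrt (inner_L2 l v v + inner_L2 l (Dx l v) (Dx l v)).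

Definition L2_L2 l T : set evolution := bochner_L2 (L2 l) (norm_L2 l) T.

Definition L2_V l T : set evolution := bochner_L2 (V l) (norm_V l) T.

Definition L2_Vdual l T : set (R -> graph_fun -> R) :=
  bochner_L2 (dual (V l) (norm_V l)) (dual_norm (V l) (norm_V l)) T.

(* g is the V*-valued distributional derivative of rho on (0, T), where rho(t)
   is seen in V* through V -> L^2 -> V*.  The identity
   int_0^T psi' rho dt = - int_0^T psi g dt  in V* is tested against phi in V. *)
Definition is_time_derivative l T (rho : evolution) (g : R -> graph_fun -> R) :=
  forall psi, test_function T psi -> forall phi, V l phi ->
    \int[mu]_(t in `]0, T[) (inner_L2 l (rho t) phi * derive1 psi t) =
    - \int[mu]_(t in `]0, T[) (g t phi * psi t).

(* rho belongs to W(0, T) and its time derivative is rho_t. *)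
Definition in_W l T (rho : evolution) (rho_t : R -> graph_fun -> R) :=
  [/\ L2_V l T rho, L2_Vdual l T rho_t & is_time_derivative l T rho rho_t].

(* rhoc is the representative of rho in C([0, T]; L^2). *)
Definition is_C_L2_rep l T (rho rhoc : evolution) :=
  [/\ forall t, t \in `[0, T] -> L2 l (rhoc t),
      forall t, t \in `[0, T] ->
        norm_L2 l (rhoc s - rhoc t) @[s --> within `[0, T] (nbhs t)]
          --> (0 : R) &
      {ae mu, forall t, t \in `]0, T[ -> norm_L2 l (rhoc t - rho t) = 0}].

(* The value rho(., t) in L^2 for rho in W(0, T) and t in [0, T]. *)
Definition at_time l T (rho : evolution) (t : R) : graph_fun :=
  xget rho [set rhoc | is_C_L2_rep l T rho rhoc] t.

Definition Q l T (i : 'I_N) : set (R * R) := `]0, l i[ `*` `]0, T[.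

Definition Linfty l T : set control :=
  [set u | forall i, ((u i : R * R -> R) \_ (Q l T i)) \in Lfun mu2 +oo%E].

Definition norm_Linfty l T (u : control) : R :=
  \sum_i fine ('N[mu2]_+oo%E[EFin \o ((u i : R * R -> R) \_ (Q l T i))])%E.

(* Norm of L^2(0, T; L^2) on controls. *)
Definition norm_L2Q l T (u : control) : R :=
  Num.sqrt (\sum_i int_Q (l i) T (fun x t => u i (x, t) ^+ 2)).

(* F[u(., t)](rho, phi) *)
Definition FP_form l D (u : control) (t : R) (rho phi : graph_fun) : R :=
  \sum_i \int[mu]_(x in `]0, l i[)
    ((D i * Dx l rho i x + u i (x, t) * rho i x) * Dx l phi i x).

(* rho in W(0, T) solves rho_t + F[u](rho, .) = 0, rho(., 0) = rho0. *)
Definition is_state l D T (rho0 : graph_fun) (u : control) (rho : evolution) :=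
  (exists rho_t, in_W l T rho rho_t /\
    {ae mu, forall t, t \in `]0, T[ -> forall phi, V l phi ->
       rho_t t phi + FP_form l D u t (rho t) phi = 0}) /\
  norm_L2 l (at_time l T rho 0 - rho0) = 0.

(* q in W(0, T) solves - q_t + F[u](., q) = rho - rhod,
   q(., T) = rho(., T) - rhoT. *)
Definition is_adjoint l D T (rhod : evolution) (rhoT : graph_fun)
    (u : control) (rho q : evolution) :=
  (exists q_t, in_W l T q q_t /\
    {ae mu, forall t, t \in `]0, T[ -> forall phi, V l phi ->
       - q_t t phi + FP_form l D u t phi (q t) =
       inner_L2 l (rho t - rhod t) phi}) /\
  norm_L2 l (at_time l T q T - (at_time l T rho T - rhoT)) = 0.

(* G and adjoint_state select a representative of the weak solution, which is
   unique as an element of W(0, T). *)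
Definition G l D T (rho0 : graph_fun) (u : control) : evolution :=
  xget (fun=> 0) [set rho | is_state l D T rho0 u rho].

Definition adjoint_state l D T (rho0 : graph_fun) (rhod : evolution)
    (rhoT : graph_fun) (u : control) : evolution :=
  xget (fun=> 0) [set q | is_adjoint l D T rhod rhoT u (G l D T rho0 u) q].

Definition J l T alpha (rhod : evolution) (rhoT : graph_fun)
    (rho : evolution) (u : control) : R :=
  2^-1 * (\sum_i int_Q (l i) T (fun x t => (rho t i x - rhod t i x) ^+ 2)) +
  2^-1 * (\sum_i \int[mu]_(x in `]0, l i[)
            ((at_time l T rho T i x - rhoT i x) ^+ 2)) +
  2^-1 * (\sum_i alpha i * int_Q (l i) T (fun x t => u i (x, t) ^+ 2)).

Definition reduced_cost l D T alpha (rho0 : graph_fun) (rhod : evolution)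
    (rhoT : graph_fun) (u : control) : R :=
  J l T alpha rhod rhoT (G l D T rho0 u) u.

Definition Uad l T (umin umax : control) : set control :=
  [set u | Linfty l T u /\ forall i,
    {ae mu2, forall z, z \in Q l T i -> umin i z <= u i z <= umax i z}].

Definition is_L2_local_solution l D T alpha (rho0 : graph_fun)
    (rhod : evolution) (rhoT : graph_fun) (umin umax ubar : control) :=
  Uad l T umin umax ubar /\
  exists2 eps : R, 0 < eps &
    forall u, Uad l T umin umax u -> norm_L2Q l T (u - ubar) <= eps ->
      J l T alpha rhod rhoT (G l D T rho0 ubar) ubar <=
      J l T alpha rhod rhoT (G l D T rho0 u) u.

End star_graph.

Arguments graph_fun : clear implicits.
Arguments control : clear implicits.
Arguments evolution : clear implicits.

(* Main.v *)
(* Write [P w] for the function equal to [- \int_x^(l i) w i] on the edge [i], and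
   [H0] for the [w] in L^2 whose integral over the edge [i] does not depend on [i].
   Then [V = P H0], the inverse of [P] being the weak derivative, and every
   functional on [V] has the form [phi |-> <g, phi_x>] with [g] in L^2.  The state
   equation for [rho = P w] becomes [d/dt <P w, P om> = - <D w + u P w, om>] for
   all [om] in [H0], an evolution equation in the single Hilbert space L^2.
   Solutions exist by Lions' method, that is, Riesz representation on the space of
   test functions; they have representatives continuous in time and satisfy the
   energy identity, which follows from difference quotients in time.  The adjoint
   equation is reduced to a forward one by reversing time.
   Let [z = G (u + h) - G u].  Pairing [z] with the adjoint state [q] gives
   [J (u + h) - J u - dJ h = - \int h z q_x + 1/2 |z|^2 + 1/2 |z(T)|^2
   + 1/2 \sum_i alpha_i |h_i|^2] with [dJ h = \sum_i \int (alpha_i u_i - rho_i q_x,i) h_i],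
   and by the energy estimate and Gronwall's lemma [z] is of order [|h|_oo], so that
   the remainder is of order [|h|_oo ^ 2].  Local optimality along the segments
   [ubar + s (v - ubar)] yields [dJ (v - ubar) >= 0]. *)
From HB Require Import structures.
Require Import Defs.
From mathcomp Require Import all_boot all_order all_algebra.
From mathcomp Require Import all_classical all_reals all_analysis.
From mathcomp Require Import measurable_realfun ring lra.
Set Implicit Arguments.
Unset Strict Implicit.
Unset Printing Implicit Defensive.
Import Order.TTheory GRing.Theory Num.Theory.
Import numFieldNormedType.Exports.
Local Open Scope classical_set_scope.
Local Open Scope ring_scope.

(** * Pre-Hilbert spaces *)

(** Hilbert spaces carry semidefinite forms on representatives, so identities between vectors are
    stated as [nrm (x - y) = 0], and only scalar integrals are formed: a vector-valued path enters
    through its pairings with vectors. Two obstacles shape the proof. Multiplication by a bounded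
    measurable control, seen as a path of operators on L^2, is in general not measurable in operator
    norm; families of operators are therefore only asked to be measurable at each fixed vector, and
    measurability of [K t (f t)] is recovered through simple functions. Moreover the time derivative
    of a solution is known only when tested against constant vectors, whereas the energy identity
    tests it against the solution itself; the passage uses approximation of the solution by simple
    paths and the L^1 convergence of difference quotients of primitives. The Fréchet derivative is
    found without differentiating the control-to-state map: the increment of the cost is expanded
    exactly and only its quadratic part is estimated. *)

Lemma cvg0_le (R : realType) (f g : nat -> R) :
  (forall n, 0 <= f n <= g n) -> g n @[n --> \oo] --> (0 : R) ->
  f n @[n --> \oo] --> (0 : R).
Proof.
move=> fg g0; apply: (@squeeze_cvgr _ _ _ _ (cst 0) g) => //; last exact: cvg_cst.
exact: nearW.
Qed.

(* [ip] is only semidefinite: vectors at distance zero are representatives of the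
   same class and are not identified. *)
Record preHilbert (R : realType) := PreHilbert {
  ph_sort :> lmodType R;
  ip : ph_sort -> ph_sort -> R;
  ipC : forall x y, ip x y = ip y x;
  ipDZl : forall a x y z, ip (a *: x + y) z = a * ip x z + ip y z;
  ip_ge0 : forall x, 0 <= ip x x }.

Section pre_hilbert.
Context {R : realType} {H : preHilbert R}.
Implicit Types (x y z : H) (a : R).

Definition nrm x : R := Num.sqrt (ip x x).

Lemma ipDl x y z : ip (x + y) z = ip x z + ip y z.
Proof. by rewrite -[x in LHS]scale1r ipDZl mul1r. Qed.

Lemma ip0l z : ip 0 z = 0.
Proof. by apply: (addrI (ip 0 z)); rewrite -ipDl !addr0. Qed.

Lemma ipZl a x z : ip (a *: x) z = a * ip x z.
Proof. by rewrite -[a *: x]addr0 ipDZl ip0l addr0. Qed.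

Lemma ipNl x z : ip (- x) z = - ip x z.
Proof. by rewrite -scaleN1r ipZl mulN1r. Qed.

Lemma ipBl x y z : ip (x - y) z = ip x z - ip y z.
Proof. by rewrite ipDl ipNl. Qed.

Lemma ipDr x y z : ip x (y + z) = ip x y + ip x z.
Proof. by rewrite ipC ipDl !(ipC x). Qed.

Lemma ip0r x : ip x 0 = 0.
Proof. by rewrite ipC ip0l. Qed.

Lemma ipZr a x y : ip x (a *: y) = a * ip x y.
Proof. by rewrite ipC ipZl ipC. Qed.

Lemma ipNr x y : ip x (- y) = - ip x y.
Proof. by rewrite ipC ipNl ipC. Qed.

Lemma ipBr x y z : ip x (y - z) = ip x y - ip x z.
Proof. by rewrite ipDr ipNr. Qed.

Lemma nrm_ge0 x : 0 <= nrm x. Proof. exact: sqrtr_ge0. Qed.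

Lemma sqr_nrm x : nrm x ^+ 2 = ip x x.
Proof. by rewrite sqr_sqrtr// ip_ge0. Qed.

Lemma nrm0 : nrm 0 = 0. Proof. by rewrite /nrm ip0l sqrtr0. Qed.

Lemma nrmZ a x : nrm (a *: x) = `|a| * nrm x.
Proof.
by rewrite /nrm ipZl ipZr mulrA -expr2 sqrtrM ?sqr_ge0// sqrtr_sqr.
Qed.

Lemma nrmN x : nrm (- x) = nrm x.
Proof. by rewrite -scaleN1r nrmZ normrN1 mul1r. Qed.

Lemma nrmBC x y : nrm (x - y) = nrm (y - x).
Proof. by rewrite -nrmN opprB. Qed.

Lemma ip_sqr_le x y : ip x y ^+ 2 <= ip x x * ip y y.
Proof.
have [y0|y0] := eqVneq (ip y y) 0.
  suff -> : ip x y = 0 by rewrite y0 mulr0 expr0n.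
  apply/eqP; apply: contraT => xy0.
  (* As [ip y y = 0], the form at [x - t *: y] is affine in [t]; this [t] gives it the value -1. *)
  have := ip_ge0 (x - ((ip x x + 1) / (2 * ip x y)) *: y).
  rewrite ipBl !ipBr !ipZl !ipZr y0 (ipC y x) => h.
  suff : ip x x - (ip x x + 1) / (2 * ip x y) * ip x y -
    ((ip x x + 1) / (2 * ip x y) * ip x y) = - 1 by move=> E; lra.
  by field.
have := ip_ge0 (ip y y *: x - ip x y *: y).
rewrite ipBl !ipBr !ipZl !ipZr (ipC y x).
have yp : 0 < ip y y by rewrite lt_def y0 ip_ge0.
move=> h; rewrite -(ler_pM2l yp); nra.
Qed.

Lemma normr_ip_le x y : `|ip x y| <= nrm x * nrm y.
Proof.
rewrite -sqrtr_sqr /nrm -sqrtrM ?ip_ge0//.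
by rewrite ler_sqrt ?mulr_ge0 ?ip_ge0// ip_sqr_le.
Qed.

Lemma ip_le x y : ip x y <= nrm x * nrm y.
Proof. exact: le_trans (ler_norm _) (normr_ip_le _ _). Qed.

Lemma ler_nrmD x y : nrm (x + y) <= nrm x + nrm y.
Proof.
rewrite -(ler_pXn2r (n := 2))// ?nnegrE ?addr_ge0 ?nrm_ge0//.
rewrite sqrrD !sqr_nrm ipDl !ipDr (ipC y x).
have := ip_le x y; lra.
Qed.

Lemma ler_nrmB x y : nrm (x - y) <= nrm x + nrm y.
Proof. by rewrite (le_trans (ler_nrmD _ _))// nrmN. Qed.

Lemma ler_nrm_distD z x y : nrm (x - y) <= nrm (x - z) + nrm (z - y).
Proof. by rewrite (le_trans _ (ler_nrmD _ _))// addrA subrK. Qed.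

Lemma ler_dist_nrm x y : `|nrm x - nrm y| <= nrm (x - y).
Proof.
have h u v : nrm u - nrm v <= nrm (u - v).
  by rewrite lerBlDr (le_trans _ (ler_nrmD _ _))// subrK.
by rewrite ler_norml h andbT lerNl opprB nrmBC h.
Qed.

Lemma nrm_eq0_ip x y : nrm x = 0 -> ip x y = 0.
Proof.
move=> x0; apply/eqP; rewrite -normr_le0.
by rewrite (le_trans (normr_ip_le _ _))// x0 mul0r.
Qed.

Lemma sqr_nrmD x y : nrm (x + y) ^+ 2 = nrm x ^+ 2 + 2 * ip x y + nrm y ^+ 2.
Proof. by rewrite !sqr_nrm !(ipDl, ipDr) (ipC y x); ring. Qed.

Definition ph_cvg (u : nat -> H) x := nrm (u n - x) @[n --> \oo] --> (0 : R).

(** Convergence is asked of rapidly Cauchy sequences only, those whose increments can be summed;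
    [cauchy_cvg] recovers the usual notion through a subsequence. *)
Definition ph_complete := forall u : nat -> H,
  (forall n, nrm (u n.+1 - u n) <= 2^-1 ^+ n) -> exists x, ph_cvg u x.

Definition ph_cauchy (u : nat -> H) := forall e : R, 0 < e ->
  exists n0, forall m n, (n0 <= m)%N -> (n0 <= n)%N -> nrm (u m - u n) <= e.

Lemma ph_cvgP (u : nat -> H) x : ph_cvg u x <->
  forall e : R, 0 < e -> exists n0, forall n, (n0 <= n)%N -> nrm (u n - x) <= e.
Proof.
split=> [/cvgrPdist_le h e e0|h].
  have [n0 _ hn] := h e e0; exists n0 => n n0n.
  by have := hn n n0n; rewrite sub0r normrN ger0_norm ?nrm_ge0.
apply/cvgrPdist_le => e e0; have [n0 hn] := h e e0.
exists n0 => // n /= n0n; rewrite sub0r normrN ger0_norm ?nrm_ge0//.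
exact: hn.
Qed.

Lemma cauchy_cvg (u : nat -> H) : ph_complete -> ph_cauchy u ->
  exists x, ph_cvg u x.
Proof.
move=> cH cu.
have /choice[N hN] : forall k, exists n0, forall m n,
    (n0 <= m)%N -> (n0 <= n)%N -> nrm (u m - u n) <= 2^-1 ^+ k.
  by move=> k; apply: cu; rewrite exprn_gt0// invr_gt0.
(* A strictly increasing choice of indices above [N], so that the subsequence [u \o M] has
   increments at most [2^-1 ^+ k]. *)
pose M := fix M k := if k is k'.+1 then maxn (N k'.+1) (M k').+1 else N 0.
have NM k : (N k <= M k)%N by case: k => //= k; exact: leq_maxl.
have MS k : (M k < M k.+1)%N by rewrite /= leq_maxr.
have [|x ux] := cH (u \o M).
  move=> n; apply: hN => //; exact: leq_trans (NM n) (ltnW (MS n)).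
exists x; apply/ph_cvgP => e e0.
have e20 : 0 < e / 2 by rewrite divr_gt0.
have [n0 hn0] := cu _ e20.
have [k0 hk0] := (ph_cvgP _ _).1 ux _ e20.
have kM k : (k <= M k)%N by elim: k => // k /leq_ltn_trans; exact.
exists n0 => n n0n.
apply: le_trans (ler_nrm_distD (u (M (maxn k0 n0))) _ _) _.
rewrite [e]splitr lerD//.
  by rewrite hn0// (leq_trans _ (kM _))// leq_maxr.
by apply: hk0; rewrite leq_maxl.
Qed.

Lemma ph_cvg_nrm (u : nat -> H) x :
  ph_cvg u x -> nrm (u n) @[n --> \oo] --> nrm x.
Proof.
move=> /ph_cvgP h; apply/cvgrPdist_le => e e0; have [n0 hn] := h e e0.
exists n0 => // n /= n0n.
by rewrite distrC (le_trans (ler_dist_nrm _ _))// hn.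
Qed.

Lemma ph_cvgDZ (u v : nat -> H) a x y : ph_cvg u x -> ph_cvg v y ->
  ph_cvg (fun n => a *: u n + v n) (a *: x + y).
Proof.
move=> ux vy; rewrite /ph_cvg.
have h : `|a| * nrm (u n - x) + nrm (v n - y) @[n --> \oo] --> `|a| * 0 + 0.
  by apply: cvgD => //; apply: cvgM => //; exact: cvg_cst.
rewrite mulr0 addr0 in h; apply: (cvg0_le _ h) => n; clear h.
rewrite nrm_ge0/= -nrmZ (le_trans _ (ler_nrmD _ _))//.
by rewrite scalerBr opprD addrACA.
Qed.

Lemma ph_cvg_cst x : ph_cvg (fun=> x) x.
Proof. by rewrite /ph_cvg; under eq_fun do rewrite subrr nrm0; exact: cvg_cst. Qed.

Lemma ph_cvg_ip (u v : nat -> H) x y : ph_cvg u x -> ph_cvg v y ->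
  ip (u n) (v n) @[n --> \oo] --> ip x y.
Proof.
move=> ux vy.
suff : ip (u n) (v n) - ip x y @[n --> \oo] --> (0 : R).
  move=> h; have {h} : ip (u n) (v n) - ip x y + ip x y @[n --> \oo] -->
      0 + ip x y by apply: cvgD => //; exact: cvg_cst.
  by rewrite add0r; under eq_fun do rewrite subrK.
apply: norm_cvg0.
have h : nrm (u n - x) * nrm (v n) + nrm x * nrm (v n - y) @[n --> \oo] -->
    0 * nrm y + nrm x * 0.
  apply: cvgD; apply: cvgM => //; [exact: ph_cvg_nrm|exact: cvg_cst].
rewrite mul0r mulr0 addr0 in h; apply: (cvg0_le _ h) => n; clear h.
rewrite normr_ge0/=.
have -> : ip (u n) (v n) - ip x y = ip (u n - x) (v n) + ip x (v n - y).
  by rewrite ipBl ipBr; ring.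
by rewrite (le_trans (ler_normD _ _))// lerD// normr_ip_le.
Qed.

End pre_hilbert.
Arguments nrm {R H} x.
Arguments ph_complete {R} H.

(** * Strong measurability *)

Section measurability_facts.
Context d {T : measurableType d} {R : realType}.
Implicit Types f g : T -> R.

Lemma measurable_set_ltr f g : measurable_fun setT f -> measurable_fun setT g ->
  measurable [set t | f t < g t].
Proof.
move=> mf mg; have := measurable_fun_ltr mf mg.
move=> /(_ measurableT [set true]); rewrite setTI.
rewrite (_ : _ @^-1` _ = [set t | f t < g t]); first by apply.
by apply/seteqP; split=> t.
Qed.

Lemma measurable_sqrt f : measurable_fun setT f -> (forall t, 0 <= f t) ->
  measurable_fun setT (fun t => Num.sqrt (f t)).
Proof.
move=> mf f0; under eq_fun do rewrite -powR12_sqrt//.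
exact: (measurableT_comp (f := fun x : R => x `^ 2^-1)).
Qed.

End measurability_facts.

Section finitely_valued.
Context {R : realType}.

(* Finitely many measurable pieces, coded by [c]; [b] gives the values. *)
Definition fsimple {X : Type} (s : R -> X) := exists m (c : R -> nat) b,
  [/\ forall t, (c t < m)%N, forall k, measurable (c @^-1` [set k]) &
      forall t, s t = b (c t)].

Lemma fsimple_comp {X Y : Type} (h : X -> Y) (s : R -> X) :
  fsimple s -> fsimple (h \o s).
Proof.
move=> [m [c [b [cm mc sb]]]]; exists m, c, (h \o b); split=> // t.
by rewrite /= sb.
Qed.

Lemma fsimple_cst {X : Type} (x : X) : fsimple (fun=> x).
Proof.
exists 1, (fun=> 0%N), (fun=> x); split=> // k.
have [->|k0] := eqVneq k 0%N.
  by rewrite (_ : _ @^-1` _ = setT)//; apply/seteqP; split.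
rewrite (_ : _ @^-1` _ = set0)//; apply/seteqP; split=> // t /= E.
by rewrite -E eqxx in k0.
Qed.

Lemma fsimple_pair {X Y : Type} (s : R -> X) (s' : R -> Y) :
  fsimple s -> fsimple s' -> fsimple (fun t => (s t, s' t)).
Proof.
move=> [m [c [b [cm mc sb]]]] [m' [c' [b' [cm' mc' sb']]]].
have m0 : (0 < m)%N by exact: leq_ltn_trans (cm 0).
(* The two codes are packed in base [m] and read off again as remainder and quotient. *)
exists (m * m')%N, (fun t => c' t * m + c t)%N,
  (fun k => (b (k %% m)%N, b' (k %/ m)%N)); split=> [t|k|t].
- rewrite (@leq_trans ((c' t).+1 * m)%N)//.
  + by rewrite mulSn addnC ltn_add2r.
  + by rewrite mulnC leq_mul2l cm' orbT.
- rewrite (_ : _ @^-1` _ =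
    (c @^-1` [set (k %% m)%N]) `&` (c' @^-1` [set (k %/ m)%N])).
    exact: measurableI.
  apply/seteqP; split=> t /=.
    by move=> <-; rewrite modnMDl modn_small// divnMDl// divn_small// addn0.
  by move=> [-> ->]; rewrite -divn_eq.
- by rewrite modnMDl modn_small// divnMDl// divn_small// addn0 sb sb'.
Qed.

Lemma fsimple_map2 {X Y Z : Type} (h : X -> Y -> Z) (s : R -> X) (s' : R -> Y) :
  fsimple s -> fsimple s' -> fsimple (fun t => h (s t) (s' t)).
Proof.
move=> fs fs'.
exact: (fsimple_comp (fun z => h z.1 z.2) (fsimple_pair fs fs')).
Qed.

Lemma fsimple_preimage {X : Type} (s : R -> X) (Y : set X) :
  fsimple s -> measurable (s @^-1` Y).
Proof.
move=> [m [c [b [cm mc sb]]]].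
rewrite (_ : s @^-1` Y = \bigcup_(k in [set k | Y (b k)]) (c @^-1` [set k])).
  exact: bigcup_measurable.
apply/seteqP; split=> [t /= Ys|t [k /= Yk E]].
  by exists (c t) => //=; rewrite -sb.
by rewrite /preimage /= sb E.
Qed.

Lemma fsimple_measurable d (T : measurableType d) (s : R -> T) : fsimple s -> measurable_fun setT s.
Proof. by move=> fs _ Y mY; rewrite setTI; exact: fsimple_preimage. Qed.

Lemma fsimple_ifS {X : Type} (A : set R) (x y : X) : measurable A ->
  fsimple (fun t => if t \in A then x else y).
Proof.
move=> mA.
exists 2, (fun t => nat_of_bool (t \in A)),
  (fun k => if k is 1%N then x else y); split=> [t|k|t].
- by case: (t \in A).
- case: k => [|[|k]].
  + rewrite (_ : _ @^-1` _ = ~` A); first exact: measurableC.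
    by apply/seteqP; split=> t /=; [case: (boolP (t \in A)) => //; rewrite notin_setE|
      move=> At; rewrite memNset].
  + rewrite (_ : _ @^-1` _ = A)//.
    by apply/seteqP; split=> t /=; [case: (boolP (t \in A)) => //; rewrite inE|
      move=> At; rewrite mem_set].
  + rewrite (_ : _ @^-1` _ = set0)//.
    by apply/seteqP; split=> t //=; case: (t \in A).
- by case: (t \in A).
Qed.

Lemma fsimple_if {X : Type} (A : set R) (s s' : R -> X) : measurable A ->
  fsimple s -> fsimple s' -> fsimple (fun t => if t \in A then s t else s' t).
Proof.
move=> mA fs fs'.
have := fsimple_map2 (fun (b : bool) z => if b then z.1 else z.2)
  (fsimple_ifS true false mA) (fsimple_pair fs fs').
by congr fsimple; apply/funext => t; case: (t \in A).
Qed.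

Lemma simple_function_fsimple (X : zmodType) (E : set X) (s : R -> X) :
  simple_function E s -> fsimple s.
Proof.
move=> [/finite_seqP[r rE] _ ms].
have sr t : s t \in r.
  have : range s (s t) by exists t.
  by rewrite rE.
exists (size r), (fun t => index (s t) r), (nth 0 r); split=> [t|k|t].
- by rewrite index_mem.
- rewrite (_ : _ @^-1` _ =
    \bigcup_(x in [set x | x \in r /\ index x r = k]) (s @^-1` [set x])).
    apply: fin_bigcup_measurable => // .
    apply: (@sub_finite_set _ _ [set` r]) => // x /= [].
    by [].
  apply/seteqP; split=> [t /= <-|t /= [x [_ <-] <-//]].
  by exists (s t).
- by rewrite nth_index.
Qed.

Lemma fsimple_simple_function (X : zmodType) (E : set X) (s : R -> X) :
  fsimple s -> (forall t, E (s t)) -> simple_function E s.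
Proof.
move=> fs Es; split=> // [|x]; last exact: fsimple_preimage.
have [m [c [b [cm _ sb]]]] := fs.
apply: (@sub_finite_set _ _ (b @` `I_m)); last exact/finite_image/finite_II.
by move=> _ [t _ <-]; exists (c t) => //; rewrite /= cm.
Qed.

End finitely_valued.

Section strong_measurability.
Context {R : realType} {H : preHilbert R}.
Implicit Types f g : R -> H.

(** Convergence holds at every time of the whole line: exceptional null sets are removed beforehand,
    by giving the path the value 0 on them ([bochner_zbL2]). *)
Definition SM f := exists s : nat -> R -> H,
  (forall n, fsimple (s n)) /\ forall t, ph_cvg (s^~ t) (f t).

Lemma fsimple_SM f : fsimple f -> SM f.
Proof. by move=> ff; exists (fun=> f); split=> // t; exact: ph_cvg_cst. Qed.

Lemma SM_cst (x : H) : SM (fun=> x).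
Proof. exact/fsimple_SM/fsimple_cst. Qed.

Lemma SM_DZ a f g : SM f -> SM g -> SM (fun t => a *: f t + g t).
Proof.
move=> [s [fs sf]] [s' [fs' sg]]; exists (fun n t => a *: s n t + s' n t).
split=> [n|t]; last exact: ph_cvgDZ.
exact: (fsimple_map2 (fun x y => a *: x + y)).
Qed.

Lemma SMZ a f : SM f -> SM (fun t => a *: f t).
Proof.
by move=> mf; under eq_fun do rewrite -[_ *: _]addr0; apply: SM_DZ => //; exact: SM_cst.
Qed.

Lemma SMD f g : SM f -> SM g -> SM (fun t => f t + g t).
Proof. by move=> mf mg; under eq_fun do rewrite -[f _]scale1r; exact: SM_DZ. Qed.

Lemma SMN f : SM f -> SM (fun t => - f t).
Proof. by move=> mf; under eq_fun do rewrite -scaleN1r; exact: SMZ. Qed.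

Lemma SMB f g : SM f -> SM g -> SM (fun t => f t - g t).
Proof. by move=> mf mg; apply: SMD => //; exact: SMN. Qed.

Lemma SM_if (A : set R) f g : measurable A -> SM f -> SM g ->
  SM (fun t => if t \in A then f t else g t).
Proof.
move=> mA [s [fs sf]] [s' [fs' sg]].
exists (fun n t => if t \in A then s n t else s' n t); split=> [n|t].
  exact: fsimple_if.
by case: (t \in A).
Qed.

Lemma measurable_ip f g : SM f -> SM g ->
  measurable_fun setT (fun t => ip (f t) (g t)).
Proof.
move=> [s [fs sf]] [s' [fs' sg]].
apply: (measurable_fun_cvg (h := fun n t => ip (s n t) (s' n t))) => //.
  by move=> n; apply: fsimple_measurable; exact: (fsimple_map2 (@ip R H) (fs n) (fs' n)).
by move=> t _; exact: ph_cvg_ip.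
Qed.

Lemma measurable_nrm f : SM f -> measurable_fun setT (fun t => nrm (f t)).
Proof.
by move=> mf; apply: measurable_sqrt => [|t]; [exact: measurable_ip|exact: ip_ge0].
Qed.

Lemma SM_separable f : SM f -> exists d : nat -> H, forall t e, 0 < e ->
  exists j, nrm (f t - d j) < e.
Proof.
move=> [s [/choice[m /choice[c /choice[b fs]]] sf]].
exists (fun j => if unpickle j is Some (n, k) then b n k else 0) => t e e0.
have /ph_cvgP/(_ (e / 2))[|n hn] := sf t; first by rewrite divr_gt0.
exists (pickle (n, c n t)); rewrite pickleK.
have [_ _ <-] := fs n; rewrite nrmBC (le_lt_trans (hn n _))//.
by rewrite ltr_pdivrMr// ltr_pMr// ltr1n.
Qed.

(** For each centre of a dense sequence and each radius [1/(k+1)], a time is picked at which [f]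
    enters the ball, if there is one. The resulting dense points are values of [f], so they inherit
    every property shared by these values, such as membership in a constraint space. *)
Lemma SM_range_separable f : SM f -> exists tau : nat -> R, forall t e, 0 < e ->
  exists j, nrm (f t - f (tau j)) < e.
Proof.
move=> /SM_separable[d fd].
have /choice[w hw] : forall jk : nat * nat, exists t, forall t',
    nrm (f t' - d jk.1) < jk.2.+1%:R^-1 -> nrm (f t - d jk.1) < jk.2.+1%:R^-1.
  move=> [j k] /=.
  have [[t ht]|nt] := pselect (exists t, nrm (f t - d j) < k.+1%:R^-1).
    by exists t.
  by exists 0 => t' ht'; exfalso; apply: nt; exists t'.
exists (fun j => w (odflt (0%N, 0%N) (unpickle j))) => t e e0.
have [k hk] : exists k : nat, k.+1%:R^-1 <= e / 2.
  have [k _ /(_ k (leqnn k)) hk] := near_infty_natSinv_lt (PosNum (divr_gt0 e0 (ltr0Sn R 1))).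
  by exists k; exact: ltW.
have [j hj] := fd t (k.+1%:R^-1) ltac:(by rewrite invr_gt0).
exists (pickle (j, k)); rewrite pickleK /=.
have := hw (j, k) t hj; rewrite /= => h.
rewrite (le_lt_trans (ler_nrm_distD (d j) _ _))// [e]splitr.
by rewrite (nrmBC (d j)) ltrD// (lt_le_trans _ hk).
Qed.

(* Nearest point among the first [n + 1] points of a dense sequence. *)
Lemma SM_approx f (d : nat -> H) :
  (forall j, measurable_fun setT (fun t => nrm (f t - d j))) ->
  (forall t e, 0 < e -> exists j, nrm (f t - d j) < e) ->
  exists c : nat -> R -> nat, [/\ forall n, fsimple (c n) &
    forall t, ph_cvg (fun n => d (c n t)) (f t)].
Proof.
move=> md fd.
pose c := fix c n t := if n is n'.+1 then
  if nrm (f t - d n) < nrm (f t - d (c n' t)) then n else c n' t else 0%N.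
have cn n t : (c n t <= n)%N.
  by elim: n => //= n IH; case: ifPn => // _; exact: leqW.
have cS n t : nrm (f t - d (c n.+1 t)) =
    Num.min (nrm (f t - d n.+1)) (nrm (f t - d (c n t))).
  by rewrite /= minEle; case: ltP => h; case: leP => //; lra.
have mg n : measurable_fun setT (fun t => nrm (f t - d (c n t))).
  elim: n => [|n IH]; first exact: md.
  by under eq_fun do rewrite cS; exact: measurable_minr.
have mc n : fsimple (c n).
  exists n.+1, (c n), id; split=> // [t|k]; first by rewrite ltnS.
  elim: n k => [|n IH] k.
    exact: (fsimple_preimage _ (fsimple_cst 0%N)).
  have mlt : measurable [set t | nrm (f t - d n.+1) < nrm (f t - d (c n t))].
    by apply: measurable_set_ltr.
  have [->|kn] := eqVneq k n.+1.
    rewrite (_ : _ @^-1` _ = [set t | nrm (f t - d n.+1) < nrm (f t - d (c n t))])//.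
    apply/seteqP; split=> t /=; case: ifPn => // _ E.
    by have := cn n t; rewrite E ltnn.
  rewrite (_ : _ @^-1` _ = (c n @^-1` [set k]) `&`
      ~` [set t | nrm (f t - d n.+1) < nrm (f t - d (c n t))]).
    by apply: measurableI => //; exact: measurableC.
  apply/seteqP; split=> t /=; case: ifPn => // h.
  - by move=> E; rewrite E eqxx in kn.
  - by move=> [_ []].
  - by move=> [].
exists c; split=> // t; apply/ph_cvgP => e e0.
have [j hj] := fd t e e0; exists j => n jn.
rewrite nrmBC (le_trans _ (ltW hj))//.
elim: n jn => [|n IH]; first by rewrite leqn0 => /eqP ->.
rewrite cS leq_eqVlt => /predU1P[->|]; first by rewrite ge_min lexx.
by rewrite ltnS => /IH h; rewrite ge_min h orbT.
Qed.

Lemma SM_of_dense f (d : nat -> H) :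
  (forall j, measurable_fun setT (fun t => nrm (f t - d j))) ->
  (forall t e, 0 < e -> exists j, nrm (f t - d j) < e) -> SM f.
Proof.
move=> md fd; have [c [fc cf]] := SM_approx md fd.
by exists (fun n t => d (c n t)); split=> // n; exact: (fsimple_comp d (fc n)).
Qed.

(** Pettis' criterion: the countable sets attached to the [u n] together approximate every value of
    [f], and the distances from [f] to fixed vectors are limits of measurable functions. *)
Lemma SM_lim (u : nat -> R -> H) f :
  (forall n, SM (u n)) -> (forall t, ph_cvg (u^~ t) (f t)) -> SM f.
Proof.
move=> mu uf.
have /choice[d hd] n := SM_separable (mu n).
pose D j := if unpickle j is Some (n, k) then d n k else 0.
apply: (@SM_of_dense _ D).
  move=> j; move: (D j) => x.
  apply: (measurable_fun_cvg (h := fun n t => nrm (u n t - x))) => //.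
    by move=> n; apply: measurable_nrm; apply: SMB => //; exact: SM_cst.
  move=> t _; apply: ph_cvg_nrm.
  have := ph_cvgDZ 1 (uf t) (ph_cvg_cst (- x)); rewrite scale1r.
  by under eq_fun do rewrite scale1r.
move=> t e e0; have e20 : 0 < e / 2 by rewrite divr_gt0.
have /ph_cvgP/(_ _ e20)[n hn] := uf t.
have [k hk] := hd n t _ e20.
exists (pickle (n, k)); rewrite /D pickleK.
rewrite (le_lt_trans (ler_nrm_distD (u n t) _ _))// [e]splitr.
by rewrite ler_ltD// nrmBC hn.
Qed.

End strong_measurability.

(** * Square-integrable vector-valued functions *)

Section subspaces.
Context {R : realType} {Z : lmodType R}.

Record subspace := Subspace {
  sset :> Z -> Prop;
  sset0 : sset 0;
  ssetDZ : forall a x y, sset x -> sset y -> sset (a *: x + y) }.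

Definition sset_pred (S : subspace) : {pred Z} := fun x => `[< S x >].

Lemma sset_submod_closed S : submod_closed (sset_pred S).
Proof.
split=> [|a x y /asboolP Sx /asboolP Sy]; apply/asboolP; first exact: sset0.
exact: ssetDZ.
Qed.

HB.instance Definition _ S :=
  GRing.isSubmodClosed.Build R Z (sset_pred S) (sset_submod_closed S).

Definition ssub S := {x : Z | x \in sset_pred S}.

HB.instance Definition _ S := SubChoice.on (ssub S).
HB.instance Definition _ S := [SubChoice_isSubLmodule of ssub S by <:].

Lemma ssubP S (x : ssub S) : S (\val x).
Proof. by have /asboolP := valP x. Qed.

Definition ssub_of (S : subspace) x (Sx : S x) : ssub S := exist _ x (asboolT Sx).

Lemma ssub_ofK (S : subspace) x (Sx : S x) : \val (ssub_of Sx) = x. Proof. by []. Qed.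

Lemma val_ssubDZ S a (x y : ssub S) : \val (a *: x + y) = a *: \val x + \val y.
Proof. by []. Qed.

End subspaces.
Arguments subspace {R} Z.

Section sub_pre_hilbert.
Context {R : realType} {Z : lmodType R} (S : subspace Z) (b : Z -> Z -> R).
Hypothesis bC : forall x y, S x -> S y -> b x y = b y x.
Hypothesis bDZl : forall a x y z, S x -> S y -> S z ->
  b (a *: x + y) z = a * b x z + b y z.
Hypothesis b_ge0 : forall x, S x -> 0 <= b x x.

(** The laws of the form are only asked on [S], because forms given by integrals are additive only
    where these integrals converge. *)
Definition sub_preHilbert : preHilbert R :=
  @PreHilbert R (ssub S) (fun x y => b (\val x) (\val y))
    (fun x y => bC (ssubP x) (ssubP y))
    (fun a x y z => bDZl a (ssubP x) (ssubP y) (ssubP z))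
    (fun x => b_ge0 (ssubP x)).

End sub_pre_hilbert.

Section interval_integral.
Context {R : realType}.
Local Notation mu := (@lebesgue_measure R).
Implicit Types (a : R) (D : set R) (f g : R -> R).

Definition intg D f := mu.-integrable D (EFin \o f).

Lemma intgP D f : intg D f <-> measurable_fun D f /\
  (\int[mu]_(t in D) `|f t|%:E < +oo)%E.
Proof.
split=> [/integrableP[/measurable_EFinP mf foo]//|[mf foo]].
by apply/integrableP; split=> //; exact/measurable_EFinP.
Qed.

Lemma le_intg D f g : measurable D -> measurable_fun D f ->
  (forall t, D t -> `|f t| <= g t) -> intg D g -> intg D f.
Proof.
move=> mD mf fg; apply: le_integrable => //; first exact/measurable_EFinP.
by move=> t Dt /=; rewrite lee_fin (le_trans (fg t Dt))// ler_norm.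
Qed.

Lemma intgZ D k f : measurable D -> intg D f -> intg D (fun t => k * f t).
Proof. by move=> mD h; rewrite /intg /comp; under eq_fun do rewrite EFinM; apply: integrableZl. Qed.

Lemma intgD D f g : measurable D -> intg D f -> intg D g ->
  intg D (fun t => f t + g t).
Proof. by move=> mD h h'; rewrite /intg /comp; under eq_fun do rewrite EFinD; apply: integrableD. Qed.

Lemma intgB D f g : measurable D -> intg D f -> intg D g ->
  intg D (fun t => f t - g t).
Proof. by move=> mD h h'; rewrite /intg /comp; under eq_fun do rewrite EFinB; apply: integrableB. Qed.

Lemma eq_intg D f g : measurable D -> (forall t, D t -> f t = g t) ->
  intg D f -> intg D g.
Proof.
move=> mD fg; apply: eq_integrable => // t; rewrite inE => Dt.
by rewrite /= fg.
Qed.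

Lemma intg_norm D f : intg D f -> intg D (fun t => `|f t|).
Proof. exact: integrable_norm. Qed.

Lemma intg_itv_cst a k : intg `]0, a[ (fun=> k).
Proof.
apply: measurable_bounded_integrable => //.
  by rewrite /= lebesgue_measure_itv /=; case: ifP => _; rewrite ?ltry.
exists `|k|; split; [exact: num_real|] => M kM t _ /=.
exact: ltW.
Qed.

Lemma Rint_itv_cst a k : 0 <= a -> \int[mu]_(t in `]0%R, a[) k = k * a.
Proof.
move=> a0; rewrite Rintegral_cst//= lebesgue_measure_itv /= lte_fin.
move: a0; rewrite le_eqVlt => /predU1P[<-|a0]; first by rewrite ltxx.
by rewrite a0 sube0.
Qed.

Lemma Rint_ae D f g : measurable D -> intg D f -> measurable_fun D g ->
  {ae mu, forall t, D t -> f t = g t} ->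
  \int[mu]_(t in D) f t = \int[mu]_(t in D) g t.
Proof.
move=> mD /intgP[mf _] mg fg; congr fine; apply: ae_eq_integral => //.
- exact/measurable_EFinP.
- exact/measurable_EFinP.
- apply: filterS fg; first exact: (ae_filter_ringOfSetsType mu).
  by move=> t /[apply] ->.
Qed.

End interval_integral.

Section bochner.
Context {R : realType} {H : preHilbert R}.
Local Notation mu := (@lebesgue_measure R).
Variable a : R.
Local Notation D := `]0%R, a[%classic.
Implicit Types f g : R -> H.

Definition bL2 f := SM f /\ intg D (fun t => ip (f t) (f t)).

Definition bip f g : R := \int[mu]_(t in D) ip (f t) (g t).

Lemma bL2_SM f : bL2 f -> SM f. Proof. by case. Qed.

Lemma SM_measurable_ip f g : SM f -> SM g ->
  measurable_fun D (fun t => ip (f t) (g t)).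
Proof. by move=> mf mg; apply: measurable_funTS; exact: measurable_ip. Qed.

Lemma intg_ip f g : bL2 f -> bL2 g -> intg D (fun t => ip (f t) (g t)).
Proof.
move=> [mf ff] [mg gg].
apply: (le_intg _ _ _ (intgD _ ff gg)) => //; first exact: SM_measurable_ip.
move=> t _; apply: le_trans (normr_ip_le _ _) _.
rewrite -!sqr_nrm; have := nrm_ge0 (f t); have := nrm_ge0 (g t).
by have := sqr_ge0 (nrm (f t) - nrm (g t)); nra.
Qed.

Lemma bL2_le f g : SM f -> (forall t, D t -> nrm (f t) <= nrm (g t)) ->
  bL2 g -> bL2 f.
Proof.
move=> mf fg [mg gg]; split=> //.
apply: (le_intg _ _ _ gg) => //; first exact: SM_measurable_ip.
move=> t Dt; rewrite ger0_norm ?ip_ge0// -!sqr_nrm.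
by rewrite ler_pXn2r ?nnegrE ?nrm_ge0// fg.
Qed.

Lemma bL2_DZ k f g : bL2 f -> bL2 g -> bL2 (k *: f + g).
Proof.
move=> lf lg; split; first by apply: SM_DZ; exact: bL2_SM.
have h : intg D (fun t => k ^+ 2 * ip (f t) (f t) +
    (2 * k * ip (f t) (g t) + ip (g t) (g t))).
  apply: intgD => //; first by apply: intgZ => //; case: lf.
  by apply: intgD => //; [apply: intgZ => //; exact: intg_ip|case: lg].
apply: eq_intg h => // t _.
by rewrite !(ipDl, ipDr, ipZl, ipZr) (ipC (g t) (f t)) /=; ring.
Qed.

Lemma bL2_cst x : bL2 (fun=> x).
Proof. by split; [exact: SM_cst|exact: intg_itv_cst]. Qed.

Definition bL2_sub : subspace (R -> H) := Subspace (bL2_cst 0) bL2_DZ.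

Lemma bipC f g : bip f g = bip g f.
Proof. by congr fine; apply: eq_integral => t _; rewrite ipC. Qed.

Lemma bipDZl k f g h : bL2 f -> bL2 g -> bL2 h ->
  bip (k *: f + g) h = k * bip f h + bip g h.
Proof.
move=> lf lg lh; rewrite /bip -RintegralZl//; last exact: intg_ip.
rewrite -RintegralD//; [|apply: intgZ => //; exact: intg_ip|exact: intg_ip].
by apply: eq_Rintegral => t _; rewrite ipDZl.
Qed.

Lemma bip_ge0 f : 0 <= bip f f.
Proof. by apply: Rintegral_ge0 => t _; exact: ip_ge0. Qed.

Definition BL2 : preHilbert R :=
  sub_preHilbert (S := bL2_sub) (fun f g _ _ => bipC f g) bipDZl
    (fun f _ => bip_ge0 f).

End bochner.

Lemma limn_einf_bounded (R : realType) (u : nat -> \bar R) (C : \bar R) n :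
  (forall m, (n <= m)%N -> (u m <= C)%E) -> (limn_einf u <= C)%E.
Proof.
move=> uC; rewrite limn_einf_lim; apply: lime_le; first exact: is_cvg_einfs.
apply: nearW => k; apply: le_trans (uC (maxn k n) _); last exact: leq_maxr.
by apply: ereal_inf_lbound; exists (maxn k n) => //=; exact: leq_maxl.
Qed.

Section bochner_complete.
Context {R : realType} {H : preHilbert R} (cH : ph_complete H).
Local Notation mu := (@lebesgue_measure R).
Variables (a : R) (a0 : 0 < a).
Local Notation D := `]0%R, a[%classic.

Lemma sqr_nrm_BL2 (u : BL2 (H := H) a) :
  nrm u ^+ 2 = \int[mu]_(t in D) ip (\val u t) (\val u t).
Proof. by rewrite sqr_nrm. Qed.

Let step (u : nat -> BL2 (H := H) a) n t : R :=
  nrm (\val (u n.+1) t - \val (u n) t).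

Let SMu (u : nat -> BL2 (H := H) a) n : SM (\val (u n)).
Proof. by case: (ssubP (u n)). Qed.

Let mstep u n : measurable_fun setT (step u n).
Proof. by apply: measurable_nrm; apply: SMB; exact: SMu. Qed.

Let int_step u n : nrm (u n.+1 - u n) <= 2^-1 ^+ n ->
  (\int[mu]_(t in D) (step u n t)%:E <= ((1 + a) * 2^-1 ^+ n)%:E)%E.
Proof.
set d := u n.+1 - u n => du.
have d2 : intg D (fun t => ip (\val d t) (\val d t)) by case: (ssubP d).
set k : R := 2 ^+ n.
have k0 : 0 < k by rewrite exprn_gt0.
have kE : 2^-1 ^+ n = k^-1 by rewrite exprVn.
(* The bound [p <= (k p^2 + 1/k) / 2] with [k = 2^n]: after integration both terms have size [2^-n],
   the squared norm of the increment being at most [4^-n]. *)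
pose g t := 2^-1 * (k * ip (\val d t) (\val d t) + k^-1).
have gi : intg D g.
  by apply: intgZ => //; apply: intgD => //; [exact: intgZ|exact: intg_itv_cst].
apply: (@le_trans _ _ (\int[mu]_(t in D) (g t)%:E)%E).
  apply: ge0_le_integral => //.
  - by move=> t _; rewrite lee_fin nrm_ge0.
  - by apply/measurable_EFinP; apply: measurable_funTS; exact: mstep.
  - exact: measurable_int gi.
  - move=> t _; rewrite lee_fin /g -sqr_nrm.
    have -> : \val d t = \val (u n.+1) t - \val (u n) t by [].
    rewrite -/(step u n t); set p := step u n t.
    have -> : 2^-1 * (k * p ^+ 2 + k^-1) = (k ^+ 2 * p ^+ 2 + 1) / (2 * k).
      by field; rewrite gt_eqF.
    rewrite ler_pdivlMr ?mulr_gt0//.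
    have := sqr_ge0 (k * p - 1); lra.
have gE : \int[mu]_(t in D) g t =
    2^-1 * (k * nrm d ^+ 2 + a * k^-1).
  rewrite RintegralZl//; last first.
    by apply: intgD => //; [exact: intgZ|exact: intg_itv_cst].
  rewrite RintegralD//; [|exact: intgZ|exact: intg_itv_cst].
  by rewrite RintegralZl// sqr_nrm_BL2 Rint_itv_cst ?ltW// (mulrC a).
rewrite -[leLHS]fineK; last exact: integrable_fin_num gi.
rewrite lee_fin -/(Rintegral _ _ _) gE.
have : nrm d ^+ 2 <= k^-1 ^+ 2.
  rewrite ler_pXn2r//; [by rewrite -kE|by rewrite nnegrE nrm_ge0|].
  by rewrite nnegrE invr_ge0 ltW.
rewrite -(ler_pM2l k0) => h.
have -> : 2^-1 ^+ n = k^-1 by [].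
have : k * k^-1 ^+ 2 = k^-1 by rewrite expr2 mulVKf ?gt_eqF.
have : 0 < k^-1 by rewrite invr_gt0.
move=> q0; have := mulr_gt0 a0 q0; lra.
Qed.

(* The sum of the norms of the increments is integrable, hence finite ae. *)
Let sum_step u t : \bar R := (\sum_(0 <= n <oo) (step u n t)%:E)%E.

Let good u : set R := D `&` [set t | (sum_step u t < +oo)%E].

Let sum_step_measurable u : measurable_fun D (sum_step u).
Proof.
apply: ge0_emeasurable_sum => // n.
  by move=> t _ _; rewrite lee_fin nrm_ge0.
by move=> _; apply/measurable_EFinP; apply: measurable_funTS; exact: mstep.
Qed.

Let good_measurable u : measurable (good u).
Proof. by apply: emeasurable_fun_infty_o => //; exact: sum_step_measurable. Qed.

Let good_ae u : (forall n, nrm (u n.+1 - u n) <= 2^-1 ^+ n) ->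
  {ae mu, forall t, D t -> good u t}.
Proof.
move=> hu.
have iS : mu.-integrable D (sum_step u).
  apply/integrableP; split; first exact: sum_step_measurable.
  under eq_integral.
    move=> t _; rewrite gee0_abs; last first.
      by apply: nneseries_ge0 => n _ _; rewrite lee_fin nrm_ge0.
    over.
  rewrite integral_nneseries//; last 2 first.
  - by move=> n; apply/measurable_EFinP; apply: measurable_funTS; exact: mstep.
  - by move=> n t _; rewrite lee_fin nrm_ge0.
  apply: (@le_lt_trans _ _
    (\sum_(0 <= n <oo) ((1 + a) * 2^-1 ^+ n)%:E)%E).
    apply: lee_nneseries => // n _; last exact: int_step.
    by move=> _; apply: integral_ge0 => t _; rewrite lee_fin nrm_ge0.
  have E : (\sum_(0 <= i < n) ((1 + a) * 2^-1 ^+ i)%:E)%E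
      @[n --> \oo] --> ((1 + a) / (1 - 2^-1))%:E.
    under eq_fun do rewrite sumEFin.
    apply: cvg_EFin; first exact: nearW.
    rewrite (_ : _ \o _ = series (geometric (1 + a) 2^-1)).
      apply: cvg_geometric_series.
      by rewrite ger0_norm ?invr_ge0// invf_lt1// ltr1n.
    by apply/funext => n.
  by rewrite (cvg_lim (@ereal_hausdorff R) E) ltry.
have hS : {ae mu, forall t, D t -> sum_step u t \is a fin_num}.
  exact: integrable_ae iS.
apply: filterS hS; first exact: (ae_filter_ringOfSetsType mu).
move=> t h Dt; split=> //=; have := h Dt.
by rewrite fin_numElt => /andP[].
Qed.

Let good_cvg u t : good u t -> exists x : H, ph_cvg (fun n => \val (u n) t) x.
Proof.
move=> [Dt /= St]; apply: cauchy_cvg => // e e0.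
have p0 n : 0 <= step u n t by exact: nrm_ge0.
have S0 : (0 <= sum_step u t)%E by apply: nneseries_ge0 => n _ _; rewrite lee_fin.
have cs : cvgn (series (fun n => step u n t)).
  apply: nondecreasing_is_cvgn.
    by apply: nondecreasing_series => n _ _.
  exists (fine (sum_step u t)) => _ [n _ <-].
  rewrite -lee_fin fineK ?ge0_fin_numE// -sumEFin.
  by apply: nneseries_lim_ge => k _ _; rewrite lee_fin.
have /cvgrPdist_le/(_ (e / 2)) := cs.
case; first by rewrite divr_gt0.
move=> n0 _ hn; exists n0 => m n n0m n0n.
have tele k j : (k <= j)%N -> nrm (\val (u j) t - \val (u k) t) <=
    series (fun n => step u n t) j - series (fun n => step u n t) k.
  elim: j => [|j IH]; first by rewrite leqn0 => /eqP ->; rewrite !subrr nrm0.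
  rewrite leq_eqVlt => /predU1P[->|]; first by rewrite !subrr nrm0.
  rewrite ltnS => /IH h; rewrite seriesSr -addrAC addrC.
  apply: le_trans (ler_nrm_distD (\val (u j) t) _ _) _.
  by rewrite lerD// addrC.
have key k j : (n0 <= k)%N -> (k <= j)%N ->
    nrm (\val (u j) t - \val (u k) t) <= e.
  move=> n0k kj; apply: le_trans (tele _ _ kj) _.
  have h1 := hn _ n0k; have h2 := hn _ (leq_trans n0k kj).
  have := ler_norm (series (fun n => step u n t) j - series (fun n => step u n t) k).
  move: h1 h2; set A := limn _; set B := series _ k; set C := series _ j.
  move=> h1 h2 _; have := ler_normB (A - B) (A - C).
  have -> : A - B - (A - C) = C - B by ring.
  have := ler_norm (C - B).
  have -> : e = e / 2 + e / 2 by field.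
  lra.
have [mn|/ltnW nm] := leqP m n; last exact: key.
by rewrite nrmBC; exact: key.
Qed.

Let aux (x y p q : R) :
  y <= 2 * q - 2 * p -> x <= p -> x + y <= 2 * q - 2 * (2^-1 * p).
Proof. lra. Qed.

(** Riesz--Fischer. The sequence converges at the times in [good u] and is replaced by 0 elsewhere;
    Fatou's lemma, applied to [v m - v n] as [m] grows, then converts the Cauchy bound into a bound
    on the distance from [v n] to the pointwise limit. *)
Theorem BL2_complete : ph_complete (BL2 (H := H) a).
Proof.
move=> u hu.
have /choice[f0 hf0] : forall t, exists x : H,
    good u t -> ph_cvg (fun n => \val (u n) t) x.
  move=> t; have [gt|ngt] := pselect (good u t); last by exists 0.
  by have [x hx] := good_cvg gt; exists x.
pose f t := if t \in good u then f0 t else 0.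
pose v n t := if t \in good u then \val (u n) t else 0.
have SMv n : SM (v n).
  by apply: SM_if; [exact: good_measurable|exact: SMu|exact: SM_cst].
have vf t : ph_cvg (v^~ t) (f t).
  rewrite /v /f; case: ifPn => [|_]; last exact: ph_cvg_cst.
  by rewrite inE => /hf0.
have SMf : SM f by exact: SM_lim vf.
have bd n m : (n <= m)%N -> nrm (u m - u n) <= 2 * 2^-1 ^+ n.
  (* The subtracted term is what makes the induction on [m] close. *)
  move=> nm; suff : nrm (u m - u n) <= 2 * 2^-1 ^+ n - 2 * 2^-1 ^+ m.
    by move/le_trans; apply; rewrite gerBl mulr_ge0// exprn_ge0// invr_ge0.
  elim: m nm => [|m IH]; first by rewrite leqn0 => /eqP ->; rewrite !subrr nrm0.
  rewrite leq_eqVlt => /predU1P[->|]; first by rewrite !subrr nrm0.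
  rewrite ltnS => /IH h; apply: le_trans (ler_nrm_distD (u m) _ _) _.
  move: h (hu m); rewrite exprS; move: (nrm _) (nrm _) (_ ^+ _) (_ ^+ _).
  exact: aux.
have uv n : {ae mu, forall t, D t -> v n t = \val (u n) t}.
  have := good_ae hu; apply: filterS; first exact: (ae_filter_ringOfSetsType mu).
  by move=> t /[apply] gt; rewrite /v mem_set.
have lv n : bL2 a (v n).
  apply: (@bL2_le _ _ _ _ (\val (u n))) => //; last exact: (ssubP (u n)).
  by move=> t _; rewrite /v; case: ifP => // _; rewrite nrm0 nrm_ge0.
have key n : (\int[mu]_(t in D) (ip (f t - v n t) (f t - v n t))%:E <=
    ((2 * 2^-1 ^+ n) ^+ 2)%:E)%E.
  pose F m t := (ip (v m t - v n t) (v m t - v n t))%:E.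
  have -> : (\int[mu]_(t in D) (ip (f t - v n t) (f t - v n t))%:E =
      \int[mu]_(t in D) limn_einf (F^~ t))%E.
    apply: eq_integral => t _; apply/esym; apply: (fst (cvg_limn_einf_sup _)).
    apply: cvg_EFin; first exact: nearW.
    have h : ph_cvg (fun m => v m t - v n t) (f t - v n t).
      have := ph_cvgDZ 1 (vf t) (ph_cvg_cst (- v n t)); rewrite scale1r.
      by under eq_fun do rewrite scale1r.
    exact: (ph_cvg_ip h h).
  apply: le_trans (fatou _ _ _ _) _ => //.
  - move=> m; apply/measurable_EFinP; apply: SM_measurable_ip; exact: SMB.
  - by move=> m t _; rewrite lee_fin ip_ge0.
  apply: (limn_einf_bounded (n := n)) => m nm.
  have -> : (\int[mu]_(t in D) F m t = (nrm (u m - u n) ^+ 2)%:E)%E.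
    rewrite sqr_nrm_BL2 /Rintegral fineK.
      apply: ae_eq_integral => //.
      - apply/measurable_EFinP; apply: SM_measurable_ip; exact: SMB.
      - apply/measurable_EFinP; apply: SM_measurable_ip; exact: (SMB (SMu _ _) (SMu _ _)).
      - have := uv m; have := uv n; apply: filterS2.
          exact: (ae_filter_ringOfSetsType mu).
        by move=> t h h' Dt; rewrite /F h// h'.
    by apply: integrable_fin_num => //; case: (ssubP (u m - u n)).
  by rewrite lee_fin ler_pXn2r ?nnegrE ?nrm_ge0 ?bd// mulr_ge0// exprn_ge0// invr_ge0.
have lfv n : bL2 a (f - v n).
  split; first exact: SMB.
  apply/intgP; split; first by apply: SM_measurable_ip; exact: SMB.
  under eq_integral do rewrite ger0_norm ?ip_ge0//.
  exact: le_lt_trans (key n) (ltry _).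
have lf : bL2 a f.
  rewrite (_ : f = 1 *: (f - v 0) + v 0); last by rewrite scale1r subrK.
  exact: bL2_DZ.
exists (ssub_of (S := bL2_sub a) lf).
apply/(cvg0_le (g := fun n => 2 * 2^-1 ^+ n)) => [n|]; last first.
  have h : 2 * 2^-1 ^+ n @[n --> \oo] --> (2 * 0 : R).
    apply: cvgM; first exact: cvg_cst.
    by apply: cvg_expr; rewrite ger0_norm ?invr_ge0// invf_lt1// ltr1n.
  by rewrite mulr0 in h.
rewrite nrm_ge0 /= nrmBC -(ler_pXn2r (n := 2))//; last 2 first.
- by rewrite nnegrE nrm_ge0.
- by rewrite nnegrE mulr_ge0// exprn_ge0// invr_ge0.
rewrite -lee_fin (le_trans _ (key n))// sqr_nrm_BL2 /Rintegral fineK; last first.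
  by apply: integrable_fin_num => //; case: (ssubP (ssub_of (S := bL2_sub a) lf - u n)).
rewrite le_eqVlt; apply/orP; left; apply/eqP; apply: ae_eq_integral => //.
- apply/measurable_EFinP; apply: SM_measurable_ip; exact: (SMB SMf (SMu _ _)).
- apply/measurable_EFinP; apply: SM_measurable_ip; exact: SMB.
- have := uv n; apply: filterS; first exact: (ae_filter_ringOfSetsType mu).
  by move=> t h Dt; rewrite h.
Qed.

End bochner_complete.

(** * Riesz representation *)

Section real_line_pre_hilbert.
Context {R : realType}.
Local Notation mu := (@lebesgue_measure R).

Definition RH : preHilbert R :=
  @PreHilbert R R^o (fun x y : R => x * y) (@mulrC R)
    (fun a x y z : R => esym (etrans (congr1 (+%R^~ (y * z)) (mulrA a x z))
      (esym (mulrDl (a * x) y z)))) (fun x : R => sqr_ge0 x).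

Lemma nrm_RH (x : RH) : nrm x = `|x : R|.
Proof. by rewrite /nrm /= -expr2 sqrtr_sqr. Qed.

Lemma RH_complete : ph_complete RH.
Proof.
move=> u hu.
have cu : cvgn (u : nat -> R).
  pose v n := u n.+1 - u n.
  have vs : cvgn (series v).
    apply: normed_cvg; apply: (@series_le_cvg _ _ (geometric 1 2^-1)).
    - by move=> n; rewrite /= normr_ge0.
    - by move=> n; rewrite /= mul1r exprn_ge0// invr_ge0.
    - by move=> n /=; rewrite mul1r; have := hu n; rewrite nrm_RH.
    - apply: is_cvg_geometric_series.
      by rewrite ger0_norm ?invr_ge0// invf_lt1// ltr1n.
  have -> : u = (fun n => series v n + u 0).
    apply/funext => n; elim: n => [|n IH].
      by rewrite /series /= big_geq// add0r.
    by rewrite seriesSr addrAC -IH /v addrC subrK.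
  by apply: is_cvgD => //; exact: is_cvg_cst.
exists (limn (u : nat -> R)); apply/ph_cvgP => e e0.
have /cvgrPdist_le/(_ e e0)[n0 _ hn] := cu.
by exists n0 => n n0n; rewrite nrm_RH distrC; exact: hn.
Qed.

Lemma measurable_SM (f : R -> R) : measurable_fun setT f -> SM (H := RH) f.
Proof.
move=> mf; apply: (@SM_of_dense _ RH _
    (fun j => if (unpickle j : option rat) is Some q then ratr q else 0)).
  move=> j; under eq_fun do rewrite nrm_RH.
  by apply: measurableT_comp => //; exact: measurable_funB.
move=> t e e0.
have [|q] := @rat_in_itvoo _ (f t) (f t + e); first by rewrite ltrDl.
rewrite in_itv /= => /andP[h1 h2].
exists (pickle q); rewrite pickleK nrm_RH ltr_norml.
by apply/andP; split; lra.
Qed.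

Lemma SM_measurable (f : R -> R) : SM (H := RH) f -> measurable_fun setT f.
Proof.
move=> mf; have := measurable_ip mf (SM_cst (1 : RH)).
by under eq_fun do rewrite /= mulr1.
Qed.

End real_line_pre_hilbert.

Section operator_families.
Context {R : realType} {H H' : preHilbert R}.

Lemma SM_comp_lip (h : H -> H') (f : R -> H) :
  (exists M, forall x y, nrm (h x - h y) <= M * nrm (x - y)) ->
  SM f -> SM (h \o f).
Proof.
move=> [M hM] [s [fs sf]]; exists (fun n => h \o s n); split=> [n|t].
  exact: fsimple_comp.
apply: (cvg0_le (g := fun n => M * nrm (s n t - f t))) => [n|].
  by rewrite nrm_ge0 hM.
have := cvgM (cvg_cst M) (sf t); rewrite mulr0; exact.
Qed.

(** Along a simple path, [K t (f t)] is a finite patchwork of the measurable paths [K t x]. The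
    general case is a pointwise limit, for which a Lipschitz constant depending on [t] is enough. *)
Lemma SM_op (K : R -> H -> H') (f : R -> H) :
  (forall t, exists M, forall x y, nrm (K t x - K t y) <= M * nrm (x - y)) ->
  (forall x, SM (K^~ x)) -> SM f -> SM (fun t => K t (f t)).
Proof.
move=> Kb Km [s [fs sf]].
apply: (@SM_lim _ _ (fun n t => K t (s n t))) => [n|t]; last first.
  have [M hM] := Kb t.
  apply: (cvg0_le (g := fun n => M * nrm (s n t - f t))) => [n|].
    by rewrite nrm_ge0 hM.
  have := cvgM (cvg_cst M) (sf t); rewrite mulr0; exact.
have [m [c [b [cm mc sb]]]] := fs n.
(* Induction on the number [j] of pieces of the simple path already patched together. *)
suff h j : SM (fun t => if (c t < j)%N then K t (b (c t)) else 0).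
  have := h m; congr SM; apply/funext => t; by rewrite cm sb.
elim: j => [|j IH]; first exact: SM_cst.
have := SM_if (mc j) (Km (b j)) IH; congr SM; apply/funext => t.
case: (boolP (t \in c @^-1` [set j])).
  by rewrite inE /= => ->; rewrite ltnS leqnn.
rewrite notin_setE /= => cj; rewrite ltnS [in RHS]leq_eqVlt.
by case: eqP => // E; case: (cj E).
Qed.

End operator_families.

Section scaling.
Context {R : realType} {H : preHilbert R}.

Lemma SM_scale (th : R -> R) (f : R -> H) : measurable_fun setT th -> SM f ->
  SM (fun t => th t *: f t).
Proof.
move=> mth mf; apply: (@SM_op _ _ _ (fun t x => th t *: x)) => //.
  by move=> t; exists `|th t| => x y; rewrite -scalerBr nrmZ.
move=> x; have := measurable_SM mth.
apply: (@SM_comp_lip _ RH H (fun r : R => r *: x)).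
exists (nrm x) => y z; rewrite -scalerBl nrmZ nrm_RH mulrC.
exact: lexx.
Qed.

End scaling.

Section riesz.
Context {R : realType} {Y : preHilbert R} (cY : ph_complete Y).
Context {Phi : lmodType R} (k : Phi -> Y) (L : Phi -> R) (C : R).
Hypothesis kDZ : forall a x y, k (a *: x + y) = a *: k x + k y.
Hypothesis LDZ : forall a x y, L (a *: x + y) = a * L x + L y.
Hypothesis Lk : forall x, `|L x| <= C * nrm (k x).

Let I x := nrm (k x) ^+ 2 / 2 - L x.

Let I_ge x : - (C ^+ 2) / 2 <= I x.
Proof.
have := Lk x; have := ler_norm (L x); rewrite /I.
have := sqr_ge0 (nrm (k x) - C); nra.
Qed.

Let inf_I : exists m, (forall x, m <= I x) /\
  forall e, 0 < e -> exists x, I x <= m + e.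
Proof.
pose S := range I.
have hS : has_inf S.
  split; first by exists (I 0), 0.
  by exists (- (C ^+ 2) / 2) => _ [x _ <-].
exists (inf S); split=> [x|e e0].
  by apply: ge_inf; [case: hS|exists x].
have [_ [x _ <-] h] := inf_adherent e0 hS.
by exists x; exact: ltW.
Qed.

Let I_line x z s : I (s *: z + x) =
  I x + s * (ip (k x) (k z) - L z) + s ^+ 2 / 2 * nrm (k z) ^+ 2.
Proof.
rewrite /I kDZ LDZ sqr_nrmD nrmZ exprMn real_normK ?num_real// ipZl (ipC (k z)).
by field.
Qed.

(** Dirichlet's principle for the functional [I]: the parallelogram identity makes the images under
    [k] of a minimizing sequence Cauchy, and minimality along lines gives the equation in the limit.
    Completeness is asked of [Y] alone, while [k] is any linear map on a space of test objects,
    which is the setting of Lions' method. *)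
Theorem riesz_representation : exists u : Y, forall x, ip u (k x) = L x.
Proof.
have [m [mI adh]] := inf_I.
(* With [q = 2^-n], the excess [q^2 / 8] bounds the square of the increment by [4 (q^2/8 + q^2/32)],
   which is at most [q^2]. *)
have /choice[x hx] : forall n : nat, exists x, I x <= m + (2^-1 ^+ n) ^+ 2 / 8.
  by move=> n; apply: adh; rewrite divr_gt0// exprn_gt0// exprn_gt0// invr_gt0.
have [n|u xu] := cY (u := k \o x).
  have q0 : 0 <= (2^-1 : R) ^+ n by rewrite exprn_ge0// invr_ge0.
  rewrite /= -(ler_pXn2r (n := 2)) ?nnegrE ?nrm_ge0//.
  have kB : nrm (k (x n.+1) - k (x n)) ^+ 2 =
      4 * (I (x n.+1) + I (x n) - 2 * I (2^-1 *: (x n.+1 - x n) + x n)).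
    rewrite I_line /I.
    have -> : L (x n.+1 - x n) = L (x n.+1) - L (x n).
      by rewrite -scaleN1r addrC LDZ; ring.
    have -> : k (x n.+1 - x n) = k (x n.+1) - k (x n).
      by rewrite -scaleN1r addrC kDZ scaleN1r addrC.
    rewrite !sqr_nrm !(ipBl, ipBr) (ipC (k (x n.+1))).
    by field.
  have := hx n; have := hx n.+1; have := mI (2^-1 *: (x n.+1 - x n) + x n).
  rewrite kB [2^-1 ^+ n.+1]exprS exprMn.
  have := sqr_ge0 ((2^-1 : R) ^+ n).
  move: (I _) (I _) (I _) (_ ^+ 2) => A B D E; lra.
exists u => z.
have lim : ip (k (x n)) (k z) - L z @[n --> \oo] --> ip u (k z) - L z.
  apply: cvgB; last exact: cvg_cst.
  by apply: ph_cvg_ip => //; exact: ph_cvg_cst.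
have d0 : (2^-1 ^+ n) ^+ 2 / 8 @[n --> \oo] --> (0 : R).
  have h : (2^-1 : R) ^+ n @[n --> \oo] --> (0 : R).
    by apply: cvg_expr; rewrite ger0_norm ?invr_ge0// invf_lt1// ltr1n.
  have := cvgM (cvgM h h) (cvg_cst (8^-1 : R)); rewrite !mul0r; exact.
have key s : 0 <= s * (ip u (k z) - L z) + s ^+ 2 / 2 * nrm (k z) ^+ 2.
  have h : s * (ip (k (x n)) (k z) - L z) + s ^+ 2 / 2 * nrm (k z) ^+ 2 +
      (2^-1 ^+ n) ^+ 2 / 8 @[n --> \oo] -->
      s * (ip u (k z) - L z) + s ^+ 2 / 2 * nrm (k z) ^+ 2 + 0.
    apply: cvgD => //; apply: cvgD; last exact: cvg_cst.
    by apply: cvgM => //; exact: cvg_cst.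
  rewrite addr0 in h; apply: (ler_cvg_to (cvg_cst 0) h).
  apply: nearW => n; have := mI (s *: z + x n); rewrite I_line.
  by have := hx n; lra.
move: key; set A := ip u (k z) - L z; set B := nrm _ ^+ 2 => key.
suff : A = 0 by rewrite /A => /eqP; rewrite subr_eq0 => /eqP.
have B0 : 0 <= B by exact: sqr_ge0.
(* At this point the quadratic in [s] is a negative multiple of [A ^+ 2]; the 1 added to [B] avoids
   dividing by zero. *)
have := key (- A / (B + 1)).
have -> : - A / (B + 1) * A + (- A / (B + 1)) ^+ 2 / 2 * B =
   - (A ^+ 2 * (B / 2 + 1) / (B + 1) ^+ 2).
  by field; lra.
rewrite oppr_ge0 pmulr_lle0 ?invr_gt0 ?exprn_gt0//; last by lra.
rewrite pmulr_lle0; last by lra.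
by move=> h; apply/eqP; rewrite -sqrf_eq0 eq_le h sqr_ge0.
Qed.

End riesz.

(** * Lions' existence theorem *)

Section almost_everywhere.
Context {R : realType}.
Local Notation mu := (@lebesgue_measure R).
Implicit Types P Q S : R -> Prop.

Lemma ae_imp P Q : {ae mu, forall t, P t} -> (forall t, P t -> Q t) ->
  {ae mu, forall t, Q t}.
Proof.
by move=> h PQ; apply: filterS h; first exact: (ae_filter_ringOfSetsType mu).
Qed.

Lemma ae_imp2 P Q S : {ae mu, forall t, P t} -> {ae mu, forall t, Q t} ->
  (forall t, P t -> Q t -> S t) -> {ae mu, forall t, S t}.
Proof.
by move=> h h' PQ; apply: filterS2 h h'; first exact: (ae_filter_ringOfSetsType mu).
Qed.

Lemma ae_all P : (forall t, P t) -> {ae mu, forall t, P t}.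
Proof. by move=> h; apply: aeW. Qed.

Lemma ae_fin (I : finType) (P : I -> R -> Prop) :
  (forall i, {ae mu, forall t, P i t}) -> {ae mu, forall t, forall i, P i t}.
Proof.
move=> h; have F := ae_filter_ringOfSetsType mu.
exact: (@filter_forall _ _ _ _ F h).
Qed.

Lemma ae_nat (P : nat -> R -> Prop) :
  (forall i, {ae mu, forall t, P i t}) -> {ae mu, forall t, forall i, P i t}.
Proof. by move=> h; apply: ae_foralln. Qed.

End almost_everywhere.

Section C1_functions.
Context {R : realType}.
Local Notation mu := (@lebesgue_measure R).
Implicit Types (f df g dg : R -> R).

Definition C1 f df := (forall x : R, is_derive x (1 : R) (f : R -> R^o) (df x)) /\
  continuous df.

Lemma C1_continuous f df : C1 f df -> continuous f.
Proof.
move=> [fd _] x; apply/differentiable_continuous/derivable1_diffP.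
by have [] := fd x.
Qed.

Lemma C1_cst (k : R) : C1 (fun=> k) (fun=> 0).
Proof. by split=> [x|x]; [exact: is_derive_cst|exact: cst_continuous]. Qed.

Lemma C1D f df g dg : C1 f df -> C1 g dg ->
  C1 (fun x => f x + g x) (fun x => df x + dg x).
Proof.
move=> [fd cf] [gd cg]; split=> [x|x]; first exact: is_deriveD.
by apply: cvgD; [exact: cf|exact: cg].
Qed.

Lemma C1M f df g dg : C1 f df -> C1 g dg ->
  C1 (fun x => f x * g x) (fun x => df x * g x + f x * dg x).
Proof.
move=> Cf Cg; have [fd cf] := Cf; have [gd cg] := Cg; split=> [x|x].
  have h := @is_deriveM R R^o f g x 1 (df x) (dg x) (fd x) (gd x).
  apply: is_derive_eq h _; rewrite /GRing.scale /=; ring.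
apply: cvgD; apply: cvgM.
- exact: cf.
- exact: (C1_continuous Cg).
- exact: (C1_continuous Cf).
- exact: cg.
Qed.

Lemma C1Z k f df : C1 f df -> C1 (fun x => k * f x) (fun x => k * df x).
Proof.
move=> Cf; have := C1M (C1_cst k) Cf.
by under [X in C1 _ X]eq_fun do rewrite mul0r add0r.
Qed.

Lemma C1_expR k : C1 (fun x => expR (k * x)) (fun x => k * expR (k * x)).
Proof.
split=> [x|x]; last first.
  apply: cvgM; first exact: cvg_cst.
  apply: continuous_comp; first exact: mulrl_continuous.
  exact: continuous_expR.
have h : is_derive x (1 : R) (fun x : R => k * x) k.
  have := @is_deriveZ R R^o R^o (fun x : R => x) k x 1 1 (is_derive_id _ _).
  by move/is_derive_eq; apply; rewrite /GRing.scale /= mulr1.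
have := @is_derive1_comp R expR (fun x : R => k * x) x _ _ (is_derive_expR _) h.
by move/is_derive_eq; apply; rewrite mulrC.
Qed.

Lemma continuous_intg f (a : R) : continuous f -> intg `]0, a[ f.
Proof.
move=> cf; apply: (@integrableS _ _ _ mu `[0, a]) => //.
  exact: subset_itv_oo_cc.
apply: continuous_compact_integrable; first exact: segment_compact.
exact: continuous_subspaceT.
Qed.

Lemma C1_FTC f df (a : R) : 0 < a -> C1 f df ->
  \int[mu]_(t in `]0, a[) df t = f a - f 0.
Proof.
move=> a0 Cf; have [fd cf] := Cf.
have i0 : intg `]0, a[ df by exact: continuous_intg.
rewrite Rintegral_itv_bndo_bndc// Rintegral_itv_obnd_cbnd; last first.
  apply: (@integrableS _ _ _ mu `[0, a]) => //; first exact: subset_itv_oc_cc.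
  apply: continuous_compact_integrable; first exact: segment_compact.
  exact: continuous_subspaceT.
rewrite /Rintegral (@continuous_FTC2 _ df f)//.
- exact: continuous_subspaceT.
- split.
  + by move=> x _; have [] := fd x.
  + exact/cvg_at_right_filter/(C1_continuous Cf).
  + exact/cvg_at_left_filter/(C1_continuous Cf).
- move=> x _; rewrite derive1E; have ? := fd x; exact: derive_val.
Qed.

End C1_functions.

Section bL2_tools.
Context {R : realType} {H : preHilbert R}.
Local Notation mu := (@lebesgue_measure R).
Variable T : R.
Local Notation D := `]0%R, T[%classic.
Implicit Types f g : R -> H.

Lemma bL2_bound M f g : SM g -> (forall t, D t -> nrm (g t) <= M * nrm (f t)) ->
  bL2 T f -> bL2 T g.
Proof.
move=> mg gf lf; apply: (@bL2_le _ _ _ _ (M *: f + 0)) => //; last first.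
  by apply: bL2_DZ => //; exact: (sset0 (bL2_sub T)).
move=> t Dt; rewrite !fctE addr0 nrmZ (le_trans (gf t Dt))//.
by rewrite ler_wpM2r ?nrm_ge0 ?ler_norm.
Qed.

Lemma bL2Z k f : bL2 T f -> bL2 T (fun t => k *: f t).
Proof.
move=> lf; apply: (bL2_bound (M := `|k|) _ _ lf); first by apply: SMZ; case: lf.
by move=> t _; rewrite nrmZ.
Qed.

Lemma bL2D f g : bL2 T f -> bL2 T g -> bL2 T (fun t => f t + g t).
Proof.
move=> lf lg; rewrite (_ : (fun _ => _) = 1 *: f + g); first exact: bL2_DZ.
by apply/funext => t; rewrite !fctE scale1r.
Qed.

Lemma bL2B f g : bL2 T f -> bL2 T g -> bL2 T (fun t => f t - g t).
Proof.
move=> lf lg; under eq_fun do rewrite -scaleN1r.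
by apply: bL2D => //; exact: bL2Z.
Qed.

Lemma Rint_eq0_ae (f : R -> R) : intg D f -> (forall t, 0 <= f t) ->
  \int[mu]_(t in D) f t = 0 -> {ae mu, forall t, D t -> f t = 0}.
Proof.
move=> fi f0 fE; have mf : measurable_fun D (EFin \o f) by exact: measurable_int fi.
have : (\int[mu]_(t in D) `|(f t)%:E| = 0)%E.
  under eq_integral do rewrite gee0_abs ?lee_fin//.
  by rewrite -[LHS]fineK ?[X in X%:E]fE//; exact: integrable_fin_num fi.
move=> E; have h : ae_eq mu D (EFin \o f) (cst 0%E).
  by apply: (ae_eq_integral_abs _ _ _).1.
by apply: (ae_imp (P := fun t => D t -> (f t)%:E = 0%E)) h _ => t h /h [].
Qed.

Lemma continuous_scale_bL2 (psi : R -> R) (om : H) f : continuous psi -> bL2 T f ->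
  bL2 T (fun t => psi t *: om + f t).
Proof.
move=> cpsi lf.
have lpsi : bL2 T (fun t => psi t *: om).
  split.
    by apply: SM_scale; [exact: continuous_measurable_fun|exact: SM_cst].
  apply: (@eq_intg _ _ (fun t => psi t * psi t * ip om om)) => //.
    by move=> t _; rewrite ipZl ipZr mulrA.
  apply: continuous_intg => t; apply: cvgM; last exact: cvg_cst.
  by apply: cvgM; exact: cpsi.
rewrite (_ : (fun _ => _) = 1 *: (fun t => psi t *: om) + f).
  exact: bL2_DZ.
by apply/funext => t; rewrite !fctE scale1r.
Qed.

Definition BL2_of f (lf : bL2 T f) : BL2 (H := H) T :=
  ssub_of (S := bL2_sub T) lf.

End bL2_tools.

Record linop (R : realType) (H H' : preHilbert R) := LinOp {
  linop_fun :> H -> H';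
  lopDZ : forall a x y, linop_fun (a *: x + y) = a *: linop_fun x + linop_fun y;
  lop_bound : exists M, forall x, nrm (linop_fun x) <= M * nrm x }.

Section linop_theory.
Context {R : realType} {H H' : preHilbert R}.
Implicit Types (h : linop H H') (a : R).

Lemma lopD h x y : h (x + y) = h x + h y.
Proof. by rewrite -[x in LHS]scale1r lopDZ scale1r. Qed.

Lemma lop0 h : h 0 = 0.
Proof. by apply: (addrI (h 0)); rewrite -lopD !addr0. Qed.

Lemma lopZ h a x : h (a *: x) = a *: h x.
Proof. by rewrite -[a *: x]addr0 lopDZ lop0 addr0. Qed.

Lemma lopB h x y : h (x - y) = h x - h y.
Proof. by rewrite lopD -scaleN1r lopZ scaleN1r. Qed.

Lemma lop_lip h : exists M, forall x y, nrm (h x - h y) <= M * nrm (x - y).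
Proof. by have [M hM] := lop_bound h; exists M => x y; rewrite -lopB. Qed.

Lemma SM_lop h (f : R -> H) : SM f -> SM (fun t => h (f t)).
Proof. by apply: SM_comp_lip; exact: lop_lip. Qed.

Lemma bL2_lop h T (f : R -> H) : bL2 T f -> bL2 T (fun t => h (f t)).
Proof.
move=> [mf fi]; have [M hM] := lop_bound h.
have mhf := SM_lop h mf; split=> //.
apply: (le_intg _ _ _ (intgZ (M ^+ 2) _ fi)) => //.
  exact: SM_measurable_ip.
move=> t _; rewrite ger0_norm ?ip_ge0// -!sqr_nrm -exprMn.
by rewrite ler_pXn2r ?nnegrE ?nrm_ge0 ?hM// (le_trans (nrm_ge0 (h (f t)))).
Qed.

End linop_theory.

Section lions.
Context {R : realType} {H : preHilbert R} (cH : ph_complete H).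
Local Notation mu := (@lebesgue_measure R).
Variables (T : R) (T0 : 0 < T).
Local Notation D := `]0%R, T[%classic.
Variables (P Pa : linop H H).
Hypothesis PPa : forall x y, ip (P x) y = ip x (Pa y).
Variables (I : finType) (c : I -> H).

(** The constraint space is cut out by finitely many vectors, so that constraints proved one at a
    time for almost every [t] hold jointly for almost every [t]. *)
Definition orth_set : set H := [set w | forall i, ip (c i) w = 0].

Variables (K Ka : R -> linop H H) (M c0 lam : R).
Hypothesis KKa : forall t x y, ip (K t x) y = ip x (Ka t y).
Hypothesis Kab : forall t x, nrm (Ka t x) <= M * nrm x.
Hypothesis Kam : forall x, SM (fun t => Ka t x).
Hypothesis c00 : 0 < c0.
Hypothesis lam0 : 0 <= lam.
Hypothesis coer : forall t w, orth_set w ->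
  c0 * nrm w ^+ 2 <= ip (K t w) w + lam * nrm (P w) ^+ 2.
Variables (F : R -> H) (lF : bL2 T F) (z0 : H).

Lemma orth_set_DZ a x y : orth_set x -> orth_set y -> orth_set (a *: x + y).
Proof. by move=> ox oy i; rewrite ipDr ipZr ox oy mulr0 addr0. Qed.

(* Finite sums [sum_j psi_j(t) om_j], together with their derivatives. *)
Inductive test_fun : (R -> H) -> (R -> H) -> Prop :=
| test_fun0 : test_fun 0 0
| test_funS psi dpsi om f df : C1 psi dpsi -> psi T = 0 -> orth_set om ->
    test_fun f df ->
    test_fun (fun t => psi t *: om + f t) (fun t => dpsi t *: om + df t).

Lemma test_fun_DZ a f df g dg : test_fun f df -> test_fun g dg ->
  test_fun (a *: f + g) (a *: df + dg).
Proof.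
move=> tf; elim: tf g dg => [|psi dpsi om f' df' Cpsi psiT om0 tf' IH] g dg tg.
  by rewrite !scaler0 !add0r.
have := test_funS (C1Z a Cpsi) _ om0 (IH g dg tg); rewrite psiT mulr0 => /(_ erefl).
by congr test_fun; apply/funext => t /=; rewrite !fctE scalerDr scalerA addrA.
Qed.

Lemma test_fun_orth f df t : test_fun f df -> orth_set (f t).
Proof.
elim=> [|psi dpsi om f' df' _ _ om0 _ IH]; first by move=> i; rewrite ip0r.
exact: orth_set_DZ.
Qed.

Lemma test_fun_end f df : test_fun f df -> f T = 0.
Proof.
by elim=> [//|psi dpsi om f' df' _ psiT _ _ ->]; rewrite psiT scale0r addr0.
Qed.

Lemma test_fun_bL2 f df : test_fun f df -> bL2 T f /\ bL2 T df.
Proof.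
elim=> [|psi dpsi om f' df' Cpsi _ _ _ [lf ldf]].
  by split; exact: (sset0 (bL2_sub T)).
split; apply: continuous_scale_bL2 => //; first exact: C1_continuous Cpsi.
by case: Cpsi.
Qed.

Lemma test_fun_C1_ip f df g dg : test_fun f df -> test_fun g dg ->
  C1 (fun t => ip (P (f t)) (P (g t)))
     (fun t => ip (P (df t)) (P (g t)) + ip (P (f t)) (P (dg t))).
Proof.
move=> tf tg.
have h om : C1 (fun t => ip (P (f t)) om) (fun t => ip (P (df t)) om).
  elim: {tg} tf => [|psi dpsi om' f' df' Cpsi _ _ _ IH].
    by under [X in C1 X _]eq_fun do rewrite lop0 ip0l;
      under [X in C1 _ X]eq_fun do rewrite lop0 ip0l; exact: C1_cst.
  have := C1D (C1Z (ip (P om') om) Cpsi) IH.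
  congr C1; apply/funext => t; by rewrite lopD lopZ /= ipDl ipZl mulrC.
elim: tg => [|psi dpsi om g' dg' Cpsi _ _ _ IH].
  have := C1_cst (0 : R); congr C1; apply/funext => t.
    by rewrite lop0 ip0r.
  by rewrite lop0 !ip0r addr0.
have := C1D (C1M Cpsi (h (P om))) IH.
congr C1; apply/funext => t; rewrite !lopD !lopZ /= !ipDr !ipZr //.
ring.
Qed.

(** Exponential weight: differentiating [th] produces the term [- lam |P f|^2] that compensates the
    defect of coercivity. *)
Let th (t : R) := expR (- (2 * lam) * t).
Let C1th : C1 th (fun t => - (2 * lam) * th t). Proof. exact: C1_expR. Qed.
Let th0 t : 0 < th t. Proof. exact: expR_gt0. Qed.

Lemma test_fun_energy f df : test_fun f df ->
  \int[mu]_(t in D) (th t * (ip (P (f t)) (P (df t)) -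
     lam * ip (P (f t)) (P (f t)))) = - (ip (P (f 0)) (P (f 0)) / 2).
Proof.
move=> tf; have C := C1Z 2^-1 (C1M C1th (test_fun_C1_ip tf tf)).
have := C1_FTC T0 C; rewrite (test_fun_end tf) lop0 ip0l !mulr0 sub0r.
rewrite [th 0]/th mulr0 expR0 mul1r (mulrC 2^-1) => <-.
by apply: eq_Rintegral => t _; rewrite (ipC (P (df t))); field.
Qed.

(** The formal adjoint of the equation applied to [th f]: the derivative of [th f] is
    [th (df - 2 lam f)]. *)
Let kapt t (x dx : H) : H := let y : H := dx - (2 * lam) *: x in
  th t *: (Ka t x - Pa (P y)).

Let kap (f df : R -> H) t : H := kapt t (f t) (df t).

Let ip_kapt t x dx : ip x (kapt t x dx) =
  th t * (ip (K t x) x - (ip (P x) (P dx) - 2 * lam * ip (P x) (P x))).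
Proof. by rewrite /kapt ipZr ipBr -KKa -PPa lopB lopZ /= ipBr ipZr. Qed.

Lemma SM_Ka f : SM f -> SM (fun t => Ka t (f t)).
Proof.
move=> mf; apply: (SM_op (K := fun t => Ka t)) => // t.
by exists M => x y; rewrite -lopB.
Qed.

Let th_le1 t : D t -> th t <= 1.
Proof.
rewrite /= in_itv /= => /andP[t0 _].
rewrite /th -expR0 ler_expR mulNr oppr_le0 mulr_ge0 ?mulr_ge0//.
exact: ltW.
Qed.

Let kap_bL2 f df : bL2 T f -> bL2 T df -> bL2 T (kap f df).
Proof.
move=> lf ldf.
have lKa : bL2 T (fun t => Ka t (f t)).
  by apply: (bL2_bound (M := M) _ _ lf) => //; apply: SM_Ka; case: lf.
have lPP : bL2 T (fun t => Pa (P (df t - (2 * lam) *: f t))).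
  apply: (bL2_lop Pa); apply: (bL2_lop P).
  by apply: bL2B => //; exact: bL2Z.
have lB := bL2B lKa lPP.
apply: (bL2_bound (M := 1) _ _ lB).
  apply: SM_scale; last by case: lB.
  by apply: continuous_measurable_fun; exact: C1_continuous C1th.
by move=> t Dt; rewrite nrmZ gtr0_norm// ler_wpM2r ?nrm_ge0 ?th_le1.
Qed.

Let Z : lmodType R := ((R -> H) * (R -> H) * (R -> H))%type.

(** The third component runs over L^2 paths orthogonal to the constraint space. Riesz representation
    takes place in the whole space of L^2 paths, and testing with this component forces the
    represented path into the constraint space. *)
Let in_Phi (z : Z) := test_fun z.1.1 z.1.2 /\
  (bL2 T z.2 /\ forall t w, orth_set w -> ip (z.2 t) w = 0).

Let Phi_DZ a x y : in_Phi x -> in_Phi y -> in_Phi (a *: x + y).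
Proof.
move=> [tx [lx ox]] [ty [ly oy]]; split; first exact: test_fun_DZ.
split; first exact: bL2_DZ.
by move=> t w ow; rewrite ipDZl ox// oy// mulr0 addr0.
Qed.

Let Phi0 : in_Phi 0.
Proof.
split; first exact: test_fun0.
by split; [exact: (sset0 (bL2_sub T))|move=> t w _; rewrite ip0l].
Qed.

Let Phi : subspace Z := Subspace Phi0 Phi_DZ.

Let kfun (z : Z) : R -> H := fun t => kap z.1.1 z.1.2 t + z.2 t.

Let kfun_bL2 z : in_Phi z -> bL2 T (kfun z).
Proof.
move=> [tf [l2 _]]; have [lf ldf] := test_fun_bL2 tf.
by apply: bL2D => //; exact: kap_bL2.
Qed.

Let k (x : ssub Phi) : BL2 (H := H) T :=
  BL2_of (kfun_bL2 (ssubP x)).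

Let subDZ a (x y x' y' : H) :
  a *: x + y - (a *: x' + y') = a *: (x - x') + (y - y').
Proof. by rewrite scalerBr opprD addrACA. Qed.

Let scaleDZ b a (x y : H) : b *: (a *: x + y) = a *: (b *: x) + b *: y.
Proof. by rewrite scalerDr !scalerA (mulrC a). Qed.

Let kaptDZ a t x dx y dy : kapt t (a *: x + y) (a *: dx + dy) =
  a *: kapt t x dx + kapt t y dy.
Proof.
have E : a *: dx + dy - (2 * lam) *: (a *: x + y) =
  a *: (dx - (2 * lam) *: x) + (dy - (2 * lam) *: y) by rewrite scaleDZ subDZ.
by rewrite /kapt /= E !lopDZ -[RHS]scaleDZ; congr (_ *: _); exact: subDZ.
Qed.

Let kfunDZ a (x y : Z) : kfun (a *: x + y) = a *: kfun x + kfun y.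
Proof.
case: x => [[f df] ka]; case: y => [[g dg] kb]; apply/funext => t.
rewrite /kfun /kap /=.
have -> : (a *: f + g) t = a *: f t + g t by [].
have -> : (a *: df + dg) t = a *: df t + dg t by [].
have -> : (a *: ka + kb) t = a *: ka t + kb t by [].
rewrite kaptDZ [RHS](_ : _ = a *: (kapt t (f t) (df t) + ka t) +
  (kapt t (g t) (dg t) + kb t))//.
by rewrite scalerDr addrACA.
Qed.

Let kDZ a x y : k (a *: x + y) = a *: k x + k y.
Proof.
by apply: val_inj; rewrite val_ssubDZ /= -kfunDZ.
Qed.

Let Lz (z : Z) : R := bip T (fun t => th t *: z.1.1 t) F + ip z0 (P (z.1.1 0)).

Let L (x : ssub Phi) : R := Lz (\val x).

Let th_bL2 (f : R -> H) : bL2 T f -> bL2 T (fun t => th t *: f t).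
Proof.
move=> lf; apply: (bL2_bound (M := 1) _ _ lf).
  apply: SM_scale; last by case: lf.
  by apply: continuous_measurable_fun; exact: C1_continuous C1th.
by move=> t Dt; rewrite nrmZ gtr0_norm// ler_wpM2r ?nrm_ge0 ?th_le1.
Qed.

Let Phi_bL2 (x : ssub Phi) : bL2 T (\val x).1.1.
Proof. by have [/test_fun_bL2[]] := ssubP x. Qed.

Let LzDZ a x y : in_Phi x -> in_Phi y -> Lz (a *: x + y) = a * Lz x + Lz y.
Proof.
case: x => [[f df] ka] [/test_fun_bL2[/= lf _] _].
case: y => [[g dg] kb] [/test_fun_bL2[/= lg _] _].
rewrite /Lz /=.
have -> : (fun t => th t *: (a *: f + g) t) =
    a *: (fun t => th t *: f t) + (fun t => th t *: g t).
  apply/funext => t; have -> : (a *: f + g) t = a *: f t + g t by [].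
  exact: scaleDZ.
have -> : (a *: f + g) 0 = a *: f 0 + g 0 by [].
rewrite bipDZl//; [|exact: th_bL2|exact: th_bL2].
by rewrite lopDZ ipDr ipZr /=; ring.
Qed.

Let LDZ a x y : L (a *: x + y) = a * L x + L y.
Proof. by rewrite /L val_ssubDZ LzDZ//; [exact: (ssubP x)|exact: (ssubP y)]. Qed.

Let fel (x : ssub Phi) : BL2 (H := H) T := BL2_of (Phi_bL2 x).

(** [th T] is the least value of the weight on [[0, T]], and 1/2 is the coefficient of the boundary
    term in [test_fun_energy]. *)
Let c2 := Num.min (c0 * th T) 2^-1.

Let c20 : 0 < c2.
Proof. by rewrite lt_min mulr_gt0//= invr_gt0. Qed.

(** The coercivity on which Lions' method rests. The third component pairs to zero with [f], whose
    values are in [orth_set]; weighted coercivity gives the integral term, and the exact derivative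
    leaves its value at time 0 as second term. *)
Let energy_lower (x : ssub Phi) :
  c2 * (nrm (fel x) ^+ 2 + nrm (P ((\val x).1.1 0)) ^+ 2) <= ip (fel x) (k x).
Proof.
have [tf [lk ok]] := ssubP x.
set f := (\val x).1.1; set df := (\val x).1.2; set ka := (\val x).2.
have [lf ldf] := test_fun_bL2 tf.
have lPf : bL2 T (fun t => P (f t)) by exact: bL2_lop.
have lPdf : bL2 T (fun t => P (df t)) by exact: bL2_lop.
have lK : bL2 T (kfun (\val x)) by exact: kfun_bL2 (ssubP x).
pose e t := th t * (ip (P (f t)) (P (df t)) - lam * ip (P (f t)) (P (f t))).
have ie : intg D e.
  apply: (@eq_intg _ _ (fun t => ip (th t *: P (f t)) (P (df t)) -
     lam * ip (th t *: P (f t)) (P (f t)))) => //.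
    by move=> t _; rewrite /e !ipZl; ring.
  apply: intgB => //; last apply: intgZ => //.
    by apply: intg_ip => //; exact: th_bL2.
  by apply: intg_ip => //; exact: th_bL2.
have iff : intg D (fun t => ip (f t) (f t)) by case: lf.
have le : \int[mu]_(t in D) (c0 * th T * ip (f t) (f t) - e t) <=
    \int[mu]_(t in D) ip (f t) (kfun (\val x) t).
  apply: le_Rintegral => //; [|exact: intg_ip|].
    by apply: intgB => //; exact: intgZ.
  move=> t Dt; rewrite /kfun ipDr -/ka -/f -/df (ipC _ (ka t)) ok; last first.
    exact: test_fun_orth tf.
  rewrite addr0 /kap ip_kapt /e.
  have := coer t (test_fun_orth t tf); rewrite -!sqr_nrm -/f => h.
  have h1 : th T <= th t.
    move: Dt; rewrite /= in_itv /= => /andP[t0 /ltW tT].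
    rewrite /th ler_expR !mulNr lerN2 ler_wpM2l ?mulr_ge0//.
  have h2 : th t * (c0 * nrm (f t) ^+ 2) <=
      th t * (ip (K t (f t)) (f t) + lam * nrm (P (f t)) ^+ 2).
    by rewrite ler_pM2l.
  have h3 : th T * (c0 * nrm (f t) ^+ 2) <= th t * (c0 * nrm (f t) ^+ 2).
    by rewrite ler_wpM2r// mulr_ge0 ?sqr_ge0// ltW.
  move: h2 h3; lra.
move: le; rewrite RintegralB//; last exact: intgZ.
rewrite RintegralZl// test_fun_energy// -/f => le.
have E1 : nrm (fel x) ^+ 2 = \int[mu]_(t in D) ip (f t) (f t) by rewrite sqr_nrm_BL2.
have E2 : ip (fel x) (k x) = \int[mu]_(t in D) ip (f t) (kfun (\val x) t) by [].
rewrite E2 (le_trans _ le)// -E1 -sqr_nrm opprK.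
have m1 : c2 <= c0 * th T by rewrite ge_min lexx.
have m2 : c2 <= 2^-1 by rewrite ge_min lexx orbT.
have := ler_wpM2r (sqr_ge0 (nrm (fel x))) m1.
have := ler_wpM2r (sqr_ge0 (nrm (P (f 0)))) m2.
rewrite mulrDr (mulrC _ 2^-1); lra.
Qed.

Let L_bound (x : ssub Phi) : `|L x| <=
  (nrm (BL2_of lF) + nrm z0) * (2 / c2) * nrm (k x).
Proof.
have := energy_lower x; have := ip_le (fel x) (k x).
have [tf _] := ssubP x.
set n1 := nrm (fel x); set n2 := nrm (P _); set nk := nrm (k x) => h1 h2.
have n10 : 0 <= n1 by exact: nrm_ge0.
have n20 : 0 <= n2 by exact: nrm_ge0.
have nk0 : 0 <= nk by exact: nrm_ge0.
(* From [(n1 + n2)^2 <= 2 (n1^2 + n2^2) <= (2 / c2) n1 nk], on dividing by [n1 + n2]. *)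
have N : n1 + n2 <= 2 / c2 * nk.
  rewrite mulrAC ler_pdivlMr//.
  have [->|p0] := eqVneq (n1 + n2) 0; first by rewrite mul0r mulr_ge0.
  have p : 0 < n1 + n2 by rewrite lt_def p0 addr_ge0.
  rewrite -(ler_pM2l p).
  have s1 : (n1 + n2) ^+ 2 <= 2 * (n1 ^+ 2 + n2 ^+ 2).
    by have := sqr_ge0 (n1 - n2); nra.
  have s2 : c2 * (n1 + n2) ^+ 2 <= c2 * (2 * (n1 ^+ 2 + n2 ^+ 2)) by rewrite ler_pM2l.
  have s3 : n1 * nk <= (n1 + n2) * nk by rewrite ler_wpM2r// lerDl.
  have -> : (n1 + n2) * ((n1 + n2) * c2) = c2 * (n1 + n2) ^+ 2 by ring.
  have -> : (n1 + n2) * (2 * nk) = 2 * ((n1 + n2) * nk) by ring.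
  have : c2 * (2 * (n1 ^+ 2 + n2 ^+ 2)) = 2 * (c2 * (n1 ^+ 2 + n2 ^+ 2)) by ring.
  lra.
set nF := nrm (BL2_of lF).
have b1 : `|bip T (fun t => th t *: (\val x).1.1 t) F| <= n1 * nF.
  pose g := BL2_of (th_bL2 (Phi_bL2 x)).
  have -> : bip T (fun t => th t *: (\val x).1.1 t) F =
    ip g (BL2_of lF) by [].
  apply: le_trans (normr_ip_le _ _) _; rewrite ler_wpM2r ?nrm_ge0//.
  rewrite -(ler_pXn2r (n := 2)) ?nnegrE ?nrm_ge0//.
  rewrite !sqr_nrm_BL2; apply: le_Rintegral => //.
  - by have [] := ssubP g.
  - by have [] := ssubP (fel x).
  - move=> t Dt; rewrite /= -!sqr_nrm ler_pXn2r ?nnegrE ?nrm_ge0// nrmZ.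
    by rewrite gtr0_norm// ler_piMl ?nrm_ge0 ?th_le1.
have b2 : `|ip z0 (P ((\val x).1.1 0))| <= nrm z0 * n2 by exact: normr_ip_le.
apply: le_trans (ler_normD _ _) _.
have F0 : 0 <= nF by exact: nrm_ge0.
have Z0 : 0 <= nrm z0 by exact: nrm_ge0.
apply: (@le_trans _ _ ((nF + nrm z0) * (n1 + n2))).
  apply: le_trans (lerD b1 b2) _; rewrite mulrDl !mulrDr mulrC.
  by have := mulr_ge0 F0 n20; have := mulr_ge0 Z0 n10; lra.
by rewrite -mulrA ler_wpM2l// addr_ge0.
Qed.

(** The tests are required to vanish at [T] but not at 0, so the identity carries the initial value
    along with the equation. *)
Theorem lions_existence : exists w, [/\ bL2 T w,
  {ae mu, forall t, D t -> orth_set (w t)} &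
  forall psi dpsi om, C1 psi dpsi -> psi T = 0 -> orth_set om ->
    \int[mu]_(t in D) (psi t * ip (K t (w t)) om - dpsi t * ip (P (w t)) (P om)) =
    \int[mu]_(t in D) (psi t * ip (F t) om) + psi 0 * ip z0 (P om)].
Proof.
have [u hu] := riesz_representation (BL2_complete cH T0) kDZ LDZ L_bound.
pose w := \val u; have lw : bL2 T w by exact: ssubP u.
have {}hu z : in_Phi z -> bip T w (kfun z) =
    bip T (fun t => th t *: z.1.1 t) F + ip z0 (P (z.1.1 0)).
  by move=> pz; have := hu (ssub_of (S := Phi) pz).
exists w; split=> //.
- have h i : {ae mu, forall t, D t -> ip (c i) (w t) = 0}.
    (* This path is orthogonal to [orth_set], and its pairing with [w] is the integral of the square
       of [ip (c i) (w t)]. *)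
    pose ka t := ip (c i) (w t) *: c i.
    have lka : bL2 T ka.
      apply: (bL2_bound (M := nrm (c i) * nrm (c i)) _ _ lw).
        apply: SM_scale; last exact: SM_cst.
        by apply: measurable_ip; [exact: SM_cst|case: lw].
      move=> t _; rewrite nrmZ mulrAC ler_wpM2r ?nrm_ge0//.
      exact: normr_ip_le.
    have pz : in_Phi (0, 0, ka).
      split; first exact: test_fun0.
      by split=> // t v ov; rewrite /ka ipZl ov mulr0.
    have := hu _ pz; rewrite /= lop0 ip0r addr0.
    have -> : (fun t => th t *: (0 : R -> H) t) = 0.
      by apply/funext => t; rewrite scaler0.
    have -> : bip T 0 F = 0.
      by rewrite /bip; under eq_Rintegral do rewrite ip0l; rewrite Rint_itv_cst ?mul0r// ltW.
    have -> : kfun (0, 0, ka) = ka.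
      apply/funext => t; rewrite /kfun /kap /=.
      have -> : (0 : R -> H) t = 0 by [].
      by rewrite /kapt /= scaler0 subr0 !lop0 subr0 scaler0 add0r.
    move=> E; have := @Rint_eq0_ae R T (fun t => ip (w t) (ka t)).
    move=> /(_ (intg_ip lw lka))/(_ _ E) h.
    have {}h : {ae mu, forall t, D t -> ip (w t) (ka t) = 0}.
      by apply: h => t; rewrite /ka ipZr (ipC (c i)) -expr2 sqr_ge0.
    apply: (ae_imp h) => t {}h Dt; have := h Dt; rewrite /ka ipZr (ipC (w t)) => /eqP.
    by rewrite mulf_eq0 orbb => /eqP.
  have : {ae mu, forall t, forall i, D t -> ip (c i) (w t) = 0}.
    exact: ae_fin.
  by move/ae_imp; apply => t ht Dt i; exact: ht.
- move=> psi dpsi om Cpsi psiT oom.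
  have Ce := C1_expR (2 * lam).
  (* The factor [expR (2 * lam * t)] cancels the weight [th], so that the tested identity is the
     unweighted one. *)
  pose f t := (expR (2 * lam * t) * psi t) *: om.
  pose df t := (2 * lam * expR (2 * lam * t) * psi t +
                expR (2 * lam * t) * dpsi t) *: om.
  have tf : test_fun f df.
    have := test_funS (C1M Ce Cpsi) _ oom test_fun0; rewrite psiT mulr0.
    by move=> /(_ erefl); congr test_fun; apply/funext => t; rewrite addr0.
  have the t : th t * expR (2 * lam * t) = 1 by rewrite /th mulNr expRN mulVf// gt_eqF// expR_gt0.
  have pz : in_Phi (f, df, 0).
    by split=> //; split; [exact: (sset0 (bL2_sub T))|move=> t v _; rewrite ip0l].
  have := hu _ pz; rewrite /= (_ : f 0 = psi 0 *: om) ?lopZ ?ipZr => [h|]; last first.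
    by rewrite /f mulr0 expR0 mul1r.
  have E1 : bip T w (kfun (f, df, 0)) = \int[mu]_(t in D)
      (psi t * ip (K t (w t)) om - dpsi t * ip (P (w t)) (P om)).
    apply: eq_Rintegral => t _; rewrite /kfun /= addr0 /kap.
    rewrite /kapt.
    have -> : df t - (2 * lam) *: f t = (expR (2 * lam * t) * dpsi t) *: om.
      by rewrite /df /f scalerA -scalerBl; congr (_ *: _); ring.
    rewrite !lopZ /= ipZr ipBr !ipZr -PPa -KKa.
    rewrite mulrBr !mulrA the !mul1r //.
  rewrite -E1 h; congr (_ + _); apply: eq_Rintegral => t _.
  by rewrite /f scalerA mulrA the mul1r ipZl (ipC om).
Qed.

End lions.

(** * Reflections, translations and difference quotients *)

Section lebesgue_reflection.
Context {R : realType}.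
Local Notation mu := (@lebesgue_measure R).
Variable c : R.
Let phi (t : measurableTypeR R) : measurableTypeR R := c - t.

Let mphi : measurable_fun setT phi.
Proof. exact: measurable_funB. Qed.

Lemma preimage_reflect_itv b0 b1 (x y : R) :
  (fun t : R => c - t) @^-1` [set` Interval (BSide b0 x) (BSide b1 y)] =
  [set` Interval (BSide (~~ b1) (c - y)) (BSide (~~ b0) (c - x))].
Proof.
case: b0; case: b1; apply/seteqP; split=> t /=; rewrite !in_itv /=;
  by move=> /andP[h1 h2]; apply/andP; split; lra.
Qed.

Lemma lebesgue_measure_reflect (A : set R) : measurable A ->
  mu ((fun t => c - t) @^-1` A) = mu A.
Proof.
move=> mA; apply/esym.
apply: (@lebesgue_measure_unique R (pushforward mu phi)) => //= _ [[a b]] _ <-.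
rewrite /pushforward preimage_reflect_itv/= !lebesgue_measure_itv/= !lte_fin.
by rewrite ltrD2l ltrN2; case: ifP => // _; rewrite -!EFinB; congr EFin; ring.
Qed.

Lemma ae_reflect (P : R -> Prop) :
  {ae mu, forall t, P t} -> {ae mu, forall t, P (c - t)}.
Proof.
move=> [N [mN N0 PN]]; exists ((fun t => c - t) @^-1` N); split.
- by rewrite -[X in measurable X]setTI; exact: mphi.
- by rewrite lebesgue_measure_reflect.
- by move=> t /= nP; exact: PN.
Qed.

Lemma intg_reflect (f : R -> R) (D : set R) : measurable D ->
  measurable_fun setT f -> intg D f ->
  intg ((fun t => c - t) @^-1` D) (fun t => f (c - t)).
Proof.
move=> mD mf /intgP[_ fi].
have mpD : measurable ((fun t => c - t) @^-1` D).
  by rewrite -[X in measurable X]setTI; exact: mphi.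
have mfc : measurable_fun setT (fun t : R => f (c - t)).
  by apply: measurableT_comp => //; exact: measurable_funB.
apply/intgP; split; first exact: measurable_funTS.
have := @ge0_integral_pushforward _ _ _ _ R phi mphi mu D (fun t => `|f t|%:E).
move=> /(_ mD) E; rewrite -E//.
- by rewrite (eq_measure_integral mu)// => A mA _; exact: lebesgue_measure_reflect.
- by apply/measurable_EFinP; apply: measurable_funTS; exact: measurableT_comp.
Qed.

Lemma Rint_reflect (f : R -> R) (D : set R) : measurable D ->
  measurable_fun setT f -> intg D f ->
  \int[mu]_(t in (fun t => c - t) @^-1` D) f (c - t) = \int[mu]_(t in D) f t.
Proof.
move=> mD mf fi; congr fine.
have := @integral_pushforward _ _ _ _ R phi mphi mu D (EFin \o f).
move=> /(_ _ _ mD) E; rewrite -[LHS]E.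
- apply: (eq_measure_integral mu) => A mA _; exact: lebesgue_measure_reflect.
- exact/measurable_EFinP.
- exact: intg_reflect.
Qed.

End lebesgue_reflection.

Section lebesgue_translation.
Context {R : realType}.
Local Notation mu := (@lebesgue_measure R).
Variable h : R.

(** A translation is the composite of the reflections [t |-> h - t] and [t |-> 0 - t]. *)
Lemma Rint_shift (f : R -> R) (a b : R) : measurable_fun setT f ->
  intg setT f ->
  \int[mu]_(t in `]a, b]) f (t + h) = \int[mu]_(t in `]a + h, b + h]) f t.
Proof.
move=> mf fi; have fi' (D : set R) : measurable D -> intg D f.
  by move=> mD; apply: integrableS fi.
rewrite -(@Rint_reflect _ h f `]a + h, b + h])//; last exact: fi'.
have mf' : measurable_fun setT (fun t : R => f (h - t)).
  by apply: measurableT_comp => //; exact: measurable_funB.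
have fi'' : intg ((fun t => h - t) @^-1` `]a + h, b + h]) (fun t => f (h - t)).
  by apply: intg_reflect => //; exact: fi'.
have E := @Rint_reflect _ 0 (fun t => f (h - t)) ((fun t => h - t) @^-1` `]a + h, b + h]).
rewrite -E//; last by rewrite preimage_reflect_itv.
rewrite !preimage_reflect_itv /=.
have -> : 0 - (h - (a + h)) = a by ring.
have -> : 0 - (h - (b + h)) = b by ring.
by apply: eq_Rintegral => t _; congr f; ring.
Qed.

End lebesgue_translation.

(** * Primitives of integrable functions and their difference quotients *)

Section cumulative.
Context {R : realType}.
Local Notation mu := (@lebesgue_measure R).
Implicit Types (f g : R -> R).

Definition cumul f (x : R) : R := \int[mu]_(t in `]-oo, x]) f t.

Lemma intgS (D E : set R) f : measurable D -> measurable E -> D `<=` E ->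
  intg E f -> intg D f.
Proof. by move=> mD mE DE; apply: integrableS. Qed.

Lemma intgT (D : set R) f : measurable D -> intg setT f -> intg D f.
Proof. by move=> mD; apply: intgS. Qed.

Lemma cumulB f (x y : R) : intg setT f -> x <= y ->
  cumul f y - cumul f x = \int[mu]_(t in `]x, y]) f t.
Proof.
move=> fi xy; rewrite /cumul Rintegral_itvB//.
by apply: intgT.
Qed.

Lemma cumulDZ k f g x : intg setT f -> intg setT g ->
  cumul (fun t => k * f t + g t) x = k * cumul f x + cumul g x.
Proof.
move=> fi gi; rewrite /cumul RintegralD//.
- by rewrite RintegralZl//; exact: intgT.
- by apply: intgZ => //; exact: intgT.
- exact: intgT.
Qed.

Lemma Rint_norm_le (D E : set R) f : measurable D -> measurable E -> D `<=` E ->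
  intg E f -> `|\int[mu]_(t in D) f t| <= \int[mu]_(t in E) `|f t|.
Proof.
move=> mD mE DE fi; have fD := intgS mD mE DE fi.
apply: le_trans; first exact: (le_normr_Rintegral _ fD).
rewrite fine_le//; [apply: integrable_fin_num|apply: integrable_fin_num|] => //.
- exact: intg_norm.
- exact: intg_norm.
- apply: ge0_subset_integral => //.
  by have /intgP[? _] := intg_norm fi; exact/measurable_EFinP.
Qed.

Lemma cumul_small f : intg setT f -> forall e : R, 0 < e -> exists2 d : R, 0 < d &
  forall x y : R, `|x - y| < d -> `|cumul f x - cumul f y| < e.
Proof.
move=> fi e e0; have [d [d0 hd]] := integral_normr_continuous fi e0.
exists d => // x y.
wlog xy : x y / x <= y => [H|].
  have [/H//|/ltW yx] := leP x y.
  by rewrite distrC (distrC (cumul f x)); exact: H.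
rewrite distrC ger0_norm ?subr_ge0// => yxd.
have H : \int[mu]_(t in `]x, y]) `|f t| < e.
  apply: hd => //.
  rewrite /= lebesgue_measure_itv/= lte_fin; case: ifP => _.
    by rewrite -EFinB lte_fin.
  by rewrite lte_fin.
apply: le_lt_trans H; rewrite distrC cumulB//.
by apply: le_normr_Rintegral => //; exact: intgT.
Qed.

Lemma cumul_continuous f : intg setT f -> continuous (cumul f).
Proof.
move=> fi x; apply/cvgrPdist_lt => e e0.
have [d d0 hd] := cumul_small fi e0.
near=> y; apply: hd.
by near: y; apply: (@cvgr_dist_lt _ _ _ (nbhs x) _ id).
Unshelve. all: by end_near. Qed.

(** Lebesgue differentiation; the exceptional null set serves all sequences of steps at once, in
    particular steps of both signs. *)
Lemma cumul_derive f : intg setT f -> {ae mu, forall x, forall h : nat -> R,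
  (forall n, h n != 0) -> h n @[n --> \oo] --> (0 : R) ->
  (cumul f (x + h n) - cumul f x) / h n @[n --> \oo] --> f x}.
Proof.
move=> fi.
have lf : locally_integrable setT f by exact: open_integrable_locally openT fi.
have fy (y : R) : mu.-integrable `]-oo, y] (EFin \o f) by exact: intgT.
have := FTC1Ny fy lf; move/ae_imp; apply => x [dF F'x] h h0 hc.
have : (fun e : R => e^-1 *: (cumul f (e *: 1 + x) - cumul f x)) @ 0^' --> f x.
  by rewrite -F'x derive1E; exact: dF.
move=> H.
have h0' : h n @[n --> \oo] --> (0 : R)^'.
  move=> A A0; have [n0 _ hn] := hc _ A0.
  by exists n0 => // n /hn; apply; exact: h0.
have := cvg_comp _ _ h0' H.
rewrite (_ : _ \o h = fun n => (cumul f (x + h n) - cumul f x) / h n)//.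
apply/funext => n /=; rewrite /GRing.scale /= mulr1 mulrC (addrC x).
by [].
Qed.

Lemma measurable_cumul f : intg setT f -> measurable_fun setT (cumul f).
Proof. by move=> fi; exact: continuous_measurable_fun (cumul_continuous fi). Qed.

(** Tonelli on the strip [t + p < s <= t + q]: each [s] is counted for [t] in an interval of length
    [q - p]. *)
Lemma cumul_shift_L1 f (p q : R) : measurable_fun setT f -> intg setT f -> p <= q ->
  (\int[mu]_t `|cumul f (t + q) - cumul f (t + p)|%:E <=
   ((q - p) * \int[mu]_t `|f t|)%:E)%E.
Proof.
move=> mf fi pq.
pose A : set (R * R) := [set z | z.1 + p < z.2] `&` [set z | z.2 <= z.1 + q].
have mA : measurable A.
  apply: measurableI.
    apply: measurable_set_ltr => //; exact: measurable_funD.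
  rewrite (_ : [set z | _] = ~` [set z : R * R | z.1 + q < z.2]).
    apply: measurableC; apply: measurable_set_ltr => //; exact: measurable_funD.
  by apply/seteqP; split=> z /=; rewrite leNgt => /negP.
pose F (z : R * R) := (`|f z.2| * \1_A z)%:E.
have mF : measurable_fun setT F.
  apply/measurable_EFinP; apply: measurable_funM => //.
  by do 2 apply: measurableT_comp => //.
have F0 z : (0 <= F z)%E by rewrite lee_fin mulr_ge0.
apply: (@le_trans _ _ (\int[mu]_t \int[mu]_s F (t, s))%E).
  apply: ge0_le_integral => //.
  - apply/measurable_EFinP; apply: measurableT_comp => //.
    by apply: measurable_funB; apply: measurableT_comp (measurable_cumul fi) _;
       exact: measurable_funD.
  - exact: measurable_fun_fubini_tonelli_F.
  - move=> t _; rewrite cumulB ?lerD2l//.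
    rewrite EFin_normr_Rintegral//; last exact: intgT.
    apply: le_trans (le_abse_integral _ _ _) _ => //.
      by apply/measurable_EFinP; exact: measurable_funTS.
    rewrite integral_mkcond; apply: ge0_le_integral => //.
    + by move=> s _; apply: erestrict_ge0.
    + apply/(measurable_restrictT _ _).1 => //.
      apply: measurableT_comp => //; apply/measurable_EFinP; exact: measurable_funTS.
    + apply: measurableT_comp => //; exact: measurable_pair1.
    + move=> s _; rewrite /F patchE /=; case: ifPn => [/set_mem|_]; last first.
        by rewrite lee_fin mulr_ge0.
      rewrite /= in_itv /= => ts; rewrite lee_fin; rewrite indicE mem_set ?mulr1//; case/andP: ts => ts1 ts2.
      by split=> /=; [exact: ts1|exact: ts2].
rewrite fubini_tonelli// /=.
have -> : (\int[mu]_s \int[mu]_t F (t, s) = \int[mu]_s ((q - p)%:E * `|f s|%:E))%E.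
  apply: eq_integral => s _.
  under eq_integral do rewrite /F /= EFinM.
  rewrite ge0_integralZl//; last first.
    by apply/measurable_EFinP; apply: measurableT_comp => //; exact: measurable_pair2.
  rewrite muleC; congr (_ * _)%E.
  rewrite (_ : (fun x : R => (\1_A (x, s))%:E) = (fun x : R => (\1_(`[s - q, s - p[) x)%:E)).
    rewrite integral_indic// setIT /= lebesgue_measure_itv/= lte_fin ltrD2l ltrN2.
    case: ltP => h; first by rewrite -EFinB; congr EFin; ring.
    by congr EFin; lra.
  apply/funext => t; congr EFin; rewrite !indicE; congr (nat_of_bool _)%:R.
  apply/idP/idP => /set_mem; rewrite /A /=.
    by move=> [/= h1 h2]; apply/mem_set; rewrite /= in_itv /=; apply/andP; split; lra.
  by rewrite in_itv /= => /andP[h1 h2]; apply/mem_set; split=> /=; lra.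
rewrite ge0_integralZl//; last 2 first.
- by apply/measurable_EFinP; exact: measurableT_comp.
- by rewrite lee_fin subr_ge0.
rewrite EFinM lee_wpmul2l ?lee_fin ?subr_ge0// /Rintegral fineK//.
by apply: integrable_fin_num => //; exact: intg_norm.
Qed.

Definition quot f (t h : R) : R := (cumul f (t + h) - cumul f t) / h.

Lemma measurable_quot f h : intg setT f -> measurable_fun setT (fun t => quot f t h).
Proof.
move=> fi; apply: measurable_funM => //; apply: measurable_funB.
  apply: (measurableT_comp (measurable_cumul fi)); exact: measurable_funD.
exact: measurable_cumul.
Qed.

(** A difference quotient of a primitive is an average of [f] over an interval of length [|h|], and
    averaging contracts the L^1 norm. This bound, uniform in [h], reduces convergence to a dense
    class. *)
Lemma quot_L1 f h : measurable_fun setT f -> intg setT f -> h != 0 ->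
  (\int[mu]_t `|quot f t h|%:E <= (\int[mu]_t `|f t|)%:E)%E.
Proof.
move=> mf fi h0.
have hp : 0 < `|h| by rewrite normr_gt0.
have key : (\int[mu]_t `|cumul f (t + h) - cumul f t|%:E <=
    (`|h| * \int[mu]_t `|f t|)%:E)%E.
  have [h1|h1] := leP 0 h.
    have := cumul_shift_L1 mf fi h1; rewrite subr0.
    by under eq_integral do rewrite addr0; rewrite ger0_norm.
  have := cumul_shift_L1 mf fi (ltW h1); rewrite sub0r.
  under eq_integral do rewrite addr0.
  by under [X in _ -> (X <= _)%E]eq_integral do rewrite distrC; rewrite ltr0_norm.
have -> : (\int[mu]_t `|quot f t h|%:E =
    `|h|^-1%:E * \int[mu]_t `|cumul f (t + h) - cumul f t|%:E)%E.
  rewrite -ge0_integralZl//.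
  - by apply: eq_integral => t _; rewrite /quot normrM normfV mulrC EFinM.
  - apply/measurable_EFinP; apply: measurableT_comp => //; apply: measurable_funB.
      apply: (measurableT_comp (measurable_cumul fi)); exact: measurable_funD.
    exact: measurable_cumul.
by rewrite lee_pdivrMl.
Qed.

Lemma quotDZ k f g t h : intg setT f -> intg setT g ->
  quot (fun s => k * f s + g s) t h = k * quot f t h + quot g t h.
Proof. by move=> fi gi; rewrite /quot !cumulDZ//; ring. Qed.

Lemma intg_quot f h : measurable_fun setT f -> intg setT f -> h != 0 ->
  intg setT (fun t => quot f t h).
Proof.
move=> mf fi h0; apply/intgP; split; first exact: measurable_quot.
exact: le_lt_trans (quot_L1 mf fi h0) (ltry _).
Qed.

Lemma dominated_L1 (fn : nat -> R -> R) f G :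
  (forall n, measurable_fun setT (fn n)) -> measurable_fun setT f ->
  {ae mu, forall t, fn n t @[n --> \oo] --> f t} -> intg setT G ->
  {ae mu, forall t, forall n, `|fn n t| <= G t} ->
  \int[mu]_t `|fn n t - f t| @[n --> \oo] --> (0 : R).
Proof.
move=> mfn mf fnf Gi fnG.
have H1 n : measurable_fun setT (EFin \o fn n) by exact/measurable_EFinP.
have H2 : measurable_fun setT (EFin \o f) by exact/measurable_EFinP.
have H3 : {ae mu, forall t, setT t -> (EFin \o fn n) t @[n --> \oo] --> (EFin \o f) t}.
  by apply: (ae_imp fnf) => t h _; apply: cvg_EFin; [exact: nearW|exact: h].
have H4 : {ae mu, forall t, forall n, setT t -> (`|(EFin \o fn n) t| <= (EFin \o G) t)%E}.
  by apply: (ae_imp fnG) => t h n _; rewrite lee_fin.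
have [_ + _] := @dominated_convergence _ (measurableTypeR R) R mu setT
  measurableT _ _ _ H1 H2 H3 Gi H4.
by move=> /fine_cvgP[].
Qed.

Lemma trunc_L1 f : measurable_fun setT f -> intg setT f ->
  \int[mu]_t `|f t * \1_[set s | `|f s| <= n%:R] t - f t| @[n --> \oo] --> (0 : R).
Proof.
move=> mf fi.
have mA n : measurable [set s | `|f s| <= n%:R].
  rewrite (_ : [set s | _] = ~` [set s | n%:R < `|f s|]).
    apply: measurableC; apply: measurable_set_ltr => //; exact: measurableT_comp.
  by apply/seteqP; split=> z /=; rewrite leNgt => /negP.
apply: (dominated_L1 _ mf _ (intg_norm fi)).
- by move=> n; apply: measurable_funM => //; exact: measurable_indic.
- apply: ae_all => t; apply/cvgrPdist_le => e e0.
  exists (Num.truncn `|f t|).+1 => // n /= hn.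
  rewrite indicE mem_set ?mulr1 ?subrr ?normr0 ?ltW//=.
  apply: le_trans (ltW (truncnS_gt _)) _; rewrite ler_nat; exact: hn.
- apply: ae_all => t n; rewrite normrM indicE.
  by case: (_ \in _); rewrite ?normr1 ?mulr1 ?normr0 ?mulr0.
Qed.

Lemma Rint_le_fin (F : R -> R) (c : R) : 
  (forall t, 0 <= F t) -> (\int[mu]_t (F t)%:E <= c%:E)%E -> \int[mu]_t F t <= c.
Proof.
move=> F0 Fc; rewrite -lee_fin /Rintegral fineK// ge0_fin_numE.
  exact: le_lt_trans Fc (ltry _).
by apply: integral_ge0 => t _; rewrite lee_fin.
Qed.

Let quot_cvg_bounded f (M L : R) (h : nat -> R) : measurable_fun setT f ->
  intg setT f -> (forall t, `|f t| <= M) -> 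
  (forall t, ~ (- L <= t <= L) -> f t = 0) ->
  (forall n, h n != 0) -> (forall n, `|h n| <= 1) -> h n @[n --> \oo] --> (0 : R) ->
  \int[mu]_t `|quot f t (h n) - f t| @[n --> \oo] --> (0 : R).
Proof.
move=> mf fi fM fL h0 h1 hc.
have M0 : 0 <= M by apply: le_trans (fM 0).
(* As [|h n| <= 1], the quotients of a function supported in [[-L, L]] are supported in this
   interval enlarged by 1. *)
pose G t : R := M * \1_(`[- L - 1, L + 1]) t.
have Gi : intg setT G.
  apply: intgZ => //; rewrite /intg.
  apply: integrable_indic_itv.
apply: (dominated_L1 _ mf _ Gi).
- by move=> n; exact: measurable_quot.
- by apply: (ae_imp (cumul_derive fi)) => t; apply.
- apply: ae_all => t n.
  have bd a b : a <= b -> `|cumul f b - cumul f a| <=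
      M * (b - a) /\ ((b < - L) || (L < a) -> cumul f b - cumul f a = 0).
    move=> ab; rewrite cumulB//; split.
      have ci : intg `]a, b] (fun=> M : R).
        apply: measurable_bounded_integrable => //.
          by rewrite /= lebesgue_measure_itv /=; case: ifP => _; rewrite ?ltry.
        exists `|M|; split; [exact: num_real|] => K MK u _ /=; exact: ltW.
      apply: le_trans; first by apply: le_normr_Rintegral => //; exact: intgT.
      apply: le_trans; first apply: (@le_Rintegral _ _ _ _ _ _ (fun=> M)) => //.
        by apply: intg_norm; exact: intgT.
      rewrite Rintegral_cst//= lebesgue_measure_itv/= lte_fin; case: ifP => // _.
      by rewrite mulr0 mulr_ge0// subr_ge0.
    move=> out; under eq_Rintegral.
      move=> u; rewrite inE /= in_itv /= => /andP[au ub].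
      rewrite fL; first over.
      by move=> /andP[h2 h3]; case/orP: out => h4; lra.
    by rewrite Rintegral_cst//= mul0r.
  rewrite /quot /G indicE normrM normfV ler_pdivrMr ?normr_gt0//.
  have [/andP[i1 i2]|out] := boolP (- L - 1 <= t <= L + 1).
    rewrite mem_set ?mulr1; last by rewrite /= in_itv /= i1.
    have [hp|hn] := leP 0 (h n).
      have := bd t (t + h n); rewrite lerDl => /(_ hp)[+ _].
      by rewrite (addrC t) addrK (ger0_norm hp).
    have := bd (t + h n) t; rewrite gerDl => /(_ (ltW hn))[+ _].
    by rewrite distrC (ltr0_norm hn) opprD addNKr.
  rewrite memNset ?mulr0 ?mul0r; last by rewrite /= in_itv /=; exact/negP.
  have hb := h1 n; have := ler_norm (h n); have := ler_norm (- h n); rewrite normrN => hb1 hb2.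
  rewrite normr_le0; apply/eqP.
  have [hp|hn] := leP 0 (h n).
    have [_] := bd t (t + h n) ltac:(by rewrite lerDl); apply.
    move: out; rewrite negb_and -!ltNge => /orP[h3|h3]; apply/orP; last by right; lra.
    by left; lra.
  have [_ E] := bd (t + h n) t ltac:(by rewrite gerDl ltW).
  apply/eqP; rewrite -oppr_eq0 opprB E//.
  move: out; rewrite negb_and -!ltNge => /orP[h3|h3]; apply/orP; last by right; lra.
  by left; lra.
Qed.

(** Truncation at a height [k] reduces to bounded functions, where dominated convergence applies;
    the quotients of the truncation error are controlled by [quot_L1]. *)
Lemma quot_cvg f (L : R) (h : nat -> R) : measurable_fun setT f ->
  intg setT f -> (forall t, ~ (- L <= t <= L) -> f t = 0) ->
  (forall n, h n != 0) -> (forall n, `|h n| <= 1) -> h n @[n --> \oo] --> (0 : R) ->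
  \int[mu]_t `|quot f t (h n) - f t| @[n --> \oo] --> (0 : R).
Proof.
move=> mf fi fL h0 h1 hc.
apply/cvgrPdist_le => e e0; have e30 : 0 < e / 3 by rewrite divr_gt0.
have /cvgrPdist_le/(_ _ e30)[k _ /(_ k (leqnn k))] := trunc_L1 mf fi.
set A := [set s | _]; pose g t := f t * \1_A t.
have I0 (F : R -> R) : 0 <= \int[mu]_t `|F t| by apply: Rintegral_ge0.
rewrite sub0r normrN ger0_norm// => hg.
have mA : measurable A.
  rewrite (_ : A = ~` [set s | k%:R < `|f s|]).
    apply: measurableC; apply: measurable_set_ltr => //; exact: measurableT_comp.
  by rewrite /A; apply/seteqP; split=> z /=; rewrite leNgt => /negP.
have mg : measurable_fun setT g.
  by apply: measurable_funM => //; exact: measurable_indic.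
have gi : intg setT g.
  apply: (le_intg _ mg _ (intg_norm fi)) => // t _; rewrite normrM indicE.
  by case: (_ \in _); rewrite ?normr1 ?mulr1 ?normr0 ?mulr0.
have mfg : measurable_fun setT (fun t => f t - g t) by exact: measurable_funB.
have fgi : intg setT (fun t => f t - g t) by exact: intgB.
have : \int[mu]_t `|quot g t (h n) - g t| @[n --> \oo] --> (0 : R).
  apply: (@quot_cvg_bounded g k%:R L) => // t.
    rewrite /g indicE; case: (boolP (t \in A)); last by rewrite mulr0 normr0.
    by rewrite inE /A /= mulr1.
  by move=> out; rewrite /g fL// mul0r.
move=> /cvgrPdist_le/(_ _ e30)[n0 _ hn0]; exists n0 => // n /= n0n.
have := hn0 n n0n; rewrite !sub0r !normrN !ger0_norm// => hn.
have qi : intg setT (fun t => quot (fun s => f s - g s) t (h n)) by exact: intg_quot.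
have i1 : intg setT (fun t => `|quot (fun s => f s - g s) t (h n)|) by exact: intg_norm.
have i2 : intg setT (fun t => `|quot g t (h n) - g t|).
  by apply: intg_norm; apply: intgB => //; exact: intg_quot.
have i3 : intg setT (fun t => `|g t - f t|) by apply: intg_norm; exact: intgB.
have le : \int[mu]_t `|quot f t (h n) - f t| <=
    \int[mu]_t (`|quot (fun s => f s - g s) t (h n)| +
      (`|quot g t (h n) - g t| + `|g t - f t|)).
  apply: le_Rintegral => //.
  - by apply: intg_norm; apply: intgB => //; exact: intg_quot.
  - by apply: intgD => //; exact: intgD.
  move=> t _.
  have -> : quot (fun s => f s - g s) t (h n) = quot f t (h n) - quot g t (h n).
    rewrite (_ : (fun s => _) = (fun s => -1 * g s + f s)).
      by rewrite quotDZ//; ring.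
    by apply/funext => s; ring.
  have -> : quot f t (h n) - f t = (quot f t (h n) - quot g t (h n)) +
    ((quot g t (h n) - g t) + (g t - f t)) by ring.
  by rewrite (le_trans (ler_normD _ _))// lerD2l ler_normD.
apply: le_trans le _; rewrite RintegralD//; last exact: intgD.
rewrite RintegralD//.
have b1 : \int[mu]_t `|quot (fun s => f s - g s) t (h n)| <=
    \int[mu]_t `|g t - f t|.
  apply: Rint_le_fin => //; apply: le_trans (quot_L1 mfg fgi (h0 n)) _.
  by rewrite lee_fin le_eqVlt; apply/orP; left; apply/eqP; apply: eq_Rintegral => t _; rewrite distrC.
have -> : e = e / 3 + (e / 3 + e / 3) by field.
by rewrite lerD// ?lerD// (le_trans b1).
Qed.

End cumulative.

(** * Paths extended by zero, simple paths and Steklov averages *)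

Section supported.
Context {R : realType} {H : preHilbert R}.
Local Notation mu := (@lebesgue_measure R).
Variables (T : R).
Local Notation D := `]0%R, T[%classic.
Implicit Types f g w : R -> H.

(** Vanishing outside the interval makes scalar pairings integrable on the line, so that primitives
    from minus infinity and translations apply to them. *)
Definition zbL2 f := bL2 T f /\ forall t, ~ D t -> f t = 0.

Lemma intg_supp (f : R -> R) : intg D f -> (forall t, ~ D t -> f t = 0) ->
  intg setT f.
Proof.
move=> fi f0.
have := (@integrable_mkcond _ (measurableTypeR R) R mu D (EFin \o f)
  (measurable_itv _)).1 fi.
congr (integrable _ _ _).
apply/funext => t; rewrite patchE; case: ifPn => // /negP tD.
by rewrite /= f0// => Dt; apply: tD; exact/mem_set.
Qed.

Lemma Rint_supp (f : R -> R) : (forall t, ~ D t -> f t = 0) ->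
  \int[mu]_t f t = \int[mu]_(t in D) f t.
Proof.
move=> f0; rewrite [RHS]Rintegral_mkcond; apply: eq_Rintegral => t _.
rewrite patchE; case: ifPn => // /negP tD.
by rewrite /= f0// => Dt; apply: tD; exact/mem_set.
Qed.

Lemma zbL2_SM f : zbL2 f -> SM f. Proof. by case=> -[]. Qed.

Lemma zbL2_ip f g : zbL2 f -> zbL2 g -> intg setT (fun t => ip (f t) (g t)).
Proof.
move=> [lf f0] [lg g0]; apply: intg_supp; first exact: intg_ip.
by move=> t /f0 ->; rewrite ip0l.
Qed.

Lemma zbL2_measurable_ip f g : zbL2 f -> zbL2 g ->
  measurable_fun setT (fun t => ip (f t) (g t)).
Proof. by move=> lf lg; apply: measurable_ip; exact: zbL2_SM. Qed.

Lemma zbL2_DZ k f g : zbL2 f -> zbL2 g -> zbL2 (fun t => k *: f t + g t).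
Proof.
move=> [lf f0] [lg g0]; split; first exact: (bL2_DZ k lf lg).
by move=> t nD; rewrite f0// g0// scaler0 addr0.
Qed.

Lemma zbL2B f g : zbL2 f -> zbL2 g -> zbL2 (fun t => f t - g t).
Proof.
move=> [lf f0] [lg g0]; split; first exact: bL2B.
by move=> t nD; rewrite f0// g0// subr0.
Qed.

Lemma zbL2_ip_cst f x : zbL2 f -> [/\ intg setT (fun t => ip (f t) x),
  measurable_fun setT (fun t => ip (f t) x) &
  forall t, ~ D t -> ip (f t) x = 0].
Proof.
move=> [lf f0]; have f0' t : ~ D t -> ip (f t) x = 0 by move=> /f0 ->; rewrite ip0l.
split=> //; last by apply: measurable_ip; [case: lf|exact: SM_cst].
by apply: intg_supp => //; apply: intg_ip => //; exact: bL2_cst.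
Qed.

Lemma simple_dense f : zbL2 f -> forall e : R, 0 < e -> exists s,
  [/\ fsimple s, zbL2 s & \int[mu]_t ip (s t - f t) (s t - f t) <= e].
Proof.
move=> lf e e0; have [[[s [fs sf]] fi] f0] := lf.
(* The approximation is kept only where it is at most twice as large as [f]. The pointwise limit is
   unchanged, and the squared error is dominated by [(2 + 1)^2 |f|^2]. *)
pose A n := D `&` [set t | nrm (s n t) <= 2 * nrm (f t)].
have mA n : measurable (A n).
  apply: measurableI => //.
  rewrite (_ : [set t | _] = ~` [set t | 2 * nrm (f t) < nrm (s n t)]).
    apply: measurableC; apply: measurable_set_ltr.
      by apply: measurable_funM => //; apply: measurable_nrm; exact: zbL2_SM lf.
    exact: (measurable_nrm (fsimple_SM (fs n))).
  by apply/seteqP; split=> z /=; rewrite leNgt => /negP.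
pose r n t := if t \in A n then s n t else 0.
have fr n : fsimple (r n) by apply: fsimple_if => //; exact: fsimple_cst.
have rle n t : nrm (r n t) <= 2 * nrm (f t).
  rewrite /r; case: ifPn => [/set_mem[]//|_].
  by rewrite nrm0 mulr_ge0 ?nrm_ge0.
have lr n : zbL2 (r n).
  split; first by apply: (bL2_bound (M := 2) _ _ lf.1) => //; exact: fsimple_SM.
  by move=> t nD; rewrite /r memNset// => -[].
have rf t : D t -> ph_cvg (r^~ t) (f t).
  move=> Dt; have [ft0|ft0] := eqVneq (nrm (f t)) 0.
    rewrite /ph_cvg; under eq_fun => n.
      rewrite (_ : nrm _ = 0); first over.
      apply/eqP; rewrite eq_le nrm_ge0 andbT.
      apply: le_trans (ler_nrmB _ _) _; rewrite ft0 addr0.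
      by have := rle n t; rewrite ft0 mulr0.
    exact: cvg_cst.
  have fp : 0 < nrm (f t) by rewrite lt_def ft0 nrm_ge0.
  apply/ph_cvgP => d d0; have /ph_cvgP sft := sf t.
  have [n1 h1] := sft _ d0; have [n2 h2] := sft _ fp.
  exists (maxn n1 n2) => n; rewrite geq_max => /andP[/h1 hn1 /h2 hn2].
  rewrite /r mem_set//; split=> //=.
  have := ler_nrmD (s n t - f t) (f t); rewrite subrK; lra.
have sub_ip (x y : H) : ip (x - y) (x - y) <= (nrm x + nrm y) ^+ 2.
  rewrite -sqr_nrm ler_pXn2r ?nnegrE ?nrm_ge0 ?addr_ge0 ?nrm_ge0//.
  exact: ler_nrmB.
have : \int[mu]_t `|ip (r n t - f t) (r n t - f t) - 0| @[n --> \oo] --> (0 : R).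
  apply: (@dominated_L1 _ _ (fun=> 0) (fun t => 9 * ip (f t) (f t))) => //.
  - by move=> n; apply: measurable_ip; apply: SMB; exact: zbL2_SM.
  - apply: ae_all => t; have [Dt|nD] := pselect (D t).
      have hD : ph_cvg (r^~ t) (f t) by exact: rf.
      have -> : (fun n => ip (r n t - f t) (r n t - f t)) =
          (fun n => nrm (r n t - f t) * nrm (r n t - f t)).
        by apply/funext => n; rewrite -sqr_nrm expr2.
      by rewrite -[X in _ --> X](mulr0 0); exact: (cvgM hD hD).
    have rt n : r n t = 0 by rewrite (lr n).2.
    under eq_fun do rewrite rt f0// subr0 ip0l.
    exact: cvg_cst.
  - by apply: intgZ => //; exact: zbL2_ip.
  - apply: ae_all => t n; rewrite ger0_norm ?ip_ge0// (le_trans (sub_ip _ _))//.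
    rewrite -sqr_nrm; have := rle n t; have := nrm_ge0 (r n t).
    have := nrm_ge0 (f t); nra.
move=> /cvgrPdist_le/(_ _ e0)[n _ /(_ n (leqnn n))].
under eq_Rintegral do rewrite subr0 ger0_norm ?ip_ge0//.
rewrite sub0r normrN ger0_norm; last by apply: Rintegral_ge0 => t _; exact: ip_ge0.
by move=> h; exists (r n).
Qed.

End supported.

Section steklov.
Context {R : realType} {H : preHilbert R}.
Local Notation mu := (@lebesgue_measure R).
Variables (T : R) (T0 : 0 < T).
Local Notation D := `]0%R, T[%classic.
Variables (g : R -> H) (lg : zbL2 T g).

Let gx x s := ip (g s) x.

(** The average of [g] between [t] and [t + h], tested against [x]: a linear functional of [x] that
    stands for a vector-valued integral. *)
Definition ipquot h t x : R := quot (gx x) t h.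

Lemma ipquotDZ h t a x y : ipquot h t (a *: x + y) = a * ipquot h t x + ipquot h t y.
Proof.
have [ix _ _] := zbL2_ip_cst x lg; have [iy _ _] := zbL2_ip_cst y lg.
rewrite /ipquot -quotDZ//; congr quot; apply/funext => s.
by rewrite /gx ipDr ipZr.
Qed.

Let n2 s := ip (g s) (g s).

(** Cauchy--Schwarz under the average followed by Young's inequality. The parameter [k] is left
    free: it is later adapted to the vector, or to the accuracy of an approximation. *)
Lemma ipquot_le k h t x : 0 < k -> h != 0 ->
  `|ipquot h t x| <= 2^-1 * (k^-1 * `|quot n2 t h| + k * nrm x ^+ 2).
Proof.
move=> k0 h0; have [ix mx _] := zbL2_ip_cst x lg.
have ni : intg setT n2 by exact: (zbL2_ip lg lg).
have bd a b : a <= b -> `|cumul (gx x) b - cumul (gx x) a| <=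
    2^-1 * (k^-1 * (cumul n2 b - cumul n2 a) + k * nrm x ^+ 2 * (b - a)).
  move=> ab; rewrite !cumulB//.
  have nab : intg `]a, b] n2 by exact: intgT.
  have ci (c : R) : intg `]a, b] (fun=> c).
    apply: measurable_bounded_integrable => //.
      by rewrite /= lebesgue_measure_itv /=; case: ifP => _; rewrite ?ltry.
    exists `|c|; split; [exact: num_real|] => K cK u _ /=; exact: ltW.
  apply: le_trans; first by apply: le_normr_Rintegral => //; exact: intgT.
  apply: (@le_trans _ _ (\int[mu]_(s in `]a, b])
      (2^-1 * (k^-1 * n2 s + k * nrm x ^+ 2)))).
    apply: le_Rintegral => //; first by apply: intg_norm; exact: intgT.
      by apply: intgZ => //; apply: intgD => //; exact: intgZ.
    move=> s _; apply: le_trans (normr_ip_le _ _) _.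
    rewrite /n2 -sqr_nrm; set p := nrm (g s); set q := nrm x.
    have -> : 2^-1 * (k^-1 * p ^+ 2 + k * q ^+ 2) =
        p * q + 2^-1 * k^-1 * (p - k * q) ^+ 2 by field; rewrite gt_eqF.
    by rewrite lerDl mulr_ge0 ?sqr_ge0// mulr_ge0// invr_ge0 ltW.
  rewrite RintegralZl//; last by apply: intgD => //; exact: intgZ.
  rewrite (RintegralD _ (intgZ _ _ nab) (ci _))//.
  rewrite RintegralZl// Rintegral_cst//= lebesgue_measure_itv/= lte_fin.
  case: ltP => // ba; rewrite mulr0 ler_pM2l ?invr_gt0// lerD2l.
  by rewrite mulr_ge0 ?subr_ge0// mulr_ge0 ?sqr_ge0// ltW.
rewrite /ipquot /quot !normrM !normfV ler_pdivrMr ?normr_gt0//.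
have E : 2^-1 * (k^-1 * (`|cumul n2 (t + h) - cumul n2 t| / `|h|) +
    k * nrm x ^+ 2) * `|h| =
    2^-1 * (k^-1 * `|cumul n2 (t + h) - cumul n2 t| + k * nrm x ^+ 2 * `|h|).
  by field; rewrite normr_eq0 h0 gt_eqF.
rewrite E; have [hp|hn] := leP 0 h.
  have := bd t (t + h); rewrite lerDl => /(_ hp)/le_trans; apply.
  rewrite (addrC t) addrK (ger0_norm hp) ler_pM2l ?invr_gt0// lerD2r.
  by rewrite ler_pM2l ?invr_gt0// ler_norm.
have := bd (t + h) t; rewrite gerDl => /(_ (ltW hn)).
rewrite distrC => /le_trans; apply.
rewrite (ltr0_norm hn) opprD addNKr ler_pM2l ?invr_gt0// lerD2r.
by rewrite ler_pM2l ?invr_gt0// distrC ler_norm.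
Qed.

Lemma ipquot_lip h t : h != 0 -> exists M, forall x y,
  `|ipquot h t x - ipquot h t y| <= M * nrm (x - y).
Proof.
move=> h0; exists (2^-1 * (`|quot n2 t h| + 1)) => x y.
have -> : ipquot h t x - ipquot h t y = ipquot h t (x - y).
  by rewrite -[x - y]addrC -scaleN1r ipquotDZ; ring.
set z := x - y; have [z0|z0] := eqVneq (nrm z) 0.
  rewrite /ipquot (_ : gx z = fun=> 0).
    by rewrite /quot /cumul !Rintegral_cst//= !mul0r subrr mul0r normr0 z0 mulr0.
  by apply/funext => s; rewrite /gx ipC nrm_eq0_ip.
have zp : 0 < nrm z by rewrite lt_def z0 nrm_ge0.
(* The choice [k = 1 / nrm z] makes both terms proportional to [nrm z]. *)
have := @ipquot_le (nrm z)^-1 h t z; rewrite invr_gt0 => /(_ zp h0).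
move=> /le_trans; apply; rewrite invrK expr2 mulKf//.
by rewrite le_eqVlt; apply/orP; left; apply/eqP; ring.
Qed.

Lemma measurable_ipquot h (w : R -> H) : h != 0 -> SM w ->
  measurable_fun setT (fun t => ipquot h t (w t)).
Proof.
move=> h0 mw; apply: SM_measurable.
apply: (@SM_op _ _ RH (fun t x => ipquot h t x)) => //.
  move=> t; have [M hM] := ipquot_lip t h0.
  by exists M => x y; rewrite nrm_RH; exact: hM.
move=> x; apply: measurable_SM; apply: measurable_quot.
by have [] := zbL2_ip_cst x lg.
Qed.

Lemma intg_ipquot h (w : R -> H) : h != 0 -> zbL2 T w ->
  intg setT (fun t => ipquot h t (w t)).
Proof.
move=> h0 lw; apply: (@le_intg _ _ _
   (fun t => 2^-1 * (1^-1 * `|quot n2 t h| + 1 * nrm (w t) ^+ 2))) => //.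
- by apply: measurable_ipquot => //; exact: zbL2_SM lw.
- by move=> t _; exact: ipquot_le.
- apply: intgZ => //; apply: intgD => //; apply: intgZ => //.
    apply: intg_norm; apply: intg_quot => //; first exact: (zbL2_measurable_ip lg lg).
    exact: (zbL2_ip lg lg).
  by under eq_fun do rewrite sqr_nrm; exact: (zbL2_ip lw lw).
Qed.

Lemma ipquot_L1_bound h (w : R -> H) k : h != 0 -> 0 < k -> zbL2 T w ->
  \int[mu]_t `|ipquot h t (w t)| <=
    2^-1 * (k^-1 * \int[mu]_t n2 t + k * \int[mu]_t ip (w t) (w t)).
Proof.
move=> h0 k0 lw.
have ni : intg setT n2 by exact: (zbL2_ip lg lg).
have mn : measurable_fun setT n2 by exact: (zbL2_measurable_ip lg lg).
have wi : intg setT (fun t => ip (w t) (w t)) by exact: (zbL2_ip lw lw).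
have qi : intg setT (fun t => `|quot n2 t h|) by apply: intg_norm; exact: intg_quot.
apply: (@le_trans _ _ (\int[mu]_t
    (2^-1 * (k^-1 * `|quot n2 t h| + k * ip (w t) (w t))))).
  apply: le_Rintegral => //.
  - by apply: intg_norm; exact: intg_ipquot.
  - by apply: intgZ => //; apply: intgD => //; exact: intgZ.
  - by move=> t _; rewrite -sqr_nrm; exact: ipquot_le.
rewrite RintegralZl//; last by apply: intgD => //; exact: intgZ.
rewrite RintegralD//; [|exact: intgZ|exact: intgZ].
rewrite !RintegralZl// ler_pM2l ?invr_gt0// lerD2r ler_pM2l ?invr_gt0//.
apply: Rint_le_fin => //; apply: le_trans (quot_L1 mn ni h0) _.
by rewrite lee_fin; under eq_Rintegral do rewrite ger0_norm ?ip_ge0//.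
Qed.

Lemma ip_L1_bound (w : R -> H) k : 0 < k -> zbL2 T w ->
  \int[mu]_t `|ip (g t) (w t)| <=
    2^-1 * (k^-1 * \int[mu]_t n2 t + k * \int[mu]_t ip (w t) (w t)).
Proof.
move=> k0 lw.
have ni : intg setT n2 by exact: (zbL2_ip lg lg).
have wi : intg setT (fun t => ip (w t) (w t)) by exact: (zbL2_ip lw lw).
apply: (@le_trans _ _ (\int[mu]_t (2^-1 * (k^-1 * n2 t + k * ip (w t) (w t))))).
  apply: le_Rintegral => //.
  - by apply: intg_norm; exact: (zbL2_ip lg lw).
  - by apply: intgZ => //; apply: intgD => //; exact: intgZ.
  - move=> t _; apply: le_trans (normr_ip_le _ _) _.
    rewrite /n2 -!sqr_nrm; set p := nrm (g t); set q := nrm (w t).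
    have -> : 2^-1 * (k^-1 * p ^+ 2 + k * q ^+ 2) =
        p * q + 2^-1 * k^-1 * (p - k * q) ^+ 2 by field; rewrite gt_eqF.
    by rewrite lerDl mulr_ge0 ?sqr_ge0// mulr_ge0// invr_ge0 ltW.
rewrite RintegralZl//; last by apply: intgD => //; exact: intgZ.
rewrite RintegralD//; [|exact: intgZ|exact: intgZ].
by rewrite !RintegralZl.
Qed.

Variable h : nat -> R.
Hypothesis h0 : forall n, h n != 0.
Hypothesis h1 : forall n, `|h n| <= 1.
Hypothesis hc : h n @[n --> \oo] --> (0 : R).

Lemma steklov_simple (w : R -> H) : fsimple w -> zbL2 T w ->
  \int[mu]_t `|ipquot (h n) t (w t) - ip (g t) (w t)| @[n --> \oo] --> (0 : R).
Proof.
move=> [m [c [b [cm mc wb]]]] lw.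
pose e n k := \int[mu]_t `|quot (gx (b k)) t (h n) - gx (b k) t|.
have ei n k : intg setT (fun t => `|quot (gx (b k)) t (h n) - gx (b k) t|).
  have [ix mx _] := zbL2_ip_cst (b k) lg.
  by apply: intg_norm; apply: intgB => //; exact: intg_quot.
apply: (cvg0_le (g := fun n => \sum_(k < m) e n k)) => [n|]; last first.
  have : \sum_(k < m) e n k @[n --> \oo] --> \sum_(k < m) (0 : R).
    apply: (@cvg_big R _ +%R) => [|k _]; first exact: add_continuous.
    have [ix mx x0] := zbL2_ip_cst (b k) lg.
    apply: (@quot_cvg _ _ T) => // t out; apply: x0 => /=; rewrite in_itv /=.
    by move=> /andP[t0 tT]; apply: out; apply/andP; split; lra.
  by rewrite big1.
rewrite Rintegral_ge0//=.
have si j : intg setT (fun t => \sum_(k < j) `|quot (gx (b k)) t (h n) - gx (b k) t|).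
  elim: j => [|j IH]; first by under eq_fun do rewrite big_ord0; exact: integrable0.
  by under eq_fun do rewrite big_ord_recr /=; exact: intgD.
have -> : \sum_(k < m) e n k = \int[mu]_t
    (\sum_(k < m) `|quot (gx (b k)) t (h n) - gx (b k) t|).
  rewrite /e; elim: m {cm} => [|m IH].
    rewrite big_ord0; under eq_Rintegral do rewrite big_ord0.
    by rewrite Rintegral_cst//= mul0r.
  rewrite big_ord_recr /= IH -(RintegralD _ (si m) (ei n m))//.
  by apply: eq_Rintegral => t _; rewrite big_ord_recr.
apply: le_Rintegral => //.
- apply: intg_norm; apply: intgB => //; first exact: intg_ipquot.
  exact: (zbL2_ip lg lw).
- exact: si.
- move=> t _; rewrite wb (bigD1 (Ordinal (cm t)))//= lerDl.
  by apply: sumr_ge0 => i _.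
Qed.

(** The tested vector moves with time. A simple [w] reduces to finitely many scalar convergences; in
    general, the quotients and the limit are both linear in [w] and bounded uniformly in [n], so [w]
    may be approximated by a simple path. *)
Theorem steklov_cvg (w : R -> H) : zbL2 T w ->
  \int[mu]_t `|ipquot (h n) t (w t) - ip (g t) (w t)| @[n --> \oo] --> (0 : R).
Proof.
move=> lw; apply/cvgrPdist_le => e e0.
set G := \int[mu]_t n2 t; have G0 : 0 <= G by apply: Rintegral_ge0 => t _; exact: ip_ge0.
(* With [|s - w|^2 <= d^2] in L^2 and Young's parameter [1/d], each of the two approximation errors
   is at most [d (G + 1) / 2 = e / 4]. *)
pose d := e / (2 * (G + 1)).
have d0 : 0 < d by rewrite divr_gt0// mulr_gt0//; lra.
have [s [fs ls sw]] := simple_dense lw (mulr_gt0 d0 d0).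
have e20 : 0 < e / 2 by rewrite divr_gt0.
have /cvgrPdist_le/(_ _ e20)[n0 _ hn0] := steklov_simple fs ls.
exists n0 => // n /= /hn0; rewrite !sub0r !normrN.
have I0 (F : R -> R) : 0 <= \int[mu]_t `|F t| by apply: Rintegral_ge0.
rewrite !ger0_norm// => hs.
have lsw : zbL2 T (fun t => s t - w t) by exact: zbL2B.
have i1 : intg setT (fun t => `|ipquot (h n) t (s t - w t)|).
  by apply: intg_norm; exact: intg_ipquot.
have i2 : intg setT (fun t => `|ipquot (h n) t (s t) - ip (g t) (s t)|).
  by apply: intg_norm; apply: intgB => //; [exact: intg_ipquot|exact: (zbL2_ip lg ls)].
have i3 : intg setT (fun t => `|ip (g t) (s t - w t)|).
  by apply: intg_norm; exact: (zbL2_ip lg lsw).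
have le : \int[mu]_t `|ipquot (h n) t (w t) - ip (g t) (w t)| <=
    \int[mu]_t (`|ipquot (h n) t (s t - w t)| +
      (`|ipquot (h n) t (s t) - ip (g t) (s t)| + `|ip (g t) (s t - w t)|)).
  apply: le_Rintegral => //.
  - by apply: intg_norm; apply: intgB => //; [exact: intg_ipquot|exact: (zbL2_ip lg lw)].
  - by apply: intgD => //; exact: intgD.
  move=> t _.
  have E : ipquot (h n) t (s t - w t) = ipquot (h n) t (s t) - ipquot (h n) t (w t).
    by rewrite -[s t - w t]addrC -scaleN1r ipquotDZ; ring.
  have -> : ipquot (h n) t (w t) - ip (g t) (w t) =
     - ipquot (h n) t (s t - w t) + ((ipquot (h n) t (s t) - ip (g t) (s t)) +
     ip (g t) (s t - w t)) by rewrite E ipBr; ring.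
  by rewrite (le_trans (ler_normD _ _))// normrN lerD2l ler_normD.
apply: le_trans le _; rewrite RintegralD//; last exact: intgD.
rewrite RintegralD//.
have di : 0 < d^-1 by rewrite invr_gt0.
have b1 := ipquot_L1_bound (h0 n) di lsw.
have b2 := ip_L1_bound di lsw.
have b : 2^-1 * (d^-1^-1 * G + d^-1 * \int[mu]_t ip (s t - w t) (s t - w t)) <=
    2^-1 * (d * (G + 1)).
  rewrite invrK ler_pM2l ?invr_gt0// mulrDr mulr1 lerD2l mulrC ler_pdivrMr//.
have E : d * (G + 1) = e / 2 by rewrite /d; field; lra.
have := le_trans b1 b; have := le_trans b2 b; rewrite E; lra.
Qed.

End steklov.

(** * Continuous representatives and the energy identity *)

Section continuous_paths.
Context {R : realType}.
Local Notation mu := (@lebesgue_measure R).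
Variables (T : R) (T0 : 0 < T).
Local Notation D := `]0%R, T[%classic.

Definition hcont {H : preHilbert R} (z : R -> H) := forall t, 0 <= t <= T ->
  forall e, 0 < e -> exists2 d, 0 < d &
  forall s, 0 <= s <= T -> `|s - t| < d -> nrm (z s - z t) <= e.

Lemma ae_point (Q : R -> Prop) : {ae mu, forall t, D t -> Q t} ->
  forall a b, 0 <= a -> a < b -> b <= T -> exists s, [/\ a < s, s < b & Q s].
Proof.
move=> [B [mB B0 hB]] a b a0 ab bT; apply: contrapT => nQ.
have : (mu `]a, b[ <= mu B)%E.
  apply: le_measure; rewrite ?inE//; move=> s /=; rewrite in_itv /= => /andP[sa sb]; apply: hB => /= hs; apply: nQ.
  exists s; split=> //; apply: hs; rewrite in_itv /=; apply/andP; split; lra.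
by rewrite B0 /= lebesgue_measure_itv /= lte_fin ab -EFinB lee_fin; lra.
Qed.

Lemma ae_near (Q : R -> Prop) : {ae mu, forall t, D t -> Q t} ->
  forall t d, 0 <= t <= T -> 0 < d -> exists s, [/\ D s, `|s - t| < d & Q s].
Proof.
move=> hQ t d /andP[t0 tT] d0.
have [|||s [s1 s2 Qs]] := @ae_point Q hQ (Num.max 0 (t - d)) (Num.min T (t + d)).
- by rewrite le_max lexx.
- by rewrite gt_max !lt_min T0 /=; apply/andP; split; [lra|apply/andP; split; lra].
- by rewrite ge_min lexx.
move: s1 s2; rewrite gt_max lt_min => /andP[s1 s2] /andP[s3 s4].
exists s; split=> //=; first by rewrite in_itv /= s1 s3.
by rewrite ltr_norml; apply/andP; split; lra.
Qed.

Section one_space.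
Context {H : preHilbert R}.
Implicit Types z : R -> H.

Lemma hcont_ae0 z : hcont z -> {ae mu, forall t, D t -> nrm (z t) = 0} ->
  forall t, 0 <= t <= T -> nrm (z t) = 0.
Proof.
move=> cz z0 t tT; apply/eqP; rewrite eq_le nrm_ge0 andbT; apply/ler_addgt0Pr => e e0; rewrite add0r.
have [d d0 hd] := cz t tT e e0; have [s [Ds st zs]] := ae_near z0 tT d0.
have sT : 0 <= s <= T.
  by move: Ds; rewrite /= in_itv /= => /andP[h1 h2]; rewrite !ltW.
have := hd s sT st; have := ler_nrmB (z s) (z s - z t).
by rewrite opprB addrC subrK zs; lra.
Qed.

Lemma hcontDZ k z z' : hcont z -> hcont z' -> hcont (fun t => k *: z t + z' t).
Proof.
move=> cz cz' t tT e e0.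
have e1 : 0 < e / (2 * (`|k| + 1)).
  by rewrite divr_gt0// mulr_gt0//; have := normr_ge0 k; lra.
have e2 : 0 < e / 2 by lra.
have [d1 d10 h1] := cz t tT _ e1; have [d2 d20 h2] := cz' t tT _ e2.
exists (Num.min d1 d2); first by rewrite lt_min d10.
move=> s sT; rewrite lt_min => /andP[/(h1 _ sT) n1 /(h2 _ sT) n2].
rewrite opprD addrACA -scalerBr (le_trans (ler_nrmD _ _))// nrmZ.
move: n1; rewrite ler_pdivlMr; last by rewrite mulr_gt0//; have := normr_ge0 k; lra.
have := nrm_ge0 (z s - z t); have := normr_ge0 k; nra.
Qed.

Lemma hcont_cst x : hcont (fun=> x : H).
Proof. by move=> t tT e e0; exists 1 => // s _ _; rewrite subrr nrm0 ltW. Qed.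

Lemma hcontB z z' : hcont z -> hcont z' -> hcont (fun t => z t - z' t).
Proof.
move=> cz cz'; have := hcontDZ (- 1) cz' cz.
by congr hcont; apply/funext => t; rewrite scaleN1r addrC.
Qed.

Lemma hcontD z z' : hcont z -> hcont z' -> hcont (fun t => z t + z' t).
Proof.
move=> cz cz'; have := hcontDZ 1 cz cz'.
by congr hcont; apply/funext => t; rewrite scale1r.
Qed.

Lemma hcont_ip z z' : hcont z -> hcont z' ->
  hcont (H := RH) (fun t => ip (z t) (z' t) : R).
Proof.
move=> cz cz' t tT e e0.
pose M := nrm (z t) + nrm (z' t) + 1.
have M0 : 1 <= M by have := nrm_ge0 (z t); have := nrm_ge0 (z' t); rewrite /M; lra.
have e1 : 0 < Num.min 1 (e / (2 * M)).
  by rewrite lt_min ltr01 divr_gt0// mulr_gt0//; lra.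
have [d1 d10 h1] := cz t tT _ e1; have [d2 d20 h2] := cz' t tT _ e1.
exists (Num.min d1 d2); first by rewrite lt_min d10.
move=> s sT; rewrite lt_min => /andP[/(h1 _ sT) n1 /(h2 _ sT) n2].
move: n1 n2; rewrite !le_min !ler_pdivlMr ?mulr_gt0//; try lra.
move=> /andP[p1 p2] /andP[q1 q2]; rewrite nrm_RH.
have -> : ip (z s) (z' s) - ip (z t) (z' t) =
    ip (z s - z t) (z' s - z' t) + (ip (z s - z t) (z' t) + ip (z t) (z' s - z' t)).
  by rewrite !(ipBl, ipBr); ring.
rewrite (le_trans (ler_normD _ _))//.
have := ler_normD (ip (z s - z t) (z' t)) (ip (z t) (z' s - z' t)).
have := normr_ip_le (z s - z t) (z' s - z' t).
have := normr_ip_le (z s - z t) (z' t).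
have := normr_ip_le (z t) (z' s - z' t).
move: p1 p2 q1 q2 M0; rewrite /M.
have := nrm_ge0 (z s - z t); have := nrm_ge0 (z' s - z' t).
have := nrm_ge0 (z t); have := nrm_ge0 (z' t).
move: (nrm (z s - z t)) (nrm (z' s - z' t)) (nrm (z t)) (nrm (z' t)).
move=> a b c d c0 d0 a0 b0 p1 p2 q1 q2 M1 i1 i2 i3 i4.
have : a * b <= a by nra.
nra.
Qed.

End one_space.

Lemma hcont_cumul f : intg setT f -> hcont (H := RH) (cumul f).
Proof.
move=> fi t tT e e0; have [d d0 hd] := cumul_small fi e0.
by exists d => // s _ st; rewrite nrm_RH; apply: ltW; exact: hd.
Qed.

Lemma hcont_ae_cst (phi : R -> R) k : hcont (H := RH) phi ->
  {ae mu, forall t, D t -> phi t = k} -> forall t, 0 <= t <= T -> phi t = k.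
Proof.
move=> cp hk t tT.
have ae0 : {ae mu, forall t, D t -> nrm (phi t - k : RH) = 0}.
  by apply: (ae_imp hk) => s hs Ds; rewrite nrm_RH hs// subrr normr0.
have := @hcont_ae0 RH (fun t => phi t - k) (hcontB cp (hcont_cst (k : RH))) ae0 t tT.
by rewrite nrm_RH => /normr0P; rewrite subr_eq0 => /eqP.
Qed.

End continuous_paths.

Section translated.
Context {R : realType}.
Local Notation mu := (@lebesgue_measure R).

Lemma ae_shift (h : R) (Q : R -> Prop) : {ae mu, forall t, Q t} ->
  {ae mu, forall t, Q (t + h)}.
Proof.
move=> /(ae_reflect h)/(ae_reflect 0) hQ; apply: (ae_imp hQ) => t.
by congr Q; ring.
Qed.

Lemma intg_shift (h : R) (f : R -> R) : intg setT f -> intg setT (fun t => f (t + h)).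
Proof.
move=> fi; have [mf _] := (intgP _ _).1 fi.
have h1 := intg_reflect h measurableT mf fi; have [mf1 _] := (intgP _ _).1 h1.
have := intg_reflect 0 measurableT mf1 h1.
by congr intg; apply/funext => t; congr f; ring.
Qed.

Lemma Rint_le_ae (D : set R) (f g : R -> R) : measurable D -> intg D f -> intg D g ->
  {ae mu, forall t, D t -> f t <= g t} ->
  \int[mu]_(t in D) f t <= \int[mu]_(t in D) g t.
Proof.
move=> mD fi gi fg; rewrite -subr_ge0 -RintegralB//.
rewrite (@Rint_ae _ _ _ (fun t => `|g t - f t|))//.
- by apply: Rintegral_ge0.
- exact: intgB.
- by have [] := (intgP _ _).1 (intg_norm (intgB mD gi fi)).
- by apply: (ae_imp fg) => t h Dt; rewrite ger0_norm// subr_ge0 h.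
Qed.

End translated.

(** The arithmetic common to the two half-steps of [path_modulus]: [N] and [W] are the integrals of
    [|g|^2] and [|w|^2] over the whole interval, [x] is the increment tested against [w m], [y] is
    the integral of [ip g w] over the half-interval, and [r = t - s]. *)
Lemma modulus_arith (R : realType) (N' N W' W p q r x y z : R) :
  N' <= N -> W' <= W -> q <= p -> p <= W + r -> 0 < r ->
  `|x| <= 2^-1 * (N' + q) -> `|y| <= 2^-1 * (N' + W') ->
  z = 2 * (x - y) \/ z = 2 * (y - x) -> z <= 2 * (N + W + r).
Proof.
move=> h1 h2 h3 h4 h5; rewrite !ler_norml => /andP[h6 h7] /andP[h8 h9].
by case=> ->; lra.
Qed.

Section weak_evolution.
Context {R : realType} {H : preHilbert R} (cH : ph_complete H).
Local Notation mu := (@lebesgue_measure R).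
Variables (T : R) (T0 : 0 < T).
Local Notation D := `]0%R, T[%classic.
Variables (P : linop H H) (H0 : set H).

(* [g] is the time derivative of [P w], read against [P om]. *)
Definition evolves (w g : R -> H) := [/\ zbL2 T w, zbL2 T g, forall t, H0 (w t) &
  forall om, H0 om -> exists k, {ae mu, forall t, D t ->
    ip (P (w t)) (P om) = k + cumul (fun s => ip (g s) om) t}].

Variables (w g : R -> H) (ev : evolves w g).
Let gx x s := ip (g s) x.
Let n2 s := ip (g s) (g s).
Let w2 s := ip (w s) (w s).
Let gw s := ip (g s) (w s).
Let E t := ip (P (w t)) (P (w t)).

Let lw : zbL2 T w. Proof. by case: ev. Qed.
Let lg : zbL2 T g. Proof. by case: ev. Qed.
Let n2i : intg setT n2. Proof. exact: (zbL2_ip lg lg). Qed.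
Let w2i : intg setT w2. Proof. exact: (zbL2_ip lw lw). Qed.
Let gwi : intg setT gw. Proof. exact: (zbL2_ip lg lw). Qed.
Let gxi x : intg setT (gx x). Proof. by have [] := zbL2_ip_cst x lg. Qed.

Lemma cumul_ipquot x s t : t != s ->
  cumul (gx x) t - cumul (gx x) s = ipquot g (t - s) s x * (t - s).
Proof.
move=> ts; have ts0 : t - s != 0 by rewrite subr_eq0.
by rewrite /ipquot /quot mulfVK// (addrC s) subrK.
Qed.

Lemma cumul_ip_le x s t : s < t -> `|cumul (gx x) t - cumul (gx x) s| <=
  2^-1 * (cumul n2 t - cumul n2 s + nrm x ^+ 2 * (t - s)).
Proof.
move=> st; have ts : 0 < t - s by lra.
rewrite cumul_ipquot ?gt_eqF// normrM (gtr0_norm ts).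
have := ipquot_le lg s x ltr01 (lt0r_neq0 ts).
rewrite -(ler_pM2r ts) => /le_trans; apply.
have nn : 0 <= cumul n2 t - cumul n2 s.
  by rewrite (cumulB n2i (ltW st)); apply: Rintegral_ge0 => u _; exact: ip_ge0.
rewrite /quot (addrC s) subrK ger0_norm; last by rewrite divr_ge0// ltW.
by rewrite invr1 !mul1r -mulrA mulrDl divfK ?gt_eqF.
Qed.

(** For each test vector the weak identity has its own null set. A dense sequence of values of [w]
    leaves countably many, and since both sides are Lipschitz in the test vector, the identity for
    increments extends to every [w r]. *)
Lemma good_increments : exists S : set R, {ae mu, forall t, D t -> S t} /\
  forall s t r, S s -> S t ->
    ip (P (w t) - P (w s)) (P (w r)) = cumul (gx (w r)) t - cumul (gx (w r)) s.
Proof.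
have [_ _ H0w hW] := ev; have [tau htau] := SM_range_separable (zbL2_SM lw).
have /choice[k hk] : forall j, exists k, {ae mu, forall t, D t ->
    ip (P (w t)) (P (w (tau j))) = k + cumul (gx (w (tau j))) t}.
  by move=> j; exact: (hW _ (H0w (tau j))).
exists [set t | forall j,
  ip (P (w t)) (P (w (tau j))) = k j + cumul (gx (w (tau j))) t]; split.
  by apply: (ae_imp (ae_nat hk)) => t h Dt j; exact: h.
move=> s t r Ss St; have [->|ts] := eqVneq t s; first by rewrite !subrr ip0l.
have ts0 : t - s != 0 by rewrite subr_eq0.
have [M1 hM1] := ipquot_lip lg s ts0.
have [M2 hM2] := lop_bound P.
apply/eqP; rewrite -subr_eq0 -normr_le0; apply/ler_addgt0Pr => e e0; rewrite add0r.
pose M := nrm (P (w t) - P (w s)) * `|M2| + `|M1| * `|t - s| + 1.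
have M0 : 0 < M.
  by rewrite ltr_wpDl// addr_ge0// mulr_ge0// nrm_ge0.
have [j hj] := htau r (e / M) (divr_gt0 e0 M0).
have E0 : ip (P (w t) - P (w s)) (P (w (tau j))) =
    cumul (gx (w (tau j))) t - cumul (gx (w (tau j))) s.
  by rewrite ipBl Ss St; ring.
set y := w (tau j) in hj E0; set x := w r in hj *.
have -> : ip (P (w t) - P (w s)) (P x) - (cumul (gx x) t - cumul (gx x) s) =
    ip (P (w t) - P (w s)) (P (x - y)) -
    (ipquot g (t - s) s x - ipquot g (t - s) s y) * (t - s).
  by rewrite lopB ipBr E0 mulrBl -!cumul_ipquot//; ring.
rewrite (le_trans (ler_normB _ _))// normrM.
have q1 : `|ip (P (w t) - P (w s)) (P (x - y))| <=
    nrm (P (w t) - P (w s)) * (`|M2| * nrm (x - y)).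
  rewrite (le_trans (normr_ip_le _ _))// ler_wpM2l ?nrm_ge0//.
  by rewrite (le_trans (hM2 _))// ler_wpM2r ?nrm_ge0// ler_norm.
have q2 : `|ipquot g (t - s) s x - ipquot g (t - s) s y| * `|t - s| <=
    `|M1| * nrm (x - y) * `|t - s|.
  rewrite ler_wpM2r// (le_trans (hM1 _ _))// ler_wpM2r ?nrm_ge0// ler_norm.
  by [].
apply: le_trans (lerD q1 q2) _.
have -> : nrm (P (w t) - P (w s)) * (`|M2| * nrm (x - y)) +
    `|M1| * nrm (x - y) * `|t - s| = (M - 1) * nrm (x - y) by rewrite /M; ring.
have : M * nrm (x - y) <= e by rewrite mulrC -ler_pdivlMr// ltW.
have := nrm_ge0 (x - y); lra.
Qed.

Let Ei : intg setT E.
Proof.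
have [M hM] := lop_bound P.
apply: (@le_intg _ _ _ (fun t => M ^+ 2 * w2 t)) => //.
- by apply: measurable_ip; apply: SM_lop; exact: zbL2_SM lw.
- move=> t _; rewrite ger0_norm ?ip_ge0// /E /w2 -!sqr_nrm -exprMn.
  by rewrite ler_sqr ?nnegrE ?(le_trans (nrm_ge0 _) (hM _))// nrm_ge0.
- exact: intgZ.
Qed.

Let mE : measurable_fun setT E.
Proof. by apply: measurable_ip; apply: SM_lop; exact: zbL2_SM lw. Qed.

(* The difference of the two sides of the inequality between increments of the
   energy and increments of the duality pairing is [|P (w t) - P (w s)|^2]; both
   signs of the increment together give equality in the limit. *)
Lemma energy_increment (h : nat -> R) (sg : R) a b : sg ^+ 2 = 1 ->
  (forall n, 0 < sg * h n) -> (forall n, `|h n| <= 1) -> h n @[n --> \oo] --> (0 : R) ->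
  0 < a -> a < b -> b < T ->
  (cumul E (a + h n) - cumul E a) / h n @[n --> \oo] --> E a ->
  (cumul E (b + h n) - cumul E b) / h n @[n --> \oo] --> E b ->
  2 * sg * (cumul gw b - cumul gw a) <= sg * (E b - E a).
Proof.
move=> sg2 sgh h1 hc a0 ab bT ca cb.
have h0 n : h n != 0 by have := sgh n; apply: contraTneq => ->; rewrite mulr0 ltxx.
have sg1 : `|sg| = 1.
  by apply/eqP; rewrite -(@eqrXn2 _ 2)// expr1n real_normK ?num_real// sg2.
have [S [Sae hS]] := good_increments.
have qi n : intg setT (fun t => ipquot g (h n) t (w t)) by exact: (intg_ipquot lg (h0 n) lw).
have si n : intg `]a, b] (fun t => E (t + h n)).
  exact: (intgT _ (intg_shift _ Ei)).
pose A n := \int[mu]_(t in `]a, b]) (E (t + h n) - E t).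
have An n : A n / h n = (cumul E (b + h n) - cumul E b) / h n -
    (cumul E (a + h n) - cumul E a) / h n.
  rewrite /A (RintegralB _ (si n) (intgT _ Ei))// Rint_shift//.
  rewrite -!cumulB ?lerD2r ?ltW//; field; exact: h0.
have Acv : A n / h n @[n --> \oo] --> E b - E a.
  by under eq_fun do rewrite An; exact: cvgB.
pose B n := \int[mu]_(t in `]a, b]) ipquot g (h n) t (w t).
have Bcv : B n @[n --> \oo] --> cumul gw b - cumul gw a.
  rewrite cumulB ?ltW//; apply/cvgrPdist_le => e e0.
  have /cvgrPdist_le/(_ _ e0)[n0 _ hn0] := steklov_cvg lg h0 h1 hc lw.
  exists n0 => // n /= /hn0; rewrite sub0r normrN ger0_norm; last first.
    by apply: Rintegral_ge0.
  apply: le_trans; rewrite /B distrC -RintegralB//; [|exact: intgT|exact: intgT].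
  by apply: Rint_norm_le => //; apply: intgB.
have hn0 : \forall n \near \oo, `|h n| < Num.min a (T - b).
  by move/cvgr0Pnorm_lt : hc; apply; rewrite lt_min a0 subr_gt0.
have le : \forall n \near \oo, 2 * sg * B n <= sg * (A n / h n).
  near=> n; have : `|h n| < Num.min a (T - b) by near: n.
  rewrite lt_min => /andP[ha hb].
  have nn : 0 < `|h n| by rewrite normr_gt0.
  have hh : 0 < h n ^+ 2 by rewrite exprn_even_gt0//= h0.
  have : \int[mu]_(t in `]a, b]) (h n * (2 * ipquot g (h n) t (w t))) <= A n.
    apply: Rint_le_ae => //.
    - by apply: intgZ => //; apply: intgZ => //; exact: intgT.
    - by apply: intgB => //; exact: (intgT _ Ei).
    apply: (ae_imp2 Sae (ae_shift (h n) Sae)) => t St Sth /=.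
    rewrite in_itv /= => /andP[at_ tb].
    have Ss : S t by apply: St; rewrite /= in_itv /=; apply/andP; split; lra.
    move: ha hb; rewrite !ltr_norml => /andP[ha1 _] /andP[_ hb2].
    have Ssh : S (t + h n).
      by apply: Sth; rewrite /= in_itv /=; apply/andP; split; lra.
    have := hS _ _ t Ss Ssh; rewrite cumul_ipquot; last first.
      by rewrite -subr_eq0 addrAC subrr add0r.
    rewrite addrAC subrr add0r => hi.
    have := ip_ge0 (P (w (t + h n)) - P (w t)).
    rewrite /E !(ipBl, ipBr) (ipC (P (w t))) in hi *; lra.
  rewrite RintegralZl//; last by apply: intgZ => //; exact: intgT.
  rewrite RintegralZl//; last exact: intgT.
  move=> le0; have -> : sg * (A n / h n) = (sg * h n) * A n / (h n ^+ 2).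
    by field.
  rewrite ler_pdivlMr// -/(B n) in le0 *.
  have := ler_wpM2l (ltW (sgh n)) le0; rewrite -/(B n); nra.
have l1 : 2 * sg * B n @[n --> \oo] --> 2 * sg * (cumul gw b - cumul gw a).
  by apply: cvgM => //; exact: cvg_cst.
have l2 : sg * (A n / h n) @[n --> \oo] --> sg * (E b - E a).
  by apply: cvgM => //; exact: cvg_cst.
exact: ler_cvg_to l1 l2 le.
Unshelve. all: end_near. Qed.

Lemma energy_increments_ae : exists S : set R, {ae mu, forall t, D t -> S t} /\
  forall a b, S a -> S b -> a < b -> E b - E a = 2 * (cumul gw b - cumul gw a).
Proof.
pose h n : R := n.+1%:R^-1; pose h' n : R := - n.+1%:R^-1.
have hp n : 0 < h n by rewrite invr_gt0.
have h1 n : `|h n| <= 1 by rewrite gtr0_norm// invf_le1// ler1n.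
have hc : h n @[n --> \oo] --> (0 : R) by exact: cvg_harmonic.
have hc' : h' n @[n --> \oo] --> (0 : R) by rewrite -oppr0; exact: cvgN.
have h0 n : h n != 0 by rewrite gt_eqF.
have h0' n : h' n != 0 by rewrite oppr_eq0.
exists [set t | D t /\ ((cumul E (t + h n) - cumul E t) / h n @[n --> \oo] --> E t /\
  (cumul E (t + h' n) - cumul E t) / h' n @[n --> \oo] --> E t)]; split.
  by apply: (ae_imp (cumul_derive Ei)) => t ct Dt; split=> //; split; exact: ct.
move=> a b [+ [ca ca']] [+ [cb cb']] ab; rewrite /= !in_itv /=.
move=> /andP[a0 _] /andP[_ bT].
have l1 : 2 * 1 * (cumul gw b - cumul gw a) <= 1 * (E b - E a).
  apply: (energy_increment (h := h)) => //; first by rewrite expr1n.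
  by move=> n; rewrite mul1r.
have l2 : 2 * -1 * (cumul gw b - cumul gw a) <= -1 * (E b - E a).
  apply: (energy_increment (h := h')) => //; first by rewrite sqrrN expr1n.
    by move=> n; rewrite mulrNN mul1r.
  by move=> n; rewrite /h' normrN; exact: h1.
lra.
Qed.

(** The primitive of [|g|^2 + |w|^2 + 1], whose increments control the squared increments of
    [P w]. *)
Let Phi t := cumul (fun s => n2 s + w2 s) t + t.

Let Phi_small e : 0 < e -> exists2 d : R, 0 < d &
  forall x y : R, `|x - y| < d -> `|Phi x - Phi y| < e.
Proof.
move=> e0; have e2 : 0 < e / 2 by lra.
have [d d0 hd] := cumul_small (intgD measurableT n2i w2i) e2.
exists (Num.min d (e / 2)); first by rewrite lt_min d0.
move=> x y; rewrite lt_min => /andP[/hd c1 c2].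
rewrite /Phi (_ : _ + x - _ = (cumul (fun s => n2 s + w2 s) x -
  cumul (fun s => n2 s + w2 s) y) + (x - y)); last by ring.
by rewrite (le_lt_trans (ler_normD _ _))//; lra.
Qed.

(** The norm of [w] at the given times [s] and [t] is not controlled, so the increment is split at a
    time [m] where [|w m|^2] does not much exceed its mean. On each half, [|P w t - P w s|^2] is
    twice a difference between the increment tested against [w m] and the integral of [ip g w] given
    by the energy. *)
Lemma path_modulus : exists S : set R, {ae mu, forall t, D t -> S t} /\
  forall s t, S s -> S t ->
    nrm (P (w t) - P (w s)) ^+ 2 <= 8 * `|Phi t - Phi s|.
Proof.
have [S1 [S1ae hS1]] := good_increments.
have [S2 [S2ae hS2]] := energy_increments_ae.
have Sae : {ae mu, forall t, D t -> (S1 t /\ S2 t) /\ D t}.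
  by apply: (ae_imp2 S1ae S2ae) => t h1 h2 Dt; split; [split; [exact: h1|exact: h2]|].
exists [set t | (S1 t /\ S2 t) /\ D t]; split=> //.
have ci (f : R -> R) : intg setT f -> (forall u, 0 <= f u) ->
    forall p q r u, p <= q -> q < r -> r <= u ->
    0 <= cumul f r - cumul f q <= cumul f u - cumul f p.
  move=> fi f0 p q r u pq qr ru.
  have mono x y : x <= y -> 0 <= cumul f y - cumul f x.
    by move=> xy; rewrite cumulB//; apply: Rintegral_ge0 => z _.
  by have := mono _ _ pq; have := mono _ _ (ltW qr); have := mono _ _ ru; lra.
have n20 u : 0 <= n2 u by exact: ip_ge0.
have w20 u : 0 <= w2 u by exact: ip_ge0.
have PhiE x y : Phi x - Phi y = cumul n2 x - cumul n2 y +
    (cumul w2 x - cumul w2 y) + (x - y).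
  have e z : cumul (fun s => n2 s + w2 s) z = cumul n2 z + cumul w2 z.
    rewrite -[X in X + _]mul1r -cumulDZ//.
    by congr (cumul _ z); apply/funext => u; rewrite mul1r.
  by rewrite /Phi !e; ring.
have gwb u v : u < v -> `|cumul gw v - cumul gw u| <=
    2^-1 * ((cumul n2 v - cumul n2 u) + (cumul w2 v - cumul w2 u)).
  move=> uv; have iT f : intg setT f -> intg `]u, v] f by exact: intgT.
  rewrite (cumulB gwi (ltW uv)) (cumulB n2i (ltW uv)) (cumulB w2i (ltW uv)).
  rewrite -(RintegralD _ (iT _ n2i) (iT _ w2i))//.
  have i2 := intgD (measurable_itv `]u, v]) (iT _ n2i) (iT _ w2i).
  rewrite -RintegralZl//.
  apply: le_trans; first by apply: le_normr_Rintegral => //; exact: iT.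
  apply: le_Rintegral => //; first by apply: intg_norm; exact: iT.
    by apply: intgZ => //; apply: intgD => //; exact: iT.
  move=> z _; rewrite (le_trans (normr_ip_le _ _))// /n2 /w2 -!sqr_nrm.
  by have := sqr_ge0 (nrm (g z) - nrm (w z)); lra.
suff lt_case s t : s < t -> (S1 s /\ S2 s) /\ D s -> (S1 t /\ S2 t) /\ D t ->
    nrm (P (w t) - P (w s)) ^+ 2 <= 8 * (Phi t - Phi s).
  move=> s t Ss St; have [st|ts|->] := ltgtP s t.
  - by rewrite (le_trans (lt_case _ _ st Ss St))// ler_pM2l// ler_norm.
  - rewrite nrmBC distrC (le_trans (lt_case _ _ ts St Ss))// ler_pM2l// ler_norm.
    by [].
  - by rewrite !subrr nrm0 normr0 mulr0 expr0n.
move=> st Ss St.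
set W := cumul w2 t - cumul w2 s.
(* Otherwise [w2] would exceed its mean over []s, t]] plus 1 almost everywhere on that interval. *)
have [m [[[S1m S2m] Dm] sm mt wm]] : exists m, [/\ (S1 m /\ S2 m) /\ D m, s < m,
    m <= t & w2 m * (t - s) <= W + (t - s)].
  apply: contrapT => nm.
  have : \int[mu]_(x in `]s, t]) (W / (t - s) + 1) <= \int[mu]_(x in `]s, t]) w2 x.
    apply: Rint_le_ae => //; [|exact: intgT|].
      apply: measurable_bounded_integrable => //.
        by rewrite /= lebesgue_measure_itv /=; case: ifP => _; rewrite ?ltry.
      exists `|W / (t - s) + 1|; split; [exact: num_real|] => K cK u _ /=; exact: ltW.
    apply: (ae_imp Sae) => x hx /=; rewrite in_itv /= => /andP[sx xt].
    have Dx : D x.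
      move: Ss.2 St.2; rewrite /= !in_itv /= => /andP[s0 _] /andP[_ tT].
      by apply/andP; split; lra.
    rewrite leNgt; apply/negP => wx; apply: nm; exists x; split=> //; first exact: hx.
    have ts : 0 < t - s by lra.
    move: wx; rewrite -(ltr_pM2r ts) mulrDl divfK ?gt_eqF// mul1r; exact: ltW.
  rewrite Rintegral_cst//= lebesgue_measure_itv/= lte_fin st -EFinB /=.
  rewrite mulrDl divfK ?gt_eqF ?subr_gt0// -(cumulB w2i (ltW st)) -/W mul1r.
  by move: (st); rewrite -subr_gt0; move: (t - s) (W) => p q; lra.
have N0 := ci _ n2i n20; have W0 := ci _ w2i w20.
have [n1 n2'] := andP (N0 s s t t (lexx _) st (lexx _)).
have [w1 w2'] := andP (W0 s s t t (lexx _) st (lexx _)).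
have D0 : 0 <= Phi t - Phi s by rewrite PhiE; lra.
have h1 : nrm (P (w m) - P (w s)) ^+ 2 <= 2 * (Phi t - Phi s).
  have := hS1 _ _ m Ss.1.1 S1m; have := hS2 _ _ Ss.1.2 S2m sm.
  have := gwb _ _ sm; have := cumul_ip_le (w m) sm.
  have [n3 n4] := andP (N0 s s m t (lexx _) sm mt).
  have [w3 w4] := andP (W0 s s m t (lexx _) sm mt).
  have c : w2 m * (m - s) <= w2 m * (t - s) by rewrite ler_wpM2l// lerD2r.
  rewrite sqr_nrm -/(w2 m) => c1 c2 c3 c4; rewrite PhiE.
  apply: (modulus_arith n4 w4 c wm _ c1 c2); rewrite ?subr_gt0//.
  rewrite !sqr_nrm !(ipBl, ipBr) (ipC (P (w s)) (P (w m))) in c4 *.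
  by left; rewrite -c4 mulrBr -c3 /E; ring.
have h2 : nrm (P (w t) - P (w m)) ^+ 2 <= 2 * (Phi t - Phi s).
  move: mt; rewrite le_eqVlt => /orP[/eqP ->|mt].
    by rewrite subrr nrm0 expr0n/= mulr_ge0.
  have := hS1 _ _ m S1m St.1.1; have := hS2 _ _ S2m St.1.2 mt.
  have := gwb _ _ mt; have := cumul_ip_le (w m) mt.
  have [n3 n4] := andP (N0 s m t t (ltW sm) mt (lexx _)).
  have [w3 w4] := andP (W0 s m t t (ltW sm) mt (lexx _)).
  have c : w2 m * (t - m) <= w2 m * (t - s).
    by rewrite ler_wpM2l// lerD2l lerN2 ltW.
  rewrite sqr_nrm -/(w2 m) => c1 c2 c3 c4; rewrite PhiE.
  apply: (modulus_arith n4 w4 c wm _ c1 c2); rewrite ?subr_gt0//.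
  rewrite !sqr_nrm !(ipBl, ipBr) (ipC (P (w m)) (P (w t))) in c4 *.
  by right; rewrite -c4 mulrBr -c3 /E; ring.
have := ler_nrm_distD (P (w m)) (P (w t)) (P (w s)).
rewrite -(@ler_sqr _ (nrm _)) ?nnegrE ?addr_ge0 ?nrm_ge0// => /le_trans; apply.
have := sqr_ge0 (nrm (P (w t) - P (w m)) - nrm (P (w m) - P (w s))); move: h1 h2.
move: (nrm _) (nrm _) (Phi t - Phi s) => a b c; lra.
Qed.

Definition crep (zc z : R -> H) :=
  hcont T zc /\ {ae mu, forall t, D t -> nrm (zc t - z t) = 0}.

(** By [path_modulus], [P w] is uniformly continuous on a set of full measure, which is dense in
    [[0, T]]; completeness extends it along sequences from that set. *)
Lemma crep_exists : exists zc, crep zc (fun t => P (w t)).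
Proof.
have [S [Sae hS]] := path_modulus.
have hS' e : 0 < e -> exists2 d, 0 < d & forall s t, S s -> S t -> `|t - s| < d ->
    nrm (P (w t) - P (w s)) <= e.
  move=> e0; have e8 : 0 < e ^+ 2 / 8 by rewrite divr_gt0// exprn_gt0.
  have [d d0 hd] := Phi_small e8; exists d => // s t Ss St /hd.
  rewrite ltr_pdivlMr// mulrC => /ltW; have := hS _ _ Ss St => /le_trans h /h.
  by rewrite ler_sqr ?nnegrE ?nrm_ge0// ltW.
have /choice[sq hsq] : forall t, exists sq : nat -> R, 0 <= t <= T ->
    forall n, S (sq n) /\ `|sq n - t| < n.+1%:R^-1.
  move=> t; have [tT|ntT] := pselect (0 <= t <= T); last by exists (fun=> 0).
  have /choice[sq hsq] : forall n : nat, exists s, S s /\ `|s - t| < n.+1%:R^-1.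
    move=> n; have [|s [_ st Ss]] := ae_near T0 Sae tT (_ : 0 < n.+1%:R^-1).
      by rewrite invr_gt0.
    by exists s.
  by exists sq.
have sqn e : 0 < e -> exists n0, forall t, 0 <= t <= T -> forall n, (n0 <= n)%N ->
    `|sq t n - t| < e.
  move=> e0; have /cvgrPdist_lt/(_ _ e0)[n0 _ hn0] := @cvg_harmonic R.
  exists n0 => t tT n /hn0 /=; have [_ h] := hsq t tT n.
  rewrite sub0r normrN ger0_norm ?invr_ge0 ?ler0n//; exact: lt_trans.
have /choice[zc hzc] : forall t, exists x, 0 <= t <= T ->
    ph_cvg (fun n => P (w (sq t n))) x.
  move=> t; have [tT|ntT] := pselect (0 <= t <= T); last by exists 0.
  have [|x hx] := @cauchy_cvg _ _ (fun n => P (w (sq t n))) cH; last by exists x.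
  move=> e /hS'[d d0 hd]; have d2 : 0 < d / 2 by lra.
  have [n0 hn0] := sqn _ d2; exists n0 => m n /(hn0 _ tT) m1 /(hn0 _ tT) n1.
  apply: hd; [exact: (hsq t tT n).1|exact: (hsq t tT m).1|].
  rewrite (_ : _ - _ = (sq t m - t) - (sq t n - t)); last by ring.
  by rewrite (le_lt_trans (ler_normB _ _))//; lra.
have key e : 0 < e -> exists2 d, 0 < d & forall t, 0 <= t <= T -> forall r, S r ->
    `|r - t| < d -> nrm (P (w r) - zc t) <= e.
  move=> e0; have e2 : 0 < e / 2 by lra.
  have [d d0 hd] := hS' _ e2; have d2 : 0 < d / 2 by lra.
  exists (d / 2) => // t tT r Sr rt.
  have [n1 hn1] := sqn _ d2; have /ph_cvgP/(_ _ e2)[n2' hn2] := hzc t tT.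
  pose n := maxn n1 n2'.
  have q1 := hn1 t tT n (leq_maxl _ _); have q2 := hn2 n (leq_maxr _ _).
  have q3 : nrm (P (w r) - P (w (sq t n))) <= e / 2.
    apply: hd => //; first exact: (hsq t tT n).1.
    rewrite (_ : _ - _ = (r - t) - (sq t n - t)); last by ring.
    by rewrite (le_lt_trans (ler_normB _ _))//; lra.
  by rewrite (le_trans (ler_nrm_distD (P (w (sq t n))) _ _))//; lra.
exists zc; split; last first.
  apply: (ae_imp Sae) => t St Dt; apply/eqP; rewrite eq_le nrm_ge0 andbT.
  apply/ler_addgt0Pr => e e0; rewrite add0r nrmBC.
  have [d d0 hd] := key _ e0; apply: hd; [|exact: St|by rewrite subrr normr0].
  by move: Dt; rewrite /= in_itv /= => /andP[h1 h2]; rewrite !ltW.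
move=> t tT e e0; have e2 : 0 < e / 2 by lra.
have [d d0 hd] := key _ e2; have d2 : 0 < d / 2 by lra.
exists (d / 2) => // s sT st.
have [r [_ rs Sr]] := ae_near T0 Sae sT d2.
have q1 := hd s sT r Sr; have q2 := hd t tT r Sr.
rewrite (le_trans (ler_nrm_distD (P (w r)) _ _))// [X in X + _]nrmBC.
have rt : `|r - t| < d.
  rewrite (_ : r - t = (r - s) + (s - t)); last by ring.
  by rewrite (le_lt_trans (ler_normD _ _))//; lra.
have := q1 _; have := q2 rt; move=> h1 h2.
have : nrm (P (w r) - zc s) <= e / 2 by apply: h2; lra.
lra.
Qed.

Lemma crep_pairing zc : crep zc (fun t => P (w t)) -> forall om, H0 om ->
  forall s t, 0 <= s <= T -> 0 <= t <= T ->
  ip (zc t) (P om) - ip (zc s) (P om) =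
  cumul (fun r => ip (g r) om) t - cumul (fun r => ip (g r) om) s.
Proof.
move=> [czc zcP] om H0om s t sT tT; have [_ _ _ hW] := ev.
have [k hk] := hW om H0om.
have c1 : hcont T (H := RH) (fun t => ip (zc t) (P om) - cumul (gx om) t : R).
  apply: hcontB; first by apply: hcont_ip => //; exact: hcont_cst.
  exact: hcont_cumul.
have /(hcont_ae_cst T0 c1) hc : {ae mu, forall t, D t ->
    ip (zc t) (P om) - cumul (gx om) t = k}.
  apply: (ae_imp2 zcP hk) => r h1 h2 Dr.
  have := nrm_eq0_ip (P om) (h1 Dr); rewrite ipBl h2//; rewrite /gx; lra.
by have := hc s sT; have := hc t tT; rewrite /gx; lra.
Qed.

Lemma nrm_eq0_sqr (x y : H) : nrm (x - y) = 0 -> ip x x = ip y y.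
Proof.
move=> h; have := nrm_eq0_ip x h; have := nrm_eq0_ip y h.
by rewrite !ipBl (ipC y x); lra.
Qed.

Lemma crep_energy zc : crep zc (fun t => P (w t)) ->
  forall s t, 0 <= s <= T -> 0 <= t <= T ->
  ip (zc t) (zc t) - ip (zc s) (zc s) =
  2 * (cumul (fun r => ip (g r) (w r)) t - cumul (fun r => ip (g r) (w r)) s).
Proof.
move=> [czc zcP] s t sT tT; have [S [Sae hS]] := energy_increments_ae.
have T2 : 0 <= T / 2 <= T by lra.
have T20 : 0 < T / 2 by rewrite divr_gt0.
have [t0 [_ _ St0]] := ae_near T0 Sae T2 T20.
have c1 : hcont T (H := RH) (fun t => (- 2) *: (cumul gw t : RH) + ip (zc t) (zc t) : R).
  by apply: hcontDZ; [exact: hcont_cumul|exact: hcont_ip].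
have /(hcont_ae_cst T0 c1) hc : {ae mu, forall t, D t ->
    (- 2) *: (cumul gw t : RH) + ip (zc t) (zc t) = E t0 - 2 * cumul gw t0 :> R}.
  apply: (ae_imp2 zcP Sae) => r h1 h2 Dr.
  rewrite (nrm_eq0_sqr (h1 Dr)) -[_ *: _]/(- 2 * cumul gw r) -/(E r).
  have [h|h|->] := ltgtP t0 r; last by ring.
    by have := hS _ _ St0 (h2 Dr) h; lra.
  by have := hS _ _ (h2 Dr) St0 h; lra.
have := hc s sT; have := hc t tT.
rewrite -![_ *: _]/(- 2 * _); rewrite /gw; lra.
Qed.

End weak_evolution.

(** * Test functions *)

Section smooth_functions.
Context {R : realType}.
Local Notation mu := (@lebesgue_measure R).
Implicit Types f : R -> R.

Definition smooth f := forall n x, derivable (derive1n n f : R -> R^o) x 1.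

(** A coinductive criterion: smoothness follows from membership in a class stable under
    differentiation, without formulas for the iterated derivatives. *)
Lemma smooth_class (C : set (R -> R)) : (forall f, C f -> exists df, C df /\
    forall x, is_derive x (1 : R) (f : R -> R^o) (df x)) ->
  forall f, C f -> smooth f.
Proof.
move=> hC f Cf n; have : C (derive1n n f).
  elim: n => // n /hC[df [Cdf fd]].
  suff -> : derive1n n.+1 f = df by [].
  by apply/funext => x; rewrite derive1nS derive1E; have [_ ->] := fd x.
by move=> /hC[df [_ fd]] x; have [] := fd x.
Qed.

Lemma is_derive0_sqr f (C : R) : (forall y, `|f y| <= C * y ^+ 2) ->
  is_derive (0 : R) (1 : R) (f : R -> R^o) 0.
Proof.
move=> fC; have f0 : f 0 = 0.
  by have := fC 0; rewrite expr0n mulr0 normr_le0 => /eqP.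
have C0 : 0 <= C by have := fC 1; rewrite expr1n mulr1; exact: le_trans.
have cv : h^-1 *: ((f : R -> R^o) (h *: (1 : R) + 0) - f 0) @[h --> 0^'] --> (0 : R^o).
  apply/cvgr0Pnorm_le => e e0; near=> h.
  have h0 : h != 0 by near: h; exact: nbhs_dnbhs_neq.
  rewrite addr0 f0 subr0 normrM normfV ler_pdivrMl ?normr_gt0//.
  rewrite [h *: 1]mulr1 (le_trans (fC h))// -real_normK ?num_real// expr2 mulrA.
  rewrite [leRHS]mulrC ler_wpM2r//.
  have : (C + 1) * `|h| <= e.
    rewrite mulrC -ler_pdivlMr; last by lra.
    by near: h; apply: dnbhs0_le; rewrite divr_gt0//; lra.
  by have := normr_ge0 h; nra.
by split; [apply/cvg_ex; exists 0|exact/cvg_lim].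
Unshelve. all: end_near. Qed.

(** The powers of [1/y] are what differentiation of [exp (-1/y)] produces, so the family indexed by
    [k] is closed under it up to linear combinations. *)
Definition flat (k : nat) (y : R) : R :=
  if 0 < y then y^-1 ^+ k * expR (- y^-1) else 0.

Lemma flat_ge0 k y : 0 <= flat k y.
Proof.
by rewrite /flat; case: ifP => // y0; rewrite mulr_ge0 ?expR_ge0// exprn_ge0// invr_ge0 ltW.
Qed.

(** From the term of degree [k + 2] in the exponential series at [1/y]. Quadratic decay at the
    origin yields a zero derivative there, by [is_derive0_sqr]. *)
Lemma flat_sqr k y : `|flat k y| <= k.+2`!%:R * y ^+ 2.
Proof.
rewrite ger0_norm ?flat_ge0// /flat; case: ifPn => [y0|_].
  have s0 : 0 <= y^-1 by rewrite invr_ge0 ltW.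
  have := expR_ge1Dxn k.+1 s0; set F : R := (_`!)%:R => h.
  have F0 : 0 < F by rewrite ltr0n fact_gt0.
  rewrite expRN ler_pdivrMr ?expR_gt0//.
  have : y^-1 ^+ k.+2 / F <= expR y^-1 by lra.
  rewrite ler_pdivrMr// => h2.
  have : y ^+ 2 * y^-1 ^+ k.+2 <= y ^+ 2 * (expR y^-1 * F) by rewrite ler_wpM2l// sqr_ge0.
  rewrite -[k.+2]addn2 exprD mulrCA -exprMn mulfV ?gt_eqF// expr1n mulr1.
  by move=> /le_trans; apply; rewrite le_eqVlt; apply/orP; left; apply/eqP; ring.
by rewrite mulr_ge0// sqr_ge0.
Qed.

Lemma is_derive_flat k (y : R) :
  is_derive y (1 : R) (flat k : R -> R^o) (flat k.+2 y - k%:R * flat k.+1 y).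
Proof.
have [y0|y0|<-] := ltgtP 0 y.
- apply: (@near_eq_is_derive R R^o R^o (fun y => y^-1 ^+ k * expR (- y^-1))).
    near=> z; rewrite /flat ifT//; near: z; exact: lt_nbhsr.
  have dv : is_derive y (1 : R) (fun y : R => y^-1 : R^o) (- y ^- 2).
    split; first by apply: derivableV; [rewrite gt_eqF|exact: derivable_id].
    rewrite (@deriveV R R^o id) ?gt_eqF//.
    by rewrite derive_id [_ *: _]mulr1.
  have de : is_derive y (1 : R) (fun y : R => expR (- y^-1) : R^o)
      (expR (- y^-1) * y ^- 2).
    have := @is_derive1_comp R expR (fun y : R => - y^-1) y _ _
      (is_derive_expR _) (is_deriveN dv).
    by rewrite opprK.
  rewrite /flat y0; case: k => [|k].
    have -> : (fun y : R^o => y^-1 ^+ 0 * expR (- y^-1)) = fun y => expR (- y^-1).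
      by apply/funext => z; rewrite expr0 mul1r.
    by apply: (is_derive_eq de); rewrite -exprVn; ring.
  have dk := is_deriveX k.+1 dv; rewrite exprfctE in dk.
  apply: (is_derive_eq (is_deriveM dk de)).
  rewrite -![_ *: _]/(_ * _) -exprVn !exprS /=; ring.
- apply: (@near_eq_is_derive R R^o R^o (cst 0)).
    by near=> z; rewrite /flat ifF//; apply/negbTE; rewrite -leNgt ltW//; near: z; exact: lt_nbhsl.
  by rewrite /flat !ifF ?mulr0 ?subr0; [exact: is_derive_cst|apply/negbTE..];
    rewrite -leNgt ltW.
- by rewrite /flat ltxx mulr0 subr0; exact: (is_derive0_sqr (flat_sqr k)).
Unshelve. all: end_near. Qed.

(** For fixed [q], a class stable under differentiation: the chain rule only multiplies polynomial
    coefficients by the derivative of [q] and raises the index of [flat]. *)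
Definition flat_sum (q : {poly R}) (s : seq ({poly R} * nat)) (x : R) : R :=
  \sum_(c <- s) c.1.[x] * flat c.2 q.[x].

Lemma smooth_flat_sum q s : smooth (flat_sum q s).
Proof.
apply: (smooth_class (C := [set f | exists s, f = flat_sum q s])); last by exists s.
move=> _ [{}s ->]; elim: s => [|[p k] s [_ [[s' ->] hs']]].
  exists (flat_sum q [::]); split; first by exists [::].
  move=> x; rewrite /flat_sum big_nil.
  have -> : (fun x : R => \sum_(c <- [::]) c.1.[x] * flat c.2 q.[x]) = cst 0.
    by apply/funext => z; rewrite big_nil.
  exact: is_derive_cst.
exists (flat_sum q [:: (p^`(), k), (p * q^`(), k.+2), (- (k%:R *: (p * q^`())), k.+1) & s']).
split; first by eexists; reflexivity.
move=> x; have -> : flat_sum q ((p, k) :: s) =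
    (fun x => p.[x] * flat k q.[x] + flat_sum q s x).
  by apply/funext => z; rewrite /flat_sum big_cons.
have dp := is_derive_poly p x; have dq := is_derive_poly q x.
have dc := @is_derive1_comp R (flat k) (horner q) x _ _ (is_derive_flat k q.[x]) dq.
apply: (is_derive_eq (is_deriveD (is_deriveM dp dc) (hs' x))).
rewrite /flat_sum !big_cons /= -![_ *: _]/(_ * _) !hornerE /=; ring.
Qed.

Lemma flat_step (y : R) : 0 < y -> flat 0 (n%:R * y) @[n --> \oo] --> (1 : R).
Proof.
move=> y0; have : expR (- (n%:R * y)^-1) @[n --> \oo] --> expR 0.
  apply: continuous_cvg; first exact: continuous_expR.
  rewrite -oppr0; apply: cvgN.
  apply/cvgr0Pnorm_lt => e e0; have ey : 0 < (e * y)^-1 by rewrite invr_gt0 mulr_gt0.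
  near=> n; have ny : (e * y)^-1 < n%:R.
    by near: n; exact: nbhs_infty_gtr.
  have n0 : 0 < n%:R :> R by exact: lt_trans ny.
  rewrite gtr0_norm ?invr_gt0 ?mulr_gt0// invf_plt ?posrE ?mulr_gt0//.
  by move: ny; rewrite invfM ltr_pdivrMr.
rewrite expR0; apply: cvg_trans; apply: near_eq_cvg; near=> m.
rewrite /flat ifT ?expr0 ?mul1r// mulr_gt0// ltr0n; near: m.
by exists 1%N.
Unshelve. all: end_near. Qed.

End smooth_functions.

Section test_functions.
Context {R : realType}.
Local Notation mu := (@lebesgue_measure R).

(** The bumps are [exp (-1 / (n (x - al) (be - x)))], extended by zero; the factor [n] lets them
    approach the indicator of the interval. *)
Lemma bump_exists (a al be : R) : 0 < al -> al < be -> be < a -> exists eta : nat -> R -> R,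
  [/\ forall n, test_function a (eta n), forall n x, 0 <= eta n x <= 1,
   forall x, al < x < be -> eta n x @[n --> \oo] --> (1 : R) &
   forall n x, ~ (al < x < be) -> eta n x = 0].
Proof.
move=> al0 albe bea; pose q n : {poly R} := n%:R *: (('X - al%:P) * (be%:P - 'X)).
have qE n x : (q n).[x] = n%:R * ((x - al) * (be - x)) by rewrite /q !hornerE.
have z n x : ~ (al < x < be) -> flat_sum (q n) [:: (1, 0%N)] x = 0.
  move=> nx; rewrite /flat_sum big_seq1 /= hornerE mul1r /flat ifF//.
  apply/negbTE; rewrite -leNgt qE mulr_ge0_le0//.
  have [xal|xal] := leP x al; first by nra.
  have [xbe|xbe] := leP be x; first by nra.
  by case: nx; rewrite xal.
exists (fun n => flat_sum (q n) [:: (1, 0%N)]); split=> [n|n x|x /andP[x1 x2]|//].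
- split; first exact: smooth_flat_sum.
  exists al, be; split=> // x; rewrite in_itv /= => xn; apply: z => /andP[x1 x2].
  by move: xn; rewrite !ltW.
- rewrite /flat_sum big_seq1 /= hornerE mul1r flat_ge0 /= /flat expr0 mul1r.
  by case: ifP => // y0; rewrite expR_le1 oppr_le0 invr_ge0 ltW.
- under eq_fun do rewrite /flat_sum big_seq1 /= hornerE mul1r qE.
  by apply: (flat_step (mulr_gt0 _ _)); rewrite subr_gt0.
Qed.

Lemma test_function_C1 (a : R) psi : test_function a psi -> C1 psi (derive1 psi).
Proof.
move=> [sp _]; split=> x.
  by have := derivableP (sp 0%N x); rewrite derive1E.
have := sp 1%N x; rewrite derive1n1 => /derivable1_diffP; exact: differentiable_continuous.
Qed.

Lemma test_function_derive0 (a : R) psi : test_function a psi ->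
  forall x, ~ (0 < x < a) -> psi x = 0 /\ derive1 psi x = 0.
Proof.
move=> [_ [b [c [b0 ca pz]]]] x nx.
have [xb|cx] : x < b \/ c < x.
  have [|bx] := ltP x b; first by left.
  have [|xc] := ltP c x; first by right.
  by case: nx; apply/andP; split; lra.
- split; first by apply: pz; rewrite in_itv /= leNgt xb.
  rewrite derive1E (@near_eq_derive R R^o R^o _ (cst 0)) ?derive_cst//.
  near=> y; apply: pz; rewrite in_itv /= leNgt (_ : y < b)//.
  by near: y; exact: lt_nbhsl.
- split; first by apply: pz; rewrite in_itv /= andbC leNgt cx.
  rewrite derive1E (@near_eq_derive R R^o R^o _ (cst 0)) ?derive_cst//.
  near=> y; apply: pz; rewrite in_itv /= andbC leNgt (_ : c < y)//.
  by near: y; exact: lt_nbhsr.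
Unshelve. all: end_near. Qed.

Lemma continuous_zbL2 (a : R) (f g : R -> R) : continuous f ->
  (forall t, 0 < t < a -> g t = f t) -> (forall t, ~ (0 < t < a) -> g t = 0) ->
  zbL2 (H := RH) a g.
Proof.
move=> cf gf g0; have -> : g = fun t => if t \in `]0, a[%classic then f t else 0.
  apply/funext => t; case: ifPn => [/set_mem|/negP nt].
    by rewrite /= in_itv /=; exact: gf.
  by apply: g0 => t0a; apply: nt; apply/mem_set; rewrite /= in_itv.
have mf : measurable_fun setT f by exact: continuous_measurable_fun.
split; last by move=> t nt; rewrite memNset.
split; first by apply: SM_if => //; [exact: measurable_SM|exact: SM_cst].
apply: (@eq_intg _ _ (fun t => f t * f t)) => //.
  by move=> t Dt; rewrite mem_set.
by apply: continuous_intg => t; apply: cvgM; exact: cf.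
Qed.

Lemma test_function_zbL2 (a : R) psi : test_function a psi ->
  zbL2 (H := RH) a psi /\ zbL2 (H := RH) a (derive1 psi).
Proof.
move=> tp; have C := test_function_C1 tp; have z := test_function_derive0 tp.
split; first by apply: (continuous_zbL2 (C1_continuous C)) => // t /z[].
by apply: (continuous_zbL2 C.2) => // t /z[].
Qed.

Lemma zbL2_intg (a : R) (f : R -> R) : zbL2 (H := RH) a f -> intg setT f.
Proof.
move=> /(zbL2_ip_cst (1 : RH))[h _ _]; move: h; congr intg.
by apply/funext => t; rewrite /= mulr1.
Qed.

Lemma cumul_supp (a : R) (f : R -> R) x : intg setT f ->
  (forall t, ~ (0 < t < a) -> f t = 0) -> cumul f x =
  if x <= 0 then 0 else if x <= a then \int[mu]_(t in `]0, x[) f t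
  else \int[mu]_(t in `]0, a[) f t.
Proof.
move=> fi f0; have mk (A B : set R) : (forall t, (0 < t < a) -> A t <-> B t) ->
    \int[mu]_(t in A) f t = \int[mu]_(t in B) f t.
  move=> AB; rewrite Rintegral_mkcond [RHS]Rintegral_mkcond.
  apply: eq_Rintegral => t _; rewrite !patchE.
  have [t0|/f0 ->] := pselect (0 < t < a); last by rewrite !if_same.
  have := AB t t0; case: ifPn => [/set_mem At [/(_ At) Bt _]|/negP nA [_ h]].
    by rewrite mem_set.
  by rewrite memNset// => /h At; apply: nA; exact/mem_set.
rewrite /cumul; case: leP => x0.
  rewrite (mk _ set0) ?Rintegral_set0// => t /andP[t0 _]; split=> //=.
  by rewrite in_itv /=; lra.
case: leP => xa.
  rewrite -Rintegral_itv_bndo_bndc; last exact: (intgT _ fi).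
  by apply: mk => t /andP[t0 ta] /=; rewrite !in_itv /= t0.
apply: mk => t /andP[t0 ta] /=; rewrite !in_itv /= t0 ta.
by split=> // _; rewrite ltW// (lt_trans ta).
Qed.

Lemma cumul_end (a : R) (f : R -> R) : 0 < a -> intg setT f ->
  (forall t, ~ (0 < t < a) -> f t = 0) ->
  cumul f 0 = 0 /\ cumul f a = \int[mu]_(t in `]0, a[) f t.
Proof.
move=> a0 fi f0; rewrite (cumul_supp _ fi f0) lexx (cumul_supp _ fi f0) lexx.
by split=> //; rewrite leNgt a0.
Qed.

Lemma test_function_primitive (a : R) eta : 0 < a -> test_function a eta ->
  \int[mu]_(x in `]0, a[) eta x = 0 -> exists psi, test_function a psi /\ derive1 psi = eta.
Proof.
move=> a0 te e0; have [se [b [c [b0 ca ez]]]] := te.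
have z x xn := (test_function_derive0 te (x := x) xn).1.
have ei : intg setT eta := zbL2_intg (test_function_zbL2 te).1.
have ce := C1_continuous (test_function_C1 te).
have FTC x : derivable (cumul eta : R -> R^o) x 1 /\ derive1 (cumul eta) x = eta x.
  apply: (@continuous_FTC1 R eta -oo%O x (x + 1)) => //.
  - by rewrite ltrDl.
  - exact: intgT ei.
  - by rewrite ltNyr.
  - exact: (ce x).
have dE : derive1 (cumul eta) = eta by apply/funext => x; have [] := FTC x.
exists (cumul eta); split; last exact: dE.
split.
  move=> [|n] x; first by have [] := FTC x.
  rewrite /derive1n iterSr dE; exact: se.
exists b, c; split=> // x; rewrite in_itv /= => xn.
have zero (A : set R) : A `&` `[b, c] `<=` set0 -> \int[mu]_(t in A) eta t = 0.
  move=> Abc; rewrite Rintegral_mkcond.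
  under eq_Rintegral => t _.
    rewrite patchE (_ : (if _ then _ else _) = 0); first over.
    case: ifPn => // /set_mem At; apply: ez; apply/negP => bct.
    by apply: (Abc t); split.
  by rewrite Rintegral_cst//= mul0r.
have [xb|bx] := ltP x b.
  apply: zero => t [] /=; rewrite !in_itv /= => tx /andP[bt _]; lra.
have cx : c < x by move: xn; rewrite bx /= -ltNge.
have [ca0 caa] := cumul_end a0 ei z.
have ca' : cumul eta a - cumul eta x = 0 \/ cumul eta x - cumul eta a = 0.
  have [xa|ax] := leP x a; [left|right].
    rewrite cumulB//; apply: zero => t [] /=; rewrite !in_itv /=; lra.
  rewrite cumulB ?ltW//; apply: zero => t [] /=; rewrite !in_itv /=; lra.
by case: ca'; rewrite caa e0; lra.
Qed.

End test_functions.

Section pairing.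
Context {R : realType} {H : preHilbert R}.
Local Notation mu := (@lebesgue_measure R).
Variables (T : R) (T0 : 0 < T).
Local Notation D := `]0%R, T[%classic.
Variables (P : linop H H) (H0 : set H).
Hypothesis H0D : forall x y, H0 x -> H0 y -> H0 (x + y).

Lemma zbL2D f g : zbL2 T f -> zbL2 T g -> zbL2 T (fun t => f t + g t : H).
Proof.
by move=> lf lg; have := zbL2_DZ 1 lf lg; under eq_fun do rewrite scale1r.
Qed.

Lemma evolvesD w1 g1 w2 g2 : evolves T P H0 w1 g1 -> evolves T P H0 w2 g2 ->
  evolves T P H0 (fun t => w1 t + w2 t) (fun t => g1 t + g2 t).
Proof.
move=> [lw1 lg1 h1 e1] [lw2 lg2 h2 e2]; split; [exact: zbL2D|exact: zbL2D| |].
  by move=> t; exact: H0D.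
move=> om H0om; have [k1 hk1] := e1 _ H0om; have [k2 hk2] := e2 _ H0om.
exists (k1 + k2); apply: (ae_imp2 hk1 hk2) => t q1 q2 Dt.
have [i1 _ _] := zbL2_ip_cst om lg1; have [i2 _ _] := zbL2_ip_cst om lg2.
rewrite lopD ipDl q1// q2// (_ : (fun s => ip (g1 s + g2 s) om) =
  fun s => 1 * ip (g1 s) om + ip (g2 s) om); first by rewrite cumulDZ//; ring.
by apply/funext => s; rewrite ipDl mul1r.
Qed.

(** Polarization: the energy identity for the sum minus those for the two terms. *)
Lemma crep_pair w1 g1 w2 g2 z1 z2 :
  evolves T P H0 w1 g1 -> evolves T P H0 w2 g2 ->
  crep T z1 (fun t => P (w1 t)) -> crep T z2 (fun t => P (w2 t)) ->
  forall s t, 0 <= s <= T -> 0 <= t <= T ->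
  ip (z1 t) (z2 t) - ip (z1 s) (z2 s) =
  (cumul (fun r => ip (g1 r) (w2 r)) t - cumul (fun r => ip (g1 r) (w2 r)) s) +
  (cumul (fun r => ip (g2 r) (w1 r)) t - cumul (fun r => ip (g2 r) (w1 r)) s).
Proof.
move=> e1 e2 c1 c2 s t sT tT.
have c12 : crep T (fun t => z1 t + z2 t) (fun t => P (w1 t + w2 t)).
  split; first exact: hcontD c1.1 c2.1.
  apply: (ae_imp2 c1.2 c2.2) => r h1 h2 Dr; apply/eqP; rewrite eq_le nrm_ge0 andbT.
  by rewrite lopD opprD addrACA (le_trans (ler_nrmD _ _))// h1// h2// addr0.
have := crep_energy T0 (evolvesD e1 e2) c12 sT tT.
have := crep_energy T0 e1 c1 sT tT; have := crep_energy T0 e2 c2 sT tT.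
have [lw1 lg1 _ _] := e1; have [lw2 lg2 _ _] := e2.
have i11 := zbL2_ip lg1 lw1; have i12 := zbL2_ip lg1 lw2.
have i21 := zbL2_ip lg2 lw1; have i22 := zbL2_ip lg2 lw2.
have E r : cumul (fun r => ip (g1 r + g2 r) (w1 r + w2 r)) r =
    cumul (fun r => ip (g1 r) (w1 r)) r + cumul (fun r => ip (g1 r) (w2 r)) r +
    (cumul (fun r => ip (g2 r) (w1 r)) r + cumul (fun r => ip (g2 r) (w2 r)) r).
  have D1 f g : intg setT f -> intg setT g ->
      cumul f r + cumul g r = cumul (fun t => f t + g t) r.
    move=> fi gi; rewrite -[X in X + _]mul1r -cumulDZ//.
    by congr (cumul _ r); apply/funext => u; rewrite mul1r.
  rewrite !D1//; try exact: intgD.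
  by congr (cumul _ r); apply/funext => u; rewrite !(ipDl, ipDr).
rewrite !E !(ipDl, ipDr) (ipC (z2 t)) (ipC (z2 s)); lra.
Qed.

End pairing.

(** * The du Bois-Reymond lemma *)

Section scalar_evolutions.
Context {R : realType}.
Local Notation mu := (@lebesgue_measure R).
Variables (a : R) (a0 : 0 < a).
Local Notation D := `]0%R, a[%classic.
Implicit Types f g v w psi : R -> R.

Let zb := zbL2 (H := @RH R) a.

Lemma eq_Rint (A : set R) f g : (forall t, A t -> f t = g t) ->
  \int[mu]_(t in A) f t = \int[mu]_(t in A) g t.
Proof. by move=> fg; apply: eq_Rintegral => t /set_mem; exact: fg. Qed.

Lemma Rint_D_supp f : (forall t, ~ D t -> f t = 0) ->
  \int[mu]_(t in D) f t = \int[mu]_t f t.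
Proof. by move=> f0; rewrite [RHS](Rint_supp (T := a)). Qed.

Lemma zb_out f : zb f -> forall t, ~ (0 < t < a) -> f t = 0.
Proof. by move=> [_ f0] t nt; apply: f0; rewrite /= in_itv. Qed.

Lemma id_bound : exists M, forall x : @RH R, nrm x <= M * nrm x.
Proof. by exists 1 => x; rewrite mul1r. Qed.

Definition id_op : linop (@RH R) (@RH R) :=
  @LinOp R RH RH (fun x => x) (fun _ _ _ => erefl) id_bound.

Lemma cumul_evolves g c : zb g ->
  evolves a id_op setT (fun t => if t \in D then c + cumul g t else 0) g.
Proof.
move=> zg; have gi := zbL2_intg zg; split=> //.
  apply: (@continuous_zbL2 R a (fun t => c + cumul g t)).
  - by move=> t; apply: continuousD; [exact: cvg_cst|exact: cumul_continuous].
  - by move=> t t0a; rewrite mem_set//= in_itv.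
  - by move=> t nt; rewrite memNset//= in_itv.
move=> om _; exists (c * om); apply: ae_all => t Dt; rewrite mem_set//=.
have := @cumulDZ R om g (fun=> 0) t gi (integrable0 _ _).
rewrite [cumul (fun=> 0) t]/cumul Rintegral_cst//= mul0r addr0 => E.
rewrite mulrDl [cumul g t * om]mulrC -E.
by congr (_ + cumul _ t); apply/funext => s; rewrite addr0 mulrC.
Qed.

(** Integration by parts for absolutely continuous functions is [crep_pair] on the real line with
    the identity operator, a primitive being an evolution driven by its integrand. *)
Lemma ibp_cumul f g c d : zb f -> zb g ->
  \int[mu]_(t in D) (f t * (d + cumul g t) + g t * (c + cumul f t)) =
  (c + cumul f a) * (d + cumul g a) - c * d.
Proof.
move=> zf zg; have fi := zbL2_intg zf; have gi := zbL2_intg zg.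
have ef := cumul_evolves c zf; have eg := cumul_evolves d zg.
have cr h k : intg setT h ->
    crep a (H := RH) (fun t => k + cumul h t : R)
      (fun t => id_op (if t \in D then k + cumul h t else 0)).
  move=> hi; split; last by apply: ae_all => t Dt; rewrite mem_set//= subrr nrm0.
  by apply: hcontD; [exact: hcont_cst|exact: hcont_cumul].
have a0' := a0; have a1 : 0 <= (0 : R) <= a by lra.
have a2 : 0 <= a <= a by lra.
have := crep_pair a0 (fun _ _ _ _ => I) ef eg (cr f c fi) (cr g d gi) a1 a2.
have [lf _ _ _] := ef; have [lg _ _ _] := eg.
have i1 := zbL2_ip zf lg; have i2 := zbL2_ip zg lf.
have z1 t : ~ (0 < t < a) -> ip (f t : RH) (if t \in D then d + cumul g t else 0) = 0.
  by move=> /(zb_out zf) ->; rewrite /= mul0r.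
have z2 t : ~ (0 < t < a) -> ip (g t : RH) (if t \in D then c + cumul f t else 0) = 0.
  by move=> /(zb_out zg) ->; rewrite /= mul0r.
have [-> ->] := cumul_end a0 i1 z1; have [-> ->] := cumul_end a0 i2 z2.
have [-> _] := cumul_end a0 fi (zb_out zf); have [-> _] := cumul_end a0 gi (zb_out zg).
have e0 (x y : R) : (x - 0) + (y - 0) = x + y by rewrite !subr0.
rewrite !addr0 /= e0 => ->; have mD : measurable D by [].
have j1 : intg D (fun t => f t * (if t \in D then d + cumul g t else 0)) := intgT mD i1.
have j2 : intg D (fun t => g t * (if t \in D then c + cumul f t else 0)) := intgT mD i2.
rewrite -RintegralD//.
by apply: eq_Rint => t Dt; rewrite mem_set.
Qed.

Lemma test_cumul psi : test_function a psi -> forall x, psi x = cumul (derive1 psi) x.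
Proof.
move=> tp x; have C := test_function_C1 tp; have z := test_function_derive0 tp.
have di := zbL2_intg (test_function_zbL2 tp).2.
rewrite (cumul_supp _ di (fun t nt => (z t nt).2)).
have psi0 : psi 0 = 0 by apply: (z 0 _).1; rewrite ltxx.
case: leP => [x0|x0]; first by apply: (z x _).1; lra.
case: leP => xa; rewrite (C1_FTC _ C) ?psi0 ?subr0//.
have nx : ~ (0 < x < a) by lra.
by rewrite (z x nx).1 (z a _).1//; lra.
Qed.

Lemma ibp_test w c psi : zb w -> test_function a psi ->
  \int[mu]_(t in D) ((c + cumul w t) * derive1 psi t) =
  - \int[mu]_(t in D) (w t * psi t).
Proof.
move=> zw tp; have [z1 z2] := test_function_zbL2 tp.
have := ibp_cumul c 0 zw z2; have wi := zbL2_intg zw.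
have ca : cumul (derive1 psi) a = 0.
  by rewrite -test_cumul//; have [] := test_function_derive0 tp (x := a) _; rewrite ?ltxx ?andbF.
rewrite add0r ca mulr0 mulr0 subrr.
rewrite (_ : (fun t => _) = (fun t => w t * psi t + (c + cumul w t) * derive1 psi t)).
  rewrite RintegralD//; first by move=> /eqP; rewrite addrC addr_eq0 => /eqP.
    exact: (intgT _ (zbL2_ip zw z1)).
  have [lw _ _ _] := cumul_evolves c zw.
  apply: (eq_intg _ _ (intgT _ (zbL2_ip lw z2))) => //.
  by move=> t Dt; rewrite /= mem_set.
by apply/funext => t; rewrite add0r -test_cumul// [X in _ + X]mulrC.
Qed.

Lemma test_functionDZ k f g : test_function a f -> test_function a g ->
  test_function a (fun x => k * f x + g x).
Proof.
move=> [sf [b [c [b0 ca fz]]]] [sg [b' [c' [b0' ca' gz]]]]; split.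
  apply: (@smooth_class R (fun h => exists f g, [/\ smooth f, smooth g &
      h = fun x => k * f x + g x])); last first.
    by exists f, g; split; [exact: sf|exact: sg|reflexivity].
  move=> h [u [v [su sv ->]]]; exists (fun x => k * derive1 u x + derive1 v x); split.
    exists (derive1 u), (derive1 v); split; last by reflexivity.
      by move=> n x; have := su n.+1 x; rewrite derive1Sn.
    by move=> n x; have := sv n.+1 x; rewrite derive1Sn.
  move=> x; have du := derivableP (su 0%N x); have dv := derivableP (sv 0%N x).
  rewrite !derive1E; exact: (is_deriveD (is_deriveZ k du) dv).
exists (Num.min b b'), (Num.max c c'); split; rewrite ?lt_min ?gt_max ?b0 ?ca//.
move=> x; rewrite in_itv /= ge_min le_max => xn.
rewrite fz; last by apply: contra xn; rewrite in_itv /= => /andP[-> ->].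
rewrite gz; first by rewrite mulr0 addr0.
by apply: contra xn; rewrite in_itv /= => /andP[-> ->]; rewrite !orbT.
Qed.

Lemma bump_integral f al be : zb f -> 0 < al -> al < be -> be < a ->
  forall eta : nat -> R -> R, (forall n, test_function a (eta n)) ->
  (forall n x, 0 <= eta n x <= 1) ->
  (forall x, al < x < be -> eta n x @[n --> \oo] --> (1 : R)) ->
  (forall n x, ~ (al < x < be) -> eta n x = 0) ->
  \int[mu]_(t in D) (f t * eta n t) @[n --> \oo] --> cumul f be - cumul f al.
Proof.
move=> zf al0 albe bea eta te e01 e1 e0; have fi := zbL2_intg zf.
pose g t := f t * \1_(`]al, be[%classic : set R) t.
have mf : measurable_fun setT f by have [] := (intgP _ _).1 fi.
have met n : measurable_fun setT (eta n).
  by apply: continuous_measurable_fun; exact: C1_continuous (test_function_C1 (te n)).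
have mg : measurable_fun setT g by apply: measurable_funM => //; exact: measurable_indic.
have gE : \int[mu]_t g t = cumul f be - cumul f al.
  rewrite cumulB ?ltW// -Rintegral_itv_bndo_bndc; last exact: intgT.
  rewrite [RHS]Rintegral_mkcond; apply: eq_Rintegral => t _.
  by rewrite /g patchE indicE; case: (t \in _); rewrite ?mulr1 ?mulr0.
have fe n : intg setT (fun t => f t * eta n t) by exact: (zbL2_ip zf (test_function_zbL2 (te n)).1).
have gi : intg setT g.
  apply: (@le_intg _ _ _ (fun t => `|f t|)) => //; last exact: intg_norm.
  move=> t _; rewrite /g normrM indicE; case: (t \in _); rewrite ?normr1 ?mulr1//.
  by rewrite normr0 mulr0.
have : \int[mu]_t `|f t * eta n t - g t| @[n --> \oo] --> (0 : R).
  apply: (@dominated_L1 _ _ g (fun t => `|f t|)) => //.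
  - by move=> n; exact: measurable_funM.
  - apply: ae_all => t; rewrite /g indicE; have [t1|t1] := pselect (al < t < be).
      rewrite mem_set /= ?in_itv// mulr1.
      by rewrite -[X in _ --> X](mulr1 (f t)); apply: cvgM; [exact: cvg_cst|exact: e1].
    rewrite memNset /= ?in_itv// mulr0.
    by under eq_fun do rewrite e0// mulr0; exact: cvg_cst.
  - exact: intg_norm.
  - apply: ae_all => t n; rewrite normrM ler_piMr// ger0_norm; by case/andP: (e01 n t).
move=> h; rewrite -gE; apply/cvgrPdist_le => e ep.
have /cvgrPdist_le/(_ _ ep)[n0 _ hn0] := h; exists n0 => // n /hn0 /=.
rewrite sub0r normrN ger0_norm; last by apply: Rintegral_ge0.
apply: le_trans; rewrite Rint_D_supp; last first.
  by move=> t nt; rewrite zf.2 ?mul0r.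
rewrite distrC -(RintegralB measurableT (fe n) gi).
apply: Rint_norm_le => //; exact: intgB.
Qed.

(** Bumps tending to indicators of intervals show that the primitive of [f] is constant inside the
    interval; [cumul_derive] then gives [f = 0] almost everywhere. *)
Lemma fundamental_lemma f : zb f ->
  (forall eta, test_function a eta -> \int[mu]_(t in D) (f t * eta t) = 0) ->
  {ae mu, forall t, D t -> f t = 0}.
Proof.
move=> zf f0; have fi := zbL2_intg zf.
have cf al be : 0 < al -> al < be -> be < a -> cumul f be - cumul f al = 0.
  move=> al0 albe bea; have [eta [te e01 e1 e0]] := bump_exists al0 albe bea.
  have := bump_integral zf al0 albe bea te e01 e1 e0.
  under eq_fun do rewrite f0//.
  by move=> h; apply: (cvg_unique _ h (cvg_cst 0)).
apply: (ae_imp (cumul_derive fi)) => t h; rewrite /= in_itv /= => /andP[t0 ta].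
pose e n : R := n.+1%:R^-1.
have ep n : 0 < e n by rewrite invr_gt0.
have ec : e n @[n --> \oo] --> (0 : R) by exact: cvg_harmonic.
have := h e (fun n => lt0r_neq0 (ep n)) ec => hc.
have z : (cumul f (t + e n) - cumul f t) / e n @[n --> \oo] --> (0 : R).
  have c0 : (fun=> 0 : R) @ \oo --> (0 : R) by exact: cvg_cst.
  apply: cvg_trans c0; apply: near_eq_cvg; near=> n.
  rewrite cf ?mul0r ?ltrDl// -ltrBrDl; near: n.
  have at0 : 0 < a - t by lra.
  have /cvgrPdist_lt/(_ _ at0)[n0 _ hn0] := ec; exists n0 => // n /hn0.
  by rewrite /= sub0r normrN gtr0_norm.
exact: cvg_unique hc z.
Unshelve. all: end_near. Qed.

(** Subtracting the primitive of [w] leaves a function [u] orthogonal to all derivatives of test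
    functions, that is, to all test functions of zero mean. One bump of nonzero mean fixes the
    constant, and the fundamental lemma concludes. *)
Lemma du_bois_reymond v w : zb v -> zb w ->
  (forall psi, test_function a psi -> \int[mu]_(t in D) (v t * derive1 psi t) =
     - \int[mu]_(t in D) (w t * psi t)) ->
  exists c, {ae mu, forall t, D t -> v t = c + cumul w t}.
Proof.
move=> zv zw vw; have wi := zbL2_intg zw.
have [zW _ _ _] := cumul_evolves 0 zw.
pose u t := v t - (if t \in D then 0 + cumul w t else 0).
have zu : zb u by exact: zbL2B.
have ui := zbL2_intg zu.
have u0 psi : test_function a psi -> \int[mu]_(t in D) (u t * derive1 psi t) = 0.
  move=> tp; have [z1 z2] := test_function_zbL2 tp.
  rewrite (@eq_Rint _ _ (fun t => v t * derive1 psi t -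
      (if t \in D then 0 + cumul w t else 0) * derive1 psi t)); last first.
    by move=> t _; rewrite /u mulrBl.
  rewrite RintegralB//; [|exact: (intgT _ (zbL2_ip zv z2))|exact: (intgT _ (zbL2_ip zW z2))].
  rewrite vw// (@eq_Rint _ (fun t => (if t \in D then _ else _) * _)
    (fun t => (0 + cumul w t) * derive1 psi t)); last by move=> t Dt; rewrite mem_set.
  by rewrite ibp_test// subrr.
have a0' := a0; have [al0 albe bea] : [/\ 0 < a / 3, a / 3 < a / 2 & a / 2 < a] by split; lra.
have z1 : zb (fun t => if t \in D then 1 else 0).
  apply: (@continuous_zbL2 R a (fun=> 1)) => [t|t t1|t t1]; first exact: cvg_cst.
    by rewrite mem_set//= in_itv.
  by rewrite memNset//= in_itv.
have [eta [te e01 e1 e0]] := bump_exists al0 albe bea.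
have bi := bump_integral z1 al0 albe bea te e01 e1 e0.
(* The integrals of the bumps tend to [a / 2 - a / 3], so they cannot all vanish. *)
have [n In] : exists n, \int[mu]_(t in D) eta n t != 0.
  apply: contrapT => h.
  have : (cumul (fun t => if t \in D then 1 else 0) (a / 2) -
      cumul (fun t => if t \in D then 1 else 0) (a / 3)) = 0 :> R.
    apply: cvg_unique bi _ => //.
    rewrite (_ : (fun n => _) = fun=> 0); first exact: cvg_cst.
    apply/funext => n; apply: contrapT => hn; apply: h; exists n; apply/eqP => En.
    by apply: hn; rewrite -[RHS]En; apply: eq_Rint => t Dt; rewrite mem_set// mul1r.
  rewrite cumulB; [|exact: zbL2_intg z1|exact: ltW].
  rewrite (@eq_Rint _ _ (fun=> 1)) => [|t]; last first.
    rewrite /= in_itv /= => /andP[t1 t2].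
    by rewrite mem_set//= in_itv /=; apply/andP; split; lra.
  rewrite Rintegral_cst//= lebesgue_measure_itv/= lte_fin albe -EFinB /=; lra.
set I0 := \int[mu]_(t in D) eta n t in In.
pose c := (\int[mu]_(t in D) (u t * eta n t)) / I0.
pose f t := u t - c * (if t \in D then 1 else 0).
have zf : zb f.
  apply: zbL2B => //; have := zbL2_DZ (c - 1) z1 z1; congr zbL2.
  by apply/funext => t; rewrite -[_ *: _]/(_ * _) mulrBl mul1r subrK.
have f0 h : test_function a h -> \int[mu]_(t in D) (f t * h t) = 0.
  move=> th; set Ih := \int[mu]_(t in D) h t.
  have ti k : test_function a k -> intg D k.
    by move=> tk; apply: (intgT _ (zbL2_intg (test_function_zbL2 tk).1)).
  have ui' k : test_function a k -> intg D (fun t => u t * k t).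
    by move=> tk; exact: (intgT _ (zbL2_ip zu (test_function_zbL2 tk).1)).
  (* This combination of the bump and [h] has zero mean, hence is the derivative of a test
     function. *)
  have tk := test_functionDZ (- Ih / I0) (te n) th.
  have [|psi [tp dp]] := test_function_primitive a0 tk.
    rewrite RintegralD//; [|apply: intgZ => //; exact: ti|exact: ti].
    by rewrite RintegralZl//; [rewrite -/I0 -/Ih; field|exact: ti].
  have := u0 _ tp; rewrite dp.
  rewrite (@eq_Rint _ _ (fun t => (- Ih / I0) * (u t * eta n t) + u t * h t)).
    rewrite RintegralD//; [|apply: intgZ => //; exact: ui'|exact: ui'].
    rewrite RintegralZl//; last exact: ui'.
    move=> E; rewrite (@eq_Rint _ _ (fun t => u t * h t - c * h t)).
      rewrite RintegralB//; [|exact: ui'|by apply: intgZ => //; exact: ti].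
      rewrite RintegralZl//; last exact: ti.
      by rewrite -/Ih /c -[RHS]E; field.
    by move=> t Dt; rewrite /f mem_set// mulr1 mulrBl.
  by move=> t _; ring.
exists c; apply: (ae_imp (fundamental_lemma zf f0)) => t ft Dt.
move: (ft Dt); rewrite /f /u mem_set// mulr1 add0r; lra.
Qed.

End scalar_evolutions.

(** * The graph space and the antiderivative *)

Section edges.
Context {R : realType}.
Local Notation mu := (@lebesgue_measure R).
Implicit Types (a c : R) (f g v w : R -> R).

Definition prim (c : R) g (a : R) (t : R) : R := if t \in `]0, a[%classic then c + cumul g t else 0.

Lemma zbL2_prim a c g : zbL2 (H := RH) a g -> zbL2 (H := RH) a (prim c g a).
Proof. by move=> zg; have [] := cumul_evolves c zg. Qed.

Lemma prim_in a c g t : 0 < t < a -> prim c g a t = c + cumul g t.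
Proof. by move=> ta; rewrite /prim mem_set//= in_itv. Qed.

Lemma L2_edgeP a v : L2_edge a v <-> zbL2 (H := RH) a (v \_ `]0, a[).
Proof.
split=> [hv|[[mv iv] v0]].
  have mv : measurable_fun setT (v \_ `]0, a[) by move: hv => /sub_Lfun_mfun; rewrite inE.
  split; last by move=> t nt; rewrite patchE memNset.
  split; first exact: measurable_SM.
  have := Lfun2_integrable_sqr hv; rewrite /intg => h.
  apply: (@integrableS _ _ _ mu setT) => //.
have mv' := SM_measurable mv.
rewrite /L2_edge /=; apply/andP; split; rewrite inE//=.
rewrite /finite_norm unlock /= poweR_lty//.
have := (intgP _ _).1 (intg_supp iv _) => -[|_].
  by move=> t nt; rewrite /= v0// mul0r.
congr (_ < _)%E; apply: eq_integral => t _.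
by rewrite powR_mulrn//= real_normK ?num_real// expr2 ger0_norm// -expr2 sqr_ge0.
Qed.

Lemma Rint_patch a v h : \int[mu]_(x in `]0, a[) ((v \_ `]0, a[) x * h x) =
  \int[mu]_(x in `]0, a[) (v x * h x).
Proof. by apply: eq_Rint => x Dx; rewrite patchE mem_set. Qed.

Lemma weak_derivative_primitive a v w : 0 < a -> L2_edge a v ->
  is_weak_derivative a v w -> exists c, {ae mu, forall x, x \in `]0, a[ ->
    v x = c + cumul (w \_ `]0, a[) x}.
Proof.
move=> a0 /L2_edgeP zv [/L2_edgeP zw vw].
have [|c hc] := du_bois_reymond a0 zv zw.
  by move=> psi /vw; rewrite !Rint_patch.
by exists c; apply: (ae_imp hc) => x h Dx; rewrite -h//= patchE mem_set.
Qed.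

Lemma primitive_weak_derivative a v g c : 0 < a -> L2_edge a v ->
  zbL2 (H := RH) a g -> {ae mu, forall x, x \in `]0, a[ -> v x = c + cumul g x} ->
  is_weak_derivative a v g.
Proof.
move=> a0 /L2_edgeP zv zg vg; split.
  apply/L2_edgeP; have := zg; congr zbL2; apply/funext => t.
  by rewrite patchE; case: ifPn => // /negP nt; rewrite zg.2// => Dt; apply: nt; exact/mem_set.
move=> psi tp; have [z1 z2] := test_function_zbL2 tp.
rewrite -(ibp_test a0 c zg tp) -Rint_patch; apply: Rint_ae => //.
- exact: (intgT _ (zbL2_ip zv z2)).
- apply: measurable_funTS; apply: measurable_funM.
    apply: measurable_funD => //; exact: measurable_cumul (zbL2_intg zg).
  exact: SM_measurable (zbL2_SM z2).
- by apply: (ae_imp vg) => x h Dx; rewrite patchE mem_set// h.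
Qed.

Lemma weak_derivative_unique a v w w' : 0 < a ->
  is_weak_derivative a v w -> is_weak_derivative a v w' ->
  {ae mu, forall x, x \in `]0, a[ -> w x = w' x}.
Proof.
move=> a0 [/L2_edgeP zw vw] [/L2_edgeP zw' vw'].
have zB : zbL2 (H := RH) a (fun t => (w \_ `]0, a[) t - (w' \_ `]0, a[) t) by exact: zbL2B.
apply: (ae_imp (fundamental_lemma zB _)) => [eta te|x hx Dx]; last first.
  by have := hx Dx; rewrite !patchE mem_set//= => /eqP; rewrite subr_eq0 => /eqP.
have [z1 _] := test_function_zbL2 te.
rewrite (@eq_Rint _ _ _ (fun t => (w \_ `]0, a[) t * eta t - (w' \_ `]0, a[) t * eta t)).
  rewrite RintegralB//; [|exact: (intgT _ (zbL2_ip zw z1))|exact: (intgT _ (zbL2_ip zw' z1))].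
  by rewrite !Rint_patch -[X in X - _]opprK -vw// -[X in _ - X]opprK -vw'// subrr.
by move=> t _; rewrite mulrBl.
Qed.

Lemma weak_derivativeP a v : H1_edge a v -> is_weak_derivative a v (weak_derivative a v).
Proof. by move=> [_ [w hw]]; exact: (xgetPex (fun=> 0) (P := [set w | is_weak_derivative a v w]) (ex_intro _ w hw)). Qed.

Lemma within_hcont {H : preHilbert R} T (z : R -> H) : hcont T z <->
  forall t, t \in `[0, T] ->
    nrm (z s - z t) @[s --> within `[0, T] (nbhs t)] --> (0 : R).
Proof.
split=> [cz t|cz t tT e e0].
  rewrite in_itv /= => tT; apply/cvgr0Pnorm_le => e e0.
  have [d d0 hd] := cz t tT e e0; rewrite near_withinE; near=> s => sT.
  rewrite ger0_norm ?nrm_ge0//; apply: hd; first by move: sT; rewrite /= in_itv.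
  rewrite distrC; near: s; apply: cvgr_dist_lt => //.
have tT' : t \in `[0, T] by rewrite in_itv.
have /cvgr0Pnorm_le/(_ _ e0) := cz t tT'; rewrite near_withinE => /nbhs_ballP[d /= d0 hd].
exists d => // s sT st; have := hd s; rewrite /ball /= distrC => /(_ st).
by rewrite /= in_itv /= => /(_ sT); rewrite ger0_norm ?nrm_ge0.
Unshelve. all: end_near. Qed.

Lemma within_continuousP T (f : R -> R) : {within `[0, T], continuous f} <->
  hcont (H := RH) T f.
Proof.
rewrite within_hcont subspace_continuousP; split=> h t tT.
  have /cvgr_dist_lt h' := h t tT; apply/cvgr0Pnorm_lt => e e0.
  apply: filterS (h' _ e0) => s; rewrite nrm_RH normr_id distrC; exact.
apply/cvgrPdist_lt => e e0; have /cvgr0Pnorm_lt/(_ _ e0) := h t tT.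
by apply: filterS => s; rewrite nrm_RH normr_id distrC.
Qed.

Lemma hcont_prim T c g : zbL2 (H := RH) T g -> hcont (H := RH) T (fun t => c + cumul g t : R).
Proof.
move=> zg; apply: (@hcontD _ _ _ (fun=> c : RH)); first exact: hcont_cst.
exact: hcont_cumul (zbL2_intg zg).
Qed.

End edges.
Section value_restriction.
Context {R : realType} {H : preHilbert R}.

Lemma val_ssubB (Z : lmodType R) (S : subspace Z) (x y : ssub S) :
  \val (x - y) = \val x - \val y.
Proof. by []. Qed.

Lemma BL2_dist_eq (a : R) (x y z : BL2 (H := H) a) :
  (forall t, `]0, a[%classic t -> \val y t = \val z t) ->
  nrm (x - y) ^+ 2 = nrm (x - z) ^+ 2.
Proof.
move=> yz; rewrite !sqr_nrm_BL2 !val_ssubB; apply: eq_Rint => t /yz h.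
have E (u v : R -> H) : (u - v) t = u t - v t by [].
by rewrite !E h.
Qed.

End value_restriction.

Section graph_space.
Context {R : realType} {N : nat}.
Local Notation mu := (@lebesgue_measure R).
Variables (l : 'I_N -> R) (hl : forall i, 0 < l i).
Local Notation Z := (graph_fun R N).
Implicit Types v w : Z.

Let gset v := forall i, zbL2 (H := @RH R) (l i) (v i).

Let gset0 : gset 0.
Proof. by move=> i; split => //; exact: (bL2_cst (l i) (0 : RH)). Qed.

Let gsetDZ a v w : gset v -> gset w -> gset (a *: v + w).
Proof. by move=> hv hw i; exact: (zbL2_DZ a (hv i) (hw i)). Qed.

Lemma gfunDZ a v w i t : ((a *: v + w) i t : R) = a * (v i t : R) + (w i t : R).
Proof. by []. Qed.

Definition graph_sub : subspace Z := Subspace gset0 gsetDZ.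

Lemma edge_intg v w i : graph_sub v -> graph_sub w ->
  intg `]0, l i[ (fun x => v i x * w i x).
Proof. by move=> hv hw; exact: (intgT _ (zbL2_ip (hv i) (hw i))). Qed.

Let ipgC v w : graph_sub v -> graph_sub w -> inner_L2 l v w = inner_L2 l w v.
Proof.
by move=> _ _; apply: eq_bigr => i _; apply: eq_Rint => x _; rewrite mulrC.
Qed.

Let ipgDZ a u v w : graph_sub u -> graph_sub v -> graph_sub w ->
  inner_L2 l (a *: u + v) w = a * inner_L2 l u w + inner_L2 l v w.
Proof.
move=> hu hv hw; rewrite mulr_sumr -big_split; apply: eq_bigr => i _ /=.
rewrite -RintegralZl//; last exact: edge_intg.
rewrite -RintegralD//; [|by apply: intgZ => //; exact: edge_intg|exact: edge_intg].
by apply: eq_Rint => x _; rewrite gfunDZ mulrDl mulrA.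
Qed.

Let ipg_ge0 v : graph_sub v -> 0 <= inner_L2 l v v.
Proof.
by move=> _; apply: sumr_ge0 => i _; apply: Rintegral_ge0 => x _; rewrite -expr2 sqr_ge0.
Qed.

(* L^2 of the graph, realised by functions vanishing outside the edges. *)
Definition GX : preHilbert R := sub_preHilbert ipgC ipgDZ ipg_ge0.

Definition gval (x : GX) : Z := \val x.

Lemma gvalP (x : GX) i : zbL2 (H := @RH R) (l i) (gval x i).
Proof. exact: (ssubP x). Qed.

Definition GX_of v (hv : graph_sub v) : GX := ssub_of hv.

Lemma gval_inj : injective gval. Proof. exact: val_inj. Qed.

Lemma gvalDZ a (x y : GX) i t : gval (a *: x + y) i t = a * (gval x i t : R) + (gval y i t : R).
Proof. by rewrite /gval val_ssubDZ gfunDZ. Qed.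

Lemma gvalDZE a (x y : GX) i :
  gval (a *: x + y) i = fun t : R => a * (gval x i t : R) + (gval y i t : R).
Proof. by apply/funext => t; rewrite gvalDZ. Qed.

Lemma ip_GX (x y : GX) : ip x y = inner_L2 l (gval x) (gval y).
Proof. by []. Qed.

Definition ecomp i (x : GX) : BL2 (H := @RH R) (l i) := BL2_of (gvalP x i).1.

Lemma ecompDZ i a (x y : GX) : ecomp i (a *: x + y) = a *: ecomp i x + ecomp i y.
Proof.
apply: val_inj; rewrite val_ssubDZ /ecomp /BL2_of !ssub_ofK gvalDZE.
by apply/funext => t.
Qed.

Lemma ecompB i (x y : GX) : ecomp i x - ecomp i y = ecomp i (x - y).
Proof. by rewrite addrC -scaleN1r -ecompDZ scaleN1r addrC. Qed.

Lemma sqr_nrm_ecomp (x : GX) : nrm x ^+ 2 = \sum_i nrm (ecomp i x) ^+ 2.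
Proof. by rewrite sqr_nrm; apply: eq_bigr => i _; rewrite sqr_nrm. Qed.

Lemma ecomp_le i (x : GX) : nrm (ecomp i x) <= nrm x.
Proof.
rewrite -ler_sqr ?nnegrE ?nrm_ge0// sqr_nrm_ecomp (bigD1 i)//= lerDl.
by apply: sumr_ge0 => j _; rewrite sqr_ge0.
Qed.

Lemma GX_complete : ph_complete GX.
Proof.
move=> u hu.
have ex i : exists f : BL2 (H := @RH R) (l i), ph_cvg (fun n => ecomp i (u n)) f.
  apply: (BL2_complete (@RH_complete R) (hl i)) => n; apply: le_trans (hu n).
  by rewrite ecompB; exact: ecomp_le.
pose f i := projT1 (cid (ex i)).
have hf i : ph_cvg (fun n => ecomp i (u n)) (f i) := projT2 (cid (ex i)).
pose v : Z := fun i => (\val (f i) : R -> R) \_ `]0, l i[.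
have hv : graph_sub v.
  move=> i; split; last by move=> t nt; rewrite /v patchE memNset.
  have [mf fi] := ssubP (f i); split.
    have := @SM_if _ (@RH R) `]0, l i[%classic (\val (f i)) (fun=> 0) _ mf (SM_cst _).
    by apply.
  apply: (eq_intg _ _ fi) => // t Dt; by rewrite /v patchE mem_set.
exists (GX_of hv).
have E n : nrm (u n - GX_of hv) ^+ 2 = \sum_i nrm (ecomp i (u n) - f i) ^+ 2.
  rewrite sqr_nrm_ecomp; apply: eq_bigr => i _; rewrite -ecompB.
  apply: BL2_dist_eq => t Dt; have -> : \val (ecomp i (GX_of hv)) t = v i t by [].
  by rewrite /v patchE mem_set.
have c : nrm (u n - GX_of hv) ^+ 2 @[n --> \oo] --> (0 : R).
  have z0 : \sum_(i < N) (0 * 0 : R) = 0 by rewrite big1// => i _; rewrite mul0r.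
  have -> : (fun n => nrm (u n - GX_of hv) ^+ 2) =
    (fun n => \sum_i nrm (ecomp i (u n) - f i) ^+ 2) by apply/funext => n; exact: E.
  rewrite -[X in _ --> X]z0.
  apply: (@cvg_big R _ +%R) => [|i _]; first exact: add_continuous.
  exact: (cvgM (hf i) (hf i)).
apply/ph_cvgP => e e0; have /cvgr0Pnorm_le/(_ _ (exprn_gt0 2 e0))[n0 _ hn0] := c.
exists n0 => n /hn0 /=; rewrite ger0_norm ?sqr_ge0// ler_sqr ?nnegrE ?nrm_ge0//.
exact: ltW.
Qed.

Lemma cumul_sqr_le a (g : R -> R) s t : 0 < a -> zbL2 (H := @RH R) a g -> 0 <= s -> s <= t -> t <= a ->
  (cumul g t - cumul g s) ^+ 2 <= a * \int[mu]_(x in `]0, a[) (g x * g x).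
Proof.
move=> a0 zg s0 st ta; have gi := zbL2_intg zg; have g2 := zbL2_ip zg zg.
set I := \int[mu]_(x in _) _; set d := cumul g t - cumul g s.
have I0 : 0 <= I by apply: Rintegral_ge0 => x _; rewrite -expr2 sqr_ge0.
have h k : 2 * k * d <= I + k ^+ 2 * a.
  have ik : intg `]s, t] (fun x => k ^+ 2).
    apply: measurable_bounded_integrable => //.
      by rewrite /= lebesgue_measure_itv /=; case: ifP => _; rewrite ?ltry.
    exists (k ^+ 2); split; [exact: num_real|] => K cK u _ /=.
    by rewrite ger0_norm ?sqr_ge0// ltW.
  have h3 : \int[mu]_(x in `]s, t]) (k ^+ 2) <= k ^+ 2 * a.
    rewrite Rintegral_cst//= lebesgue_measure_itv/= lte_fin.
    by case: ifP => _; rewrite -?EFinB /= ler_wpM2l ?sqr_ge0//; lra.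
  have j1 : intg `]s, t] g by exact: intgT.
  have j2 : intg `]s, t] (fun x => g x * g x) by exact: (intgT _ g2).
  have : \int[mu]_(x in `]s, t]) (2 * k * g x) <=
      \int[mu]_(x in `]s, t]) (g x * g x + k ^+ 2).
    apply: le_Rintegral => //; first exact: intgZ.
      exact: intgD.
    by move=> x _; have := sqr_ge0 (g x - k); lra.
  rewrite RintegralZl// -cumulB// RintegralD//.
  move=> h1.
  have h2 : \int[mu]_(x in `]s, t]) (g x * g x) <= I.
    rewrite -cumulB// /I.
    have z x : ~ (0 < x < a) -> g x * g x = 0 by move=> /(zb_out zg) ->; rewrite mul0r.
    have [e1 e2] := cumul_end a0 g2 z.
    apply: (@le_trans _ _ (cumul (fun x => g x * g x) a - cumul (fun x => g x * g x) 0)).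
    2: by rewrite e1 subr0 e2.
    have m x y : x <= y -> cumul (fun x => g x * g x) x <= cumul (fun x => g x * g x) y.
      move=> xy; rewrite -subr_ge0 cumulB//; apply: Rintegral_ge0 => u _.
      by rewrite -expr2 sqr_ge0.
    by apply: lerB; exact: m.
  exact: le_trans h1 (lerD h2 h3).
(* The value [k = d / a] is the one for which the bound becomes Cauchy--Schwarz on an interval of
   length at most [a]. *)
have := h (d / a); rewrite -(ler_pM2r a0).
have -> : 2 * (d / a) * d * a = 2 * d ^+ 2 by field; lra.
have -> : (I + (d / a) ^+ 2 * a) * a = a * I + d ^+ 2 by field; lra.
lra.
Qed.

Let Ltot := \sum_i l i.

Let l_le i : l i <= Ltot.
Proof. by rewrite /Ltot (bigD1 i)//= lerDl; apply: sumr_ge0 => j _; exact: ltW. Qed.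

(** A Poincaré inequality in a form that covers both the antiderivative vanishing at [l i] and its
    adjoint, which vanishes at 0; the total length serves as a constant for all edges. *)
Lemma antiderivative_bound v w : graph_sub v -> graph_sub w ->
  (forall i x, 0 < x < l i -> exists s t, [/\ 0 <= s, s <= t, t <= l i &
     v i x = cumul (w i) s - cumul (w i) t]) ->
  inner_L2 l v v <= Ltot ^+ 2 * inner_L2 l w w.
Proof.
move=> hv hw vw; rewrite mulr_sumr; apply: ler_sum => i _.
set I := \int[mu]_(x in `]0, l i[) (w i x * w i x).
have I0 : 0 <= I by apply: Rintegral_ge0 => x _; rewrite -expr2 sqr_ge0.
apply: (@le_trans _ _ (\int[mu]_(x in `]0, l i[) (l i * I))).
  apply: le_Rintegral => //; first exact: edge_intg.
    exact: intg_itv_cst.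
  move=> x; rewrite /= in_itv /= => /vw[s [t [s0 st tl ->]]].
  by rewrite -expr2 -sqrrN opprB; exact: (cumul_sqr_le (hl i) (hw i)).
rewrite (Rint_itv_cst _ (ltW (hl i))) mulrAC -expr2 ler_wpM2r//.
rewrite ler_sqr ?nnegrE ?l_le//; first exact: ltW.
exact: le_trans (ltW (hl i)) (l_le i).
Qed.

Lemma prim_graph_sub (c : 'I_N -> R) (x : GX) :
  graph_sub (fun i => prim (c i) (gval x i) (l i)).
Proof. by move=> i; apply: zbL2_prim; exact: gvalP. Qed.

Let ca (x : GX) i := - cumul (gval x i) (l i).

Definition antid_fun (x : GX) : GX := GX_of (prim_graph_sub (ca x) x).
Definition antid_adj_fun (x : GX) : GX := GX_of (prim_graph_sub (fun=> 0) (- x)).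

Lemma antid_adjE (x : GX) i t : 0 < t < l i ->
  gval (antid_adj_fun x) i t = - cumul (gval x i) t.
Proof.
move=> ti; rewrite /gval /= prim_in// add0r.
have xi := zbL2_intg (gvalP x i).
have := cumulDZ (-1) t xi (integrable0 _ _); rewrite [cumul (fun=> 0) t]/cumul.
rewrite Rintegral_cst//= mul0r addr0 mulN1r => <-; congr (cumul _ t).
by apply/funext => s; rewrite mulN1r addr0.
Qed.

Lemma antidE (x : GX) i t : 0 < t < l i ->
  gval (antid_fun x) i t = cumul (gval x i) t - cumul (gval x i) (l i).
Proof. by move=> ti; rewrite /gval /= prim_in// addrC. Qed.

Lemma GX_eq (x y : GX) : (forall i t, 0 < t < l i -> gval x i t = gval y i t) -> x = y.
Proof.
move=> xy; apply: gval_inj; apply/funext => i; apply/funext => t.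
have [/xy //|nt] := pselect (0 < t < l i).
by rewrite (zb_out (gvalP x i) nt) (zb_out (gvalP y i) nt).
Qed.

Lemma antid_funDZ a x y : antid_fun (a *: x + y) = a *: antid_fun x + antid_fun y.
Proof.
apply: GX_eq => i t ti; rewrite gvalDZ !antidE//.
have E s : cumul (gval (a *: x + y) i) s = a * cumul (gval x i) s + cumul (gval y i) s.
  by rewrite gvalDZE (cumulDZ _ _ (zbL2_intg (gvalP x i)) (zbL2_intg (gvalP y i))).
by rewrite !E; ring.
Qed.

Lemma antid_adj_funDZ a x y :
  antid_adj_fun (a *: x + y) = a *: antid_adj_fun x + antid_adj_fun y.
Proof.
apply: GX_eq => i t ti; rewrite gvalDZ !antid_adjE//.
have E s : cumul (gval (a *: x + y) i) s = a * cumul (gval x i) s + cumul (gval y i) s.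
  by rewrite gvalDZE (cumulDZ _ _ (zbL2_intg (gvalP x i)) (zbL2_intg (gvalP y i))).
by rewrite E; ring.
Qed.

Let Ltot0 : 0 <= Ltot. Proof. by apply: sumr_ge0 => i _; exact: ltW. Qed.

Lemma antid_bound : exists M, forall x, nrm (antid_fun x) <= M * nrm x.
Proof.
exists Ltot => x.
rewrite -ler_sqr ?nnegrE ?nrm_ge0 ?mulr_ge0 ?nrm_ge0// exprMn !sqr_nrm.
apply: antiderivative_bound; [exact: (ssubP (antid_fun x))|exact: (ssubP x)|].
move=> i t ti; exists t, (l i); split=> //; [lra|lra|exact: antidE].
Qed.

Lemma antid_adj_bound : exists M, forall x, nrm (antid_adj_fun x) <= M * nrm x.
Proof.
exists Ltot => x.
rewrite -ler_sqr ?nnegrE ?nrm_ge0 ?mulr_ge0 ?nrm_ge0// exprMn !sqr_nrm.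
apply: antiderivative_bound; [exact: (ssubP (antid_adj_fun x))|exact: (ssubP x)|].
move=> i t ti; exists 0, t; split=> //; [lra|lra|].
have [-> _] := cumul_end (hl i) (zbL2_intg (gvalP x i)) (zb_out (gvalP x i)).
by rewrite sub0r; exact: antid_adjE.
Qed.

Definition antid : linop GX GX := LinOp antid_funDZ antid_bound.
Definition antid_adj : linop GX GX := LinOp antid_adj_funDZ antid_adj_bound.

(** Integration by parts on each edge: one factor of the boundary term vanishes at [l i], the other
    at 0. *)
Lemma antid_adjoint x y : ip (antid x) y = ip x (antid_adj y).
Proof.
apply: eq_bigr => i _.
have zx := gvalP x i; have zy := gvalP y i.
have := ibp_cumul (hl i) (- cumul (gval x i) (l i)) 0 zx zy.
rewrite addNr mul0r mulr0 subrr.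
rewrite (@eq_Rint _ _ _ (fun t => gval (antid x) i t * gval y i t -
    gval x i t * gval (antid_adj y) i t)) => [|t].
  rewrite RintegralB//; first by move=> /eqP; rewrite subr_eq0 => /eqP.
    exact: (edge_intg _ (ssubP (antid x)) (ssubP y)).
  exact: (edge_intg _ (ssubP x) (ssubP (antid_adj y))).
rewrite /= in_itv /= => ti; rewrite [gval (antid x) i t]antidE//.
by rewrite [gval (antid_adj y) i t]antid_adjE//; ring.
Qed.

(* Equality of all the [\int w_i], i.e. continuity of [antid w] at the vertex. *)
Definition kirch_fun (p : 'I_N * 'I_N) : Z := fun i t =>
  if t \in `]0, l i[%classic then (i == p.1)%:R - (i == p.2)%:R else 0.

Lemma kirch_sub p : graph_sub (kirch_fun p).
Proof.
move=> i; apply: (@continuous_zbL2 R (l i) (fun=> (i == p.1)%:R - (i == p.2)%:R)).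
- by move=> t; exact: cvg_cst.
- by move=> t ti; rewrite /kirch_fun mem_set//= in_itv.
- by move=> t ti; rewrite /kirch_fun memNset//= in_itv.
Qed.

Definition kirch p : GX := GX_of (kirch_sub p).

Lemma kirchP (x : GX) : orth_set kirch x <->
  forall i j, cumul (gval x i) (l i) = cumul (gval x j) (l j).
Proof.
have E p : ip (kirch p) x = cumul (gval x p.1) (l p.1) - cumul (gval x p.2) (l p.2).
  have xi i := zbL2_intg (gvalP x i).
  have ei i : cumul (gval x i) (l i) = \int[mu]_(t in `]0, l i[) gval x i t.
    by have [] := cumul_end (hl i) (xi i) (zb_out (gvalP x i)).
  rewrite (_ : ip _ x = \sum_i ((i == p.1)%:R - (i == p.2)%:R) * cumul (gval x i) (l i)).
    under eq_bigr do rewrite mulrBl; rewrite sumrB; congr (_ - _).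
      by rewrite (bigD1 p.1)//= eqxx mul1r big1 ?addr0// => i /negbTE ->; rewrite mul0r.
    by rewrite (bigD1 p.2)//= eqxx mul1r big1 ?addr0// => i /negbTE ->; rewrite mul0r.
  apply: eq_bigr => i _; rewrite ei -RintegralZl//; last exact: intgT.
  by apply: eq_Rint => t Dt; rewrite /= /kirch_fun mem_set.
split=> h.
  by move=> i j; have /eqP := h (i, j); rewrite E subr_eq0 => /eqP.
by move=> p; rewrite E (h p.1 p.2) subrr.
Qed.

End graph_space.

(** * The space V as the range of the antiderivative *)

Section representatives.
Context {R : realType} {N : nat}.
Local Notation mu := (@lebesgue_measure R).
Variables (l : 'I_N -> R) (hl : forall i, 0 < l i).
Local Notation Z := (graph_fun R N).
Local Notation X := (GX (N := N) l).
Local Notation H0 := (orth_set (kirch (N := N) l)).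
Implicit Types v : Z.

Definition edge_restr v : Z := fun i => (v i : R -> R) \_ `]0, l i[.

Lemma graph_subP v : graph_sub l v <-> forall i, zbL2 (H := @RH R) (l i) (v i).
Proof. by []. Qed.

Lemma L2P v : L2 l v <-> graph_sub l (edge_restr v).
Proof.
split=> h; first by apply/graph_subP => i; exact: (L2_edgeP _ _).1 (h i).
by move=> i; apply/L2_edgeP; exact: ((graph_subP _).1 h).
Qed.

(** The element of L^2 represented by [v], cut off outside the edges; the default 0 is taken when
    [v] is not in L^2. *)
Definition toX v : X :=
  if pselect (graph_sub l (edge_restr v)) is left h then GX_of h else 0.

Lemma gval_toX v : L2 l v -> gval (toX v) = edge_restr v.
Proof. by move=> /L2P h; rewrite /toX; case: pselect. Qed.

Lemma gval_toX_in v i x : L2 l v -> `]0, l i[%classic x -> gval (toX v) i x = v i x.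
Proof. by move=> Lv Dx; rewrite gval_toX// /edge_restr patchE mem_set. Qed.

Lemma L2_gval (x : X) : L2 l (gval x).
Proof.
apply/L2P/graph_subP => i; have := gvalP x i; congr zbL2; apply/funext => t.
rewrite /edge_restr patchE; case: ifPn => // /negP nt.
by rewrite (gvalP x i).2// => Dt; apply: nt; exact/mem_set.
Qed.

Lemma toX_gval (x : X) : toX (gval x) = x.
Proof.
apply: GX_eq => i t ti; rewrite gval_toX_in//=; exact: L2_gval.
Qed.

Lemma L2_DZ a v v' : L2 l v -> L2 l v' -> L2 l (a *: v + v').
Proof.
move=> /L2P h /L2P h'; apply/L2P; have := ssetDZ a h h'; congr (graph_sub l _).
apply/funext => i; apply/funext => t; rewrite gfunDZ /edge_restr !patchE.
by case: ifP => _; rewrite ?gfunDZ// mulr0 addr0.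
Qed.

Lemma toX_DZ a v v' : L2 l v -> L2 l v' -> toX (a *: v + v') = a *: toX v + toX v'.
Proof.
move=> h h'; apply: GX_eq => i t ti; rewrite gvalDZ.
have Dt : `]0, l i[%classic t by rewrite /= in_itv.
by rewrite !gval_toX_in//; exact: L2_DZ.
Qed.

Lemma L2B v v' : L2 l v -> L2 l v' -> L2 l (v - v').
Proof. by move=> h h'; rewrite addrC -scaleN1r; exact: L2_DZ. Qed.

Lemma toXB v v' : L2 l v -> L2 l v' -> toX (v - v') = toX v - toX v'.
Proof.
move=> h h'; have := toX_DZ (-1) h' h.
by rewrite !scaleN1r [- v' + v]addrC [- toX v' + _]addrC.
Qed.

Lemma gvalB (x y : X) i t : gval (x - y) i t = (gval x i t : R) - (gval y i t : R).
Proof. by have := gvalDZ (-1) y x i t; rewrite scaleN1r (addrC (- y)) => ->; ring. Qed.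

Lemma inner_L2E v v' : L2 l v -> L2 l v' -> inner_L2 l v v' = ip (toX v) (toX v').
Proof.
move=> h h'; rewrite ip_GX; apply: eq_bigr => i _; apply: eq_Rint => t Dt.
by rewrite !gval_toX_in.
Qed.

Lemma norm_L2E v : L2 l v -> norm_L2 l v = nrm (toX v).
Proof. by move=> h; rewrite /norm_L2 inner_L2E. Qed.

Lemma GX_ae0 (x : X) :
  (forall i, {ae mu, forall t, `]0, l i[%classic t -> gval x i t = 0}) -> nrm x = 0.
Proof.
move=> x0; rewrite /nrm ip_GX (_ : inner_L2 _ _ _ = 0) ?sqrtr0//.
rewrite /inner_L2 big1// => i _.
transitivity (\int[mu]_(x in `]0, l i[) (0 : R)); last first.
  by rewrite (Rint_itv_cst _ (ltW (hl i))) mul0r.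
apply: Rint_ae => //; first exact: (edge_intg _ (ssubP x) (ssubP x)).
by apply: (ae_imp (x0 i)) => t h Dt; rewrite h// mul0r.
Qed.

Lemma GX_ae_eq (x y : X) : (forall i, {ae mu, forall t, `]0, l i[%classic t ->
  gval x i t = gval y i t}) -> nrm (x - y) = 0.
Proof.
move=> xy; apply: GX_ae0 => i; apply: (ae_imp (xy i)) => t h Dt.
by rewrite gvalB h// subrr.
Qed.

Lemma GX_nrm0_ae (x : X) i : nrm x = 0 ->
  {ae mu, forall t, `]0, l i[%classic t -> gval x i t = 0}.
Proof.
move=> x0; have : nrm (ecomp i x) = 0.
  by apply/eqP; rewrite eq_le nrm_ge0 andbT -x0 ecomp_le.
move=> /(congr1 (fun r => r ^+ 2)); rewrite expr0n/= sqr_nrm_BL2 => e.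
have := edge_intg i (ssubP x) (ssubP x) => ei.
have [mf _] := (intgP _ _).1 ei.
have e' : (\int[mu]_(t in `]0%R, l i[) `|(gval x i t * gval x i t)%:E| = 0)%E.
  rewrite -[LHS]fineK; last first.
    by rewrite ge0_fin_numE; [exact: ((intgP _ _).1 ei).2|exact: integral_ge0].
  congr (_%:E); rewrite -[RHS]e; congr fine; apply: eq_integral => t _ /=.
  by rewrite ger0_norm// -expr2 sqr_ge0.
have mf' : measurable_fun `]0, l i[ (EFin \o (fun t => gval x i t * gval x i t)).
  exact/measurable_EFinP.
have h := (@ae_eq_integral_abs _ (measurableTypeR R) R mu _ (measurable_itv _) _ mf').1 e'.
apply: (ae_imp h) => t ht Dt.
by have := ht Dt => -[] /eqP; rewrite mulf_eq0 orbb => /eqP.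
Qed.

Lemma V_antid (w : X) : H0 w -> V l (gval (antid hl w)) /\
  forall i, {ae mu, forall x, x \in `]0, l i[ -> Dx l (gval (antid hl w)) i x = gval w i x}.
Proof.
move=> hw; have La i := L2_gval (antid hl w) i.
pose c i := - cumul (gval w i) (l i).
have wd i : is_weak_derivative (l i) (gval (antid hl w) i) (gval w i).
  apply: (primitive_weak_derivative (c := c i) (hl i)) => //; first exact: gvalP.
  apply: ae_all => x; rewrite in_itv /= => xl.
  by rewrite [LHS](antidE w xl) /c addrC.
have hH i : H1_edge (l i) (gval (antid hl w) i) by split => //; exists (gval w i).
split; last first.
  by move=> i; exact: (weak_derivative_unique (hl i) (weak_derivativeP (hH i)) (wd i)).
split=> //; exists (fun i x => c i + cumul (gval w i) x); split=> [i|i j _|i].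
- split; first by apply/within_continuousP; apply: hcont_prim; exact: gvalP.
  apply: ae_all => x; rewrite in_itv /= => xl.
  by rewrite [RHS](antidE w xl) /c addrC.
- have e k : cumul (gval w k) 0 = 0.
    by have [] := cumul_end (hl k) (zbL2_intg (gvalP w k)) (zb_out (gvalP w k)).
  by rewrite !e /c ((kirchP hl w).1 hw i j).
- by rewrite /c addNr.
Qed.

Definition dX v : X := toX (Dx l v).

Lemma V_L2_Dx v : V l v -> L2 l v /\ L2 l (Dx l v).
Proof.
move=> [hv _]; split=> i; first by have [] := hv i.
by have [] := weak_derivativeP (hv i).
Qed.

(** On each edge [v] is a primitive of its weak derivative up to a constant. The Dirichlet condition
    at [l i] determines the constant, and continuity at the vertex then says that the integrals of
    the derivative agree. *)
Lemma V_primitive v : V l v -> H0 (dX v) /\ nrm (toX v - antid hl (dX v)) = 0.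
Proof.
move=> Vv; have [Lv Ld] := V_L2_Dx Vv; have [hH [vc [vcr vc0 vcl]]] := Vv.
have zd i := gvalP (dX v) i.
have /choice[c hc] : forall i, exists c, {ae mu, forall x, x \in `]0, l i[ ->
    v i x = c + cumul (gval (dX v) i) x}.
  move=> i; rewrite gval_toX//.
  exact: (weak_derivative_primitive (hl i) (Lv i) (weak_derivativeP (hH i))).
have vcE i x : 0 <= x <= l i -> vc i x = c i + cumul (gval (dX v) i) x.
  have [/within_continuousP cv av] := vcr i.
  have cB : hcont (l i) (H := RH) (fun x => vc i x - (c i + cumul (gval (dX v) i) x) : R).
    by apply: hcontB => //; exact: hcont_prim.
  have ae0 : {ae mu, forall t, `]0, l i[%classic t ->
      vc i t - (c i + cumul (gval (dX v) i) t) = 0}.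
    by apply: (ae_imp2 av (hc i)) => t h1 h2 Dt; rewrite h1// h2// subrr.
  by move=> xl; apply/eqP; rewrite -subr_eq0; apply/eqP; exact: (hcont_ae_cst (hl i) cB ae0).
have e i : cumul (gval (dX v) i) 0 = 0.
  by have [] := cumul_end (hl i) (zbL2_intg (zd i)) (zb_out (zd i)).
have ce i : c i = - cumul (gval (dX v) i) (l i).
  have li : 0 <= l i <= l i by rewrite lexx ltW.
  by have := vcE _ _ li; rewrite vcl => /eqP; rewrite eq_sym addr_eq0 => /eqP.
split.
  apply/(kirchP hl) => i j; apply: oppr_inj; rewrite -!ce.
  have [->//|ij] := eqVneq i j.
  have z k : 0 <= 0 <= l k by rewrite lexx ltW.
  by have := vc0 i j ij; rewrite !vcE// !e !addr0.
apply: GX_ae_eq => i; apply: (ae_imp (hc i)) => t h Dt.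
have tl : 0 < t < l i by move: Dt; rewrite /= in_itv.
by rewrite gval_toX_in// h// [RHS](antidE _ tl) ce addrC.
Qed.

Lemma dX_antid (w : X) : H0 w -> nrm (dX (gval (antid hl w)) - w) = 0.
Proof.
move=> hw; have [Va aw] := V_antid hw; have [_ Ld] := V_L2_Dx Va.
apply: GX_ae_eq => i; apply: (ae_imp (aw i)) => t h Dt.
by rewrite gval_toX_in// h.
Qed.

Lemma norm_VE v : V l v -> norm_V l v = Num.sqrt (nrm (toX v) ^+ 2 + nrm (dX v) ^+ 2).
Proof.
by move=> /V_L2_Dx[Lv Ld]; rewrite /norm_V !inner_L2E// !sqr_nrm.
Qed.

Lemma dX_le_norm_V v : V l v -> nrm (dX v) <= norm_V l v.
Proof.
move=> Vv; rewrite norm_VE// -[leLHS]ger0_norm ?nrm_ge0// -sqrtr_sqr ler_wsqrtr//.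
by rewrite lerDr sqr_ge0.
Qed.

Lemma V_0 : V l (0 : Z).
Proof.
have h0 : H0 (0 : X) by move=> p; rewrite ip0r.
have [] := V_antid h0; rewrite lop0.
by rewrite (_ : gval 0 = 0)//.
Qed.

(** [Dx] selects a weak derivative by choice, hence is linear only up to null sets; this is why the
    identity is stated in the seminorm. *)
Lemma V_DZ a v v' : V l v -> V l v' -> V l (a *: v + v') /\
  nrm (dX (a *: v + v') - (a *: dX v + dX v')) = 0.
Proof.
move=> Vv Vv'; have [Lv Ld] := V_L2_Dx Vv; have [Lv' Ld'] := V_L2_Dx Vv'.
have [hH [vc [vcr vc0 vcl]]] := Vv; have [hH' [vc' [vcr' vc0' vcl']]] := Vv'.
have [h e] := V_primitive Vv; have [h' e'] := V_primitive Vv'.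
pose w := a *: dX v + dX v'.
have hw : H0 w by move=> p; rewrite ipDr ipZr h h' mulr0 addr0.
have Ls := L2_DZ a Lv Lv'.
pose c i := - cumul (gval w i) (l i).
have aeq i : {ae mu, forall x, x \in `]0, l i[ ->
    (a *: v + v') i x = c i + cumul (gval w i) x}.
  have n0 : nrm (toX (a *: v + v') - antid hl w) = 0.
    apply/eqP; rewrite eq_le nrm_ge0 andbT toX_DZ// lopDZ opprD addrACA -scalerBr.
    by rewrite (le_trans (ler_nrmD _ _))// nrmZ e e' mulr0 addr0.
  apply: (ae_imp (GX_nrm0_ae i n0)) => x hx Dx.
  have xl : 0 < x < l i by move: Dx; rewrite in_itv.
  have := hx Dx; rewrite gvalB gval_toX_in// [gval (antid hl w) i x](antidE _ xl).
  rewrite /c => /eqP; rewrite subr_eq0 => /eqP ->; exact: addrC.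
have wd i : is_weak_derivative (l i) ((a *: v + v') i) (gval w i).
  exact: (primitive_weak_derivative (hl i) (Ls i) (gvalP w i) (aeq i)).
have hHs i : H1_edge (l i) ((a *: v + v') i) by split => //; exists (gval w i).
have Vs : V l (a *: v + v').
  split=> //; exists (fun i x => a * (vc i x : R) + vc' i x); split=> [i|i j ij|i].
  - have [c1 a1] := vcr i; have [c2 a2] := vcr' i; split.
      apply/within_continuousP; apply: (@hcontDZ _ _ RH); exact/within_continuousP.
    by apply: (ae_imp2 a1 a2) => t q1 q2 Dt; rewrite q1// q2.
  - by rewrite (vc0 _ _ ij) (vc0' _ _ ij).
  - by rewrite vcl vcl' mulr0 addr0.
split=> //; apply: GX_ae_eq => i.
have [_ Lds] := V_L2_Dx Vs.
apply: (ae_imp (weak_derivative_unique (hl i) (weak_derivativeP (hHs i)) (wd i))) => t ht Dt.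
by rewrite gval_toX_in// -ht.
Qed.

Lemma VB v v' : V l v -> V l v' -> V l (v - v') /\ nrm (dX (v - v') - (dX v - dX v')) = 0.
Proof.
move=> h h'; have := V_DZ (-1) h' h; rewrite !scaleN1r.
by rewrite (addrC (- v')) (addrC (- dX v')).
Qed.

End representatives.

(** * Bochner spaces and the dual of V *)

Section bochner_conversion.
Context {R : realType} {X : preHilbert R} {Y : zmodType}.
Local Notation mu := (@lebesgue_measure R).
Variables (E : set Y) (nrmY : Y -> R) (T : R).
Local Notation D := `]0%R, T[%classic.

(** No measurability is asked of the majorant [g]: the integral of a nonnegative function is a
    supremum over simple functions below it, and is monotone as such. In the application [g] is the
    squared norm of an arbitrary representative. *)
Lemma intg_dominated (f g : R -> R) : measurable_fun setT f ->
  (forall t, 0 <= f t) -> (forall t, D t -> f t <= g t) ->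
  (\int[mu]_(t in D) (g t)%:E < +oo)%E -> intg D f.
Proof.
move=> mf f0 fg gi; apply/intgP; split; first exact: measurable_funTS.
apply: le_lt_trans gi; rewrite (@ge0_integralE _ (measurableTypeR R))//.
rewrite (@ge0_integralE _ (measurableTypeR R)); last first.
  by move=> t Dt; rewrite lee_fin (le_trans (f0 t))// fg.
apply: le_ereal_sup => _ [h /= hf <-]; exists h => // t.
apply: le_trans (hf t) _; rewrite !patchE; case: ifPn => // /set_mem Dt.
by rewrite lee_fin ger0_norm// fg.
Qed.

Lemma bochner_zbL2 (phi : Y -> X) (C : R) (f : R -> Y) : 0 < C ->
  (forall x y, E x -> E y -> nrm (phi x - phi y) <= C * nrmY (x - y)) ->
  (forall x, E x -> nrm (phi x) <= C * nrmY x) ->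
  bochner_L2 E nrmY T f ->
  exists w, [/\ zbL2 T w, forall t, w t = 0 \/ exists2 y, E y & w t = phi y &
    {ae mu, forall t, D t -> E (f t) /\ w t = phi (f t)}].
Proof.
move=> C0 lipphi lephi [[s [hs [B [mB B0 hB]]]] fi].
have hB' t : ~ B t -> D t ->
    E (f t) /\ nrmY (s n t - f t) @[n --> \oo] --> (0 : R).
  by move=> nB Dt; apply: contrapT => h; apply: nB; apply: hB => /(_ Dt).
pose A : set R := D `&` ~` B.
have mA : measurable A by apply: measurableI => //; exact: measurableC.
pose w t := if t \in A then phi (f t) else 0.
have wA t : A t -> w t = phi (f t) by move=> At; rewrite /w mem_set.
have Ef t : A t -> E (f t) by case=> Dt nB; have [] := hB' t nB Dt.
have mw : SM w.
  exists (fun n t => if t \in A then phi (s n t) else 0); split.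
    move=> n; apply: fsimple_if => //; last exact: fsimple_cst.
    by apply: fsimple_comp; exact: simple_function_fsimple (hs n).
  move=> t; rewrite /w; case: ifPn => [/set_mem At|_]; last exact: ph_cvg_cst.
  have [Eft c] := hB' t At.2 At.1.
  apply: (cvg0_le (g := fun n => C * nrmY (s n t - f t))).
    by move=> n; rewrite nrm_ge0/= lipphi//; have [_ ? _] := hs n.
  by rewrite -[X in _ --> X](mulr0 C); apply: cvgM => //; exact: cvg_cst.
have wi : intg D (fun t => C^-1 ^+ 2 * ip (w t) (w t)).
  apply: (intg_dominated _ _ _ fi).
  - by apply: measurable_funM => //; exact: measurable_ip.
  - by move=> t; rewrite mulr_ge0 ?ip_ge0// sqr_ge0.
  - move=> t Dt; rewrite -sqr_nrm -exprMn /w; case: ifPn => [/set_mem At|_].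
      have le : C^-1 * nrm (phi (f t)) <= nrmY (f t).
        by rewrite mulrC ler_pdivrMr// mulrC; exact: lephi (Ef t At).
      have p0 : 0 <= C^-1 * nrm (phi (f t)) by rewrite mulr_ge0 ?nrm_ge0// invr_ge0 ltW.
      by rewrite ler_sqr ?nnegrE// (le_trans p0).
    by rewrite nrm0 mulr0 expr0n sqr_ge0.
exists w; split.
- split; last by move=> t nD; rewrite /w memNset// => -[].
  split=> //; have := intgZ (C ^+ 2) (measurable_itv _) wi; congr intg.
  by apply/funext => t; rewrite mulrA -exprMn mulfV ?gt_eqF// expr1n mul1r.
- move=> t; rewrite /w; case: ifPn => [/set_mem At|_]; last by left.
  by right; exists (f t) => //; exact: Ef.
- exists B; split=> // t /= h; apply: contrapT => nB; apply: h => Dt.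
  by have [] := hB' t nB Dt; rewrite wA.
Qed.

(** The approximating simple functions are built from values of [w] itself, so that they lie in [H0]
    and [phi] sends them into [E]. *)
Lemma zbL2_bochner (H0 : set X) (phi : X -> Y) (C : R) (w : R -> X) :
  (forall x, H0 x -> E (phi x)) -> (forall y, 0 <= nrmY y) ->
  (forall x y, H0 x -> H0 y -> nrmY (phi x - phi y) <= C * nrm (x - y)) ->
  (forall x, H0 x -> nrmY (phi x) <= C * nrm x) ->
  zbL2 T w -> (forall t, H0 (w t)) -> bochner_L2 E nrmY T (fun t => phi (w t)).
Proof.
move=> Ephi nY0 lipphi lephi zw hw; split.
  have mw := zbL2_SM zw; have [tau ht] := SM_range_separable mw.
  have [|c [fc cw]] := @SM_approx _ _ w (w \o tau) _ ht.
    by move=> j; apply: measurable_nrm; apply: SMB => //; exact: SM_cst.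
  exists (fun n t => phi (w (tau (c n t)))); split.
    move=> n; apply: fsimple_simple_function; last by move=> t; exact: Ephi.
    exact: (fsimple_comp (fun j => phi (w (tau j))) (fc n)).
  apply: ae_all => t _; split; first exact: Ephi.
  apply: (cvg0_le (g := fun n => C * nrm (w (tau (c n t)) - w t))).
    by move=> n; rewrite nY0 lipphi.
  by rewrite -[X in _ --> X](mulr0 C); apply: cvgM; [exact: cvg_cst|exact: cw].
have := (intgZ (C ^+ 2) (measurable_itv _) zw.1.2); move=> /intgP[_].
apply: le_lt_trans; rewrite (@ge0_integralE _ (measurableTypeR R))//; last first.
  by move=> t _; rewrite lee_fin sqr_ge0.
rewrite (@ge0_integralE _ (measurableTypeR R))//.
apply: le_ereal_sup => _ [h /= hf <-]; exists h => // t.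
apply: le_trans (hf t) _; rewrite !patchE; case: ifPn => // _.
rewrite lee_fin -sqr_nrm -exprMn ger0_norm ?sqr_ge0//.
by rewrite ler_sqr ?nnegrE ?(le_trans (nY0 _) (lephi _ (hw t))) ?nY0// lephi.
Qed.

End bochner_conversion.

(** * Riesz representation of the dual of V *)

Section orthogonal_space.
Context {R : realType} {X : preHilbert R} (cX : ph_complete X).
Context {I : finType} (c : I -> X).
Local Notation H0 := (orth_set c).

Lemma orth_set0 : H0 0. Proof. by move=> p; rewrite ip0r. Qed.

Let orthDZ a x y : H0 x -> H0 y -> H0 (a *: x + y).
Proof. exact: orth_set_DZ. Qed.

Lemma orth_setB x y : H0 x -> H0 y -> H0 (x - y).
Proof. by move=> hx hy; rewrite addrC -scaleN1r; exact: orthDZ. Qed.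

Lemma orth_setZ a x : H0 x -> H0 (a *: x).
Proof. by move=> hx; rewrite -[_ *: _]addr0; apply: orthDZ => //; exact: orth_set0. Qed.

Definition orth_sub : subspace X := Subspace orth_set0 orthDZ.

Definition orth_preHilbert : preHilbert R :=
  sub_preHilbert (S := orth_sub) (b := fun x y : X => ip x y)
  (fun x y _ _ => ipC x y) (fun a x y z _ _ _ => ipDZl a x y z)
  (fun x _ => ip_ge0 x).

Lemma orth_complete : ph_complete orth_preHilbert.
Proof.
move=> u hu.
have [|x hx] := cX (u := fun n => (\val (u n) : X)); first exact: hu.
have Hx : H0 x.
  move=> p; have := ph_cvg_ip (ph_cvg_cst (c p)) hx.
  have -> : (fun n => ip (c p) (\val (u n) : X)) = fun=> 0.
    by apply/funext => n; exact: (ssubP (u n)).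
  by move=> h; exact: (cvg_unique _ h (cvg_cst 0)).
by exists (ssub_of (S := orth_sub) Hx).
Qed.

Lemma riesz_orth (L : X -> R) (C : R) :
  (forall a x y, H0 x -> H0 y -> L (a *: x + y) = a * L x + L y) ->
  (forall x, H0 x -> `|L x| <= C * nrm x) ->
  exists2 y, H0 y & forall x, H0 x -> ip y x = L x.
Proof.
move=> LDZ LC.
have Hval (x : orth_preHilbert) : H0 (\val x : X) by exact: (ssubP x).
have [||u hu] := @riesz_representation _ _ orth_complete _ (fun x : orth_preHilbert => x)
    (fun x : orth_preHilbert => L (\val x)) C (fun _ _ _ => erefl).
- by move=> a x y; rewrite val_ssubDZ LDZ.
- by move=> x; exact: LC.
exists (\val u : X); first exact: Hval.
by move=> x hx; exact: (hu (ssub_of (S := orth_sub) hx)).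
Qed.

End orthogonal_space.

Section graph_dual.
Context {R : realType} {N : nat}.
Local Notation mu := (@lebesgue_measure R).
Variables (l : 'I_N -> R) (hl : forall i, 0 < l i).
Local Notation Z := (graph_fun R N).
Local Notation X := (GX (N := N) l).
Local Notation H0 := (orth_set (kirch (N := N) l)).
Local Notation nV := (norm_V (N := N) l).
Local Notation VD := (dual (V l) nV).
Implicit Types f g : Z -> R.

Lemma norm_V_antid : exists2 C, 0 < C & forall x, H0 x -> nV (gval (antid hl x)) <= C * nrm x.
Proof.
have [M hM] := lop_bound (antid hl).
exists (`|M| + 1) => [|x hx]; first by have := normr_ge0 M; lra.
have [Vx _] := V_antid hl hx; rewrite norm_VE// toX_gval.
have dn : nrm (dX l (gval (antid hl x))) = nrm x.
  have h := dX_antid hl hx.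
  by rewrite /nrm (nrm_eq0_sqr h).
rewrite dn -[leRHS]ger0_norm; last by rewrite mulr_ge0 ?nrm_ge0// addr_ge0.
rewrite -sqrtr_sqr ler_wsqrtr//.
have h1 : nrm (antid hl x) <= `|M| * nrm x.
  by rewrite (le_trans (hM x))// ler_wpM2r ?nrm_ge0// ler_norm.
have := nrm_ge0 (antid hl x); have := nrm_ge0 x; have := normr_ge0 M.
move: h1; move: (nrm _) (nrm x) `|M| => a b c; nra.
Qed.

(** A functional bounded by [norm_V] does not distinguish [v] from the antiderivative of its weak
    derivative, their difference having norm zero. *)
Lemma dual_antid f v : VD f -> V l v -> f v = f (gval (antid hl (dX l v))).
Proof.
move=> [lf [C fC]] Vv; have [hd e] := V_primitive hl Vv.
have [Va _] := V_antid hl hd.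
have [Vd nd] := V_DZ hl (-1) Va Vv; have := fC _ Vd.
have n0 : nV (-1 *: gval (antid hl (dX l v)) + v) = 0.
  rewrite norm_VE//.
  have e1 : nrm (toX l (-1 *: gval (antid hl (dX l v)) + v)) = 0.
    rewrite toX_DZ; [|exact: (V_L2_Dx Va).1|exact: (V_L2_Dx Vv).1].
    by rewrite toX_gval scaleN1r addrC.
  have e2 : nrm (dX l (-1 *: gval (antid hl (dX l v)) + v)) = 0.
    by rewrite /nrm (nrm_eq0_sqr nd) -/(nrm _) scaleN1r addrC nrmBC dX_antid.
  by rewrite e1 e2 expr0n addr0 sqrtr0.
by rewrite n0 mulr0 normr_le0 lf// mulN1r addrC subr_eq0 => /eqP.
Qed.

Lemma riesz_ex f : VD f -> exists y : X, H0 y /\ forall v, V l v -> f v = ip y (dX l v).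
Proof.
move=> df; have [lf [C fC]] := df; have [K K0 hK] := norm_V_antid.
have Va x : H0 x -> V l (gval (antid hl x)) by move=> /(V_antid hl)[].
have gaDZ a x y : gval (antid hl (a *: x + y)) = a *: gval (antid hl x) + gval (antid hl y).
  by apply/funext => i; apply/funext => t; rewrite lopDZ gvalDZ gfunDZ.
have [|x hx|y hy yf] := @riesz_orth _ _ (GX_complete hl) _ (kirch (N := N) l)
    (fun x => f (gval (antid hl x))) (`|C| * K).
- by move=> a x y hx hy; rewrite gaDZ lf//; exact: Va.
- rewrite (le_trans (fC _ (Va _ hx)))// -mulrA.
  apply: (@le_trans _ _ (`|C| * nV (gval (antid hl x)))).
    by rewrite ler_wpM2r ?sqrtr_ge0// ler_norm.
  by rewrite ler_wpM2l// hK.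
exists y; split=> // v Vv; have [hd _] := V_primitive hl Vv.
by rewrite yf// -dual_antid.
Qed.

Definition rz f : X := if pselect (VD f) is left h then projT1 (cid (riesz_ex h)) else 0.

Lemma rzP f : VD f -> H0 (rz f) /\ forall v, V l v -> f v = ip (rz f) (dX l v).
Proof. by move=> h; rewrite /rz; case: pselect => // h'; exact: (projT2 (cid (riesz_ex h'))). Qed.

Lemma dual_norm_ge f v : VD f -> V l v -> nV v <= 1 -> `|f v| <= dual_norm (V l) nV f.
Proof.
move=> [_ [C fC]] Vv v1; apply: ub_le_sup; last by exists v.
exists `|C| => _ [u [Vu u1] <-]; rewrite (le_trans (fC u Vu))//.
rewrite (le_trans (ler_wpM2r (sqrtr_ge0 _) (ler_norm C)))//.
by rewrite ler_piMr.
Qed.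

Lemma dual_norm_le f M : (forall v, V l v -> nV v <= 1 -> `|f v| <= M) ->
  dual_norm (V l) nV f <= M.
Proof.
move=> fM; apply: ge_sup; last by move=> _ [u [Vu u1] <-]; exact: fM.
exists `|f 0|; exists 0 => //; split; first exact: (V_0 hl).
have := @norm_V_antid => -[K K0 /(_ 0 (orth_set0 _))]; rewrite nrm0 mulr0 lop0.
by rewrite (_ : gval 0 = 0)// => /le_trans; apply.
Qed.

Lemma dual_norm_ge0 f : 0 <= dual_norm (V l) nV f.
Proof.
have [h|h] := pselect (has_sup [set `|f x| | x in [set x | V l x /\ nV x <= 1]]).
  have [[r [v hv vr]] ub] := h.
  by apply: (@le_trans _ _ `|f v|) => //; apply: ub_le_sup => //; exists v.
by rewrite /dual_norm sup_out.
Qed.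

Lemma rz_le : exists2 K, 0 < K & forall f, VD f -> nrm (rz f) <= K * dual_norm (V l) nV f.
Proof.
have [K K0 hK] := norm_V_antid; exists K => // f df; have [hy yf] := rzP df.
set y := rz f in hy yf *; have [y0|y0] := eqVneq (nrm y) 0.
  by rewrite y0 mulr_ge0 ?dual_norm_ge0// ltW.
have yp : 0 < nrm y by rewrite lt_def y0 nrm_ge0.
(* Scaling by [s] brings the antiderivative of [y] into the unit ball of V, where the dual norm
   bounds the functional. *)
pose s := (K * nrm y)^-1; have s0 : 0 < s by rewrite invr_gt0 mulr_gt0.
have hs : H0 (s *: y) by exact: orth_setZ.
have [Vs _] := V_antid hl hs.
have v1 : nV (gval (antid hl (s *: y))) <= 1.
  rewrite (le_trans (hK _ hs))// nrmZ gtr0_norm// /s.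
  by rewrite mulrCA mulVf// mulf_neq0// gt_eqF.
have := dual_norm_ge df Vs v1; rewrite yf//.
have -> : ip y (dX l (gval (antid hl (s *: y)))) = ip y (s *: y).
  apply/eqP; rewrite -subr_eq0 -ipBr ipC; apply/eqP; apply: nrm_eq0_ip.
  exact: dX_antid.
rewrite ipZr -sqr_nrm ger0_norm; last by rewrite mulr_ge0 ?sqr_ge0 ?ltW.
move=> /(ler_wpM2l (ltW K0)); apply: le_trans.
have K1 : K != 0 by rewrite gt_eqF.
rewrite le_eqVlt; apply/orP; left; apply/eqP; rewrite /s; field.
by rewrite y0 K1.
Qed.

Lemma dualB f g : VD f -> VD g -> VD (f - g).
Proof.
move=> [lf [C fC]] [lg [C' gC]]; split.
  move=> a x y hx hy; have E u : (f - g) u = f u - g u by [].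
  by rewrite !E lf// lg//; ring.
exists (C + C') => v Vv; have E u : (f - g) u = f u - g u by [].
by rewrite E mulrDl (le_trans (ler_normB _ _))// lerD ?fC ?gC.
Qed.

Lemma rzB f g : VD f -> VD g -> nrm (rz f - rz g) = nrm (rz (f - g)).
Proof.
move=> df dg; have [hf ef] := rzP df; have [hg eg] := rzP dg.
have [hB eB] := rzP (dualB df dg).
suff h : nrm (rz (f - g) - (rz f - rz g)) = 0 by rewrite /nrm (nrm_eq0_sqr h).
set x := rz (f - g) - _; have hx : H0 x by do ?apply: orth_setB.
have [Vx _] := V_antid hl hx; have nx := dX_antid hl hx.
have dE z : ip z (dX l (gval (antid hl x))) = ip z x.
  apply/eqP; rewrite -subr_eq0 -ipBr ipC; apply/eqP; exact: nrm_eq0_ip.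
have E u : (f - g) u = f u - g u by [].
have := eB _ Vx; rewrite E ef// eg// !dE => e.
by apply/eqP; rewrite -[_ == _](@expf_eq0 _ _ 2) sqr_nrm {1}/x !ipBl -e subrr.
Qed.

Definition fun_of (x : X) : Z -> R := fun v => ip x (dX l v).

Lemma dual_fun_of x : VD (fun_of x).
Proof.
split.
  move=> a u v Vu Vv; have [_ e] := V_DZ hl a Vu Vv.
  rewrite /fun_of -ipZr -ipDr; apply/eqP; rewrite -subr_eq0 -ipBr ipC.
  by apply/eqP; exact: nrm_eq0_ip.
exists (nrm x) => v Vv; rewrite (le_trans (normr_ip_le _ _))// ler_wpM2l ?nrm_ge0//.
exact: dX_le_norm_V.
Qed.

Lemma dual_norm_fun_of x : dual_norm (V l) nV (fun_of x) <= nrm x.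
Proof.
apply: dual_norm_le => v Vv v1; rewrite (le_trans (normr_ip_le _ _))//.
rewrite -[leRHS]mulr1 ler_wpM2l ?nrm_ge0// (le_trans _ v1)//; exact: dX_le_norm_V.
Qed.

Variables (T : R).
Local Notation D := `]0%R, T[%classic.

Lemma L2_V_rep rho : L2_V l T rho -> exists w, [/\ zbL2 T w, forall t, H0 (w t) &
  {ae mu, forall t, D t -> V l (rho t) /\ w t = dX l (rho t)}].
Proof.
have h1 x y : V l x -> V l y -> nrm (dX l x - dX l y) <= 1 * nV (x - y).
  move=> Vx Vy; have [VB e] := VB hl Vx Vy.
  by rewrite mul1r {1}/nrm -(nrm_eq0_sqr e) -/(nrm _) dX_le_norm_V.
have h2 x : V l x -> nrm (dX l x) <= 1 * nV x.
  by move=> Vx; rewrite mul1r dX_le_norm_V.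
move=> /(bochner_zbL2 ltr01 h1 h2)[w [zw hw ew]]; exists w; split=> // t.
have [->|[y Vy ->]] := hw t; first exact: orth_set0.
by have [] := V_primitive hl Vy.
Qed.

Lemma L2_V_of w : zbL2 T w -> (forall t, H0 (w t)) ->
  L2_V l T (fun t => gval (antid hl (w t))).
Proof.
have [K K0 hK] := norm_V_antid.
have Va x : H0 x -> V l (gval (antid hl x)) by move=> /(V_antid hl)[].
apply: (zbL2_bochner (phi := fun x => gval (antid hl x)) (C := K) Va) => //.
  by move=> y; exact: sqrtr_ge0.
move=> x y hx hy.
have -> : gval (antid hl x) - gval (antid hl y) = gval (antid hl (x - y)).
  by apply/funext => i; apply/funext => t; rewrite lopB gvalB.
by apply: hK; exact: orth_setB.
Qed.

Lemma L2_L2_rep rho : L2_L2 l T rho -> exists w, [/\ zbL2 T w &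
  {ae mu, forall t, D t -> L2 l (rho t) /\ w t = toX l (rho t)}].
Proof.
have h1 x y : L2 l x -> L2 l y -> nrm (toX l x - toX l y) <= 1 * norm_L2 l (x - y).
  by move=> hx hy; rewrite mul1r norm_L2E ?toXB//; exact: L2B.
have h2 x : L2 l x -> nrm (toX l x) <= 1 * norm_L2 l x.
  by move=> hx; rewrite mul1r norm_L2E.
by move=> /(bochner_zbL2 ltr01 h1 h2)[w [zw hw ew]]; exists w.
Qed.

Lemma L2_Vdual_rep (g : R -> Z -> R) : L2_Vdual l T g -> exists h, [/\ zbL2 T h &
  {ae mu, forall t, D t -> forall v, V l v -> g t v = ip (h t) (dX l v)}].
Proof.
have [K K0 hK] := rz_le.
have h1 x y : VD x -> VD y -> nrm (rz x - rz y) <= K * dual_norm (V l) nV (x - y).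
  by move=> dx dy; rewrite rzB// hK//; exact: dualB.
move=> /(bochner_zbL2 K0 h1 hK)[w [zw hw ew]]; exists w; split=> //.
apply: (ae_imp ew) => t h /h[dg ->] v Vv; exact: (rzP dg).2.
Qed.

Lemma L2_Vdual_of h : zbL2 T h -> L2_Vdual l T (fun t => fun_of (h t)).
Proof.
move=> zh; apply: (zbL2_bochner (H0 := setT) (phi := fun_of) (C := 1)) => //.
- by move=> x _; exact: dual_fun_of.
- exact: dual_norm_ge0.
- move=> x y _ _; rewrite mul1r (_ : _ - _ = fun_of (x - y)) ?dual_norm_fun_of//.
  by apply/funext => v; rewrite /fun_of ipBl.
- by move=> x _; rewrite mul1r dual_norm_fun_of.
Qed.

End graph_dual.

(** * Multiplication operators *)

Section multiplication.
Context {R : realType} {N : nat}.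
Local Notation mu := (@lebesgue_measure R).
Variables (l : 'I_N -> R) (hl : forall i, 0 < l i).
Local Notation Z := (graph_fun R N).
Local Notation X := (GX (N := N) l).
Implicit Types (b : 'I_N -> R * R -> R) (x : X).

(** The bound holds at every point rather than almost everywhere, so that multiplication is bounded
    at each single time; [cut] provides such a representative of a control. *)
Definition bounded_by (M : R) b := (forall i, measurable_fun setT (b i)) /\
  forall i z, `|b i z| <= M.

Definition mulop b (t : R) x : X :=
  toX l (fun i s => b i (s, t) * (gval x i s : R) : R^o).

Lemma gval_mulop M b t x i s : bounded_by M b ->
  gval (mulop b t x) i s = b i (s, t) * (gval x i s : R).
Proof.
move=> [mb bM]; pose v : Z := fun i s => b i (s, t) * (gval x i s : R).
have hv : graph_sub l v.
  apply/graph_subP => j; have [lx x0] := gvalP x j; split; last first.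
    by move=> r nr; rewrite /v x0// mulr0.
  apply: (bL2_bound (M := M) _ _ lx).
    apply: measurable_SM; apply: measurable_funM.
      exact: (measurableT_comp (mb j) (pair2_measurable t)).
    exact: SM_measurable lx.1.
  by move=> r _; rewrite /v !nrm_RH normrM ler_wpM2r.
have Lv : L2 l v.
  by have := L2_gval (GX_of hv).
rewrite /mulop -/v gval_toX// /edge_restr patchE; case: ifPn => // /negP ns.
by rewrite (gvalP x i).2 ?mulr0// => Ds; apply: ns; exact/mem_set.
Qed.

Lemma gval_mulopB M M' b b' t x i s : bounded_by M b -> bounded_by M' b' ->
  gval (mulop b t x - mulop b' t x) i s = (b i (s, t) - b' i (s, t)) * (gval x i s : R).
Proof.
by move=> hb hb'; rewrite gvalB (gval_mulop t x i s hb) (gval_mulop t x i s hb') mulrBl.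
Qed.

Lemma mulop_nrm M b t x : bounded_by M b -> nrm (mulop b t x) <= M * nrm x.
Proof.
move=> hb; have := hb => -[mb bM]; have [M0|Mn] := leP 0 M; last first.
  have z y : nrm (y : X) = 0.
    rewrite /nrm ip_GX /inner_L2 big1 ?sqrtr0// => i.
    by have := le_lt_trans (bM i (0, 0)) Mn; rewrite normr_lt0.
  by rewrite !z mulr0.
rewrite -ler_sqr ?nnegrE ?nrm_ge0 ?mulr_ge0 ?nrm_ge0// exprMn !sqr_nrm !ip_GX mulr_sumr.
apply: ler_sum => j _; rewrite -RintegralZl//; last exact: (edge_intg _ (ssubP x) (ssubP x)).
apply: le_Rintegral => //.
- exact: (edge_intg _ (ssubP (mulop b t x)) (ssubP (mulop b t x))).
- by apply: intgZ => //; exact: (edge_intg _ (ssubP x) (ssubP x)).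
move=> s _; rewrite (gval_mulop t x j s hb) mulrACA -!expr2 ler_wpM2r ?sqr_ge0//.
by rewrite -real_normK ?num_real// ler_sqr ?nnegrE.
Qed.

Lemma mulop_DZ M b t a x y : bounded_by M b ->
  mulop b t (a *: x + y) = a *: mulop b t x + mulop b t y.
Proof.
move=> hb; apply: GX_eq => i s _; rewrite gvalDZ !(gval_mulop _ _ _ _ hb) gvalDZ; ring.
Qed.

Lemma mulop_adj M b t x y : bounded_by M b -> ip (mulop b t x) y = ip x (mulop b t y).
Proof.
move=> hb; rewrite !ip_GX; apply: eq_bigr => i _; apply: eq_Rint => s _.
by rewrite !(gval_mulop _ _ _ _ hb) mulrCA mulrA.
Qed.

Lemma mulop_comb M M' M'' b b' b'' a t x : bounded_by M b -> bounded_by M' b' ->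
  bounded_by M'' b'' -> (forall i z, b'' i z = a * b i z + b' i z) ->
  mulop b'' t x = a *: mulop b t x + mulop b' t x.
Proof.
move=> hb hb' hb'' E; apply: GX_eq => i s _; rewrite gvalDZ.
by rewrite (gval_mulop _ _ _ _ hb) (gval_mulop _ _ _ _ hb') (gval_mulop _ _ _ _ hb'') E; ring.
Qed.

Definition on_edge (i : 'I_N) (f : R * R -> R) : 'I_N -> R * R -> R :=
  fun j z => if j == i then f z else 0.

Lemma bounded_on_edge M i (f : R * R -> R) : 0 <= M -> measurable_fun setT f ->
  (forall z, `|f z| <= M) -> bounded_by M (on_edge i f).
Proof.
move=> M0 mf fM; split=> [j|j z]; rewrite /on_edge; case: eqP => // _.
by rewrite normr0.
Qed.

Lemma bounded_indic i (B : set (R * R)) : measurable B ->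
  bounded_by 1 (on_edge i (\1_B : R * R -> R)).
Proof.
move=> mB; apply: bounded_on_edge => //.
by move=> z; rewrite indicE; case: (z \in B); rewrite ?normr1 ?normr0.
Qed.

(** Dynkin's pi-lambda theorem. For a rectangle the path takes two values; complements are handled
    by linearity, and countable disjoint unions by dominated convergence in L^2 at each time. *)
Lemma SM_mul_indic i (B : set (R * R)) x : measurable B ->
  SM (fun t => mulop (on_edge i (\1_B : R * R -> R)) t x).
Proof.
have := @dynkin_induction _ (measurableTypeR R * measurableTypeR R)%type
  [set A `*` C | A in measurable & C in measurable]
  (fun B => measurable B -> SM (fun t => mulop (on_edge i (\1_B : R * R -> R)) t x))
  (measurable_prod_measurableType _ _) => ind.
suff: <<s [set A `*` C | A in (@measurable _ (measurableTypeR R)) &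
  C in (@measurable _ (measurableTypeR R))] >> `<=`
  (fun B => measurable B -> SM (fun t => mulop (on_edge i (\1_B : R * R -> R)) t x)).
  by move=> h mB; apply: h => //; rewrite -measurable_prod_measurableType.
apply: ind.
- move=> _ _ [A mA [C mC <-]] [A' mA' [C' mC' <-]].
  exists (A `&` A'); first exact: measurableI.
  by exists (C `&` C'); [exact: measurableI|rewrite setXI].
- move=> _; have -> : (fun t => mulop (on_edge i (\1_setT : R * R -> R)) t x) =
      fun=> mulop (on_edge i (\1_setT : R * R -> R)) 0 x.
    apply/funext => t; apply: GX_eq => j s _.
    by rewrite !(gval_mulop _ _ _ _ (bounded_indic i measurableT)) /on_edge !indicT.
  exact: SM_cst.
- move=> _ [A mA [C mC <-]] mAC.
  have mAT : measurable (A `*` [set: R]) by exact: measurableX.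
  have -> : (fun t => mulop (on_edge i (\1_(A `*` C) : R * R -> R)) t x) =
      fun t => if t \in C then mulop (on_edge i (\1_(A `*` [set: R]) : R * R -> R)) 0 x else 0.
    apply/funext => t; apply: GX_eq => j s _.
    rewrite (gval_mulop _ _ _ _ (bounded_indic i mAC)).
    have h := gval_mulop 0 x j s (bounded_indic i mAT).
    case: ifPn => [/set_mem Ct|/negP nC].
      rewrite h /on_edge !indicE; case: eqP => // _.
      have [As|nA] := pselect (A s); first by rewrite !mem_set.
      by rewrite !memNset// => -[].
    rewrite /on_edge indicE memNset ?mulr0n; last by case=> _ /= Ct; apply: nC; exact/mem_set.
    by case: eqP => _; rewrite mul0r.
  by apply: SM_if => //; exact: SM_cst.
- move=> B' mB' PB _; have -> : (fun t => mulop (on_edge i (\1_(~` B') : R * R -> R)) t x) =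
      fun t => -1 *: mulop (on_edge i (\1_B' : R * R -> R)) t x +
       mulop (on_edge i (\1_setT : R * R -> R)) t x.
    apply/funext => t; apply: (mulop_comb _ _ (bounded_indic i mB')
      (bounded_indic i measurableT) (bounded_indic i (measurableC mB'))) => j z.
    rewrite /on_edge; case: eqP => _; rewrite ?mulr0 ?addr0//.
    by rewrite !indicE in_setC in_setT; case: (z \in B') => /=; ring.
  apply: SM_DZ; first exact: PB.
  have -> : (fun t => mulop (on_edge i (\1_setT : R * R -> R)) t x) =
      fun=> mulop (on_edge i (\1_setT : R * R -> R)) 0 x.
    apply/funext => t; apply: GX_eq => j s _.
    by rewrite !(gval_mulop _ _ _ _ (bounded_indic i measurableT)) /on_edge !indicT.
  exact: SM_cst.
- move=> F mF tF PF mU.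
  pose E n := \big[setU/set0]_(k < n) F k.
  have mE n : measurable (E n) by exact: bigsetU_measurable.
  apply: (@SM_lim _ _ (fun n t => mulop (on_edge i (\1_(E n) : R * R -> R)) t x)).
    elim=> [|n IH].
      have -> : (fun t => mulop (on_edge i (\1_(E 0%N) : R * R -> R)) t x) = fun=> 0.
        apply/funext => t; apply: GX_eq => j s _.
        rewrite (gval_mulop _ _ _ _ (bounded_indic i (mE 0%N))) /on_edge /E big_ord0.
        by rewrite indic0; case: eqP => _; rewrite mul0r.
      exact: SM_cst.
    have -> : (fun t => mulop (on_edge i (\1_(E n.+1) : R * R -> R)) t x) =
        fun t => 1 *: mulop (on_edge i (\1_(E n) : R * R -> R)) t x +
         mulop (on_edge i (\1_(F n) : R * R -> R)) t x.
      apply/funext => t; apply: (mulop_comb _ _ (bounded_indic i (mE n))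
        (bounded_indic i (mF n)) (bounded_indic i (mE n.+1))) => j z.
      rewrite /on_edge; case: eqP => _; last by ring.
      have -> : E n.+1 = E n `|` F n by rewrite /E big_ord_recr.
      rewrite !indicE in_setU; case: (boolP (z \in F n)) => [/set_mem Fz|_]; last first.
        by rewrite orbF mul1r addr0.
      rewrite (_ : z \in E n = false); first by rewrite /= mulr0 add0r.
      apply/negbTE/negP => /set_mem; rewrite /E -bigcup_mkord => -[k /= kn Fkz].
      have := tF k n I I => /(_ (ex_intro _ z (conj Fkz Fz))) kE.
      by move: kn; rewrite kE ltnn.
    by apply: SM_DZ; [exact: IH|exact: (PF n (mF n))].
  move=> t; have bU := bounded_indic i mU; have bE n := bounded_indic i (mE n).
  pose d n s : R := \1_(\bigcup_k F k) (s, t) - \1_(E n) (s, t).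
  have dE n : nrm (mulop (on_edge i (\1_(E n) : R * R -> R)) t x -
      mulop (on_edge i (\1_(\bigcup_k F k) : R * R -> R)) t x) ^+ 2 =
      \int[mu]_s `|d n s ^+ 2 * (gval x i s * gval x i s) - 0|.
    rewrite sqr_nrm ip_GX /inner_L2 (bigD1 i)//= big1 ?addr0; last first.
      move=> j /negbTE ji; transitivity (\int[mu]_(s in `]0, l j[) (0 : R)).
        apply: eq_Rint => s _; rewrite (gval_mulopB t x j s (bE n) bU).
        have z f : on_edge i f j (s, t) = 0 by rewrite /on_edge ji.
        by rewrite !z subrr !mul0r.
      by rewrite (Rint_itv_cst _ (ltW (hl j))) mul0r.
    rewrite -(Rint_D_supp (a := l i)); last first.
      by move=> s nD; rewrite (gvalP x i).2// !mulr0 subrr normr0.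
    apply: eq_Rint => s _; rewrite (gval_mulopB t x i s (bE n) bU).
    have z f : on_edge i f i (s, t) = f (s, t) by rewrite /on_edge eqxx.
    rewrite !z -opprB -/(d n s) subr0 ger0_norm; last by rewrite -expr2 mulr_ge0 ?sqr_ge0.
    move: (d n s) (gval x i s : R) => p q; ring.
  have c : nrm (mulop (on_edge i (\1_(E n) : R * R -> R)) t x -
      mulop (on_edge i (\1_(\bigcup_k F k) : R * R -> R)) t x) ^+ 2 @[n --> \oo] --> (0 : R).
    rewrite (_ : (fun n => _) = fun n =>
      \int[mu]_s `|d n s ^+ 2 * (gval x i s * gval x i s) - 0|); last first.
      by apply/funext => n; exact: dE.
    have mx : measurable_fun setT (gval x i) := SM_measurable (zbL2_SM (gvalP x i)).
    apply: (@dominated_L1 _ _ (fun=> 0) (fun s => gval x i s * gval x i s)) => //.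
    + move=> n; apply: measurable_funM; last exact: measurable_funM.
      apply: measurable_funX; apply: measurable_funB.
        exact: (measurableT_comp (measurable_indic mU) (pair2_measurable t)).
      exact: (measurableT_comp (measurable_indic (mE n)) (pair2_measurable t)).
    + apply: ae_all => s; apply: cvg_near_cst.
      have [[k _ Fk]|nU] := pselect ((\bigcup_k F k) (s, t)).
        exists k.+1 => // n /= kn; rewrite /d !indicE mem_set ?mem_set ?subrr ?expr0n ?mul0r//.
          by rewrite /E -bigcup_mkord; exists k.
        by exists k.
      apply: nearW => n; rewrite /d !indicE memNset// memNset ?subrr ?expr0n ?mul0r//.
      by rewrite /E -bigcup_mkord => -[k _ Fk]; apply: nU; exists k.
    + exact: (zbL2_ip (gvalP x i) (gvalP x i)).
    + apply: ae_all => s n; rewrite normrM -expr2 (ger0_norm (sqr_ge0 (gval x i s))).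
      rewrite ler_piMl ?sqr_ge0// normrX exprn_ile1// /d !indicE.
      by case: (_ \in _); case: (_ \in _) => /=; rewrite ?subrr ?subr0 ?sub0r ?normrN ?normr1 ?normr0.
  apply/ph_cvgP => e e0; have /cvgr0Pnorm_le/(_ _ (exprn_gt0 2 e0))[n0 _ hn0] := c.
  exists n0 => n /hn0 /=; rewrite ger0_norm ?sqr_ge0// ler_sqr ?nnegrE ?nrm_ge0//.
  exact: ltW.
Qed.

(* Bisection: the remainder after [n] steps is bounded by [M / 2 ^ n]. *)
Lemma SM_mul_on_edge i (f : R * R -> R) (M : R) x : measurable_fun setT f ->
  0 <= M -> (forall z, `|f z| <= M) -> SM (fun t => mulop (on_edge i f) t x).
Proof.
move=> mf M0 fM; pose c n : R := M * 2^-1 ^+ n.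
have c0 n : 0 <= c n by rewrite mulr_ge0// exprn_ge0// invr_ge0.
pose r := fix r n : R * R -> R := if n is n'.+1 then
  fun z => r n' z - (c n' / 2) * (2 * \1_[set z | 0 <= r n' z] z - 1) else f.
have mB (g : R * R -> R) : measurable_fun setT g -> measurable [set z | 0 <= g z].
  move=> mg; have := mg measurableT `[0, +oo[%classic (measurable_itv _).
  rewrite setTI; congr measurable; apply/seteqP; split=> z /=; rewrite in_itv /= andbT//.
have mr n : measurable_fun setT (r n).
  elim: n => //= n IH; apply: measurable_funB => //; apply: measurable_funM => //.
  apply: measurable_funB => //; apply: measurable_funM => //; apply: measurable_indic.
  exact: mB.
have rc n z : `|r n z| <= c n.
  elim: n => [|n IH]; first by rewrite /c expr0 mulr1.
  move: IH; rewrite /= /c exprS ler_norml => /andP[h1 h2]; rewrite indicE.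
  have e : M * (2^-1 * 2^-1 ^+ n) = c n / 2 by rewrite /c; field.
  rewrite e -/(c n); rewrite -/(c n) in h1 h2; rewrite ler_norml.
  case: (boolP (_ \in _)) => [/set_mem|/negP nz] /=.
    by move=> /= rp; apply/andP; split; lra.
  have rn : r n z < 0 by rewrite ltNge; apply/negP => ?; apply: nz; apply/mem_set.
  by apply/andP; split; lra.
have br n : bounded_by (c n) (on_edge i (r n)) by exact: bounded_on_edge.
have bs n : bounded_by (M + c n) (on_edge i (fun z => f z - r n z)).
  apply: bounded_on_edge => [||z]; first exact: addr_ge0.
    by apply: measurable_funB.
  by rewrite (le_trans (ler_normB _ _))// lerD.
have bf : bounded_by M (on_edge i f) by exact: bounded_on_edge.
apply: (@SM_lim _ _ (fun n t => mulop (on_edge i (fun z => f z - r n z)) t x)).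
  elim=> [|n IH].
    have -> : (fun t => mulop (on_edge i (fun z => f z - r 0%N z)) t x) = fun=> 0.
      apply/funext => t; apply: GX_eq => j s _; rewrite (gval_mulop _ _ _ _ (bs 0%N)).
      by rewrite /on_edge /= subrr; case: eqP => _; rewrite mul0r.
    exact: SM_cst.
  have m1 := mB _ (mr n).
  have b1 := bounded_indic i m1; have bT := bounded_indic i (@measurableT _ (R * R)%type).
  pose g z : R := (c n / 2) * (2 * \1_[set z | 0 <= r n z] z - 1).
  have bg : bounded_by (c n / 2) (on_edge i g).
    apply: bounded_on_edge; first by rewrite divr_ge0.
      apply: measurable_funM => //; apply: measurable_funB => //; apply: measurable_funM => //.
    move=> z; rewrite /g normrM ger0_norm ?divr_ge0// ler_piMr ?divr_ge0// indicE.
    case: (_ \in _) => /=; rewrite ?mulr1 ?mulr0 ?sub0r ?normrN ?normr1//.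
    by rewrite (_ : 2 - 1 = 1) ?normr1//; ring.
  have -> : (fun t => mulop (on_edge i (fun z => f z - r n.+1 z)) t x) =
      fun t => 1 *: mulop (on_edge i (fun z => f z - r n z)) t x + mulop (on_edge i g) t x.
    apply/funext => t; apply: (mulop_comb _ _ (bs n) bg (bs n.+1)) => j z.
    by rewrite /on_edge; case: eqP => _; [rewrite /= /g; ring|ring].
  apply: SM_DZ; first exact: IH.
  have -> : (fun t => mulop (on_edge i g) t x) = fun t =>
     (c n) *: mulop (on_edge i (\1_[set z | 0 <= r n z] : R * R -> R)) t x +
     (- (c n / 2)) *: mulop (on_edge i (\1_setT : R * R -> R)) t x.
    apply/funext => t; apply: GX_eq => j s _; rewrite gvalDZ.
    rewrite -[(- _) *: mulop _ _ _]addr0 gvalDZ.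
    rewrite (gval_mulop _ _ _ _ bg) (gval_mulop _ _ _ _ b1) (gval_mulop _ _ _ _ bT).
    have -> : gval (0 : X) j s = 0 by [].
    by rewrite /on_edge /g indicT; case: eqP => _ /=; field.
  by apply: SM_DZ; [exact: SM_mul_indic|apply: SMZ; exact: SM_mul_indic].
move=> t; apply: (cvg0_le (g := fun n => c n * nrm x)).
  move=> n; rewrite nrm_ge0 /= nrmBC.
  have -> : mulop (on_edge i f) t x - mulop (on_edge i (fun z => f z - r n z)) t x =
      mulop (on_edge i (r n)) t x.
    apply: GX_eq => j s _; rewrite gvalB.
    rewrite (gval_mulop _ _ _ _ bf) (gval_mulop _ _ _ _ (bs n)) (gval_mulop _ _ _ _ (br n)).
    by rewrite /on_edge; case: eqP => _; ring.
  exact: mulop_nrm.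
rewrite -[X in _ --> X](mul0r (nrm x)); apply: cvgM; last exact: cvg_cst.
rewrite -[X in _ --> X](mulr0 M); apply: cvgM; first exact: cvg_cst.
by apply: cvg_expr; rewrite gtr0_norm ?invr_gt0// invf_lt1// ltr1n.
Qed.

Lemma SM_sum (I : Type) (s : seq I) (f : I -> R -> X) :
  (forall i, SM (f i)) -> SM (fun t => \sum_(i <- s) f i t).
Proof.
move=> mf; elim: s => [|i s IH].
  by under eq_fun do rewrite big_nil; exact: SM_cst.
by under eq_fun do rewrite big_cons; exact: SMD.
Qed.

Lemma SM_mulop M b x : 0 <= M -> bounded_by M b -> SM (fun t => mulop b t x).
Proof.
move=> M0 hb; have [mb bM] := hb.
have -> : (fun t => mulop b t x) = fun t => \sum_i mulop (on_edge i (b i)) t x.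
  apply/funext => t; apply: GX_eq => j s _; rewrite (gval_mulop _ _ _ _ hb).
  have E (r : seq 'I_N) (F : 'I_N -> X) : gval (\sum_(i <- r) F i) j s = \sum_(i <- r) gval (F i) j s.
    elim: r => [|i r IH]; first by rewrite !big_nil.
    rewrite !big_cons -IH -[in LHS](scale1r (F i)) gvalDZ mul1r.
    by [].
  rewrite E (bigD1 j)//= big1 ?addr0 => [|i /negbTE ij].
    by rewrite (gval_mulop _ _ _ _ (bounded_on_edge j M0 (mb j) (bM j))) /on_edge eqxx.
  rewrite (gval_mulop _ _ _ _ (bounded_on_edge i M0 (mb i) (bM i))) /on_edge.
  by rewrite eq_sym ij mul0r.
by apply: SM_sum => i; exact: (SM_mul_on_edge _ _ (mb i) M0 (bM i)).
Qed.

End multiplication.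

(** * Controls *)

Import HBNNSimple.

Section almost_everywhere_integrals.
Context {R : realType}.
Local Notation mu := (@lebesgue_measure R).

(** Valid without measurability of [f] and [g]: a simple function below [f] may be set to 0 on the
    null set without changing its integral, and is then below [g]. *)
Let nn_le_ae (f g : R -> \bar R) : (forall t, 0 <= f t)%E -> (forall t, 0 <= g t)%E ->
  {ae mu, forall t, f t = g t} -> (\int[mu]_t f t <= \int[mu]_t g t)%E.
Proof.
move=> f0 g0 [B [mB B0 hB]].
rewrite (@ge0_integralTE _ (measurableTypeR R))// (@ge0_integralTE _ (measurableTypeR R))//.
apply: ge_ereal_sup => _ [h /= hf <-].
have mC : measurable (~` B) by exact: measurableC.
have -> : sintegral mu h = sintegral mu (proj_nnsfun h mC).
  rewrite -(@integralT_nnsfun _ (measurableTypeR R)) -(@integralT_nnsfun _ (measurableTypeR R)).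
  apply: ae_eq_integral => //.
  - exact/measurable_EFinP.
  - exact/measurable_EFinP.
  - exists B; split=> // t /= ht; apply: contrapT => nB; apply: ht => _.
    by rewrite /= mindicE mem_set// mulr1.
apply: ereal_sup_ubound; exists (proj_nnsfun h mC) => // t.
rewrite /= mindicE; have [Bt|nB] := pselect (B t).
  by rewrite memNset ?mulr0//= => /(_ Bt).
rewrite mem_set// mulr1 (le_trans (hf t))// le_eqVlt; apply/orP; left; apply/eqP.
by apply: contrapT => n; apply: nB; exact: hB.
Qed.

(** Allows arbitrary representatives to be exchanged inside the integrals that define the cost and
    the weak equations, where measurability of the original integrand is not at hand. *)
Lemma Rint_ae_eq (A : set R) (f g : R -> R) : {ae mu, forall t, A t -> f t = g t} ->
  \int[mu]_(t in A) f t = \int[mu]_(t in A) g t.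
Proof.
move=> fg.
rewrite /Rintegral; congr fine.
rewrite (@integral_mkcond _ (measurableTypeR R)) [RHS](@integral_mkcond _ (measurableTypeR R)).
rewrite integralE [RHS]integralE.
have E (p q : R -> \bar R) : (forall t, 0 <= p t)%E -> (forall t, 0 <= q t)%E ->
    {ae mu, forall t, p t = q t} -> (\int[mu]_t p t = \int[mu]_t q t)%E.
  move=> p0 q0 pq; apply/eqP; rewrite eq_le !nn_le_ae//.
  by apply: (ae_imp pq) => t ->.
have fg' : {ae mu, forall t, ((EFin \o f) \_ A) t = ((EFin \o g) \_ A) t}.
  by apply: (ae_imp fg) => t h; rewrite !patchE; case: ifPn => // /set_mem /h /= ->.
congr (_ - _)%E; apply: E => //.
- by apply: (ae_imp fg') => t h; rewrite !funeposE; congr maxe.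
- by apply: (ae_imp fg') => t h; rewrite !funenegE h.
Qed.

(** By Tonelli, almost every section of a measurable null set is null. *)
Lemma ae_sections (P : R * R -> Prop) : {ae (mu \x mu)%E, forall z, P z} ->
  {ae mu, forall t, {ae mu, forall x, P (x, t)}}.
Proof.
move=> [B [mB B0 hB]].
have mi : measurable_fun setT (fun z : R * R => (\1_B z)%:E : \bar R).
  exact/measurable_EFinP/measurable_indic.
have i0 : forall z : R * R, (0 <= (\1_B z)%:E :> \bar R)%E by move=> z; rewrite lee_fin.
have := @fubini_tonelli2 _ _ (measurableTypeR R) (measurableTypeR R) R mu mu _ mi i0.
have e0 : (\int[mu \x mu]_z (\1_B z)%:E = 0)%E.
  by rewrite integral_indic// setIT; exact: B0.
rewrite e0 => /esym G0.
have mG := @measurable_fun_fubini_tonelli_G _ _ (measurableTypeR R) (measurableTypeR R) R mu _ mi i0.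
have G00 y : (0 <= fubini_G mu (fun z : R * R => (\1_B z)%:E) y)%E.
  by apply: integral_ge0 => x _; exact: i0.
have h : (\int[mu]_t `|fubini_G mu (fun z : R * R => (\1_B z)%:E) t| = 0)%E.
  by rewrite -[RHS]G0; apply: eq_integral => t _; rewrite gee0_abs.
have {}h := (@ae_eq_integral_abs _ (measurableTypeR R) R mu _ measurableT _ mG).1 h.
apply: (ae_imp h) => t ht; have {ht} := ht I => /= ht.
pose Bt := ysection B t; have mBt : measurable Bt by exact: measurable_ysection.
exists Bt; split=> //.
  rewrite -ht /fubini_G /=.
  rewrite (eq_integral (fun x => (\1_Bt x)%:E)); last first.
    by move=> x _; rewrite !indicE /Bt mem_ysection.
  by rewrite integral_indic// setIT.
by move=> x /= nP; rewrite /Bt /ysection /=; apply/mem_set; exact: hB.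
Qed.

End almost_everywhere_integrals.

Section controls.
Context {R : realType} {N : nat}.
Local Notation mu := (@lebesgue_measure R).
Local Notation mu2 := (mu \x mu)%E.
Variables (l : 'I_N -> R) (T : R).
Implicit Types u : control R N.

Definition uQ u i : R * R -> R := (u i : R * R -> R) \_ (Q l T i).

Lemma Linfty_measurable u i : Linfty l T u -> measurable_fun setT (uQ u i).
Proof. by move=> /(_ i) /sub_Lfun_mfun; rewrite inE. Qed.

Lemma ae2_imp (P P' : R * R -> Prop) : {ae mu2, forall z, P z} ->
  (forall z, P z -> P' z) -> {ae mu2, forall z, P' z}.
Proof.
by move=> h PP; apply: filterS h; first exact: (ae_filter_ringOfSetsType mu2).
Qed.

Lemma Lnorm_bound (f : R * R -> R) : f \in Lfun mu2 +oo%E ->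
  0 <= fine ('N[mu2]_+oo%E[EFin \o f])%E /\
  {ae mu2, forall z, `|f z| <= fine ('N[mu2]_+oo%E[EFin \o f])%E}.
Proof.
move=> /sub_Lfun_finLfun; rewrite inE /= /finite_norm => foo.
have n0 : (0 <= 'N[mu2]_+oo%E[EFin \o f])%E by exact: Lnorm_ge0.
split; first exact: fine_ge0.
have fn : ('N[mu2]_+oo%E[EFin \o f])%E \is a fin_num by rewrite ge0_fin_numE.
move: fn; rewrite unlock; case: ifPn => [_ fn|mu0 _].
  apply: (ae2_imp (ess_sup_inf.ess_sup_ge mu2 (abse \o (EFin \o f)))) => z.
  by rewrite -{1}(fineK fn) /= lee_fin.
exists setT; split=> //.
by apply/eqP; rewrite eq_le measure_ge0 andbT leNgt.
Qed.

Lemma Linfty_bound u i : Linfty l T u ->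
  {ae mu2, forall z, `|uQ u i z| <= norm_Linfty l T u}.
Proof.
move=> Lu; have [n0 h] := Lnorm_bound (Lu i).
apply: (ae2_imp h) => z /le_trans; apply.
rewrite /norm_Linfty (bigD1 i)//= lerDl; apply: sumr_ge0 => j _.
by have [] := Lnorm_bound (Lu j).
Qed.

Lemma norm_Linfty_ge0 u : Linfty l T u -> 0 <= norm_Linfty l T u.
Proof. by move=> Lu; apply: sumr_ge0 => i _; have [] := Lnorm_bound (Lu i). Qed.

(** Truncation at the L^oo norm alters the control inside the space-time domain on a null set only,
    and produces a measurable coefficient bounded everywhere. *)
Definition cut u i (z : R * R) : R :=
  uQ u i z * \1_[set z | `|uQ u i z| <= norm_Linfty l T u] z.

Lemma bounded_cut u : Linfty l T u -> bounded_by (norm_Linfty l T u) (cut u).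
Proof.
move=> Lu; split=> [i|i z].
  apply: measurable_funM; first exact: Linfty_measurable.
  apply: measurable_indic; rewrite -[X in measurable X]setTI.
  have mn : measurable_fun setT (fun z => `|uQ u i z|).
    by apply: measurableT_comp => //; exact: Linfty_measurable.
  have := mn measurableT `]-oo, norm_Linfty l T u]%classic (measurable_itv _).
  by congr measurable; apply/seteqP; split=> z /= [_]; rewrite in_itv /=.
rewrite /cut indicE; case: (boolP (_ \in _)) => [/set_mem /=|_]; rewrite ?mulr1//.
by rewrite mulr0 normr0; exact: norm_Linfty_ge0.
Qed.

Lemma cut_ae u : Linfty l T u -> {ae mu, forall t, `]0, T[%classic t ->
  forall i, {ae mu, forall x, `]0, l i[%classic x -> cut u i (x, t) = u i (x, t)}}.
Proof.
move=> Lu.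
have h : {ae mu, forall t, forall i, {ae mu, forall x, `|uQ u i (x, t)| <= norm_Linfty l T u}}.
  by apply: ae_fin => i; exact: ae_sections (Linfty_bound i Lu).
apply: (ae_imp h) => t ht Dt i; apply: (ae_imp (ht i)) => x hx Dx.
by rewrite /cut indicE mem_set// mulr1 /uQ patchE mem_set.
Qed.

End controls.

(** * Abstract parabolic equations *)

Section scalar_products.
Context {R : realType} {X : preHilbert R}.
Local Notation mu := (@lebesgue_measure R).
Variables (T : R).
Local Notation D := `]0%R, T[%classic.

Lemma ip_lop_bound (om : X) : exists M, forall x, nrm (ip x om : @RH R) <= M * nrm x.
Proof. by exists (nrm om) => x; rewrite nrm_RH mulrC normr_ip_le. Qed.

Definition ip_lop (om : X) : linop X (@RH R) :=
  @LinOp R X RH (fun x => ip x om) (fun a x y => ipDZl a x y om) (ip_lop_bound om).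

Lemma zbL2_lop (H' : preHilbert R) (h : linop X H') (f : R -> X) :
  zbL2 T f -> zbL2 T (fun t => h (f t)).
Proof.
by move=> [lf f0]; split=> [|t /f0 ->]; [exact: bL2_lop|exact: lop0].
Qed.

Lemma zbL2_ip_om (f : R -> X) om : zbL2 T f -> zbL2 (H := @RH R) T (fun t => ip (f t) om : R).
Proof. exact: (zbL2_lop (ip_lop om)). Qed.

Lemma intg_continuous_mul (psi ga : R -> R) : continuous psi -> zbL2 (H := @RH R) T ga ->
  intg D (fun t => psi t * ga t).
Proof.
move=> cpsi zga; have zp : zbL2 (H := @RH R) T (fun t => if t \in D then psi t else 0).
  apply: (continuous_zbL2 cpsi) => t ht; first by rewrite mem_set//= in_itv.
  by rewrite memNset//= in_itv.
apply: (eq_intg _ _ (intgT _ (zbL2_ip zp zga))) => // t Dt.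
by rewrite /= mem_set.
Qed.

End scalar_products.

Section parabolic.
Context {R : realType} {X : preHilbert R} (cX : ph_complete X).
Local Notation mu := (@lebesgue_measure R).
Variables (T : R) (T0 : 0 < T).
Local Notation D := `]0%R, T[%classic.
Variables (P Pa : linop X X).
Hypothesis PPa : forall x y, ip (P x) y = ip x (Pa y).
Variables (I : finType) (c : I -> X).
Local Notation H0 := (orth_set c).
Hypothesis dense : forall z, (forall om, H0 om -> ip z (P om) = 0) -> nrm z = 0.

(** Tests with support inside []0, T[] give the differential equation through du Bois-Reymond; a
    test that is nonzero at time 0 then identifies the initial value, first against [P om], hence
    fully by density of these vectors. *)
Lemma weak_evolves (w g : R -> X) z0 : zbL2 T w -> zbL2 T g -> (forall t, H0 (w t)) ->
  (forall psi dpsi om, C1 psi dpsi -> psi T = 0 -> H0 om ->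
    \int[mu]_(t in D) (dpsi t * ip (P (w t)) (P om)) =
    - (\int[mu]_(t in D) (psi t * ip (g t) om)) - psi 0 * ip z0 (P om)) ->
  evolves T P H0 w g /\ forall zc, crep T zc (fun t => P (w t)) -> nrm (zc 0 - z0) = 0.
Proof.
move=> zw zg hw weak.
pose ga om t : R := ip (g t) om; pose v om t : R := ip (P (w t)) (P om).
have zga om : zbL2 (H := @RH R) T (ga om) by exact: zbL2_ip_om.
have zv om : zbL2 (H := @RH R) T (v om) by apply: zbL2_ip_om; exact: zbL2_lop.
have exk om : H0 om -> exists k, {ae mu, forall t, D t -> v om t = k + cumul (ga om) t}.
  move=> hom; apply: (du_bois_reymond T0 (zv om) (zga om)) => psi tp.
  have z := test_function_derive0 tp.
  have e0 : psi 0 = 0 by apply: (z 0 _).1; rewrite ltxx.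
  have eT : psi T = 0 by apply: (z T _).1; rewrite ltxx andbF.
  have := weak psi (derive1 psi) om (test_function_C1 tp) eT hom.
  rewrite e0 mul0r subr0 => h.
  rewrite (@eq_Rint _ _ _ (fun t => derive1 psi t * ip (P (w t)) (P om))); last first.
    by move=> t _; rewrite /v mulrC.
  by rewrite h; congr (- _); apply: eq_Rint => t _; rewrite /ga mulrC.
have ev : evolves T P H0 w g by split.
split=> // zc hzc; apply: dense => om hom; rewrite ipBl.
have [k hk] := exk om hom.
(* The affine test with value 1 at time 0 and 0 at time [T]. *)
pose psi t : R := - T^-1 * t + 1.
have Cpsi : C1 psi (fun=> - T^-1).
  have Cid : C1 (fun t : R => t) (fun=> 1).
    by split=> [x|x]; [exact: is_derive_id|exact: cst_continuous].
  have := C1D (C1Z (- T^-1) Cid) (C1_cst 1).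
  by under [X in C1 _ X]eq_fun do rewrite mulr1 addr0.
have psiT : psi T = 0 by rewrite /psi mulNr mulVf ?gt_eqF// addNr.
have psi0 : psi 0 = 1 by rewrite /psi mulr0 add0r.
have := weak psi _ om Cpsi psiT hom; rewrite psi0 mul1r => W.
pose g2 t : R := if t \in D then - T^-1 else 0.
have zg2 : zbL2 (H := @RH R) T g2.
  apply: (@continuous_zbL2 R T (fun=> - T^-1)) => [t|t ht|t ht]; first exact: cvg_cst.
    by rewrite /g2 mem_set//= in_itv.
  by rewrite /g2 memNset//= in_itv.
have i2 := zbL2_intg zg2.
have cg2 t : 0 <= t <= T -> cumul g2 t = - T^-1 * t.
  move=> /andP[t0 tT]; rewrite (cumul_supp _ i2 (zb_out zg2)).
  case: leP => [tn|tp]; first by have -> : t = 0; [lra|rewrite mulr0].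
  rewrite tT (@eq_Rint _ _ _ (fun=> - T^-1)); first by rewrite Rint_itv_cst.
  move=> s; rewrite /= in_itv /= => /andP[s0 st].
  by rewrite /g2 mem_set//= in_itv /= s0 (lt_le_trans st).
have := ibp_cumul T0 k 1 (zga om) zg2.
have TT : 0 <= T <= T by rewrite lexx ltW.
rewrite (cg2 T TT) mulNr mulVf ?gt_eqF// subrr mulr0 sub0r mulr1 => B.
have E : \int[mu]_(t in D) (ga om t * (1 + cumul g2 t) + g2 t * (k + cumul (ga om) t)) =
    \int[mu]_(t in D) (psi t * ga om t) + \int[mu]_(t in D) (- T^-1 * v om t).
  rewrite -RintegralD//; last 2 first.
  - exact: (intg_continuous_mul (C1_continuous Cpsi) (zga om)).
  - by apply: intgZ => //; exact: (intgT _ (zbL2_intg (zv om))).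
  apply: Rint_ae_eq; apply: (ae_imp hk) => t h Dt; rewrite h//.
  have tT : 0 <= t <= T by move: Dt; rewrite /= in_itv /= => /andP[? ?]; rewrite !ltW.
  by rewrite cg2// /g2 mem_set// /psi; ring.
have zk : k = ip z0 (P om) by move: B; rewrite E W; lra.
have T00 : (0 : R) <= 0 <= T by rewrite lexx ltW.
have c0 : cumul (ga om) 0 = 0.
  by have [] := cumul_end T0 (zbL2_intg (zga om)) (zb_out (zga om)).
have h0 : {ae mu, forall t, D t -> ip (zc 0) (P om) = k}.
  apply: (ae_imp2 hk hzc.2) => t h1 h2 Dt.
  have tT : 0 <= t <= T by move: Dt; rewrite /= in_itv /= => /andP[? ?]; rewrite !ltW.
  have := crep_pairing T0 ev hzc hom T00 tT; rewrite -/(ga om) c0.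
  have := nrm_eq0_ip (P om) (h2 Dt); rewrite ipBl -/(v om t) h1//; lra.
have [s [_ _ hs]] := ae_near T0 h0 T00 T0.
by rewrite hs zk subrr.
Qed.

Variables (K Ka : R -> linop X X) (M c0 lam : R).
Hypothesis KKa : forall t x y, ip (K t x) y = ip x (Ka t y).
Hypothesis Kb : forall t x, nrm (K t x) <= M * nrm x.
Hypothesis Km : forall x, SM (fun t => K t x).
Hypothesis Kab : forall t x, nrm (Ka t x) <= M * nrm x.
Hypothesis Kam : forall x, SM (fun t => Ka t x).
Hypothesis c00 : 0 < c0.
Hypothesis lam0 : 0 <= lam.
Hypothesis coer : forall t w, H0 w ->
  c0 * nrm w ^+ 2 <= ip (K t w) w + lam * nrm (P w) ^+ 2.

Lemma zbL2_opfam w : zbL2 T w -> zbL2 T (fun t => K t (w t)).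
Proof.
move=> [lw w0]; split; last by move=> t /w0 ->; rewrite lop0.
apply: (bL2_bound (M := M) _ _ lw); last by move=> t _; exact: Kb.
apply: (SM_op _ Km (bL2_SM lw)) => t; exists M => x y; rewrite -lopB; exact: Kb.
Qed.

Theorem parabolic_existence (F : R -> X) z0 : zbL2 T F -> exists w,
  evolves T P H0 w (fun t => F t - K t (w t)) /\
  forall zc, crep T zc (fun t => P (w t)) -> nrm (zc 0 - z0) = 0.
Proof.
move=> zF.
have [w0 [lw0 hw0 weak]] := lions_existence cX T0 PPa KKa Kab Kam c00 lam0 coer zF.1 z0.
(* Lions' solution satisfies the constraints at almost every time only; it is set to 0 at the
   others, since [evolves] asks for them at all times. *)
pose A := D `&` [set t | forall i, ip (c i) (w0 t) = 0].
have mA : measurable A.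
  apply: measurableI => //.
  rewrite (_ : [set t | _] = \bigcap_(i in [set: I]) [set t | ip (c i) (w0 t) = 0]); last first.
    by apply/seteqP; split=> [t h i _|t h]; [exact: h|move=> i; have := h i; apply].
  apply: fin_bigcap_measurable => // i _.
  have mi : measurable_fun setT (fun t => ip (c i) (w0 t)).
    by apply: measurable_ip; [exact: SM_cst|exact: bL2_SM lw0].
  by have := mi measurableT [set 0] (measurable_set1 _); rewrite setTI.
pose w t := if t \in A then w0 t else 0.
have ww0 : {ae mu, forall t, D t -> w t = w0 t}.
  by apply: (ae_imp hw0) => t h Dt; rewrite /w mem_set//; split=> //; exact: h.
have hw t : H0 (w t).
  by rewrite /w; case: ifPn => [/set_mem[_ h]|_] //; exact: orth_set0.
have zw : zbL2 T w.
  split; last by move=> t nt; rewrite /w memNset// => -[].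
  apply: (bL2_bound (M := 1) _ _ lw0).
    by apply: SM_if => //; [exact: bL2_SM lw0|exact: SM_cst].
  by move=> t _; rewrite mul1r /w; case: ifP => _ //; rewrite nrm0 nrm_ge0.
exists w; apply: weak_evolves => //; first exact: (zbL2B zF (zbL2_opfam zw)).
move=> psi dpsi om Cpsi psiT hom; have := weak psi dpsi om Cpsi psiT hom.
have cpsi := C1_continuous Cpsi.
have zKw := zbL2_opfam zw.
have i1 := intg_continuous_mul cpsi (zbL2_ip_om om zKw).
have i2 := intg_continuous_mul cpsi (zbL2_ip_om om zF).
have i3 := intg_continuous_mul Cpsi.2 (zbL2_ip_om (P om) (zbL2_lop P zw)).
have -> : \int[mu]_(t in D) (psi t * ip (K t (w0 t)) om - dpsi t * ip (P (w0 t)) (P om)) =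
    \int[mu]_(t in D) (psi t * ip (K t (w t)) om) -
    \int[mu]_(t in D) (dpsi t * ip (P (w t)) (P om)).
  rewrite -RintegralB//; apply: Rint_ae_eq; apply: (ae_imp ww0) => t h Dt.
  by rewrite h.
have -> : \int[mu]_(t in D) (psi t * ip (F t - K t (w t)) om) =
    \int[mu]_(t in D) (psi t * ip (F t) om) - \int[mu]_(t in D) (psi t * ip (K t (w t)) om).
  by rewrite -RintegralB//; apply: eq_Rint => t _; rewrite ipBl mulrBr.
lra.
Qed.

(** The derivative of [exp (-B t) * cumul y t] is at most [A] almost everywhere. Integrating it uses
    [ibp_cumul], since [cumul y] is only absolutely continuous. *)
Lemma gronwall (y : R -> R) A B : zbL2 (H := @RH R) T y -> 0 <= A -> 0 <= B ->
  {ae mu, forall t, D t -> y t <= A + B * cumul y t} ->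
  cumul y T <= A * T * expR (B * T).
Proof.
move=> zy A0 B0 hy; pose e t := expR (- B * t); pose de t := - B * expR (- B * t).
have Ce : C1 e de by exact: C1_expR.
pose g t : R := if t \in D then de t else 0.
have zg : zbL2 (H := @RH R) T g.
  apply: (continuous_zbL2 Ce.2) => t ht; first by rewrite /g mem_set//= in_itv.
  by rewrite /g memNset//= in_itv.
have cg t : 0 <= t <= T -> 1 + cumul g t = e t.
  move=> /andP[t0 tT]; have e0 : e 0 = 1 by rewrite /e mulr0 expR0.
  rewrite (cumul_supp _ (zbL2_intg zg) (zb_out zg)).
  case: leP => [tn|tp]; first by have -> : t = 0; [lra|rewrite e0 addr0].
  rewrite tT (@eq_Rint _ _ _ de); first by rewrite (C1_FTC tp Ce) e0; ring.
  move=> s; rewrite /= in_itv /= => /andP[s0 st].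
  by rewrite /g mem_set//= in_itv /= s0 (lt_le_trans st).
have := ibp_cumul T0 0 1 zy zg; rewrite mul0r subr0 add0r.
have TT : 0 <= T <= T by rewrite lexx ltW.
rewrite (cg T TT) => E.
have le : cumul y T * e T <= A * T.
  rewrite -E -(Rint_itv_cst A (ltW T0)).
  have [zG _ _ _] := cumul_evolves 1 zg; have [zY _ _ _] := cumul_evolves 0 zy.
  apply: Rint_le_ae => //.
  - apply: intgD => //.
      by apply: (eq_intg _ _ (intgT _ (zbL2_ip zy zG))) => // t Dt; rewrite /= mem_set.
    by apply: (eq_intg _ _ (intgT _ (zbL2_ip zg zY))) => // t Dt; rewrite /= mem_set.
  - exact: intg_itv_cst.
  - apply: (ae_imp hy) => t h Dt.
    have tT : 0 < t < T by move: Dt; rewrite /= in_itv.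
    rewrite cg; last by case/andP: tT => ? ?; rewrite !ltW.
    rewrite /g mem_set// /de add0r -/(e t).
    have et : 0 < e t <= 1.
      rewrite expR_gt0 -expR0 ler_expR mulNr oppr_le0 mulr_ge0//; lra.
    have := h Dt; move: et => /andP[e1 e2]; nra.
have eT : expR (B * T) * e T = 1 by rewrite /e -expRD mulNr subrr expR0.
have ep : 0 < expR (B * T) by exact: expR_gt0.
have -> : cumul y T = cumul y T * e T * expR (B * T) by rewrite -mulrA (mulrC (e T)) eT mulr1.
by rewrite ler_pM2r.
Qed.

Lemma cumul_le (f g : R -> R) t : intg setT f -> intg setT g ->
  (forall s, f s <= g s) -> cumul f t <= cumul g t.
Proof.
move=> If Ig fg; apply: Rint_le_ae => //; [exact: intgT|exact: intgT|].
by apply: ae_all => s _; exact: fg.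
Qed.

Lemma cumul_ge0_le (f : R -> R) s t : intg setT f -> (forall s, 0 <= f s) -> s <= t ->
  cumul f s <= cumul f t.
Proof.
by move=> If f0 st; rewrite -subr_ge0 cumulB//; apply: Rintegral_ge0 => r _; exact: f0.
Qed.

(** The last factor comes from Gronwall's lemma, which bounds the integral of [|P w|^2] by
    [T exp (2 lam T)] times the data; this integral enters the energy identity with coefficient
    [2 lam]. *)
Lemma energy_estimate F w zc : zbL2 T F ->
  evolves T P H0 w (fun t => F t - K t (w t)) -> crep T zc (fun t => P (w t)) ->
  ip (zc T) (zc T) + c0 * \int[mu]_(t in D) ip (w t) (w t) <=
  (ip (zc 0) (zc 0) + c0^-1 * \int[mu]_(t in D) ip (F t) (F t)) *
  (1 + 2 * lam * T * expR (2 * lam * T)).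
Proof.
move=> zF ev hzc; have [zw zg hw _] := ev.
have H0D x y : H0 x -> H0 y -> H0 (x + y).
  by move=> hx hy i; rewrite ipDr hx hy addr0.
pose gw s := ip (F s - K s (w s)) (w s).
have Igw : intg setT gw := zbL2_ip zg zw.
have IFF := zbL2_ip zF zF; have Iww := zbL2_ip zw zw.
have zPw := zbL2_lop P zw; have IPP := zbL2_ip zPw zPw.
set FF := (fun t => ip (F t) (F t)) in IFF; set ww := (fun t => ip (w t) (w t)) in Iww.
set PP := (fun t => ip (P (w t)) (P (w t))) in IPP.
have T00 : (0 : R) <= 0 <= T by rewrite lexx ltW.
have TT : 0 <= T <= T by rewrite lexx ltW.
have E t : 0 <= t <= T -> ip (zc t) (zc t) = ip (zc 0) (zc 0) + 2 * cumul gw t.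
  move=> tT; have := crep_energy T0 ev hzc T00 tT; rewrite -/gw.
  have gw0 r : ~ (0 < r < T) -> gw r = 0.
    by move=> nr; rewrite /gw (zw.2 r) ?ip0r//= in_itv.
  have [-> _] := cumul_end T0 Igw gw0; lra.
have gwle s : gw s <= (2 * c0)^-1 * FF s + (- (c0 / 2) * ww s + lam * PP s).
  have := coer s (hw s); rewrite !sqr_nrm -/(ww s) -/(PP s).
  (* Young's inequality, weighted so as to consume half of the coercivity constant [c0]. *)
  have : ip (F s) (w s) <= (2 * c0)^-1 * FF s + c0 / 2 * ww s.
    have := ip_ge0 (c0^-1 *: F s - w s).
    rewrite ipBl !ipBr !ipZl !ipZr (ipC (w s)) -/(FF s) -/(ww s) => h.
    have := mulr_ge0 (ltW c00) h.
    rewrite (_ : c0 * (_ - _ - _) = c0^-1 * FF s - 2 * ip (F s) (w s) + c0 * ww s); last first.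
      by field; rewrite gt_eqF.
    rewrite (_ : (2 * c0)^-1 = c0^-1 / 2); last by field; rewrite gt_eqF.
    lra.
  rewrite /gw ipBl; lra.
have Cle t : cumul gw t <= (2 * c0)^-1 * cumul FF t + (- (c0 / 2) * cumul ww t + lam * cumul PP t).
  have I2 : intg setT (fun s => lam * PP s) by exact: intgZ.
  have I3 : intg setT (fun s => - (c0 / 2) * ww s + lam * PP s).
    by apply: intgD => //; apply: intgZ.
  have I4 : intg setT (fun s => (2 * c0)^-1 * FF s + (- (c0 / 2) * ww s + lam * PP s)).
    by apply: intgD => //; apply: intgZ.
  have := cumul_le t Igw I4 gwle; rewrite cumulDZ// cumulDZ//.
  have -> : cumul (fun s => lam * PP s) t = lam * cumul PP t.
    have -> : lam * cumul PP t = (lam - 1) * cumul PP t + cumul PP t by ring.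
    by rewrite -cumulDZ//; congr cumul; apply/funext => s; ring.
  by [].
(* The right-hand side of the energy identity: a continuous function of time that agrees with
   [|P w|^2] almost everywhere. *)
pose y t : R := if t \in D then ip (zc 0) (zc 0) + 2 * cumul gw t else 0.
have zy : zbL2 (H := @RH R) T y.
  apply: (@continuous_zbL2 R T (fun t => ip (zc 0) (zc 0) + 2 * cumul gw t)) => [t|t ht|t ht].
  - apply: cvgD; first exact: cvg_cst.
    by apply: cvgM; [exact: cvg_cst|exact: cumul_continuous].
  - by rewrite /y mem_set//= in_itv.
  - by rewrite /y memNset//= in_itv.
have yPP t : cumul y t = cumul PP t.
  apply: Rint_ae_eq; apply: (ae_imp hzc.2) => s hs _.
  rewrite /y; case: ifPn => [/set_mem Ds|/negP nD].
    rewrite -E; last by move: Ds; rewrite /= in_itv /= => /andP[? ?]; rewrite !ltW.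
    exact: (nrm_eq0_sqr (hs Ds)).
  by rewrite /PP (zw.2 s) ?lop0 ?ip0l// => Ds; apply: nD; exact: mem_set.
have FF0 s : 0 <= FF s by exact: ip_ge0.
have ww0 s : 0 <= ww s by exact: ip_ge0.
have FFend : cumul FF 0 = 0 /\ cumul FF T = \int[mu]_(t in D) FF t.
  by apply: cumul_end => // t nt; rewrite /FF (zF.2 t) ?ip0r//= in_itv.
have wwend : cumul ww 0 = 0 /\ cumul ww T = \int[mu]_(t in D) ww t.
  by apply: cumul_end => // t nt; rewrite /ww (zw.2 t) ?ip0r//= in_itv.
set S := \int[mu]_(t in D) FF t in FFend *; set W := \int[mu]_(t in D) ww t in wwend *.
set A := ip (zc 0) (zc 0) + c0^-1 * S.
have c0V : 0 < c0^-1 by rewrite invr_gt0.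
have S0 : 0 <= S by apply: Rintegral_ge0.
have A0 : 0 <= A by rewrite addr_ge0 ?ip_ge0// mulr_ge0// ltW.
have E2 : (2 * c0)^-1 = c0^-1 / 2 by field; rewrite gt_eqF.
have G : cumul y T <= A * T * expR (2 * lam * T).
  apply: gronwall => //; first by rewrite mulr_ge0.
  apply: ae_all => t Dt; rewrite /y mem_set// yPP.
  have /andP[t0 tT] : 0 <= t <= T by move: Dt; rewrite /= in_itv /= => /andP[? ?]; rewrite !ltW.
  have h1 := cumul_ge0_le IFF FF0 tT; rewrite FFend.2 in h1.
  have h2 := cumul_ge0_le Iww ww0 t0; rewrite wwend.1 in h2.
  have := Cle t; rewrite E2 /A.
  have := ler_wpM2l (ltW c0V) h1; have := mulr_ge0 (ltW c00) h2; lra.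
have := Cle T; rewrite FFend.2 wwend.2 -yPP (E T TT) E2.
have := ler_wpM2l lam0 G; rewrite -/A /A; lra.
Qed.

End parabolic.

(** * Fokker-Planck operators *)

Section time_reversal.
Context {R : realType} {H : preHilbert R}.
Local Notation mu := (@lebesgue_measure R).
Variables (T : R) (T0 : 0 < T).
Local Notation D := `]0%R, T[%classic.

Lemma SM_reflect (f : R -> H) : SM f -> SM (fun t => f (T - t)).
Proof.
move=> [s [ss fs]]; exists (fun n t => s n (T - t)); split=> [n|t]; last exact: fs.
have [m [c [b [cm mc sE]]]] := ss n; exists m, (fun t => c (T - t)), b.
split=> [t|k|t]; [exact: cm| |exact: sE].
have mr : measurable_fun setT (fun t : R => T - t) by exact: measurable_funB.
by have := mr measurableT _ (mc k); rewrite setTI.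
Qed.

Lemma reflect_in t : D (T - t) <-> D t.
Proof. by rewrite /= !in_itv /=; split=> /andP[h1 h2]; apply/andP; split; lra. Qed.

Lemma reflect_D : (fun t => T - t) @^-1` D = D.
Proof. by apply/seteqP; split=> t /=; [move/reflect_in|move=> h; apply/reflect_in]. Qed.

Lemma ae_D_reflect (P : R -> Prop) : {ae mu, forall t, D t -> P t} ->
  {ae mu, forall t, D t -> P (T - t)}.
Proof. by move=> /(ae_reflect T) h; apply: (ae_imp h) => t ht /reflect_in. Qed.

Lemma zbL2_reflect (f : R -> H) : zbL2 T f -> zbL2 T (fun t => f (T - t)).
Proof.
move=> zf; have [[mf If] f0] := zf; split; last first.
  by move=> t nt; apply: f0 => Dt; apply: nt; exact/reflect_in.
split; first exact: SM_reflect.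
have := intg_reflect T _ (zbL2_measurable_ip zf zf) If.
by rewrite reflect_D; apply.
Qed.

Lemma hcont_reflect (z : R -> H) : hcont T z -> hcont T (fun t => z (T - t)).
Proof.
move=> hz t tT e e0.
have tT' : 0 <= T - t <= T by move: tT => /andP[? ?]; apply/andP; split; lra.
have [d d0 hd] := hz _ tT' e e0; exists d => // s sT st; apply: hd.
  by move: sT => /andP[? ?]; apply/andP; split; lra.
by rewrite (_ : T - s - (T - t) = t - s) 1?distrC//; ring.
Qed.

Lemma crep_reflect (zc z : R -> H) : crep T zc z ->
  crep T (fun t => zc (T - t)) (fun t => z (T - t)).
Proof. by move=> [h1 h2]; split; [exact: hcont_reflect|exact: (ae_D_reflect h2)]. Qed.

Lemma cumul_reflect (f : R -> R) t : measurable_fun setT f -> intg setT f ->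
  (forall t, ~ (0 < t < T) -> f t = 0) -> 0 <= t <= T ->
  cumul (fun s => f (T - s)) t = cumul f T - cumul f (T - t).
Proof.
move=> mf If f0 /andP[t0 tT].
have If' : intg setT (fun s => f (T - s)).
  by have := intg_reflect T measurableT mf If; rewrite preimage_setT.
have [c0 _] : cumul (fun s => f (T - s)) 0 = 0 /\ cumul (fun s => f (T - s)) T =
    \int[mu]_(s in D) f (T - s).
  by apply: cumul_end => // s ns; apply: f0 => /andP[? ?]; apply: ns; apply/andP; split; lra.
rewrite -[LHS]subr0 -c0 (cumulB If')// (cumulB If); last lra.
rewrite -(@Rintegral_itv_bndo_bndc R _ T); last first.
  exact: (intgT _ If).
rewrite (@Rintegral_itv_obnd_cbnd R (T - t)); last exact: (intgT _ If).
have := Rint_reflect T (D := `[T - t, T[%classic) (measurable_itv _) mf (intgT _ If).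
rewrite (preimage_reflect_itv T) /= subrr (_ : T - (T - t) = t); last by ring.
by apply; exact: measurable_itv.
Qed.

Section evolutions.
Variables (P : linop H H) (H0 : set H).

Lemma evolves_reflect w g : evolves T P H0 w g ->
  evolves T P H0 (fun t => w (T - t)) (fun t => - g (T - t)).
Proof.
move=> [zw zg hw e]; have zg' := zbL2_reflect zg; split=> //.
- exact: zbL2_reflect.
- have := zbL2_DZ (-1) zg' (zbL2B zg' zg').
  by congr zbL2; apply/funext => t; rewrite subrr addr0 scaleN1r.
move=> om hom; have [k hk] := e om hom.
have [i m s] := zbL2_ip_cst om zg; have s' := zb_out (zbL2_ip_om om zg).
exists (k + cumul (fun s => ip (g s) om) T); apply: (ae_imp (ae_D_reflect hk)) => t h Dt.
have tT : 0 <= t <= T by move: Dt; rewrite /= in_itv /= => /andP[? ?]; rewrite !ltW.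
rewrite h//; have := cumul_reflect m i s' tT.
have [i' _ _] := zbL2_ip_cst om zg'.
have -> : cumul (fun s => ip (- g (T - s)) om) t = - cumul (fun s => ip (g (T - s)) om) t.
  have := cumulDZ (-2) t i' i'.
  rewrite (_ : (fun s => -2 * ip (g (T - s)) om + ip (g (T - s)) om) =
    (fun s => ip (- g (T - s)) om)); last by apply/funext => r; rewrite ipNl; ring.
  by move=> ->; ring.
by move=> ->; ring.
Qed.

Hypothesis H0B : forall x y, H0 x -> H0 y -> H0 (x - y).

Lemma evolvesB w1 g1 w2 g2 : evolves T P H0 w1 g1 -> evolves T P H0 w2 g2 ->
  evolves T P H0 (fun t => w1 t - w2 t) (fun t => g1 t - g2 t).
Proof.
move=> [lw1 lg1 h1 e1] [lw2 lg2 h2 e2]; split; [exact: zbL2B|exact: zbL2B| |].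
  by move=> t; exact: H0B.
move=> om H0om; have [k1 hk1] := e1 _ H0om; have [k2 hk2] := e2 _ H0om.
exists (k1 - k2); apply: (ae_imp2 hk1 hk2) => t q1 q2 Dt.
have [i1 _ _] := zbL2_ip_cst om lg1; have [i2 _ _] := zbL2_ip_cst om lg2.
rewrite lopB ipBl q1// q2// (_ : (fun s => ip (g1 s - g2 s) om) =
  fun s => -1 * ip (g2 s) om + ip (g1 s) om); first by rewrite cumulDZ//; ring.
by apply/funext => s; rewrite ipBl; ring.
Qed.

End evolutions.

Lemma crepB (z1 z2 y1 y2 : R -> H) : crep T z1 y1 -> crep T z2 y2 ->
  crep T (fun t => z1 t - z2 t) (fun t => y1 t - y2 t).
Proof.
move=> [h1 a1] [h2 a2]; split; first exact: hcontB.
apply: (ae_imp2 a1 a2) => t e1 e2 Dt; apply/eqP; rewrite eq_le nrm_ge0 andbT.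
rewrite (_ : z1 t - z2 t - (y1 t - y2 t) = (z1 t - y1 t) - (z2 t - y2 t)).
  by apply: (le_trans (ler_nrmB _ _)); rewrite e1// e2// addr0.
by rewrite !opprD !opprK addrACA.
Qed.

End time_reversal.

(** * Diffusion and drift in the gradient variable *)

Section fokker_planck_operators.
Context {R : realType} {N : nat}.
Local Notation mu := (@lebesgue_measure R).
Variables (l D : 'I_N -> R) (hl : forall i, 0 < l i) (hD : forall i, 0 < D i).
Local Notation X := (GX (N := N) l).
Local Notation H0 := (orth_set (kirch (N := N) l)).
Local Notation P := (antid hl).
Local Notation Pa := (antid_adj hl).
Implicit Types (b : 'I_N -> R * R -> R) (x y w : X).

(** Take [om] to be the derivative of a test function on one edge and 0 on the others. All its
    integrals vanish, so it satisfies the vertex condition, and its antiderivative is the test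
    function; the fundamental lemma applies edge by edge. *)
Lemma antid_dense x : (forall om, H0 om -> ip x (P om) = 0) -> nrm x = 0.
Proof.
move=> h; apply: (GX_ae0 hl) => i; have F := fundamental_lemma (gvalP x i).
apply: F => eta te.
have [_ zd] := test_function_zbL2 te.
pose om0 : graph_fun R N := fun j => if j == i then derive1 eta else fun=> 0.
have hom0 : graph_sub l om0.
  apply/graph_subP => j; rewrite /om0; case: eqP => [->|_] //.
  by split=> //; exact: (bL2_cst (H := @RH R) (l j) 0).
pose om : X := GX_of hom0.
have cE j : forall t, cumul (gval om j) t = if j == i then eta t else 0.
  move=> t; rewrite /gval /om /GX_of /= /om0; case: eqP => [_|_].
    by rewrite -(test_cumul (hl i) te).
  by rewrite /cumul /Rintegral integral0.
have el : eta (l i) = 0.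
  by apply: (test_function_derive0 te _).1; rewrite ltxx andbF.
have hom : H0 om.
  apply/(kirchP hl) => j k; rewrite !cE; do 2 case: eqP => [->|_] //; by rewrite el.
have := h _ hom; rewrite ip_GX /inner_L2 (bigD1 i)//= big1 ?addr0 => [h0|j ji].
  rewrite -[RHS]h0; apply: eq_Rint => t; rewrite /= in_itv /= => tl.
  by rewrite (antidE om tl) !cE eqxx el subr0.
transitivity (\int[mu]_(t in `]0, l j[) (0 : R)).
  apply: eq_Rint => t; rewrite /= in_itv /= => tl.
  by rewrite (antidE om tl) !cE (negbTE ji) subrr mulr0.
by rewrite /Rintegral integral0.
Qed.

Let Dsum := \sum_i D i.
(** The inverse of [Dinv] is a positive lower bound common to all diffusion coefficients, obtained
    without taking a minimum over the edges. *)
Let Dinv := \sum_i (D i)^-1 + 1.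
Definition dlow : R := Dinv^-1.

Lemma dlow_gt0 : 0 < dlow.
Proof.
by rewrite invr_gt0 ltr_wpDl// sumr_ge0// => i _; rewrite invr_ge0 ltW.
Qed.

Lemma dlow_le i : dlow <= D i.
Proof.
rewrite -[D i]invrK lef_pV2 ?posrE ?invr_gt0//.
  rewrite /Dinv (bigD1 i)//= -addrA lerDl addr_ge0//.
  by apply: sumr_ge0 => j _; rewrite invr_ge0 ltW.
by have := dlow_gt0; rewrite invr_gt0.
Qed.

Definition diff : 'I_N -> R * R -> R := fun i _ => D i.

Lemma bounded_diff : bounded_by Dsum diff.
Proof.
split=> [i|i z]; first exact: measurable_cst.
rewrite /diff gtr0_norm// /Dsum (bigD1 i)//= lerDl.
by apply: sumr_ge0 => j _; rewrite ltW.
Qed.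

Lemma Dsum_ge0 : 0 <= Dsum.
Proof. by apply: sumr_ge0 => j _; rewrite ltW. Qed.

Lemma diff_coercive t w : dlow * nrm w ^+ 2 <= ip (mulop diff t w) w.
Proof.
rewrite sqr_nrm !ip_GX /inner_L2 mulr_sumr; apply: ler_sum => i _.
have I := edge_intg i (ssubP w) (ssubP w).
rewrite [leRHS](@eq_Rint _ _ _ (fun s => D i * (gval w i s * gval w i s))); last first.
  by move=> s _; rewrite (gval_mulop t w i s bounded_diff) /diff mulrA.
rewrite !RintegralZl//; apply: ler_wpM2r; last exact: dlow_le.
by apply: Rintegral_ge0 => s _; exact: sqr_ge0.
Qed.

Variables (M : R) (b : 'I_N -> R * R -> R) (hb : bounded_by M b) (M0 : 0 <= M).

(** The operator of the Fokker--Planck form in the gradient variable: for [w] and [om] in [H0],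
    pairing [fp_fun t w] with [om] gives the form at [P w] and [P om]. *)
Definition fp_fun t w : X := mulop diff t w + mulop b t (P w).
Definition fp_adj_fun t w : X := mulop diff t w + Pa (mulop b t w).

Lemma fp_funDZ t a x y : fp_fun t (a *: x + y) = a *: fp_fun t x + fp_fun t y.
Proof.
rewrite /fp_fun lopDZ (mulop_DZ _ _ _ _ bounded_diff) (mulop_DZ _ _ _ _ hb).
by rewrite scalerDr addrACA.
Qed.

Lemma fp_adj_funDZ t a x y :
  fp_adj_fun t (a *: x + y) = a *: fp_adj_fun t x + fp_adj_fun t y.
Proof.
rewrite /fp_adj_fun (mulop_DZ _ _ _ _ bounded_diff) (mulop_DZ _ _ _ _ hb) lopDZ.
by rewrite scalerDr addrACA.
Qed.

Lemma fp_bounds : exists B, forall t x,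
  nrm (fp_fun t x) <= B * nrm x /\ nrm (fp_adj_fun t x) <= B * nrm x.
Proof.
have [p hp] := lop_bound P; have [q hq] := lop_bound Pa.
exists (Dsum + M * (`|p| + `|q|)) => t x.
have hd := mulop_nrm t x bounded_diff.
have nx := nrm_ge0 x.
have px : p * nrm x <= `|p| * nrm x by rewrite ler_wpM2r// ler_norm.
have qx y : q * nrm y <= `|q| * nrm y by rewrite ler_wpM2r ?nrm_ge0// ler_norm.
have p0 : 0 <= M * (`|p| * nrm x) by rewrite !mulr_ge0.
have q0 : 0 <= M * (`|q| * nrm x) by rewrite !mulr_ge0.
have -> : (Dsum + M * (`|p| + `|q|)) * nrm x =
    Dsum * nrm x + M * (`|p| * nrm x) + M * (`|q| * nrm x) by ring.
split; apply: (le_trans (ler_nrmD _ _)).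
  have h1 := mulop_nrm t (P x) hb.
  have h2 := ler_wpM2l M0 (le_trans (hp x) px).
  by apply: le_trans (lerD hd (le_trans h1 h2)) _; rewrite lerDl.
have h1 := le_trans (hq (mulop b t x)) (qx _).
have h2 := ler_wpM2l (normr_ge0 q) (mulop_nrm t x hb).
rewrite mulrCA in h2.
by apply: le_trans (lerD hd (le_trans h1 h2)) _; rewrite addrAC lerDl.
Qed.

Lemma fp_bounded t : exists B, forall x, nrm (fp_fun t x) <= B * nrm x.
Proof. by have [B h] := fp_bounds; exists B => x; have [] := h t x. Qed.

Lemma fp_adj_bounded t : exists B, forall x, nrm (fp_adj_fun t x) <= B * nrm x.
Proof. by have [B h] := fp_bounds; exists B => x; have [] := h t x. Qed.

Definition fp_op t : linop X X := LinOp (fp_funDZ t) (fp_bounded t).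
Definition fp_adj t : linop X X := LinOp (fp_adj_funDZ t) (fp_adj_bounded t).

Lemma fp_opE t w : fp_op t w = mulop diff t w + mulop b t (P w).
Proof. by []. Qed.

Lemma fp_adjE t w : fp_adj t w = mulop diff t w + Pa (mulop b t w).
Proof. by []. Qed.

Lemma fp_adjoint t x y : ip (fp_op t x) y = ip x (fp_adj t y).
Proof.
rewrite fp_opE fp_adjE ipDl ipDr (mulop_adj _ _ _ bounded_diff).
by rewrite (mulop_adj _ _ _ hb) antid_adjoint.
Qed.

Lemma SM_fp x : SM (fun t => fp_op t x).
Proof.
apply: (SMD (SM_mulop hl x Dsum_ge0 bounded_diff)).
exact: (SM_mulop hl _ M0 hb).
Qed.

Lemma SM_fp_adj x : SM (fun t => fp_adj t x).
Proof.
apply: (SMD (SM_mulop hl x Dsum_ge0 bounded_diff)).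
by apply: SM_lop; exact: (SM_mulop hl _ M0 hb).
Qed.

(** Young's inequality splits the drift term [M |P w| |w|] into half of the diffusion,
    [dlow / 2 |w|^2], and [M^2 / (2 dlow) |P w|^2]; hence [c0] and [lam]. *)
Let c0 := dlow / 2.
Let lam := M ^+ 2 / (2 * dlow).

Lemma fp_coercive t w : c0 * nrm w ^+ 2 <= ip (fp_op t w) w + lam * nrm (P w) ^+ 2.
Proof.
rewrite fp_opE ipDl; have h1 := diff_coercive t w.
have h2 := normr_ip_le (mulop b t (P w)) w.
have h3 := mulop_nrm t (P w) hb.
have nw := nrm_ge0 w; have np := nrm_ge0 (P w).
have h4 := ler_wpM2r nw h3; have d0 := dlow_gt0.
have h5 : - ip (mulop b t (P w)) w <= M * nrm (P w) * nrm w.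
  by have := ler_norm (- ip (mulop b t (P w)) w); rewrite normrN; lra.
have h6 : M * nrm (P w) * nrm w <= c0 * nrm w ^+ 2 + lam * nrm (P w) ^+ 2.
  have := mulr_ge0 (ltW (ltr0Sn R 0)) (sqr_ge0 (M * nrm (P w) - dlow * nrm w)).
  have dv : 0 <= (2 * dlow)^-1 by rewrite invr_ge0; lra.
  have := mulr_ge0 dv (sqr_ge0 (M * nrm (P w) - dlow * nrm w)).
  rewrite /c0 /lam.
  rewrite (_ : (2 * dlow)^-1 * _ = M ^+ 2 / (2 * dlow) * nrm (P w) ^+ 2 -
    M * nrm (P w) * nrm w + dlow / 2 * nrm w ^+ 2); last by field; rewrite gt_eqF.
  lra.
have : dlow * nrm w ^+ 2 = c0 * nrm w ^+ 2 + c0 * nrm w ^+ 2 by rewrite /c0; field.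
lra.
Qed.

End fokker_planck_operators.

(** Only the pairings of [g] with [H0] at almost every time matter. This allows the Riesz
    representative of the time derivative to be replaced by the right-hand side of the equation,
    with which it need not coincide off [H0]. *)
Lemma evolves_ae (R : realType) (H : preHilbert R) (T : R) (P : linop H H) (H0 : set H)
    (w g g' : R -> H) : evolves T P H0 w g -> zbL2 T g' ->
  {ae (@lebesgue_measure R), forall t, `]0%R, T[%classic t ->
    forall om, H0 om -> ip (g t) om = ip (g' t) om} ->
  evolves T P H0 w g'.
Proof.
move=> [zw zg hw e] zg' hg; split; [exact: zw|exact: zg'|exact: hw|move=> om hom].
have [k hk] := e om hom; exists k; apply: (ae_imp hk) => t h Dt; rewrite (h Dt).
have -> // : cumul (fun s => ip (g s) om) t = cumul (fun s => ip (g' s) om) t.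
apply: Rint_ae_eq; apply: (ae_imp hg) => s hs _.
have [Ds|nD] := pselect (`]0%R, T[%classic s); first exact: hs.
by rewrite zg.2// zg'.2.
Qed.

Section fokker_planck_evolutions.
Context {R : realType} {N : nat}.
Local Notation mu := (@lebesgue_measure R).
Variables (T : R) (T0 : 0 < T).
Variables (l D : 'I_N -> R) (hl : forall i, 0 < l i) (hD : forall i, 0 < D i).
Local Notation X := (GX (N := N) l).
Local Notation H0 := (orth_set (kirch (N := N) l)).
Local Notation P := (antid hl).
Local Notation Pa := (antid_adj hl).
Local Notation DT := `]0%R, T[%classic.
Variables (M : R) (b : 'I_N -> R * R -> R) (hb : bounded_by M b) (M0 : 0 <= M).
Local Notation K := (fp_op hl hD hb M0).
Local Notation Ka := (fp_adj hl hD hb M0).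

(** The factor of [energy_estimate] for the constant [lam] of [fp_coercive]. It sees the control
    only through its bound [M], so it is uniform over small perturbations. *)
Definition energy_const (M : R) : R :=
  1 + 2 * (M ^+ 2 / (2 * dlow D)) * T * expR (2 * (M ^+ 2 / (2 * dlow D)) * T).

Let c0 := dlow D / 2.
Let lam := M ^+ 2 / (2 * dlow D).

Let c00 : 0 < c0.
Proof. by rewrite divr_gt0// dlow_gt0. Qed.

Let lam0 : 0 <= lam.
Proof. by rewrite divr_ge0 ?sqr_ge0// mulr_ge0// ltW// dlow_gt0. Qed.

Lemma energy_const_gt0 : 0 < energy_const M.
Proof.
rewrite /energy_const -/lam ltr_wpDr//; apply: mulr_ge0; last exact: expR_ge0.
by apply: mulr_ge0; [exact: mulr_ge0|exact: ltW].
Qed.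

Lemma forward_existence (F : R -> X) z0 : zbL2 T F -> exists w,
  evolves T P H0 w (fun t => F t - K t (w t)) /\
  forall zc, crep T zc (fun t => P (w t)) -> nrm (zc 0 - z0) = 0.
Proof.
move=> zF; have [B hB] := fp_bounds hl hD hb M0.
apply: (parabolic_existence (GX_complete hl) T0 (antid_adjoint hl) (@antid_dense R N l hl)
  (fp_adjoint hl hD hb M0) (M := B) _ (SM_fp hl hD hb M0) _ (SM_fp_adj hl hD hb M0)
  c00 lam0) => // [t x|t x|t w _].
- by have [] := hB t x.
- by have [] := hB t x.
- exact: fp_coercive.
Qed.

(** Reversing time exchanges the roles of [K] and its adjoint, and coercivity is unaffected because
    both have the same quadratic form. *)
Lemma backward_existence (F : R -> X) zT : zbL2 T F -> exists w,
  evolves T P H0 w (fun t => Ka t (w t) - F t) /\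
  forall zc, crep T zc (fun t => P (w t)) -> nrm (zc T - zT) = 0.
Proof.
move=> zF; have [B hB] := fp_bounds hl hD hb M0.
have [w [ew iw]] : exists w,
    evolves T P H0 w (fun t => F (T - t) - Ka (T - t) (w t)) /\
    forall zc, crep T zc (fun t => P (w t)) -> nrm (zc 0 - zT) = 0.
  apply: (parabolic_existence (K := fun t => Ka (T - t)) (Ka := fun t => K (T - t))
    (GX_complete hl) T0 (antid_adjoint hl) (@antid_dense R N l hl)
    _ (M := B) _ _ _ _ c00 lam0) => [t x y|t x|x|t x|x|t w _|].
  - by rewrite ipC -fp_adjoint ipC.
  - by have [] := hB (T - t) x.
  - exact: (SM_reflect T (SM_fp_adj hl hD hb M0 x)).
  - by have [] := hB (T - t) x.
  - exact: (SM_reflect T (SM_fp hl hD hb M0 x)).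
  - have -> : ip (Ka (T - t) w) w = ip (K (T - t) w) w by rewrite fp_adjoint ipC.
    exact: fp_coercive.
  - exact: (zbL2_reflect zF).
exists (fun t => w (T - t)); split.
  have := evolves_reflect T0 ew; congr evolves; apply/funext => t.
  by rewrite opprB (_ : T - (T - t) = t)//; ring.
move=> zc /crep_reflect hz; have := iw (fun t => zc (T - t)); rewrite subr0; apply.
by move: hz; congr crep; apply/funext => t; rewrite (_ : T - (T - t) = t)//; ring.
Qed.

Lemma forward_energy (F w zc : R -> X) : zbL2 T F ->
  evolves T P H0 w (fun t => F t - K t (w t)) -> crep T zc (fun t => P (w t)) ->
  ip (zc T) (zc T) + c0 * \int[mu]_(t in DT) ip (w t) (w t) <=
  (ip (zc 0) (zc 0) + c0^-1 * \int[mu]_(t in DT) ip (F t) (F t)) * energy_const M.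
Proof.
move=> zF ew hz; apply: (energy_estimate T0 c00 lam0 _ zF ew hz) => t x _.
exact: fp_coercive.
Qed.

End fokker_planck_evolutions.

(** * Weak solutions in the gradient variable *)

Section weak_solutions.
Context {R : realType} {N : nat}.
Local Notation mu := (@lebesgue_measure R).
Variables (T : R) (T0 : 0 < T).
Variables (l D : 'I_N -> R) (hl : forall i, 0 < l i) (hD : forall i, 0 < D i).
Local Notation Z := (graph_fun R N).
Local Notation X := (GX (N := N) l).
Local Notation H0 := (orth_set (kirch (N := N) l)).
Local Notation P := (antid hl).
Local Notation Pa := (antid_adj hl).
Local Notation DT := `]0%R, T[%classic.
Implicit Types (rho : evolution R N) (w g : R -> X).

Definition gradient_of rho w :=
  {ae mu, forall t, DT t -> V l (rho t) /\ w t = dX l (rho t)}.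

Lemma V_toX v : V l v -> nrm (toX l v - P (dX l v)) = 0.
Proof. by move=> /(V_primitive hl)[]. Qed.

Lemma nrm_eq0_ipl (x y z : X) : nrm (x - y) = 0 -> ip x z = ip y z.
Proof. by move=> h; apply/eqP; rewrite -subr_eq0 -ipBl (nrm_eq0_ip z h). Qed.

Lemma nrm_eq0_ipr (x y z : X) : nrm (x - y) = 0 -> ip z x = ip z y.
Proof. by rewrite !(ipC z); exact: nrm_eq0_ipl. Qed.

(** Here [w] is the gradient of [rho] and [g] the Riesz representative of [rho_t]. Against a fixed
    [P om], the distributional identity becomes scalar and is integrated by du Bois-Reymond. *)
Lemma in_W_evolves rho rho_t : in_W l T rho rho_t -> exists w g,
  [/\ evolves T P H0 w g, gradient_of rho w &
   {ae mu, forall t, DT t -> forall v, V l v -> rho_t t v = ip (g t) (dX l v)}].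
Proof.
move=> [Wr Wt td]; have [w [zw hw aw]] := L2_V_rep hl Wr.
have [g [zg ag]] := L2_Vdual_rep hl Wt; exists w, g; split=> //; split=> // om hom.
have [Vom _] := V_antid hl hom; have dom := dX_antid hl hom.
apply: (du_bois_reymond T0 (zbL2_ip_om (P om) (zbL2_lop P zw)) (zbL2_ip_om om zg)).
move=> psi tp.
transitivity (\int[mu]_(t in DT) (inner_L2 l (rho t) (gval (P om)) * derive1 psi t)).
  apply: Rint_ae_eq; apply: (ae_imp aw) => t /[apply] -[Vt ->].
  have [Lt _] := V_L2_Dx Vt; have [Lom _] := V_L2_Dx Vom.
  by rewrite (inner_L2E Lt Lom) toX_gval (nrm_eq0_ipl _ (V_toX Vt)).
rewrite (td psi tp _ Vom); congr (- _).
apply: Rint_ae_eq; apply: (ae_imp ag) => t /[apply] /(_ _ Vom) ->.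
by rewrite (nrm_eq0_ipr _ dom).
Qed.

Lemma evolves_in_W w g : evolves T P H0 w g ->
  in_W l T (fun t => gval (P (w t))) (fun t => fun_of (g t)).
Proof.
move=> [zw zg hw e]; split; [exact: L2_V_of|exact: L2_Vdual_of|].
move=> psi tp v Vv; have [hv _] := V_primitive hl Vv.
have [k hk] := e _ hv; have [Lv _] := V_L2_Dx Vv.
rewrite -(ibp_test T0 k (zbL2_ip_om (dX l v) zg) tp).
apply: Rint_ae_eq; apply: (ae_imp hk) => t /[apply] <-.
by rewrite (inner_L2E (L2_gval _) Lv) toX_gval (nrm_eq0_ipr _ (V_toX Vv)).
Qed.

(** [at_time] selects some continuous representative. One exists, built from [zc], and continuous
    paths that agree almost everywhere agree on all of [[0, T]], so the selected values are those of
    [zc]. *)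
Lemma at_time_rep rho w zc : gradient_of rho w -> crep T zc (fun t => P (w t)) ->
  forall t, 0 <= t <= T ->
    L2 l (at_time l T rho t) /\ nrm (toX l (at_time l T rho t) - zc t) = 0.
Proof.
move=> hr hz.
have ex : exists rc, is_C_L2_rep l T rho rc.
  exists (fun t => gval (zc t)); split.
  - by move=> t _; exact: L2_gval.
  - move=> t tT; have [hc _] := hz; have := (within_hcont T zc).1 hc t tT.
    have -> : (fun s => norm_L2 l (gval (zc s) - gval (zc t))) = (fun s => nrm (zc s - zc t)).
      apply/funext => s; rewrite (norm_L2E (L2B (L2_gval _) (L2_gval _))).
      by rewrite (toXB (L2_gval _) (L2_gval _)) !toX_gval.
    by [].
  - apply: (ae_imp2 hr hz.2) => t h1 h2; rewrite in_itv /= => tD.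
    have Dt : DT t by rewrite /= in_itv.
    have [Vt wt] := h1 Dt; have [Lt _] := V_L2_Dx Vt.
    rewrite (norm_L2E (L2B (L2_gval _) Lt)) (toXB (L2_gval _) Lt) toX_gval.
    apply/eqP; rewrite eq_le nrm_ge0 andbT.
    apply: (le_trans (ler_nrm_distD (P (w t)) _ _)).
    by rewrite h2// wt (nrmBC (P _)) V_toX// addr0.
have : is_C_L2_rep l T rho (xget rho [set rc | is_C_L2_rep l T rho rc]).
  by have [rc hrc] := ex; apply: (@xgetI _ rho _ rc).
rewrite /at_time; set rc := xget _ _ => -[rL rcont rae] t tT.
have Lt s : 0 <= s <= T -> L2 l (rc s) by move=> sT; apply: rL; rewrite in_itv.
split; first exact: Lt.
apply: (hcont_ae0 T0 (z := fun t => toX l (rc t) - zc t) _ _ tT).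
  apply: hcontB; last exact: hz.1.
  apply/within_hcont => s sT; apply: cvg_trans (rcont s sT); apply: near_eq_cvg.
  rewrite near_withinE; apply: nearW => r; rewrite /= in_itv /= => rT.
  have sT' : 0 <= s <= T by rewrite in_itv /= in sT.
  by rewrite (norm_L2E (L2B (Lt r rT) (Lt s sT'))) (toXB (Lt r rT) (Lt s sT')).
apply: (ae_imp2 (ae_imp2 hr hz.2 (fun t a c => conj a c)) rae) => s [h1 h2] h3 Ds.
have sD : s \in `]0, T[ by [].
have [Vs ws] := h1 Ds; have [Ls _] := V_L2_Dx Vs.
have sT : 0 <= s <= T by move: Ds; rewrite /= in_itv /= => /andP[? ?]; rewrite !ltW.
have := h3 sD; rewrite (norm_L2E (L2B (Lt s sT) Ls)) (toXB (Lt s sT) Ls) => e3.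
apply/eqP; rewrite eq_le nrm_ge0 andbT.
apply: (le_trans (ler_nrm_distD (toX l (rho s)) _ _)); rewrite e3 add0r.
apply: (le_trans (ler_nrm_distD (P (w s)) _ _)).
by rewrite ws V_toX// add0r nrmBC -ws h2.
Qed.

(** Equality is asked section by section in time, because the operators act at one time at a
    time. *)
Definition represents (b : 'I_N -> R * R -> R) (u : control R N) :=
  {ae mu, forall t, DT t -> forall i,
    {ae mu, forall x, `]0, l i[%classic x -> b i (x, t) = u i (x, t)}}.

Variables (M : R) (b : 'I_N -> R * R -> R) (hb : bounded_by M b) (M0 : 0 <= M).
Variables (u : control R N) (bu : represents b u).
Local Notation K := (fp_op hl hD hb M0).
Local Notation Ka := (fp_adj hl hD hb M0).

(** The null set of times depends on the control alone and serves all [v] and [phi] together, which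
    is what substituting [rho t] for [v] requires. *)
Lemma FP_formE : {ae mu, forall t, DT t -> forall v phi, V l v -> V l phi ->
  FP_form l D u t v phi = ip (K t (dX l v)) (dX l phi)}.
Proof.
apply: (ae_imp bu) => t /[apply] h v phi Vv Vp.
have [Lv Ldv] := V_L2_Dx Vv; have [Lp Ldp] := V_L2_Dx Vp.
have e0 : nrm (mulop b t (P (dX l v)) - mulop b t (toX l v)) = 0.
  have -> : mulop b t (P (dX l v)) - mulop b t (toX l v) =
      mulop b t (P (dX l v) - toX l v).
    have := mulop_DZ t (-1) (toX l v) (P (dX l v)) hb.
    by rewrite !scaleN1r ![- _ + _]addrC => ->.
  apply/eqP; rewrite eq_le nrm_ge0 andbT.
  by apply: (le_trans (mulop_nrm t _ hb)); rewrite nrmBC V_toX// mulr0.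
rewrite fp_opE ipDl (nrm_eq0_ipl _ e0) -ipDl ip_GX /inner_L2 /FP_form.
apply: eq_bigr => i _; apply: Rint_ae_eq; apply: (ae_imp (h i)) => x hx Dx.
have -> : gval (mulop (diff D) t (dX l v) + mulop b t (toX l v)) i x =
    D i * (gval (dX l v) i x : R) + b i (x, t) * (gval (toX l v) i x : R).
  have := gvalDZ 1 (mulop (diff D) t (dX l v)) (mulop b t (toX l v)) i x.
  rewrite scale1r mul1r => ->.
  by rewrite (gval_mulop t _ i x (bounded_diff hD)) (gval_mulop t _ i x hb).
by rewrite hx// /dX !gval_toX_in.
Qed.

End weak_solutions.

(** * State and adjoint equations *)

Lemma lop_nrm0 (R : realType) (H H' : preHilbert R) (h : linop H H') (x y : H) :
  nrm (x - y) = 0 -> nrm (h x - h y) = 0.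
Proof.
move=> xy; have [M hM] := lop_bound h; apply/eqP; rewrite eq_le nrm_ge0 andbT -lopB.
by apply: (le_trans (hM _)); rewrite xy mulr0.
Qed.

Lemma nrm_trans0 (R : realType) (H : preHilbert R) (y x z : H) :
  nrm (x - y) = 0 -> nrm (y - z) = 0 -> nrm (x - z) = 0.
Proof.
move=> xy yz; apply/eqP; rewrite eq_le nrm_ge0 andbT.
by apply: (le_trans (ler_nrm_distD y _ _)); rewrite xy yz addr0.
Qed.

Section state_and_adjoint.
Context {R : realType} {N : nat}.
Local Notation mu := (@lebesgue_measure R).
Variables (T : R) (T0 : 0 < T).
Variables (l D : 'I_N -> R) (hl : forall i, 0 < l i) (hD : forall i, 0 < D i).
Local Notation Z := (graph_fun R N).
Local Notation X := (GX (N := N) l).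
Local Notation H0 := (orth_set (kirch (N := N) l)).
Local Notation P := (antid hl).
Local Notation Pa := (antid_adj hl).
Local Notation DT := `]0%R, T[%classic.
Implicit Types (rho q : evolution R N) (w g : R -> X).
Variables (M : R) (b : 'I_N -> R * R -> R) (hb : bounded_by M b) (M0 : 0 <= M).
Variables (u : control R N) (bu : represents T l b u).
Local Notation K := (fp_op hl hD hb M0).
Local Notation Ka := (fp_adj hl hD hb M0).
Variables (rho0 : Z) (hrho0 : L2 l rho0).

Lemma zbL2_fp w : zbL2 T w -> zbL2 T (fun t => K t (w t)).
Proof.
move=> zw; have [B hB] := fp_bounds hl hD hb M0.
apply: (@zbL2_opfam R X T K B _ _ w zw) => [t x|x]; last exact: SM_fp.
by have [] := hB t x.
Qed.

Lemma zbL2_fp_adj w : zbL2 T w -> zbL2 T (fun t => Ka t (w t)).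
Proof.
move=> zw; have [B hB] := fp_bounds hl hD hb M0.
apply: (@zbL2_opfam R X T Ka B _ _ w zw) => [t x|x]; last exact: SM_fp_adj.
by have [] := hB t x.
Qed.

Lemma zbL2_0 : zbL2 T (fun=> 0 : X).
Proof. by split=> //; exact: bL2_cst. Qed.

Lemma nrm_eq0_ip2 (x x' y y' : X) : nrm (x - x') = 0 -> nrm (y - y') = 0 ->
  ip x y = ip x' y'.
Proof. by move=> hx hy; rewrite (nrm_eq0_ipl _ hx) (nrm_eq0_ipr _ hy). Qed.

Lemma at_time_antid w zc : (forall t, H0 (w t)) -> crep T zc (fun t => P (w t)) ->
  forall t, 0 <= t <= T -> L2 l (at_time l T (fun t => gval (P (w t))) t) /\
    nrm (toX l (at_time l T (fun t => gval (P (w t))) t) - zc t) = 0.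
Proof.
move=> hw hz; apply: (@at_time_rep R N T T0 l hl _ (fun t => dX l (gval (P (w t))))).
  by apply: ae_all => t _; split=> //; have [] := V_antid hl (hw t).
have [h1 h2] := hz; split; first exact: h1.
apply: (ae_imp h2) => t h Dt; apply: nrm_trans0 (h Dt) _; apply: lop_nrm0.
by rewrite nrmBC; exact: dX_antid.
Qed.

(** The right-hand side is written with an explicit zero source to match the shape [F t - K t (w t)]
    of the abstract results. *)
Definition state_rep rho w zc :=
  [/\ evolves T P H0 w (fun t => 0 - K t (w t)), gradient_of T rho w,
      crep T zc (fun t => P (w t)) & nrm (zc 0 - toX l rho0) = 0].

Let T00 : (0 : R) <= 0 <= T. Proof. by rewrite lexx ltW. Qed.
Let TT : 0 <= T <= T. Proof. by rewrite lexx ltW. Qed.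

Lemma norm_L2B_eq0 v v' : L2 l v -> L2 l v' -> norm_L2 l (v - v') = nrm (toX l v - toX l v').
Proof. by move=> Lv Lv'; rewrite (norm_L2E (L2B Lv Lv')) (toXB Lv Lv'). Qed.

Lemma is_state_rep rho : is_state l D T rho0 u rho -> exists w zc, state_rep rho w zc.
Proof.
move=> [[rho_t [Wr eqn]] init].
have [w [g [ev gr ag]]] := in_W_evolves T0 hl Wr; have [zw zg hw _] := ev.
have [zc hz] := crep_exists (GX_complete hl) T0 ev; exists w, zc; split; [|exact: gr|exact: hz|].
  apply: (evolves_ae ev); first exact: (zbL2B zbL2_0 (zbL2_fp zw)).
  apply: (ae_imp2 (ae_imp2 gr ag (fun t x y => conj x y))
    (ae_imp2 eqn (FP_formE hl hD hb M0 bu) (fun t x y => conj x y))).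
  move=> t [h1 h2] [h3 h4] Dt om hom; have Dt' : t \in `]0, T[ by [].
  have [Vom _] := V_antid hl hom; have dom := dX_antid hl hom.
  have [Vr wr] := h1 Dt; have := h3 Dt' _ Vom; rewrite (h2 Dt _ Vom) (h4 Dt _ _ Vr Vom) -wr.
  rewrite !(nrm_eq0_ipr _ dom) sub0r ipNl => /eqP; rewrite addr_eq0 => /eqP.
  by [].
have [La ha] := at_time_rep T0 gr hz T00; rewrite nrmBC in ha.
by apply: (nrm_trans0 ha); rewrite -(norm_L2B_eq0 La hrho0).
Qed.

Lemma state_exists : exists rho, is_state l D T rho0 u rho.
Proof.
have [w [ev iw]] := forward_existence T0 hl hD hb M0 (toX l rho0) zbL2_0.
have [zc hz] := crep_exists (GX_complete hl) T0 ev; have [zw _ hw _] := ev.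
exists (fun t => gval (P (w t))); split; last first.
  have [La ha] := at_time_antid hw hz T00.
  by rewrite (norm_L2B_eq0 La hrho0); exact: (nrm_trans0 ha (iw _ hz)).
exists (fun t => fun_of (0 - K t (w t))); split; first exact: evolves_in_W.
apply: (ae_imp (FP_formE hl hD hb M0 bu)) => t h Dt v Vv.
have Dt' : DT t by [].
have [Vw _] := V_antid hl (hw t); rewrite (h Dt' _ _ Vw Vv) /fun_of sub0r ipNl.
rewrite (nrm_eq0_ipl _ (lop_nrm0 (K t) (dX_antid hl (hw t)))).
by rewrite addNr.
Qed.

Lemma G_rep : exists w zc, state_rep (G l D T rho0 u) w zc.
Proof.
apply: is_state_rep; have [rho hrho] := state_exists.
exact: (@xgetI _ (fun=> 0) [set rho | is_state l D T rho0 u rho] rho hrho).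
Qed.

Variables (rhod : evolution R N) (rhoT : Z) (hrhoT : L2 l rhoT) (rd : R -> X).
Hypothesis zrd : zbL2 T rd.
Hypothesis ard : {ae mu, forall t, DT t -> L2 l (rhod t) /\ rd t = toX l (rhod t)}.
Variables (rho : evolution R N) (wr zr : R -> X) (hrho : state_rep rho wr zr).

(** The tracking term is a functional of [phi]; since [phi] is the antiderivative of its gradient,
    the adjoint [Pa] moves it onto the gradient. *)
Definition tracking_load (t : R) : X := Pa (P (wr t) - rd t).

Lemma zbL2_tracking : zbL2 T tracking_load.
Proof.
have [[zw _ _ _] _ _ _] := hrho.
exact: (zbL2_lop Pa (zbL2B (zbL2_lop P zw) zrd)).
Qed.

Lemma tracking_loadE : {ae mu, forall t, DT t -> forall v, V l v ->
  inner_L2 l (rho t - rhod t) v = ip (tracking_load t) (dX l v)}.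
Proof.
have [_ gr _ _] := hrho; apply: (ae_imp2 gr ard) => t h1 h2 Dt v Vv.
have [Vr wE] := h1 Dt; have [Ld rE] := h2 Dt; have [Lr _] := V_L2_Dx Vr.
have [Lv _] := V_L2_Dx Vv.
rewrite (inner_L2E (L2B Lr Ld) Lv) (toXB Lr Ld) /tracking_load ipC (ipC (Pa _)).
rewrite -antid_adjoint (nrm_eq0_ipl _ (V_toX hl Vv)) !ipBr rE; congr (_ - _).
by rewrite wE; exact: (nrm_eq0_ipr _ (V_toX hl Vr)).
Qed.

Definition adjoint_rep q w zc :=
  [/\ evolves T P H0 w (fun t => Ka t (w t) - tracking_load t), gradient_of T q w,
      crep T zc (fun t => P (w t)) & nrm (zc T - (zr T - toX l rhoT)) = 0].

Lemma at_time_state : L2 l (at_time l T rho T - rhoT) /\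
  nrm (toX l (at_time l T rho T - rhoT) - (zr T - toX l rhoT)) = 0.
Proof.
have [_ gr hz _] := hrho; have [La ha] := at_time_rep T0 gr hz TT.
split; first exact: L2B.
by rewrite (toXB La hrhoT) opprB addrA subrK.
Qed.

Lemma is_adjoint_rep q : is_adjoint l D T rhod rhoT u rho q ->
  exists w zc, adjoint_rep q w zc.
Proof.
move=> [[q_t [Wq eqn]] init].
have [w [g [ev gr ag]]] := in_W_evolves T0 hl Wq; have [zw zg hw _] := ev.
have [zc hz] := crep_exists (GX_complete hl) T0 ev; exists w, zc; split; [|exact: gr|exact: hz|].
  apply: (evolves_ae ev); first exact: (zbL2B (zbL2_fp_adj zw) zbL2_tracking).
  apply: (ae_imp2 (ae_imp2 gr ag (fun t x y => conj x y))
    (ae_imp2 (ae_imp2 eqn tracking_loadE (fun t x y => conj x y))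
     (FP_formE hl hD hb M0 bu) (fun t x y => conj x y))).
  move=> t [h1 h2] [[h3 h5] h4] Dt om hom; have Dt' : t \in `]0, T[ by [].
  have [Vom _] := V_antid hl hom; have dom := dX_antid hl hom.
  have [Vr wE] := h1 Dt; have := h3 Dt' _ Vom.
  rewrite (h2 Dt _ Vom) (h4 Dt _ _ Vom Vr) (h5 Dt _ Vom) -wE fp_adjoint (ipC (dX l _)).
  by rewrite !(nrm_eq0_ipr _ dom) ipBl; lra.
have [La ha] := at_time_rep T0 gr hz TT; rewrite nrmBC in ha.
have [Ls hs] := at_time_state.
apply: (nrm_trans0 ha); apply: (nrm_trans0 _ hs).
by rewrite -(norm_L2B_eq0 La Ls).
Qed.

Lemma adjoint_exists : exists q, is_adjoint l D T rhod rhoT u rho q.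
Proof.
have [w [ev iw]] := backward_existence T0 hl hD hb M0 (zr T - toX l rhoT) zbL2_tracking.
have [zc hz] := crep_exists (GX_complete hl) T0 ev; have [zw _ hw _] := ev.
have [Ls hs] := at_time_state; rewrite nrmBC in hs.
exists (fun t => gval (P (w t))); split; last first.
  have [La ha] := at_time_antid hw hz TT.
  rewrite (norm_L2B_eq0 La Ls).
  exact: (nrm_trans0 ha (nrm_trans0 (iw _ hz) hs)).
exists (fun t => fun_of (Ka t (w t) - tracking_load t)); split; first exact: evolves_in_W.
apply: (ae_imp2 (FP_formE hl hD hb M0 bu) tracking_loadE) => t h h' Dt v Vv.
have Dt' : DT t by [].
have [Vw _] := V_antid hl (hw t); rewrite (h Dt' _ _ Vv Vw) (h' Dt' _ Vv) /fun_of ipBl.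
rewrite (nrm_eq0_ipr _ (dX_antid hl (hw t))) fp_adjoint ipC.
by rewrite opprB subrK.
Qed.

End state_and_adjoint.

(** * Expansion of the cost *)

Section space_time_integrals.
Context {R : realType} {N : nat}.
Local Notation mu := (@lebesgue_measure R).
Variables (T : R) (T0 : 0 < T) (l : 'I_N -> R) (hl : forall i, 0 < l i).
Local Notation X := (GX (N := N) l).
Local Notation DT := `]0%R, T[%classic.
Implicit Types (x y : R -> X) (a : 'I_N -> R).

Lemma RintZ (k : R) (f : R -> R) : intg DT f ->
  \int[mu]_(t in DT) (k * f t) = k * \int[mu]_(t in DT) f t.
Proof. by move=> If; rewrite RintegralZl. Qed.

Lemma Rint_sum (I : Type) (s : seq I) (f : I -> R -> R) : (forall i, intg DT (f i)) ->
  \int[mu]_(t in DT) \sum_(i <- s) f i t = \sum_(i <- s) \int[mu]_(t in DT) f i t /\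
  intg DT (fun t => \sum_(i <- s) f i t).
Proof.
move=> If; elim: s => [|i s [IH1 IH2]].
  have -> : (fun t => \sum_(i <- [::]) f i t) = fun=> 0 by apply/funext => t; rewrite big_nil.
  by split; [rewrite big_nil Rint_itv_cst ?mul0r// ltW|exact: intg_itv_cst].
have -> : (fun t => \sum_(j <- i :: s) f j t) = fun t => f i t + \sum_(j <- s) f j t.
  by apply/funext => t; rewrite big_cons.
have Ii := If i; split; last exact: intgD.
by rewrite big_cons -IH1 -RintegralD.
Qed.

Definition weight a : 'I_N -> R * R -> R := fun i _ => a i.

Lemma bounded_weight a : bounded_by (\sum_i `|a i|) (weight a).
Proof.
split=> [i|i z]; first exact: measurable_cst.
by rewrite /weight (bigD1 i)//= lerDl; apply: sumr_ge0.
Qed.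

Lemma weight_bound a : exists M, forall x : X, nrm (mulop (weight a) 0 x) <= M * nrm x.
Proof. by exists (\sum_i `|a i|) => x; exact: mulop_nrm (bounded_weight a). Qed.

Definition wmul a : linop X X :=
  LinOp (fun c (x y : X) => mulop_DZ 0 c x y (bounded_weight a)) (weight_bound a).

Lemma gval_wmul a (x : X) i s : gval (wmul a x) i s = a i * (gval x i s : R).
Proof. exact: (gval_mulop 0 x i s (bounded_weight a)). Qed.

Lemma ip_wmul a (x y : X) : ip (wmul a x) y =
  \sum_i a i * \int[mu]_(s in `]0, l i[) (gval x i s * gval y i s).
Proof.
rewrite ip_GX; apply: eq_bigr => i _.
have I := edge_intg i (ssubP x) (ssubP y).
by rewrite -RintegralZl//; apply: eq_Rint => s _; rewrite gval_wmul mulrA.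
Qed.

Lemma intg_ip_zb x y : zbL2 T x -> zbL2 T y -> intg DT (fun t => ip (x t) (y t)).
Proof. by move=> zx zy; exact: (intgT _ (zbL2_ip zx zy)). Qed.

Lemma intg_edge x y i : zbL2 T x -> zbL2 T y ->
  intg DT (fun t => \int[mu]_(s in `]0, l i[) (gval (x t) i s * gval (y t) i s)).
Proof.
(* A weight that is 1 on the edge [i] and 0 elsewhere exhibits the edge integral as a scalar product
   of paths, whose integrability is known. *)
move=> zx zy; pose a j : R := (j == i)%:R.
apply: (eq_intg _ _ (intg_ip_zb (zbL2_lop (wmul a) zx) zy)) => // t _.
rewrite ip_wmul (bigD1 i)//= /a eqxx mul1r big1 ?addr0// => j /negbTE ->.
by rewrite mul0r.
Qed.

Lemma sum_int_Q a x y x' y' (f : 'I_N -> R -> R -> R) :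
  zbL2 T x -> zbL2 T y -> zbL2 T x' -> zbL2 T y' ->
  {ae mu, forall t, DT t -> forall i, {ae mu, forall s, `]0, l i[%classic s ->
    f i s t = (gval (x t) i s : R) * gval (y t) i s -
              (gval (x' t) i s : R) * gval (y' t) i s}} ->
  \sum_i a i * int_Q (l i) T (f i) =
  \int[mu]_(t in DT) ip (wmul a (x t)) (y t) -
  \int[mu]_(t in DT) ip (wmul a (x' t)) (y' t).
Proof.
move=> zx zy zx' zy' hf.
pose F (z z' : R -> X) i t : R := \int[mu]_(s in `]0, l i[) (gval (z t) i s * gval (z' t) i s).
have E (z z' : R -> X) : zbL2 T z -> zbL2 T z' ->
    \int[mu]_(t in DT) ip (wmul a (z t)) (z' t) = \sum_i a i * \int[mu]_(t in DT) F z z' i t.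
  move=> hz hz'; rewrite (@eq_Rint _ _ _ (fun t => \sum_i a i * F z z' i t)); last first.
    by move=> t _; rewrite ip_wmul.
  have I i : intg DT (F z z' i) by exact: intg_edge.
  rewrite (Rint_sum _ _).1 => [|i]; last exact: intgZ.
  by apply: eq_bigr => i _; exact: (RintZ (a i) (I i)).
rewrite !E// -sumrB; apply: eq_bigr => i _; rewrite -mulrBr; congr (_ * _).
have I1 : intg DT (F x y i) by exact: intg_edge.
have I2 : intg DT (F x' y' i) by exact: intg_edge.
rewrite -RintegralB//; apply: Rint_ae_eq; apply: (ae_imp hf) => t h Dt.
have J1 := edge_intg i (ssubP (x t)) (ssubP (y t)).
have J2 := edge_intg i (ssubP (x' t)) (ssubP (y' t)).
rewrite /F -RintegralB//; apply: Rint_ae_eq; exact: (h Dt i).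
Qed.

Lemma sum_int_Q1 a x y (f : 'I_N -> R -> R -> R) : zbL2 T x -> zbL2 T y ->
  {ae mu, forall t, DT t -> forall i, {ae mu, forall s, `]0, l i[%classic s ->
    f i s t = (gval (x t) i s : R) * gval (y t) i s}} ->
  \sum_i a i * int_Q (l i) T (f i) = \int[mu]_(t in DT) ip (wmul a (x t)) (y t).
Proof.
move=> zx zy hf; have z0 : zbL2 T (fun=> 0 : X) by split=> //; exact: bL2_cst.
rewrite (@sum_int_Q a x y (fun=> 0) (fun=> 0) f zx zy z0 z0); last first.
  apply: (ae_imp hf) => t h Dt i; apply: (ae_imp (h Dt i)) => s hs Ds.
  rewrite hs//; have -> : gval (0 : X) i s = 0 by [].
  by rewrite mul0r subr0.
rewrite (@eq_Rint _ _ (fun t => ip (wmul a 0) (0 : X)) (fun=> 0)); last first.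
  by move=> t _; rewrite ip0r.
by rewrite Rint_itv_cst ?mul0r ?subr0// ltW.
Qed.

Lemma wmul1 (x : X) : wmul (fun=> 1) x = x.
Proof. by apply: GX_eq => i s _; rewrite gval_wmul mul1r. Qed.

Lemma intg_nrm2 x y : zbL2 T x -> zbL2 T y -> intg DT (fun t => nrm (x t) * nrm (y t)).
Proof.
move=> zx zy.
have I : intg DT (fun t => ip (x t) (x t) + ip (y t) (y t)).
  by apply: intgD => //; exact: intg_ip_zb.
apply: (le_intg _ _ _ I) => //.
  apply: measurable_funTS; apply: measurable_funM; apply: measurable_nrm.
    exact: zbL2_SM zx.
  exact: zbL2_SM zy.
move=> t _; rewrite ger0_norm ?mulr_ge0 ?nrm_ge0// -!sqr_nrm.
have := sqr_ge0 (nrm (x t) - nrm (y t)); rewrite sqrrB; have := mulr_ge0 (nrm_ge0 (x t)) (nrm_ge0 (y t)).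
rewrite -mulr_natr; lra.
Qed.

Lemma zbL2_mulop M b x : 0 <= M -> bounded_by M b -> zbL2 T x ->
  zbL2 T (fun t => mulop b t (x t)).
Proof.
move=> M0 hb zx; split; last first.
  by move=> t /zx.2 ->; apply: GX_eq => i s _; rewrite (gval_mulop t 0 i s hb) mulr0.
apply: (bL2_bound (M := M) _ _ zx.1); last by move=> t _; exact: mulop_nrm.
apply: (SM_op (K := fun t => mulop b t)) => [t|v|]; last exact: zbL2_SM zx.
  exists M => v v'; have -> : mulop b t v - mulop b t v' = mulop b t (v - v').
    have := mulop_DZ t (-1) v' v hb.
    by rewrite !scaleN1r ![- _ + _]addrC => ->.
  exact: mulop_nrm.
exact: (SM_mulop hl v M0 hb).
Qed.

Lemma Rint_mulop_le M b x y : 0 <= M -> bounded_by M b -> zbL2 T x -> zbL2 T y ->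
  `|\int[mu]_(t in DT) ip (mulop b t (x t)) (y t)| <=
  M * \int[mu]_(t in DT) (nrm (x t) * nrm (y t)).
Proof.
move=> M0 hb zx zy; have I := intg_nrm2 zx zy.
have I1 := intg_ip_zb (zbL2_mulop M0 hb zx) zy.
rewrite -RintegralZl//; apply: (le_trans (le_normr_Rintegral _ I1)) => //.
apply: Rint_le_ae => //; [exact: intg_norm|exact: intgZ|].
apply: ae_all => t _; apply: (le_trans (normr_ip_le _ _)).
by rewrite mulrA ler_wpM2r ?nrm_ge0// mulop_nrm.
Qed.

Lemma Rint_nrm2_young k x y : 0 <= k -> zbL2 T x -> zbL2 T y ->
  k * \int[mu]_(t in DT) (nrm (x t) * nrm (y t)) <=
  2^-1 * (\int[mu]_(t in DT) ip (x t) (x t) + k ^+ 2 * \int[mu]_(t in DT) ip (y t) (y t)).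
Proof.
move=> k0 zx zy; have I := intg_nrm2 zx zy.
have Ix := intg_ip_zb zx zx; have Iy := intg_ip_zb zy zy.
have IZ : intg DT (fun t => k ^+ 2 * ip (y t) (y t)) by exact: intgZ.
have IS : intg DT (fun t => ip (x t) (x t) + k ^+ 2 * ip (y t) (y t)) by exact: intgD.
rewrite -(RintZ _ Iy) -RintegralD// -(RintZ _ I) -(RintZ _ IS).
apply: Rint_le_ae => //; [exact: intgZ|exact: intgZ|].
apply: ae_all => t _; rewrite -!sqr_nrm.
have := sqr_ge0 (nrm (x t) - k * nrm (y t)); nra.
Qed.

End space_time_integrals.

(** Arithmetic of the cost remainder. In the application [e] is the squared size of the perturbation
    and [z + c * w <= Zc * e] the energy estimate for the difference of states; [x1] is the product
    of perturbation, state difference and adjoint gradient, and [x3] the quadratic control cost. *)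
Lemma remainder_arith (R : realType) (c e p A x1 x2 x3 x4 h u z w Zc Q : R) :
  0 < c -> 0 <= w -> 0 <= z -> 0 <= x2 -> z + c * w <= Zc * e -> x2 <= p ^+ 2 * w ->
  `|x1| <= 2^-1 * (x2 + e * Q) -> h <= e * u -> x4 <= A ^+ 2 * h ->
  `|x3| <= 2^-1 * (x4 + h) ->
  `|- x1 + 2^-1 * x2 + 2^-1 * z + 2^-1 * x3| <=
  (p ^+ 2 * (c^-1 * Zc) + 2^-1 * Q + 2^-1 * Zc + 4^-1 * (A ^+ 2 + 1) * u) * e.
Proof.
move=> c0 w0 z0 x20 zw xw h1 h2 h3 h4.
have zE : z <= Zc * e by have := mulr_ge0 (ltW c0) w0; lra.
have wE : w <= c^-1 * Zc * e by rewrite -mulrA ler_pdivlMl//; lra.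
have p2 := ler_wpM2l (sqr_ge0 p) wE; have A2 := ler_wpM2l (sqr_ge0 A) h2.
move: h1 h4; rewrite !ler_norml => /andP[b1 b2] /andP[b3 b4].
have -> : (p ^+ 2 * (c^-1 * Zc) + 2^-1 * Q + 2^-1 * Zc + 4^-1 * (A ^+ 2 + 1) * u) * e =
  p ^+ 2 * (c^-1 * Zc * e) + 2^-1 * (e * Q) + 2^-1 * (Zc * e) +
  4^-1 * (A ^+ 2 * (e * u) + e * u) by ring.
by apply/andP; split; lra.
Qed.

Section bochner_products.
Context {R : realType} {H : preHilbert R}.
Local Notation mu := (@lebesgue_measure R).
Variable T : R.
Local Notation DT := `]0%R, T[%classic.
Implicit Types x y z : R -> H.

Lemma bip_addl x y z : zbL2 T x -> zbL2 T y -> zbL2 T z ->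
  bip T (fun t => x t + y t) z = bip T x z + bip T y z.
Proof.
move=> zx zy zz; have I1 := intgT (D := DT) (measurable_itv _) (zbL2_ip zx zz).
have I2 := intgT (D := DT) (measurable_itv _) (zbL2_ip zy zz).
by rewrite /bip -RintegralD//; apply: eq_Rint => t _; rewrite ipDl.
Qed.

Lemma bip_subl x y z : zbL2 T x -> zbL2 T y -> zbL2 T z ->
  bip T (fun t => x t - y t) z = bip T x z - bip T y z.
Proof.
move=> zx zy zz; have I1 := intgT (D := DT) (measurable_itv _) (zbL2_ip zx zz).
have I2 := intgT (D := DT) (measurable_itv _) (zbL2_ip zy zz).
by rewrite /bip -RintegralB//; apply: eq_Rint => t _; rewrite ipBl.
Qed.

Lemma bip_scalel (k : R) x y : zbL2 T x -> zbL2 T y ->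
  bip T (fun t => k *: x t) y = k * bip T x y.
Proof.
move=> zx zy; rewrite /bip -(RintZ k (intgT (D := DT) (measurable_itv _) (zbL2_ip zx zy))).
by apply: eq_Rint => t _; rewrite ipZl.
Qed.

Lemma bip_scaler (k : R) x y : zbL2 T x -> zbL2 T y ->
  bip T y (fun t => k *: x t) = k * bip T y x.
Proof. by move=> zx zy; rewrite bipC (bip_scalel k zx zy) bipC. Qed.

Lemma bip_addr x y z : zbL2 T x -> zbL2 T y -> zbL2 T z ->
  bip T z (fun t => x t + y t) = bip T z x + bip T z y.
Proof. by move=> zx zy zz; rewrite !(bipC _ z) bip_addl. Qed.

Lemma bip_subr x y z : zbL2 T x -> zbL2 T y -> zbL2 T z ->
  bip T z (fun t => x t - y t) = bip T z x - bip T z y.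
Proof. by move=> zx zy zz; rewrite !(bipC _ z) bip_subl. Qed.

Lemma bip_young x y : zbL2 T x -> zbL2 T y ->
  `|bip T x y| <= 2^-1 * (bip T x x + bip T y y).
Proof.
move=> zx zy; have h1 := bip_ge0 T (fun t => x t - y t).
have h2 := bip_ge0 T (fun t => x t + y t).
have zB := zbL2B zx zy; have zD := zbL2D zx zy.
rewrite (bip_subl zx zy zB) (bip_subr zx zy zx) (bip_subr zx zy zy) in h1.
rewrite (bip_addl zx zy zD) (bip_addr zx zy zx) (bip_addr zx zy zy) in h2.
rewrite (bipC T y x) in h1 h2.
move: (bip T x x) (bip T x y) (bip T y y) h1 h2 => a b c h1 h2.
by rewrite ler_norml; apply/andP; split; lra.
Qed.

Lemma cumul_bip x y : 0 < T -> zbL2 T x -> zbL2 T y ->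
  cumul (fun t => ip (x t) (y t)) T - cumul (fun t => ip (x t) (y t)) 0 = bip T x y.
Proof.
move=> T0 zx zy; have [|-> ->] := cumul_end T0 (zbL2_ip zx zy); last by rewrite subr0.
by move=> t nt; rewrite (zx.2 t) ?ip0l//= in_itv.
Qed.

Lemma bip_le_scale (k : R) x y : zbL2 T x -> zbL2 T y ->
  (forall t, nrm (x t) <= k * nrm (y t)) -> bip T x x <= k ^+ 2 * bip T y y.
Proof.
move=> zx zy xy; have Ix := intgT (D := DT) (measurable_itv _) (zbL2_ip zx zx).
have Iy := intgT (D := DT) (measurable_itv _) (zbL2_ip zy zy).
rewrite /bip -(RintZ _ Iy); apply: Rint_le_ae => //; first exact: intgZ.
apply: ae_all => t _; rewrite -!sqr_nrm -exprMn ler_pXn2r ?nnegrE ?nrm_ge0//.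
by apply: le_trans (xy t); exact: nrm_ge0.
Qed.

End bochner_products.

Section cost_expansion.
Context {R : realType} {N : nat}.
Local Notation mu := (@lebesgue_measure R).
Variables (T : R) (T0 : 0 < T).
Variables (l D alpha : 'I_N -> R) (hl : forall i, 0 < l i) (hD : forall i, 0 < D i).
Local Notation Z := (graph_fun R N).
Local Notation X := (GX (N := N) l).
Local Notation H0 := (orth_set (kirch (N := N) l)).
Local Notation P := (antid hl).
Local Notation Pa := (antid_adj hl).
Local Notation DT := `]0%R, T[%classic.
Variables (rho0 : Z) (hrho0 : L2 l rho0).
Variables (rhod : evolution R N) (rhoT : Z) (hrhoT : L2 l rhoT) (rd : R -> X).
Hypothesis zrd : zbL2 T rd.
Hypothesis ard : {ae mu, forall t, DT t -> L2 l (rhod t) /\ rd t = toX l (rhod t)}.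
Implicit Types (rho q : evolution R N) (w z : R -> X) (b : 'I_N -> R * R -> R).

Let T00 : (0 : R) <= 0 <= T. Proof. by rewrite lexx ltW. Qed.
Let TT : 0 <= T <= T. Proof. by rewrite lexx ltW. Qed.

Lemma L2_cst1 : L2 l (fun _ _ => 1 : R^o).
Proof.
apply/L2P/graph_subP => i.
apply: (@continuous_zbL2 R (l i) (fun=> 1)) => [|x xl|x xl]; first exact: cst_continuous.
  by rewrite /edge_restr patchE mem_set//= in_itv.
by rewrite /edge_restr patchE memNset//= in_itv.
Qed.

(** The constant function 1 on the graph: multiplying it by a coefficient turns a control into an
    L^2 path, whose measurability is that of multiplication operators. *)
Definition unit_path (t : R) : X := if t \in DT then toX l (fun _ _ => 1 : R^o) else 0.

Lemma zbL2_unit : zbL2 T unit_path.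
Proof.
split; last by move=> t nt; rewrite /unit_path memNset.
apply: (bL2_bound (M := 1) _ _ (bL2_cst T (toX l (fun _ _ => 1 : R^o)))).
  by apply: SM_if => //; exact: SM_cst.
by move=> t Dt; rewrite /unit_path mem_set// mul1r.
Qed.

Definition ctl b t : X := mulop b t (unit_path t).

Lemma gval_ctl M b t i s : bounded_by M b -> DT t -> `]0, l i[%classic s ->
  gval (ctl b t) i s = b i (s, t).
Proof.
move=> hb Dt Ds; rewrite /ctl (gval_mulop t _ i s hb) /unit_path mem_set//.
by rewrite (gval_toX_in L2_cst1 Ds) mulr1.
Qed.

Lemma zbL2_ctl M b : 0 <= M -> bounded_by M b -> zbL2 T (ctl b).
Proof. by move=> M0 hb; exact: (zbL2_mulop hl M0 hb zbL2_unit). Qed.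

Lemma gval_antid_ae v (w : X) i : V l v -> w = dX l v ->
  {ae mu, forall s, `]0, l i[%classic s -> gval (P w) i s = v i s}.
Proof.
move=> Vv ->; have [Lv _] := V_L2_Dx Vv.
apply: (ae_imp (GX_nrm0_ae i (V_toX hl Vv))) => s h Ds.
by have := h Ds; rewrite gvalB (gval_toX_in Lv Ds) => /eqP; rewrite subr_eq0 => /eqP.
Qed.

Lemma gval_dX_ae v (w : X) i s : V l v -> w = dX l v -> `]0, l i[%classic s ->
  gval w i s = Dx l v i s.
Proof. by move=> Vv -> Ds; rewrite /dX gval_toX_in//; have [] := V_L2_Dx Vv. Qed.

Section one_control.
Variables (M : R) (b : 'I_N -> R * R -> R) (hb : bounded_by M b) (M0 : 0 <= M).
Variables (u : control R N) (bu : represents T l b u).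

Lemma J_E rho w z : state_rep T hl hD hb M0 rho0 rho w z ->
  J l T alpha rhod rhoT rho u =
  2^-1 * bip T (fun t => P (w t) - rd t) (fun t => P (w t) - rd t) +
  2^-1 * ip (z T - toX l rhoT) (z T - toX l rhoT) +
  2^-1 * bip T (fun t => wmul l alpha (ctl b t)) (ctl b).
Proof.
move=> hrho; have [[zw _ _ _] gr _ _] := hrho; rewrite /J; congr (_ * _ + _ * _ + _ * _).
- have zx : zbL2 T (fun t => P (w t) - rd t) by exact: (zbL2B (zbL2_lop P zw) zrd).
  transitivity (\sum_i 1 * int_Q (l i) T (fun x t => (rho t i x - rhod t i x) ^+ 2)).
    by apply: eq_bigr => i _; rewrite mul1r.
  have hf : {ae mu, forall t, DT t -> forall i, {ae mu, forall s, `]0, l i[%classic s ->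
      (rho t i s - rhod t i s) ^+ 2 =
      (gval (P (w t) - rd t) i s : R) * gval (P (w t) - rd t) i s}}.
    apply: (ae_imp2 gr ard) => t h1 h2 Dt i; have [Vr wE] := h1 Dt; have [Ld rE] := h2 Dt.
    apply: (ae_imp (gval_antid_ae i Vr wE)) => s hs Ds.
    by rewrite gvalB hs// rE (gval_toX_in Ld Ds) expr2.
  rewrite (sum_int_Q1 T0 (fun=> 1) zx zx hf).
  by apply: eq_Rint => t _; rewrite wmul1.
- have [LT hT] := at_time_state T0 hrhoT hrho.
  transitivity (inner_L2 l (at_time l T rho T - rhoT) (at_time l T rho T - rhoT)).
    by apply: eq_bigr => i _; apply: eq_Rint => x _; rewrite expr2.
  by rewrite inner_L2E//; exact: nrm_eq0_ip2.
- have zc := zbL2_ctl M0 hb.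
  apply: (sum_int_Q1 T0 alpha zc zc); apply: (ae_imp bu) => t h Dt i.
  by apply: (ae_imp (h Dt i)) => s hs Ds; rewrite (gval_ctl hb Dt Ds) hs// expr2.
Qed.

End one_control.

Variables (Ma : R) (a : 'I_N -> R * R -> R) (ha : bounded_by Ma a) (Ma0 : 0 <= Ma).
Variables (r0 : evolution R N) (w0 z0 : R -> X).
Hypothesis st0 : state_rep T hl hD ha Ma0 rho0 r0 w0 z0.
Variables (q : evolution R N) (wq zq : R -> X).
Hypothesis adq : adjoint_rep T hl hD ha Ma0 rhoT rd w0 z0 q wq zq.

Definition dcost h : R :=
  bip T (fun t => wmul l alpha (ctl a t)) (ctl h) -
  bip T (fun t => mulop h t (P (w0 t))) wq.

Let zw0 : zbL2 T w0. Proof. by have [[]] := st0. Qed.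
Let zwq : zbL2 T wq. Proof. by have [[]] := adq. Qed.
Let zPw0 : zbL2 T (fun t => P (w0 t)). Proof. exact: (zbL2_lop P zw0). Qed.
Let zac : zbL2 T (fun t => wmul l alpha (ctl a t)).
Proof. exact: (zbL2_lop (wmul l alpha) (zbL2_ctl Ma0 ha)). Qed.

Lemma dcostE (u : control R N) : represents T l a u ->
  forall eta h, 0 <= eta -> bounded_by eta h -> forall v, represents T l h v ->
  \sum_i int_Q (l i) T (fun x t =>
    (alpha i * u i (x, t) - r0 t i x * Dx l (q t) i x) * v i (x, t)) = dcost h.
Proof.
move=> au eta h e0 hh v hv.
transitivity (\sum_i 1 * int_Q (l i) T (fun x t =>
    (alpha i * u i (x, t) - r0 t i x * Dx l (q t) i x) * v i (x, t))).
  by apply: eq_bigr => i _; rewrite mul1r.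
have zh := zbL2_ctl e0 hh; have zm := zbL2_mulop hl e0 hh zPw0.
have [_ gr _ _] := st0; have [_ gq _ _] := adq.
have hf : {ae mu, forall t, DT t -> forall i, {ae mu, forall s, `]0, l i[%classic s ->
    (alpha i * u i (s, t) - r0 t i s * Dx l (q t) i s) * v i (s, t) =
    (gval (wmul l alpha (ctl a t)) i s : R) * gval (ctl h t) i s -
    (gval (mulop h t (P (w0 t))) i s : R) * gval (wq t) i s}}.
  apply: (ae_imp2 (ae_imp2 gr gq (fun t x y => conj x y))
    (ae_imp2 au hv (fun t x y => conj x y))) => t [h1 h2] [h3 h4] Dt i.
  have [Vr wE] := h1 Dt; have [Vq qE] := h2 Dt.
  apply: (ae_imp2 (gval_antid_ae i Vr wE)
    (ae_imp2 (h3 Dt i) (h4 Dt i) (fun t x y => conj x y))) => s e1 [e2 e3] Ds.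
  rewrite gval_wmul (gval_ctl ha Dt Ds) (gval_ctl hh Dt Ds) (gval_mulop t _ i s hh).
  by rewrite e1// e2// e3// (gval_dX_ae Vq qE Ds); ring.
have W1 (x y : R -> X) :
    \int[mu]_(t in DT) ip (wmul l (fun=> 1) (x t)) (y t) = bip T x y.
  by apply: eq_Rint => t _; rewrite wmul1.
rewrite (sum_int_Q T0 (fun=> 1) zac zh zm zwq hf).
rewrite (W1 (fun t => wmul l alpha (ctl a t)) (ctl h)).
by rewrite (W1 (fun t => mulop h t (P (w0 t))) wq) /dcost.
Qed.

Lemma dcost_comb (k e1 e2 e3 : R) h1 h2 h3 : 0 <= e1 -> 0 <= e2 ->
  bounded_by e1 h1 -> bounded_by e2 h2 -> bounded_by e3 h3 ->
  (forall i x, h3 i x = k * h1 i x + h2 i x) ->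
  dcost h3 = k * dcost h1 + dcost h2.
Proof.
move=> e10 e20 b1 b2 b3 hE; rewrite /dcost.
have zc1 := zbL2_ctl e10 b1; have zc2 := zbL2_ctl e20 b2.
have zm1 := zbL2_mulop hl e10 b1 zPw0; have zm2 := zbL2_mulop hl e20 b2 zPw0.
have zk1 : zbL2 T (fun t => k *: ctl h1 t).
  by have := zbL2_DZ k zc1 (zbL2_0 T l); congr zbL2; apply/funext => t; rewrite addr0.
have zk2 : zbL2 T (fun t => k *: mulop h1 t (P (w0 t))).
  by have := zbL2_DZ k zm1 (zbL2_0 T l); congr zbL2; apply/funext => t; rewrite addr0.
have -> : ctl h3 = fun t => k *: ctl h1 t + ctl h2 t.
  by apply/funext => t; exact: (mulop_comb t _ b1 b2 b3 hE).
have -> : (fun t => mulop h3 t (P (w0 t))) =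
    fun t => k *: mulop h1 t (P (w0 t)) + mulop h2 t (P (w0 t)).
  by apply/funext => t; exact: (mulop_comb t _ b1 b2 b3 hE).
rewrite (bip_addr zk1 zc2 zac) (bip_addl zk2 zm2 zwq) (bip_scalel _ zm1 zwq).
rewrite (bip_scaler _ zc1 zac).
by move: (bip T _ _) (bip T _ _) (bip T _ _) (bip T _ _) => x1 x2 x3 x4; ring.
Qed.

Lemma dcost_bounded : exists2 C, 0 <= C & forall eta h, 0 <= eta -> bounded_by eta h ->
  `|dcost h| <= C * eta.
Proof.
pose c1 := \int[mu]_(t in DT) (nrm (unit_path t) * nrm (wmul l alpha (ctl a t))).
pose c2 := \int[mu]_(t in DT) (nrm (P (w0 t)) * nrm (wq t)).
exists (c1 + c2).
  by apply: addr_ge0; apply: Rintegral_ge0 => t _; rewrite mulr_ge0 ?nrm_ge0.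
move=> eta h e0 hh; rewrite /dcost (bipC _ _ (ctl h)).
have h1 := Rint_mulop_le hl e0 hh zbL2_unit zac.
have h2 := Rint_mulop_le hl e0 hh zPw0 zwq.
apply: (le_trans (ler_normB _ _)); rewrite mulrC mulrDr; exact: lerD h1 h2.
Qed.

Section perturbation.
Variables (Mb : R) (b h : 'I_N -> R * R -> R) (hb : bounded_by Mb b) (Mb0 : 0 <= Mb).
Variables (eta : R) (hh : bounded_by eta h) (eta0 : 0 <= eta).
Hypothesis bah : forall i x, b i x = a i x + h i x.
Variables (r1 : evolution R N) (w1 z1 : R -> X).
Hypothesis st1 : state_rep T hl hD hb Mb0 rho0 r1 w1 z1.

Let w t := w1 t - w0 t.
Let z t := z1 t - z0 t.

Let zw1 : zbL2 T w1. Proof. by have [[]] := st1. Qed.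
Let zw : zbL2 T w. Proof. exact: (zbL2B zw1 zw0). Qed.
Let zPw : zbL2 T (fun t => P (w t)). Proof. exact: (zbL2_lop P zw). Qed.

Lemma fp_op_add t x :
  fp_op hl hD hb Mb0 t x = fp_op hl hD ha Ma0 t x + mulop h t (P x).
Proof.
rewrite !fp_opE -addrA (mulop_comb (a := 1) t _ ha hh hb) ?scale1r// => i y.
by rewrite mul1r.
Qed.

Lemma evolves_difference : evolves T P H0 w
  (fun t => (0 - fp_op hl hD hb Mb0 t (w1 t)) - (0 - fp_op hl hD ha Ma0 t (w0 t))).
Proof.
have [e1 _ _ _] := st1; have [e0 _ _ _] := st0.
exact: (evolvesB (@orth_setB _ _ _ _) e1 e0).
Qed.

Lemma crep_difference : crep T z (fun t => P (w t)).
Proof.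
have [_ _ c1 _] := st1; have [_ _ c0 _] := st0.
by have := crepB c1 c0; congr crep; apply/funext => t; rewrite lopB.
Qed.

Lemma difference_initial : nrm (z 0) = 0.
Proof.
have [_ _ _ i1] := st1; have [_ _ _ i0] := st0; rewrite nrmBC in i0.
exact: nrm_trans0 i1 i0.
Qed.

(** The equation of the difference is written with the perturbed operator, so that the source is
    [- h P w0]: it involves the unperturbed state only, and is of order [eta] without prior
    knowledge of the perturbed state. *)
Lemma difference_energy :
  ip (z T) (z T) + dlow D / 2 * bip T w w <=
  (dlow D / 2)^-1 * (eta ^+ 2 * bip T (fun t => P (w0 t)) (fun t => P (w0 t))) *
  energy_const T D Mb.
Proof.
pose F t : X := -1 *: mulop h t (P (w0 t)).
have zF : zbL2 T F.
  have := zbL2_DZ (-1) (zbL2_mulop hl eta0 hh zPw0) (zbL2_0 T l).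
  by congr zbL2; apply/funext => t; rewrite addr0.
have ev : evolves T P H0 w (fun t => F t - fp_op hl hD hb Mb0 t (w t)).
  have := evolves_difference; congr evolves; apply/funext => t.
  rewrite /F /w lopB [in RHS](fp_op_add t (w0 t)).
  move: (fp_op _ _ _ _ _ _) (fp_op _ _ _ _ _ _) (mulop _ _ _) => B A C.
  by rewrite scaleN1r !sub0r opprK opprB addrA (addrC B) addKr addrC.
have := forward_energy T0 zF ev crep_difference.
rewrite -!/(bip T _ _) (_ : ip (z 0) (z 0) = 0) ?add0r; last first.
  by rewrite -sqr_nrm difference_initial expr0n.
move=> E; apply: (le_trans E); apply: ler_wpM2r; first exact: ltW (energy_const_gt0 T0 hD _).
apply: ler_wpM2l; first by rewrite invr_ge0 divr_ge0// ltW// dlow_gt0.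
apply: bip_le_scale => // t; rewrite /F nrmZ normrN1 mul1r; exact: mulop_nrm hh.
Qed.

(** Here the equation of the difference is written with the unperturbed operator, with source
    [- h P w1], so that this operator cancels against that of the adjoint equation; terminal and
    tracking data of the adjoint produce the left-hand side. *)
Lemma adjoint_identity : ip (z T) (z0 T - toX l rhoT) +
  bip T (fun t => P (w t)) (fun t => P (w0 t) - rd t) =
  - bip T (fun t => mulop h t (P (w1 t))) wq.
Proof.
pose F t : X := -1 *: mulop h t (P (w1 t)).
have zm := zbL2_mulop hl eta0 hh (zbL2_lop P zw1).
have zF : zbL2 T F.
  have := zbL2_DZ (-1) zm (zbL2_0 T l).
  by congr zbL2; apply/funext => t; rewrite addr0.
have zK := zbL2_fp hl hD ha Ma0 zw; have zKq := zbL2_fp_adj hl hD ha Ma0 zwq.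
have ztr := zbL2_tracking zrd st0.
have ev : evolves T P H0 w (fun t => F t - fp_op hl hD ha Ma0 t (w t)).
  have := evolves_difference; congr evolves; apply/funext => t.
  rewrite /F /w lopB [in LHS](fp_op_add t (w1 t)).
  move: (fp_op _ _ _ _ _ _) (fp_op _ _ _ _ _ _) (mulop _ _ _) => B A C.
  by rewrite scaleN1r !sub0r opprK opprB opprD addrAC addrC (addrC (- A)).
have [evq _ cq iq] := adq.
have H0D x y : H0 x -> H0 y -> H0 (x + y).
  by move=> hx hy i; rewrite ipDr hx hy addr0.
have := crep_pair T0 H0D ev evq crep_difference cq T00 TT.
have cb1 := cumul_bip T0 (zbL2B zF zK) zwq; have cb2 := cumul_bip T0 (zbL2B zKq ztr) zw.
rewrite cb1 cb2 => {cb1 cb2}.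
rewrite (nrm_eq0_ip _ difference_initial) subr0 (nrm_eq0_ipr _ iq).
rewrite (bip_subl zF zK zwq) (bip_subl zKq ztr zw) (bip_scalel _ zm zwq).
have -> : bip T (fun t => fp_adj hl hD ha Ma0 t (wq t)) w =
    bip T (fun t => fp_op hl hD ha Ma0 t (w t)) wq.
  by apply: eq_Rint => t _; rewrite fp_adjoint ipC.
have -> : bip T (tracking_load hl rd w0) w =
    bip T (fun t => P (w t)) (fun t => P (w0 t) - rd t).
  by apply: eq_Rint => t _; rewrite antid_adjoint ipC.
by move: (ip (z T) _) (bip T _ _) (bip T _ _) (bip T _ _) => e x1 x2 x3 ->; ring.
Qed.

Variables (p A : R).
Hypothesis pP : forall x, nrm (P x) <= p * nrm x.
Hypothesis Aal : forall x, nrm (wmul l alpha x) <= A * nrm x.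
Variables (u0 u1 : control R N) (au : represents T l a u0) (bu : represents T l b u1).

Let c := dlow D / 2.
Let Zc := c^-1 * bip T (fun t => P (w0 t)) (fun t => P (w0 t)) * energy_const T D Mb.
Definition remainder_const : R :=
  p ^+ 2 * (c^-1 * Zc) + 2^-1 * bip T wq wq + 2^-1 * Zc +
  4^-1 * (A ^+ 2 + 1) * bip T unit_path unit_path.

(** The first-order terms cancel against [dcost h] by [adjoint_identity]; the remaining ones are
    quadratic in quantities of order [eta]. The constant depends on the perturbed control only
    through its bound [Mb]. *)
Theorem cost_remainder :
  `|J l T alpha rhod rhoT r1 u1 - J l T alpha rhod rhoT r0 u0 - dcost h| <=
  remainder_const * eta ^+ 2.
Proof.
have c0 : 0 < c by rewrite /c divr_gt0 ?dlow_gt0.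
have zu := zbL2_unit; have zcb := zbL2_ctl Mb0 hb; have zca := zbL2_ctl Ma0 ha.
have zch := zbL2_ctl eta0 hh; have zah := zbL2_lop (wmul l alpha) zch.
have zmw := zbL2_mulop hl eta0 hh zPw; have zm0 := zbL2_mulop hl eta0 hh zPw0.
have z0d := zbL2B zPw0 zrd.
have E : J l T alpha rhod rhoT r1 u1 - J l T alpha rhod rhoT r0 u0 - dcost h =
    - bip T (fun t => mulop h t (P (w t))) wq +
    2^-1 * bip T (fun t => P (w t)) (fun t => P (w t)) + 2^-1 * ip (z T) (z T) +
    2^-1 * bip T (fun t => wmul l alpha (ctl h t)) (ctl h).
  rewrite (J_E au st0) (J_E bu st1) /dcost.
  have -> : (fun t => P (w1 t) - rd t) = fun t => P (w t) + (P (w0 t) - rd t).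
    by apply/funext => t; rewrite /w lopB addrA subrK.
  have -> : z1 T - toX l rhoT = z T + (z0 T - toX l rhoT) by rewrite /z addrA subrK.
  have cE : ctl b = fun t => ctl a t + ctl h t.
    apply/funext => t; rewrite /ctl (mulop_comb (a := 1) t _ ha hh hb) ?scale1r// => i y.
    by rewrite mul1r.
  have lE : (fun t => wmul l alpha (ctl b t)) =
      fun t => wmul l alpha (ctl a t) + wmul l alpha (ctl h t).
    by apply/funext => t; rewrite cE lopD.
  rewrite lE cE.
  have zD : zbL2 T (fun t => P (w t) + (P (w0 t) - rd t)) by exact: zbL2D.
  have zC : zbL2 T (fun t => ctl a t + ctl h t) by exact: zbL2D.
  rewrite (bip_addl zPw z0d zD) (bip_addr zPw z0d zPw) (bip_addr zPw z0d z0d).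
  rewrite (bip_addl zac zah zC) (bip_addr zca zch zac) (bip_addr zca zch zah).
  have sq (x y : X) : ip (x + y) (x + y) = ip x x + 2 * ip x y + ip y y.
    by rewrite ipDl !ipDr (ipC y x); ring.
  rewrite sq.
  have := adjoint_identity.
  (* Writing [w1 = w + w0] separates the second-order term [h P w] from the term [h P w0], which
     belongs to [dcost h]. *)
  have -> : (fun t => mulop h t (P (w1 t))) =
      fun t => mulop h t (P (w t)) + mulop h t (P (w0 t)).
    apply/funext => t; rewrite /w lopB.
    have := mulop_DZ t 1 (P (w1 t) - P (w0 t)) (P (w0 t)) hh.
    by rewrite !scale1r subrK.
  rewrite (bip_addl zmw zm0 zwq) (bipC T (fun t => P (w0 t) - rd t) (fun t => P (w t))).
  have -> : bip T (fun t => wmul l alpha (ctl h t)) (ctl a) =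
      bip T (fun t => wmul l alpha (ctl a t)) (ctl h).
    apply: eq_Rint => t _; rewrite !ip_wmul; apply: eq_bigr => i _; congr (_ * _).
    by apply: eq_Rint => s _; rewrite mulrC.
  move: (ip (z T) (z T)) (ip (z T) _) (ip (z0 T - _) _) => e1 e2 e3.
  repeat match goal with |- context [bip ?x1 ?x2 ?x3] =>
    move: (bip x1 x2 x3) => ? end.
  lra.
have en := difference_energy; rewrite -/c in en.
set E0 := bip T (fun t => P (w0 t)) _ in en.
set W := bip T w w in en; set Zt := ip (z T) (z T) in en.
have W0 : 0 <= W := bip_ge0 T w; have Zt0 : 0 <= Zt by exact: ip_ge0.
have enZ : Zt + c * W <= Zc * eta ^+ 2.
  by move: en; congr (_ <= _); rewrite /Zc -/E0; ring.
have PW : bip T (fun t => P (w t)) (fun t => P (w t)) <= p ^+ 2 * W.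
  by apply: bip_le_scale.
have B1 : `|bip T (fun t => mulop h t (P (w t))) wq| <=
    2^-1 * (bip T (fun t => P (w t)) (fun t => P (w t)) + eta ^+ 2 * bip T wq wq).
  apply: (le_trans (Rint_mulop_le hl eta0 hh zPw zwq)).
  exact: Rint_nrm2_young.
have U1 : bip T (ctl h) (ctl h) <= eta ^+ 2 * bip T unit_path unit_path.
  by apply: bip_le_scale => // t; exact: mulop_nrm.
have AU : bip T (fun t => wmul l alpha (ctl h t)) (fun t => wmul l alpha (ctl h t)) <=
    A ^+ 2 * bip T (ctl h) (ctl h) by exact: bip_le_scale.
have B2 := bip_young zah zch.
have PP0 := bip_ge0 T (fun t => P (w t)).
rewrite E; exact: (remainder_arith c0 W0 Zt0 PP0 enZ PW B1 U1 AU B2).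
Qed.

End perturbation.

End cost_expansion.

(** * Operations on controls and the choice of a descent step *)

Section control_algebra.
Context {R : realType} {N : nat}.
Local Notation mu := (@lebesgue_measure R).
Local Notation mu2 := (mu \x mu)%E.
Variables (T : R) (l : 'I_N -> R).
Local Notation DT := `]0%R, T[%classic.
Implicit Types (u v : control R N) (b : 'I_N -> R * R -> R).

Lemma Linfty_DZ (k : R) u v : Linfty l T u -> Linfty l T v -> Linfty l T (k *: u + v).
Proof.
move=> Lu Lv i.
have -> : ((k *: u + v) i : R * R -> R) \_ (Q l T i) =
    k *: ((u i : R * R -> R) \_ (Q l T i)) + (v i : R * R -> R) \_ (Q l T i).
  apply/funext => z; rewrite !fctE !patchE.
  by case: ifP => // _; rewrite scaler0 addr0.
exact: ((Lfun_submod_closed mu2 (leey 1)).2 k _ _ (Lu i) (Lv i)).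
Qed.

Lemma bounded_DZ (k M M' : R) b b' : bounded_by M b -> bounded_by M' b' ->
  bounded_by (`|k| * M + M') (fun i z => k * b i z + b' i z).
Proof.
move=> [mb hb] [mb' hb']; split=> [i|i z].
  by apply: measurable_funD => //; apply: measurable_funM.
by apply: (le_trans (ler_normD _ _)); rewrite lerD// normrM ler_wpM2l.
Qed.

Lemma represents_DZ (k : R) b b' u u' : represents T l b u -> represents T l b' u' ->
  represents T l (fun i z => k * b i z + b' i z) (k *: u + u').
Proof.
move=> bu bu'; apply: (ae_imp2 bu bu') => t h h' Dt i.
by apply: (ae_imp2 (h Dt i) (h' Dt i)) => x e e' Dx; rewrite e// e'.
Qed.

Lemma represents_cut u : Linfty l T u -> represents T l (cut l T u) u.
Proof. exact: cut_ae. Qed.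

Lemma Uad_convex (umin umax : control R N) u v (s : R) : 0 <= s <= 1 ->
  Uad l T umin umax u -> Uad l T umin umax v -> Uad l T umin umax (u + s *: (v - u)).
Proof.
move=> /andP[s0 s1] [Lu hu] [Lv hv]; split.
  rewrite (_ : u + _ = s *: (-1 *: u + v) + u).
    by apply: Linfty_DZ => //; exact: Linfty_DZ.
  by rewrite scaleN1r addrC (addrC (- u)).
move=> i; apply: (@filterS2 _ _ (ae_filter_ringOfSetsType mu2) _ _ _ _ (hu i) (hv i)) => z h1 h2 Qz.
have := h1 Qz; have := h2 Qz => /andP[a1 a2] /andP[a3 a4].
have -> : (u + s *: (v - u)) i z = (1 - s) * (u i z : R) + s * (v i z : R).
  by rewrite !fctE; change (u i z + s * (v i z - u i z) = (1 - s) * (u i z : R) + s * v i z); ring.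
have s1' : 0 <= 1 - s by rewrite subr_ge0.
have := ler_wpM2l s0 a1; have := ler_wpM2l s0 a2.
have := ler_wpM2l s1' a3; have := ler_wpM2l s1' a4.
by move=> *; apply/andP; split; lra.
Qed.

Hypotheses (T0 : 0 < T) (hl : forall i, 0 < l i).

Lemma norm_L2Q_le (M : R) b u : 0 <= M -> bounded_by M b -> represents T l b u ->
  norm_L2Q l T u <= M * Num.sqrt (bip T (unit_path T l) (unit_path T l)).
Proof.
move=> M0 hb bu; have zu := zbL2_unit T l; have zb := zbL2_ctl T hl M0 hb.
rewrite -(ger0_norm M0) -sqrtr_sqr -sqrtrM ?sqr_ge0// /norm_L2Q ler_wsqrtr//.
have hf : {ae mu, forall t, DT t -> forall i, {ae mu, forall s, `]0, l i[%classic s ->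
    (u i (s, t) : R) ^+ 2 = (gval (ctl T l b t) i s : R) * gval (ctl T l b t) i s}}.
  apply: (ae_imp bu) => t h Dt i; apply: (ae_imp (h Dt i)) => s hs Ds.
  by rewrite (gval_ctl hb Dt Ds) hs// expr2.
have := sum_int_Q1 T0 (fun=> 1) zb zb hf.
rewrite (eq_bigr (fun i => int_Q (l i) T (fun x t => u i (x, t) ^+ 2))); last first.
  by move=> i _; rewrite mul1r.
move=> ->; apply: (@le_trans _ _ (bip T (ctl T l b) (ctl T l b))).
  by rewrite le_eqVlt; apply/orP; left; apply/eqP; apply: eq_Rint => t _; rewrite wmul1.
by apply: bip_le_scale => // t; exact: mulop_nrm.
Qed.

End control_algebra.

(** The step is [1 / r], where [r] sums one quantity for each requirement. The summand 1 in [r] also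
    makes the last inequality strict. *)
Lemma small_step (R : realType) (M K eps C L : R) : 0 <= M -> 0 <= K -> 0 < eps ->
  0 <= C -> L < 0 -> exists s : R,
  [/\ 0 < s <= 1, s * M <= 1, s * M * K <= eps & s * L + C * (s * M) ^+ 2 < 0].
Proof.
move=> M0 K0 e0 C0 L0.
pose r := 1 + M + M * K / eps + C * M ^+ 2 / (- L) .
have nL : 0 < - L by lra.
have a1 : 0 <= M * K / eps by rewrite divr_ge0 ?mulr_ge0// ltW.
have a2 : 0 <= C * M ^+ 2 / (- L) by rewrite divr_ge0 ?mulr_ge0 ?sqr_ge0// ltW.
have r0 : 0 < r by rewrite /r; lra.
have s0 : 0 < r^-1 by rewrite invr_gt0.
have le x : x <= r -> r^-1 * x <= 1 by rewrite ler_pdivrMl// mulr1.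
exists r^-1; split.
- by rewrite s0 /=; have := le 1; rewrite mulr1; apply; rewrite /r; lra.
- by apply: le; rewrite /r; lra.
- rewrite -mulrA -[leRHS]mul1r -ler_pdivrMr// -mulrA; apply: le.
  by rewrite /r; lra.
have h : r^-1 * (C * M ^+ 2 / - L) < 1.
  by rewrite ltr_pdivrMl// mulr1 /r; lra.
have h' : r^-1 * (C * M ^+ 2) < - L by move: h; rewrite mulrA ltr_pdivrMr// mul1r.
have := ltr_pM2l s0 (r^-1 * (C * M ^+ 2)) (- L); rewrite h' exprMn => h3.
have -> : C * (r^-1 ^+ 2 * M ^+ 2) = r^-1 * (r^-1 * (C * M ^+ 2)) by ring.
move: h3 => /idP; lra.
Qed.

(** * Optimality condition *)

Theorem theorem4p11 (R : realType) (N : nat) (hN : (1 <= N)%N)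
  (T : R) (hT : 0 < T)
  (l D alpha : 'I_N -> R) (hl : forall i, 0 < l i) (hD : forall i, 0 < D i)
  (halpha : forall i, 0 < alpha i)
  (rho0 : graph_fun R N) (hrho0 : L2 l rho0)
  (rhod : evolution R N) (hrhod : L2_L2 l T rhod)
  (rhoT : graph_fun R N) (hrhoT : L2 l rhoT)
  (umin umax : control R N) (humin : Linfty l T umin) (humax : Linfty l T umax)
  (ubar : control R N)
  (hubar : is_L2_local_solution l D T alpha rho0 rhod rhoT umin umax ubar) :
  (exists2 dJ : control R N -> R,
    is_frechet_derivative (Linfty l T) (norm_Linfty l T)
      (reduced_cost l D T alpha rho0 rhod rhoT) ubar dJ &
    forall v, Uad l T umin umax v -> 0 <= dJ (v - ubar)) /\
  (let rho := G l D T rho0 ubar in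
   let q := adjoint_state l D T rho0 rhod rhoT ubar in
   forall v, Uad l T umin umax v ->
     0 <= \sum_i int_Q (l i) T (fun x t =>
       (alpha i * ubar i (x, t) - rho t i x * Dx l (q t) i x) *
       (v i (x, t) - ubar i (x, t)))).
Proof.
have descent (x1 x2 x3 x4 : R) : x1 <= x2 -> x3 + x4 < 0 -> x2 - x1 - x3 <= x4 -> False.
  by lra.
have [[Lu hu] [eps0 eps00 opt]] := hubar; have [rd [zrd ard]] := L2_L2_rep hrhod.
pose a := cut l T ubar; pose Ma := norm_Linfty l T ubar.
have Ma0 : 0 <= Ma by exact: norm_Linfty_ge0.
have ha : bounded_by Ma a by exact: bounded_cut.
have au : represents T l a ubar by exact: represents_cut.
have [w0 [z0 st0]] := G_rep hT hl hD ha Ma0 au hrho0.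
have adj : is_adjoint l D T rhod rhoT ubar (G l D T rho0 ubar)
    (adjoint_state l D T rho0 rhod rhoT ubar).
  have [q hq] := adjoint_exists hT au hrhoT zrd ard st0.
  exact: (@xgetI _ (fun=> 0) [set q | is_adjoint l D T rhod rhoT ubar _ q] q hq).
have [wq [zq adq]] := is_adjoint_rep hT au hrhoT zrd ard st0 adj.
(* Taking the integral formula itself as the derivative makes the two assertions the same
   inequality; [L] is its expression on everywhere bounded representatives, where linearity and
   bounds are available. *)
pose dJ (h : control R N) := \sum_i int_Q (l i) T (fun x t =>
  (alpha i * ubar i (x, t) - G l D T rho0 ubar t i x *
   Dx l (adjoint_state l D T rho0 rhod rhoT ubar t) i x) * h i (x, t)).
pose L := dcost T alpha hl a w0 wq.
have dJE (eta : R) h b : 0 <= eta -> bounded_by eta b -> represents T l b h -> dJ h = L b.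
  by move=> e0 hb bh; exact: (dcostE hT alpha st0 adq au e0 hb bh).
have [p hp] := lop_bound (antid hl); have [A hA] := lop_bound (wmul l alpha).
(* Perturbations of size at most 1 keep the coefficient bounded by [Ma + 1], so a single remainder
   constant serves them all. *)
pose C := `|remainder_const T D hl w0 wq (Ma + 1) p A|.
pose F := reduced_cost l D T alpha rho0 rhod rhoT.
have expand (eta : R) h b : 0 <= eta -> eta <= 1 -> bounded_by eta b -> represents T l b h ->
    `|F (ubar + h) - F ubar - L b| <= C * eta ^+ 2.
  move=> e0 e1 hb bh; pose c i z := a i z + b i z.
  have hc : bounded_by (Ma + 1) c.
    split=> [i|i z]; first exact: measurable_funD (ha.1 i) (hb.1 i).
    by apply: (le_trans (ler_normD _ _)); apply: lerD; [exact: ha.2|exact: le_trans (hb.2 i z) e1].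
  have Mc0 : 0 <= Ma + 1 by rewrite addr_ge0.
  have cu : represents T l c (ubar + h).
    apply: (ae_imp2 au bh) => t h1 h2 Dt i.
    by apply: (ae_imp2 (h1 Dt i) (h2 Dt i)) => x e2 e3 Dx; rewrite /c e2// e3.
  have [w1 [z1 st1]] := G_rep hT hl hD hc Mc0 cu hrho0.
  have := cost_remainder hT hrhoT zrd ard st0 adq hb e0 (fun i z => erefl) st1 hp hA au cu.
  by move=> H; apply: (le_trans H); rewrite ler_wpM2r ?sqr_ge0// ler_norm.
have C0 : 0 <= C by exact: normr_ge0.
have ineq v : Uad l T umin umax v -> 0 <= dJ (v - ubar).
  move=> Uv; have [Lv _] := Uv; set h := v - ubar.
  (* A bounded representative of [v - ubar], built from the two truncations; its bound need not be
     small, but that of its multiple by [s] is. *)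
  pose b i z := -1 * a i z + cut l T v i z; pose Mh := `|-1| * Ma + norm_Linfty l T v.
  have hb : bounded_by Mh b := bounded_DZ (-1) ha (bounded_cut Lv).
  have Mh0 : 0 <= Mh by rewrite addr_ge0 ?norm_Linfty_ge0// mulr_ge0.
  have bh : represents T l b h.
    have := represents_DZ (-1) au (represents_cut Lv); congr represents.
    by rewrite scaleN1r addrC.
  rewrite (dJE _ _ _ Mh0 hb bh) leNgt; apply/negP => Lneg.
  pose K := Num.sqrt (bip T (unit_path T l) (unit_path T l)).
  (* If the derivative in the direction [h] were negative, this step would stay admissible, within
     the L^2 radius and in the range of the expansion, while its linear gain would beat the
     quadratic remainder. *)
  have [s [/andP[s0 s1] sM sK sL]] :=
    small_step Mh0 (sqrtr_ge0 _ : 0 <= K) eps00 C0 Lneg.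
  have sM0 : 0 <= s * Mh by rewrite mulr_ge0// ltW.
  pose bs i z := s * b i z.
  have hbs : bounded_by (s * Mh) bs.
    split=> [i|i z]; first by apply: measurable_funM => //; exact: hb.1.
    by rewrite /bs normrM gtr0_norm// ler_wpM2l ?hb.2// ltW.
  have bsh : represents T l bs (s *: h).
    by apply: (ae_imp bh) => t h1 Dt i; apply: (ae_imp (h1 Dt i)) => x e Dx; rewrite /bs e.
  have Us : Uad l T umin umax (ubar + s *: h).
    by apply: Uad_convex => //; rewrite (ltW s0).
  have ns : norm_L2Q l T (ubar + s *: h - ubar) <= eps0.
    have -> : ubar + s *: h - ubar = s *: h by rewrite addrC addKr.
    exact: (le_trans (norm_L2Q_le hT hl sM0 hbs bsh) sK).
  have Js := opt _ Us ns.
  have Ls : L bs = s * L b.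
    have -> : L bs = (s - 1) * L b + L b.
      by apply: (dcost_comb alpha st0 adq Mh0 Mh0 hb hb hbs) => i z; rewrite /bs; ring.
    by ring.
  have := expand _ _ _ sM0 sM hbs bsh; rewrite Ls ler_norml => /andP[_].
  have Fs : F ubar <= F (ubar + s *: h) := Js.
  exact: (descent _ _ _ _ Fs sL).
split=> [|rho q v Uv]; last exact: (ineq v Uv).
exists dJ; last exact: ineq.
split.
  split=> [k x y Lx Ly|].
    have hx := bounded_cut Lx; have hy := bounded_cut Ly.
    have x0 := norm_Linfty_ge0 Lx; have y0 := norm_Linfty_ge0 Ly.
    have hk := bounded_DZ k hx hy.
    have k0 : 0 <= `|k| * norm_Linfty l T x + norm_Linfty l T y by rewrite addr_ge0// mulr_ge0.
    rewrite (dJE _ _ _ k0 hk (represents_DZ k (represents_cut Lx) (represents_cut Ly))).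
    rewrite (dJE _ _ _ x0 hx (represents_cut Lx)) (dJE _ _ _ y0 hy (represents_cut Ly)).
    exact: (dcost_comb alpha st0 adq x0 y0 hx hy hk).
  have [B B0 hB] := dcost_bounded alpha st0 adq; exists B => x Lx.
  have hx := bounded_cut Lx; have x0 := norm_Linfty_ge0 Lx.
  by rewrite (dJE _ _ _ x0 hx (represents_cut Lx)); exact: hB.
move=> eps eps_gt0; have C1 : 0 < C + 1 by rewrite ltr_wpDl.
(* The bound 1 is the range of the expansion, and [C + 1] instead of [C] covers the case [C = 0]. *)
exists (Num.min 1 (eps / (C + 1))); first by rewrite lt_min ltr01 divr_gt0.
move=> h Lh; rewrite le_min => /andP[h1 h2].
have hh := bounded_cut Lh; have h0 := norm_Linfty_ge0 Lh.
rewrite (dJE _ _ _ h0 hh (represents_cut Lh)).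
apply: (le_trans (expand _ _ _ h0 h1 hh (represents_cut Lh))).
rewrite expr2 mulrA; apply: ler_wpM2r => //.
rewrite ler_pdivlMr// mulrC in h2; apply: le_trans h2.
by rewrite mulrDl mul1r lerDl.
Qed.
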